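(* Let $\Sigma$ be a compact oriented surface with nonempty boundary and negative Euler characteristic, $\Gamma=\pi_1(\Sigma,v)$ with $v\in\partial\Sigma$, and let $\rho:\Gamma\to\mathrm{Sp}(2n,\mathbf R)$ be an Anosov maximal representation with holomorphic double $D\rho:\pi_1(D\Sigma,v)\to\mathrm{Sp}(2n,\mathbf R)$. For each orthotube $\alpha$ we have: 1. $\mathcal Y_\alpha=\mathcal Y_{D\alpha}$; 2. $2\,\ell^F(\alpha)=\ell^F(D\alpha)$.
   Context: **Siegel space.** $\mathrm{Sp}(2n,\mathbf R)$ preserves the symplectic form with matrix $\begin{pmatrix}0&\mathrm{Id}_n\\-\mathrm{Id}_n&0\end{pmatrix}$ in the standard basis $e_1,\dots,e_{2n}$. $\mathcal L(\mathbf K^{2n})$ is the set of Lagrangian subspaces. $\mathcal X=\{X+iY: X\in \mathrm{Sym}(n,\mathbf R),\ Y\in\mathrm{Sym}^+(n,\mathbf R)\}$ with action $\begin{pmatrix}A&B\\C&D\end{pmatrix}\cdot Z=(AZ+B)(CZ+D)^{-1}$. A symmetric matrix $Z$ is identified with the Lagrangian spanned by the columns of $\begin{pmatrix}Z\\ \mathrm{Id}_n\end{pmatrix}$, so $\mathcal X\subset\mathcal L(\mathbf C^{2n})$; $l_\infty=\langle e_1,\dots,e_n\rangle$; $\sigma$ (or a bar) is complex conjugation. A triple of pairwise transverse real Lagrangians is *maximal* if it is in the $\mathrm{Sp}(2n,\mathbf R)$-orbit of $(l_\infty,0,\mathrm{Id})$. For $l_1$ transverse to $l_2$ and $l_3$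 transverse to $l_4$, $R(l_1,l_2,l_3,l_4)=p_{l_1}^{\parallel l_2}\circ p_{l_4}^{\parallel l_3}|_{l_1}$, with $p_l^{\parallel l'}$ the projection onto $l$ parallel to $l'$. The Finsler distance is $d^F(X,Z)=\frac12\sum\log\lambda_i$ with $\lambda_i=\frac{1+\sqrt{r_i}}{1-\sqrt{r_i}}$, $r_i$ the eigenvalues of $R(X,\overline Z,Z,\overline X)$. For $g\in\mathrm{Sp}(2n,\mathbf R)$, $\ell^F(g)=\inf_{X\in\mathcal X}d^F(X,gX)$. **Tubes.** For transverse real $a,b$: $\mathcal Y_{a,b}=\{l\in\mathcal X: R(a,l,\sigma(l),b)=-\mathrm{Id}\}$. Two tubes are *orthogonal* if they meet in a point and their tangent spaces there are orthogonal for the invariant Riemannian metric. **Maximal representations.** For a compact oriented surface $S$ with $\chi(S)<0$, fix a complete finite-area hyperbolization of its interior, giving an action of $\pi_1(S)$ on $\mathbb S^1$; $\rho:\pi_1(S)\to\mathrm{Sp}(2n,\mathbf R)$ is *maximal* if there is a $\rho$-equivariant right-continuous map $\mathbb S^1\to\mathcal L(\mathbf R^{2n})$ sending positively oriented triples to maximal triples. $g$ is *Shilov hyperbolic* if conjugate to $\begin{pmatrix}A&0\\0&{}^tA^{-1}\end{pmatrix}$ with all eigenvalues of $A$ of absolute value $>1$; it fixes two transverse real Lagrangians $\Lambda_g^+$ (attractive, on which $g$ acts expandingly) and $\Lambda_g^-$ (repulsive). A maximal representation is *Anosov* if images of peripheral elements are Shilov hyperbolic; then every nontrivial element has Shilov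 hyperbolic image. For $\gamma\neq1$ write $\Lambda_\gamma^\pm$ for the Lagrangians of its image and $\mathcal Y_\gamma=\mathcal Y_{\Lambda_\gamma^-,\Lambda_\gamma^+}$. **Orthotubes.** ''Peripheral element'' means primitive peripheral element oriented so that the surface lies to the right of the boundary. For an (ordered) pair $\alpha=(\delta_1,\delta_2)$ of distinct peripheral elements, the orthotube $\mathcal Y_\alpha$ is the unique $\mathbf R$-tube orthogonal to both $\mathcal Y_{\delta_1}$ and $\mathcal Y_{\delta_2}$; $\ell^F(\alpha)$ is the $d^F$-distance between its intersection points with $\mathcal Y_{\delta_1}$ and $\mathcal Y_{\delta_2}$. **Double.** $D\Sigma$ is the double of $\Sigma$: two copies $j_0(\Sigma)$, $j_1(\overline\Sigma)$ ($\overline\Sigma$ with opposite orientation) glued along the boundary; $j$ is the involution of $D\Sigma$ fixing the boundary pointwise with $j\circ j_0=j_1$ (same notation on $\pi_1$). Boundary components are $c_0\ni v,c_1,\dots,c_m$, also regarded as loops leaving the surface to the right. For an arc $\alpha$ in $\Sigma$ from $v$ to $c_i$, $\gamma_\alpha=\alpha\ast c_i\ast\alpha^{-1}$. For $g$ Shilov hyperbolic let $\sigma_g\in\mathrm{GL}(2n,\mathbf R)$ be $+\mathrm{Id}$ on $\Lambda_g^-$ and $-\mathrm{Id}$ on $\Lambda_g^+$ (the map induced by the complex conjugation of $\mathbf C^{2n}$ with fixed real form $\Lambda_g^-\oplus i\Lambda_g^+$), and $\sigma_\rho=\sigma_{\rho(c_0)}$. The *holomorphic double* $D\rho$ is the unique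 maximal representation of $\pi_1(D\Sigma,v)$ with $D\rho\circ j_0=\rho$, $D\rho(j(\gamma))=\sigma_\rho D\rho(\gamma)\sigma_\rho$ for all $\gamma$, and $D\rho(\alpha\ast j(\alpha)^{-1})=\sigma_{\rho(\gamma_\alpha)}\sigma_\rho$ for every arc $\alpha$ in $\Sigma$ from $v$ to a boundary component. **The element $D\alpha$.** For $\alpha=(\delta_1,\delta_2)$, let $\overline\beta$ be a path in the universal cover $\widetilde\Sigma$ from the preferred lift of $v$ to the axis of $\delta_1$ (the boundary component of $\widetilde\Sigma$ stabilized by $\delta_1$), followed by a path $\overline\alpha$ from the endpoint of $\overline\beta$ to the axis of $\delta_2$; let $\beta,\alpha$ be their projections to $\Sigma$. Then $D\alpha\in\pi_1(D\Sigma,v)$ is the class of $\beta\ast\alpha\ast j(\alpha)^{-1}\ast\beta^{-1}$. $\mathcal Y_{D\alpha}$ and $\ell^F(D\alpha)$ are the tube and Finsler translation length of $D\rho(D\alpha)$. *)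

(* Defs.v *)
From HB Require Import structures.
From mathcomp Require Import all_boot all_order all_algebra.
From mathcomp Require Import complex.
From mathcomp Require Import all_classical all_reals all_analysis.

Set Implicit Arguments.
Unset Strict Implicit.
Unset Printing Implicit Defensive.

Import Order.TTheory GRing.Theory Num.Theory.
Import numFieldNormedType.Exports.

Local Open Scope classical_set_scope.
Local Open Scope ring_scope.

(* A linear subspace of K^2n is the row space of a matrix with 2n columns, its
   vectors being written as rows.  Hence g in GL(2n) sends the subspace L to
   L *m g^T, two matrices give the same subspace iff (L1 :=: L2)%MS, and the
   subspace spanned by the columns of a 2n x n matrix M is the row space of
   M^T. *)

Section Siegel.
Variables (R : realType) (n : nat).
Local Notation C := R[i].

Definition sympl_form : 'M[R]_(n + n) := block_mx 0 1%:M (- 1%:M) 0.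

Definition Sp : set 'M[R]_(n + n) :=
  [set g | g^T *m sympl_form *m g = sympl_form].

Definition Lagrangian (L : 'M[R]_(n, n + n)) : Prop :=
  row_free L /\ L *m sympl_form *m L^T = 0.

Definition transverse (a b : 'M[R]_(n, n + n)) : Prop := (a :&: b)%MS = 0.

Definition lag_infty : 'M[R]_(n, n + n) := row_mx 1%:M 0.

(* the Lagrangian spanned by the columns of (Z ; Id) *)
Definition lag_of (K : nzRingType) (Z : 'M[K]_n) : 'M[K]_(n, n + n) :=
  row_mx Z^T 1%:M.

Definition maximal_triple (l1 l2 l3 : 'M[R]_(n, n + n)) : Prop :=
  exists2 g, Sp g &
    [/\ (l1 :=: lag_infty *m g^T)%MS,
        (l2 :=: lag_of (0 : 'M[R]_n) *m g^T)%MS &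
        (l3 :=: lag_of (1%:M : 'M[R]_n) *m g^T)%MS].

Definition cplx_mx (p q : nat) (M : 'M[R]_(p, q)) : 'M[C]_(p, q) :=
  map_mx (real_complex R) M.
Definition conj_mx (p q : nat) (M : 'M[C]_(p, q)) : 'M[C]_(p, q) :=
  map_mx (@conjc R) M.
Definition Im_mx (p q : nat) (M : 'M[C]_(p, q)) : 'M[R]_(p, q) :=
  map_mx (@complex.Im R) M.

Definition pos_def (Y : 'M[R]_n) : Prop :=
  Y^T = Y /\ forall x : 'rV[R]_n, x != 0 -> 0 < (x *m Y *m x^T) 0 0.

Definition Siegel : set 'M[C]_n := [set Z | Z^T = Z /\ pos_def (Im_mx Z)].

Definition siegel_act (g : 'M[R]_(n + n)) (Z : 'M[C]_n) : 'M[C]_n :=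
  let h := cplx_mx g in
  (ulsubmx h *m Z + ursubmx h) *m invmx (dlsubmx h *m Z + drsubmx h).

(* projection onto l parallel to l' (acting on rows from the right) *)
Definition proj (l l' : 'M[C]_(n, n + n)) : 'M[C]_(n + n) :=
  proj_mx (genmx l) (genmx l').

(* R(l1,l2,l3,l4) = p_{l1}^{||l2} o p_{l4}^{||l3} restricted to l1, as a matrix
   in the basis [row_base l1] of l1 *)
Definition cross_ratio (l1 l2 l3 l4 : 'M[C]_(n, n + n)) : 'M[C]_(\rank l1) :=
  restrictmx l1 (proj l4 l3 *m proj l1 l2).

(* eigenvalues with algebraic multiplicities *)
Definition spectrum (m : nat) (M : 'M[C]_m) : seq C :=
  sval (closed_field_poly_normal (char_poly M)).

(* the eigenvalues below are real, in [0, 1[, when X and Z are in the Siegel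
   space *)
Definition dF (X Z : 'M[C]_n) : R :=
  2^-1 * \sum_(r <- spectrum (cross_ratio (lag_of X) (lag_of (conj_mx Z))
                                          (lag_of Z) (lag_of (conj_mx X))))
           ln ((1 + Num.sqrt (complex.Re r)) / (1 - Num.sqrt (complex.Re r))).

Definition lF (g : 'M[R]_(n + n)) : R :=
  inf [set dF X (siegel_act g X) | X in Siegel].

Definition tube (a b : 'M[R]_(n, n + n)) : set 'M[C]_n :=
  [set Z | Siegel Z /\
           cross_ratio (cplx_mx a) (lag_of Z) (conj_mx (lag_of Z)) (cplx_mx b)
           = - 1%:M].

Definition is_tube (T : set 'M[C]_n) : Prop :=
  exists a b, [/\ Lagrangian a, Lagrangian b, transverse a b & T = tube a b].

(* Siegel's metric tr (Y^-1 dZ Y^-1 dZbar) at Z = X + iY, on tangent vectors in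
   Sym(n, C); it is the only Sp(2n,R)-invariant Riemannian metric up to a
   constant factor, which does not affect orthogonality. *)
Definition siegel_metric (Z U V : 'M[C]_n) : R :=
  let Yi := cplx_mx (invmx (Im_mx Z)) in
  complex.Re (\tr (Yi *m U *m Yi *m conj_mx V)).

(* velocities at Z of the curves drawn on T *)
Definition tangent (T : set 'M[C]_n) (Z : 'M[C]_n) : set 'M[C]_n :=
  [set V | exists c : R -> 'M[C]_n,
    [/\ c 0 = Z,
        \forall t \near (0 : R), T (c t) &
        forall i j,
          is_derive (0 : R) (1 : R)
            (fun t : R => complex.Re (c t i j) : R) (complex.Re (V i j)) /\
          is_derive (0 : R) (1 : R)
            (fun t : R => complex.Im (c t i j) : R) (complex.Im (V i j))]].

Definition orthogonal_at (T1 T2 : set 'M[C]_n) (Z : 'M[C]_n) : Prop :=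
  T1 `&` T2 = [set Z] /\
  forall U V, tangent T1 Z U -> tangent T2 Z V -> siegel_metric Z U V = 0.

(* [shilov_lags g Lm Lp]: g is Shilov hyperbolic, with repulsive Lagrangian Lm
   and attractive Lagrangian Lp *)
Definition shilov_lags (g : 'M[R]_(n + n)) (Lm Lp : 'M[R]_(n, n + n)) : Prop :=
  exists (h : 'M[R]_(n + n)) (A : 'M[R]_n),
    [/\ Sp h, A \in unitmx,
        forall x : C, eigenvalue (cplx_mx A) x -> 1 < `|x|,
        g = h *m block_mx A 0 0 (invmx A)^T *m invmx h &
        (Lp :=: lag_infty *m h^T)%MS /\
        (Lm :=: lag_of (0 : 'M[R]_n) *m h^T)%MS].

Definition Shilov_hyperbolic (g : 'M[R]_(n + n)) : Prop :=
  exists Lm Lp, shilov_lags g Lm Lp.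

(* [is_tube_of g T]: g is Shilov hyperbolic and T = Y_g *)
Definition is_tube_of (g : 'M[R]_(n + n)) (T : set 'M[C]_n) : Prop :=
  exists Lm Lp, shilov_lags g Lm Lp /\ T = tube Lm Lp.

(* [is_sigma g s]: g is Shilov hyperbolic and s = sigma_g *)
Definition is_sigma (g s : 'M[R]_(n + n)) : Prop :=
  exists Lm Lp, [/\ shilov_lags g Lm Lp, Lm *m s^T = Lm & Lp *m s^T = - Lp].

(* [orthotube g1 g2 T X1 X2]: T is a tube orthogonal to Y_g1 at X1 and to Y_g2
   at X2 *)
Definition orthotube (g1 g2 : 'M[R]_(n + n)) (T : set 'M[C]_n)
    (X1 X2 : 'M[C]_n) : Prop :=
  is_tube T /\
  exists T1 T2, [/\ is_tube_of g1 T1, is_tube_of g2 T2,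
                    orthogonal_at T T1 X1 & orthogonal_at T T2 X2].

End Siegel.

(* A path in X is a function R -> X of which only the restriction to [0, 1]
   matters.  Elements of pi_1(X, v) are represented by loops, and functions on
   pi_1(X, v) by functions on loops that are invariant under homotopy. *)

Section Paths.
Variable R : realType.

Section OneSpace.
Variable X : topologicalType.

Definition path_from_to (x y : X) (f : R -> X) : Prop :=
  [/\ {within `[0, 1], continuous f}, f 0 = x & f 1 = y].

Definition loop_at (x : X) : (R -> X) -> Prop := path_from_to x x.

Definition concat (f g : R -> X) : R -> X :=
  fun t => if t <= 2^-1 then f (2 * t) else g (2 * t - 1).

Definition rev_path (f : R -> X) : R -> X := fun t => f (1 - t).

(* homotopy relative to the endpoints *)
Definition homotopic (f g : R -> X) : Prop :=
  exists H : R * R -> X,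
    [/\ {within `[0, 1] `*` `[0, 1], continuous H},
        forall t, t \in `[0, 1]%R -> H (0, t) = f t /\ H (1, t) = g t &
        forall s, s \in `[0, 1]%R -> H (s, 0) = f 0 /\ H (s, 1) = f 1].

(* homomorphisms pi_1(X, v) -> Sp(2n, R) *)
Definition representation (n : nat) (v : X)
    (rho : (R -> X) -> 'M[R]_(n + n)) : Prop :=
  [/\ forall f, loop_at v f -> Sp (rho f),
      forall f g, loop_at v f -> loop_at v g -> homotopic f g -> rho f = rho g &
      forall f g, loop_at v f -> loop_at v g ->
        rho (concat f g) = rho f *m rho g].

Definition simply_connected : Prop :=
  (forall x y : X, exists f, path_from_to x y f) /\
  (forall x f, loop_at x f -> homotopic f (fun=> x)).

End OneSpace.

(* f restricts to a homeomorphism of A onto B, with inverse g *)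
Definition homeo_on (X Y : topologicalType) (f : X -> Y) (g : Y -> X)
    (A : set X) (B : set Y) : Prop :=
  [/\ f @` A = B, forall x, A x -> g (f x) = x,
      {within A, continuous f} & {within B, continuous g}].

Definition covering_map (E X : topologicalType) (p : E -> X) : Prop :=
  continuous p /\ range p = setT /\
  forall x, exists U : set X, [/\ open U, U x &
    exists W : set (set E),
      [/\ forall w, W w -> open w /\ exists s, homeo_on p s w U,
          trivIset W id & \bigcup_(w in W) w = p @^-1` U]].

(* universal cover of (X, v), with preferred lift of v *)
Record univ_cover (X : topologicalType) (v : X) := UnivCover {
  uc_space :> topologicalType;
  uc_proj : uc_space -> X;
  uc_base : uc_space;
  uc_covering : covering_map uc_proj;
  uc_simply_connected : simply_connected uc_space;
  uc_baseP : uc_proj uc_base = v }.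

(* [deck f e e']: the element of pi_1(X, v) represented by f sends e to e',
   i.e. e' is the endpoint of the lift from the preferred base point of f
   followed by the projection of a path from the base point to e *)
Definition deck (X : topologicalType) (v : X) (E : univ_cover v)
    (f : R -> X) (e e' : E) : Prop :=
  exists q l : R -> E,
    [/\ path_from_to (uc_base E) e q, path_from_to (uc_base E) e' l &
        homotopic (@uc_proj _ _ E \o l) (concat f (@uc_proj _ _ E \o q))].

End Paths.

Section Surfaces.
Variable R : realType.
Local Notation plane := (R * R)%type.

Definition cplx_of (z : plane) : R[i] := Complex z.1 z.2.
Definition half_plane : set plane := [set z | 0 <= z.2].
Definition disc : set plane := [set z | z.1 ^+ 2 + z.2 ^+ 2 < 1].

(* The local degree at z of a map f that is continuous near z, with z isolated
   in its fibre: the image of each small positively oriented circle around z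
   winds d times around f z.  A local homeomorphism of the plane preserves the
   orientation iff d = 1 and reverses it iff d = -1. *)
Definition local_degree (f : plane -> plane) (z : plane) (d : int) : Prop :=
  exists2 r0 : R, 0 < r0 & forall r, 0 < r < r0 ->
    exists theta : R -> R,
      [/\ {within `[0, 2 * pi], continuous theta},
          theta (2 * pi) = theta 0 + d%:~R * (2 * pi) &
          forall t, t \in `[0, 2 * pi]%R -> exists2 m : R, 0 < m &
            f (z + (r * cos t, r * sin t)) =
            f z + (m * cos (theta t), m * sin (theta t))].

Record chart (S : topologicalType) := Chart {
  chart_dom : set S;
  chart_fun : S -> plane;
  chart_inv : plane -> S }.

Definition chartP (S : topologicalType) (c : chart S) : Prop :=
  open (chart_dom c) /\
  exists2 O : set plane, open O &
    homeo_on (chart_fun c) (chart_inv c) (chart_dom c) (O `&` half_plane).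

Definition boundary_of (S : topologicalType) (A : set (chart S)) : set S :=
  [set x | exists2 c, A c & chart_dom c x /\ (chart_fun c x).2 = 0].

(* Compact connected oriented surface, possibly with boundary; the charts take
   values in the upper half-plane and are positively oriented. *)
Record surface := Surface {
  surf_space :> topologicalType;
  surf_atlas : set (chart surf_space);
  surf_hausdorff : hausdorff_space surf_space;
  surf_compact : compact [set: surf_space];
  surf_connected : connected [set: surf_space];
  surf_chart : forall c, surf_atlas c -> chartP c;
  surf_cover : forall x, exists2 c, surf_atlas c & chart_dom c x;
  surf_oriented : forall c c' x, surf_atlas c -> surf_atlas c' ->
    chart_dom c x -> chart_dom c' x -> ~ boundary_of surf_atlas x ->
    local_degree (chart_fun c' \o chart_inv c) (chart_fun c x) 1 }.

Definition boundary (S : surface) : set S := boundary_of (@surf_atlas S).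

(* Degree of a local homeomorphism j : S -> S' in the interior of S *)
Definition has_degree (S S' : surface) (j : S -> S') (d : int) : Prop :=
  forall c c' x, @surf_atlas S c -> @surf_atlas S' c' ->
    chart_dom c x -> chart_dom c' (j x) -> ~ boundary x ->
    local_degree (chart_fun c' \o j \o chart_inv c) (chart_fun c x) d.

Definition simplicial_complex (m : nat) (K : {set {set 'I_m}}) : Prop :=
  finset.set0 \notin K /\
  forall s t : {set 'I_m},
    s \in K -> t \subset s -> t != finset.set0 -> t \in K.

Definition realization (m : nat) (K : {set {set 'I_m}}) : set 'rV[R]_m :=
  [set x | [/\ forall i, 0 <= x 0 i, \sum_i x 0 i = 1 &
               finset (fun i => x 0 i != 0) \in K]].

(* chi is the Euler characteristic of S, computed with a triangulation *)
Definition euler_char (S : surface) (chi : int) : Prop :=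
  exists (m : nat) (K : {set {set 'I_m}}) (f : 'rV[R]_m -> S)
         (g : S -> 'rV[R]_m),
    [/\ simplicial_complex K, homeo_on f g (realization K) setT &
        chi = \sum_(s in K) (-1) ^+ (#|s|.-1)].

(* The hyperbolic plane is the unit disc; (a, b) with |a|^2 - |b|^2 = 1 acts on
   the disc and on its boundary circle by z |-> (a z + b) / (b^* z + a^* ). *)

Definition SU11 (ab : R[i] * R[i]) : Prop :=
  ab.1 * conjc ab.1 - ab.2 * conjc ab.2 = 1.

Definition mobius (ab : R[i] * R[i]) (z : R[i]) : R[i] :=
  (ab.1 * z + ab.2) / (conjc ab.2 * z + conjc ab.1).

Definition uc_interior (S : surface) (v : S) (E : univ_cover R v) : set E :=
  ~` (@uc_proj _ _ _ E @^-1` @boundary S).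

(* A complete hyperbolic structure of finite area on the interior of S,
   compatible with the orientation: developing map (a homeomorphism onto the
   hyperbolic plane) and holonomy.  The interior of the universal cover of S is
   a universal cover of the interior of S, so pi_1(S, v) acts on it even when v
   is a boundary point. *)
Record hyperbolization (S : surface) (v : S) (E : univ_cover R v) := Hyperb {
  dev : E -> plane;
  dev_inv : plane -> E;
  hol : (R -> S) -> R[i] * R[i];
  dev_homeo : homeo_on dev dev_inv (@uc_interior S v E) disc;
  hol_SU11 : forall f, loop_at v f -> SU11 (hol f);
  dev_equiv : forall f e e', loop_at v f -> uc_interior e -> deck f e e' ->
    cplx_of (dev e') = mobius (hol f) (cplx_of (dev e));
  dev_oriented : forall c e, @surf_atlas S c ->
    chart_dom c (uc_proj e) -> uc_interior e ->
    local_degree (chart_fun c \o @uc_proj _ _ _ E \o dev_inv) (dev e) 1;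
  hyp_finite_area : exists F : set (measurableTypeR R * measurableTypeR R),
    [/\ measurable F, F `<=` disc,
        forall z, disc z -> exists f w, [/\ loop_at v f, F w &
          cplx_of z = mobius (hol f) (cplx_of w)] &
        (\int[(@lebesgue_measure R \x @lebesgue_measure R)]_(w in F)
            ((4 / (1 - (w.1 ^+ 2 + w.2 ^+ 2)) ^+ 2)%R)%:E < +oo)%E] }.

Definition cis (t : R) : R[i] := Complex (cos t) (sin t).

(* [rho] is a maximal representation of pi_1(S, v).  The boundary map xi is
   considered on the unit circle only; its right-continuity is for the quotient
   topology on the space of Lagrangians, i.e. up to the choice of bases. *)
Definition maximal_rep (n : nat) (S : surface) (v : S) (E : univ_cover R v)
    (h : hyperbolization E) (rho : (R -> S) -> 'M[R]_(n + n)) : Prop :=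
  representation v rho /\
  exists xi : R[i] -> 'M[R]_(n, n + n),
    [/\ forall t, Lagrangian (xi (cis t)),
        forall f t, loop_at v f ->
          (xi (mobius (hol h f) (cis t)) :=: xi (cis t) *m (rho f)^T)%MS,
        forall t (U : set 'M[R]_(n, n + n)), nbhs (xi (cis t)) U ->
          exists2 eps : R, 0 < eps & forall s, t < s < t + eps ->
            exists2 P : 'M[R]_n, P \in unitmx & U (P *m xi (cis s)) &
        forall t1 t2 t3, t1 < t2 -> t2 < t3 -> t3 < t1 + 2 * pi ->
          maximal_triple (xi (cis t1)) (xi (cis t2)) (xi (cis t3))].

(* [boundary_loop c]: c runs once along a boundary component, leaving the
   surface to its right.  As charts are positively oriented with values in the
   upper half-plane, this means that c moves to the left in charts. *)
Definition boundary_loop (S : surface) (c : R -> S) : Prop :=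
  [/\ loop_at (c 0) c,
      {in `[0, 1[%R &, injective c},
      forall t, t \in `[0, 1]%R -> boundary (c t) &
      forall k t, t \in `[0, 1]%R -> @surf_atlas S k -> chart_dom k (c t) ->
        exists2 eps : R, 0 < eps & forall s s',
          s \in `[0, 1]%R -> s' \in `[0, 1]%R ->
          `|s - t| < eps -> `|s' - t| < eps -> s < s' ->
          (chart_fun k (c s')).1 < (chart_fun k (c s)).1].

(* the element alpha * c * alpha^-1 of pi_1 *)
Definition lasso (X : topologicalType) (alpha c : R -> X) : R -> X :=
  concat (concat alpha c) (rev_path alpha).

(* primitive peripheral elements, with the surface to the right *)
Definition peripheral (S : surface) (v : S) (d : R -> S) : Prop :=
  loop_at v d /\ exists q c, [/\ boundary_loop c, path_from_to v (c 0) q &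
                                 homotopic d (lasso q c)].

Definition Anosov (n : nat) (S : surface) (v : S)
    (rho : (R -> S) -> 'M[R]_(n + n)) : Prop :=
  forall d, peripheral v d -> Shilov_hyperbolic (rho d).

(* [axis d A]: A is the boundary component of the universal cover stabilized
   by d *)
Definition axis (S : surface) (v : S) (E : univ_cover R v) (d : R -> S)
    (A : set E) : Prop :=
  let bE : set E := @uc_proj _ _ _ E @^-1` @boundary S in
  (exists2 x, bE x & A = connected_component bE x) /\
  [set e' | exists2 e, A e & deck d e e'] = A.

(* D is the double of S, with embeddings j0 and j1 of the two copies, glued
   along the boundary, and involution j *)
Definition is_double (S D : surface) (j0 j1 : S -> D) (j : D -> D) : Prop :=
  [/\ continuous j0 /\ continuous j1,
      injective j0 /\ injective j1,
      range j0 `|` range j1 = setT /\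
        (forall x y, j0 x = j1 y <-> x = y /\ boundary x),
      has_degree j0 1 /\ has_degree j1 (-1) &
      forall x, j (j0 x) = j1 x /\ j (j1 x) = j0 x].

(* [holomorphic_double ... Drho]: s0 below is sigma_rho *)
Definition holomorphic_double (n : nat) (S D : surface) (j0 : S -> D)
    (j : D -> D) (v : S) (ED : univ_cover R (j0 v)) (hD : hyperbolization ED)
    (rho : (R -> S) -> 'M[R]_(n + n)) (Drho : (R -> D) -> 'M[R]_(n + n)) : Prop :=
  [/\ maximal_rep hD Drho,
      forall f, loop_at v f -> Drho (j0 \o f) = rho f &
      exists c0 s0, [/\ boundary_loop c0, c0 0 = v, is_sigma (rho c0) s0,
        forall f, loop_at (j0 v) f -> Drho (j \o f) = s0 *m Drho f *m s0 &
        forall alpha c s, boundary_loop c -> path_from_to v (c 0) alpha ->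
          is_sigma (rho (lasso alpha c)) s ->
          Drho (concat (j0 \o alpha) (rev_path (j \o (j0 \o alpha))))
          = s *m s0]].

(* D alpha = beta * alpha * j(alpha)^-1 * beta^-1 *)
Definition double_loop (S D : surface) (j0 : S -> D) (j : D -> D)
    (beta alpha : R -> S) : R -> D :=
  concat (concat (concat (j0 \o beta) (j0 \o alpha))
                 (rev_path (j \o (j0 \o alpha))))
         (rev_path (j0 \o beta)).

End Surfaces.

(* Main.v *)
(* Write s1, s2 for the involutions sigma attached to rho(d1) and rho(d2).  If k
   runs from v to a point of the boundary component of the universal cover
   stabilized by d_i, then Drho(k j(k)^-1) sigma_rho commutes with rho(d_i),
   hence with s_i; both are involutions, and their product is the image of a loop,
   of square 1, hence trivial: otherwise the loop would act on the circle as a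
   nontrivial involution, and fix a point of the disc.  Thus
   Drho(D alpha) = s2 s1.  If T = { h(iY) } is orthogonal to the tube of
   rho(d_i) at h(i Y_i), then s_i = +-h (0, Y_i; Y_i^-1, 0) h^-1, so that s2 s1 is
   +-h diag(A, A^-T) h^-1 with A = Y2 Y1^-1, whose eigenvalues mu are positive.

   The boundary map takes some point of the circle to a Lagrangian fixed by
   rho(d1), and the maximality of this Lagrangian and its first two translates by
   s2 s1 forces all the mu to lie on the same side of 1; then T is the tube of
   s2 s1.  The distance 1/2 sum |ln mu| between h(i Y1) and h(i Y2) is half of the
   translation length, which is bounded below through the determinants of the
   imaginary parts.  The translates are distinct because D alpha is nontrivial:
   from a null homotopy, Sperner's lemma extracts a piece of the common boundary
   that makes d1 and d2 homotopic. *)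
Require Import Defs.
From mathcomp Require Import all_boot all_order all_algebra.
From mathcomp Require Import complex ring lra.
From mathcomp Require Import all_classical all_reals all_analysis.

Set Implicit Arguments.
Unset Strict Implicit.
Unset Printing Implicit Defensive.

Import Order.TTheory GRing.Theory Num.Theory.
Import numFieldNormedType.Exports.

Local Open Scope classical_set_scope.
Local Open Scope ring_scope.

(** The fundamental group of the double is never computed: what is needed about [D alpha] is read
    off the mirror loops [k j(k)^-1]. The involution [j] inverts them, so each gives an involution
    after multiplication by [sigma_rho]. Their class does not change while the end of [k] slides
    along a boundary component of the universal cover, and translating this end by [d_i] replaces
    the loop [m] by [d_i m j(d_i)^-1]; this is the source of the commutation with [rho(d_i)].
    Orthogonality only says that the real part of [(w G w1^T)^2] vanishes for all real [w], [w1],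
    with [G] a complex matrix; so the real and imaginary parts of [G] agree up to one global sign,
    the sign in [s_i]. Nothing in this tells which [mu] exceed 1, hence the appeal to the boundary
    map. That map is only right-continuous: the fixed Lagrangian is found at a fixed point of a
    homography which an orbit of [rho(d1)], or of its inverse, approaches from the right. Attractive
    or repulsive, it is an eigenspace of [s1], thus [Y1] or [-Y1] in the frame of [T]; its
    translates are diagonalised together with it, and maximality becomes one inequality for each
    [mu]. *)

Local Notation rev_path := (@Defs.rev_path _ _).

(** * Paths and homotopies *)

Section WithinContinuity.
Variable R : realType.

Lemma within_comp (T U V : topologicalType) (B : set T) (A : set U)
    (g : T -> U) (f : U -> V) :
  {within B, continuous g} -> (forall x, B x -> A (g x)) ->
  {within A, continuous f} -> {within B, continuous (f \o g)}.
Proof.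
move=> /subspace_continuousP gc gA /subspace_continuousP fc.
apply/subspace_continuousP => x Bx W /= Wf.
have := fc _ (gA _ Bx) _ Wf; rewrite /within /= => AW.
have gW : nbhs x [set z | B z -> A (g z) -> W (f (g z))] := gc _ Bx _ AW.
have fgW : nbhs x [set z | B z -> W (f (g z))].
  by apply: filterS gW => z zW Bz; apply: zW => //; exact: gA.
exact: fgW.
Qed.

Lemma within_eq (T U : topologicalType) (A : set T) (f g : T -> U) :
  (forall x, A x -> f x = g x) -> {within A, continuous f} ->
  {within A, continuous g}.
Proof.
move=> fg; apply: subspace_eq_continuous => x xA; apply: fg.
by rewrite inE in xA.
Qed.

Lemma within_sub (T U : topologicalType) (A B : set T) (f : T -> U) :
  A `<=` B -> {within B, continuous f} -> {within A, continuous f}.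
Proof. exact: continuous_subspaceW. Qed.

(** Both sides of the level [m] are closed in [A]. Concatenations of paths, and homotopies glued in
    either variable, all have this form, with [c] a coordinate. *)
Lemma within_paste (T U : topologicalType) (A : set T) (c : T -> R) (m : R)
    (f g : T -> U) :
  continuous c -> closed A ->
  {within A `&` [set x | c x <= m], continuous f} ->
  {within A `&` [set x | m <= c x], continuous g} ->
  (forall x, A x -> c x = m -> f x = g x) ->
  {within A, continuous (fun x => if c x <= m then f x else g x)}.
Proof.
move=> cc Acl fc gc fg.
have lec : closed [set x | c x <= m].
  by apply: (@closed_comp _ _ c [set y | y <= m]) => //; exact: closed_le.
have gec : closed [set x | m <= c x].
  by apply: (@closed_comp _ _ c [set y | m <= y]) => //; exact: closed_ge.
have -> : A = (A `&` [set x | c x <= m]) `|` (A `&` [set x | m <= c x]).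
  apply/seteqP; split=> x; last by case=> -[].
  by move=> Ax; case: (leP (c x) m) => [|/ltW] ?; [left|right].
apply: withinU_continuous; [exact: closedI|exact: closedI| |].
- by apply: within_eq fc => x [_ /= ->].
- apply: within_eq gc => x [Ax /= mc]; case: ifPn => // cm.
  by rewrite fg //; apply/eqP; rewrite eq_le cm.
Qed.

Lemma withinD (T : topologicalType) (A : set T) (f g : T -> R) :
  {within A, continuous f} -> {within A, continuous g} ->
  {within A, continuous (fun x => f x + g x)}.
Proof.
move=> /subspace_continuousP fc /subspace_continuousP gc.
by apply/subspace_continuousP => x Ax; apply: cvgD; [exact: fc|exact: gc].
Qed.

Lemma withinM (T : topologicalType) (A : set T) (f g : T -> R) :
  {within A, continuous f} -> {within A, continuous g} ->
  {within A, continuous (fun x => f x * g x)}.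
Proof.
move=> /subspace_continuousP fc /subspace_continuousP gc.
by apply/subspace_continuousP => x Ax; apply: cvgM; [exact: fc|exact: gc].
Qed.

Lemma within_pair (T U V : topologicalType) (A : set T)
    (f : T -> U) (g : T -> V) :
  {within A, continuous f} -> {within A, continuous g} ->
  {within A, continuous (fun x => (f x, g x))}.
Proof.
move=> /subspace_continuousP fc /subspace_continuousP gc.
by apply/subspace_continuousP => x Ax; apply: cvg_pair; [exact: fc|exact: gc].
Qed.

Lemma within_fst (T U : topologicalType) (A : set (T * U)) :
  {within A, continuous fst}.
Proof. by apply: continuous_subspaceT => x; exact: cvg_fst. Qed.

Lemma within_snd (T U : topologicalType) (A : set (T * U)) :
  {within A, continuous snd}.
Proof. by apply: continuous_subspaceT => x; exact: cvg_snd. Qed.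

Lemma within_cst (T U : topologicalType) (A : set T) (y : U) :
  {within A, continuous (fun=> y)}.
Proof. by apply: continuous_subspaceT => x; exact: cvg_cst. Qed.

Lemma within_id (T : topologicalType) (A : set T) :
  {within A, continuous (fun x : T => x)}.
Proof. by apply: continuous_subspaceT => x; exact: cvg_id. Qed.

Lemma withinN (T : topologicalType) (A : set T) (f : T -> R) :
  {within A, continuous f} -> {within A, continuous (fun x => - f x)}.
Proof.
move=> /subspace_continuousP fc.
by apply/subspace_continuousP => x Ax; apply: cvgN; exact: fc.
Qed.

Definition lin (p q : R * R) (s : R) : R * R :=
  ((1 - s) * p.1 + s * q.1, (1 - s) * p.2 + s * q.2).

Lemma lin0 p q : lin p q 0 = p.
Proof. by case: p q => [a b] [c d]; rewrite /lin /=; congr (_, _); ring. Qed.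

Lemma lin1 p q : lin p q 1 = q.
Proof. by case: p q => [a b] [c d]; rewrite /lin /=; congr (_, _); ring. Qed.

Lemma within_lin (T : topologicalType) (A : set T) (a b : T -> R * R)
    (s : T -> R) :
  {within A, continuous a} -> {within A, continuous b} ->
  {within A, continuous s} ->
  {within A, continuous (fun x => lin (a x) (b x) (s x))}.
Proof.
move=> ac bc sc.
have fs (e : T -> R * R) : {within A, continuous e} ->
    {within A, continuous (fst \o e)} /\ {within A, continuous (snd \o e)}.
  move=> ec; split; apply: (@within_comp _ _ _ _ setT) ec _ _ => //.
    exact: within_fst.
  exact: within_snd.
have [a1 a2] := fs _ ac; have [b1 b2] := fs _ bc.
have s1 : {within A, continuous (fun x => 1 - s x)}.
  by apply: withinD; [exact: within_cst|exact: withinN].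
by apply: within_pair; apply: withinD; apply: withinM.
Qed.

Definition convex2 (Q : set (R * R)) :=
  forall p q s, Q p -> Q q -> 0 <= s <= 1 -> Q (lin p q s).

End WithinContinuity.

Ltac wcont := lazymatch goal with
  | |- {within _, continuous (fun x => (_ , _))} =>
      apply: within_pair; [wcont | wcont]
  | |- {within _, continuous (fun x => _ + _)} =>
      apply: withinD; [wcont | wcont]
  | |- {within _, continuous (fun x => _ * _)} =>
      apply: withinM; [wcont | wcont]
  | |- {within _, continuous (fun x => - _)} =>
      apply: withinN; wcont
  | |- _ => first [exact: within_fst | exact: within_snd | exact: within_id
      | exact: within_cst | assumption
      | apply: withinD; wcont | apply: withinM; wcont | apply: withinN; wcont]
  end.

Section Homotopy.
Variables (R : realType) (X : topologicalType).
Local Notation I := (`[0, 1]%classic : set R).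
Implicit Types (f g k : R -> X).

Lemma I01E (t : R) : (t \in `[0, 1]%R) = (0 <= t <= 1).
Proof. by rewrite in_itv. Qed.

Lemma closed_I : closed I.
Proof. exact: interval_closed. Qed.

Lemma within_affine (A : set R) (a b : R) f :
  {within I, continuous f} -> (forall t, A t -> 0 <= a * t + b <= 1) ->
  {within A, continuous (fun t => f (a * t + b))}.
Proof.
move=> fc ab; refine (@within_comp _ _ _ A I (fun t => a * t + b) f _ _ _) => //.
by wcont.
Qed.

Lemma path_cst (x : X) : path_from_to x x (fun _ : R => x).
Proof. by split=> //; exact: within_cst. Qed.

Lemma path_concat (x y z : X) f g : path_from_to x y f -> path_from_to y z g ->
  path_from_to x z (concat f g).
Proof.
move=> [fc f0 f1] [gc g0 g1]; split.
- apply: (@within_paste R _ _ I (fun t => t)); first by move=> t; exact: cvg_id.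
  + exact: closed_I.
  + refine (within_eq (f := fun t : R => f (2 * t + 0)) _ _) => [t _|]; first by rewrite addr0.
    by apply: within_affine => // t [/=]; rewrite in_itv /=; lra.
  + by apply: within_affine => // t [/=]; rewrite in_itv /=; lra.
  + move=> t _ ->; rewrite mulfV ?pnatr_eq0 //.
    by rewrite f1 subrr g0.
- by rewrite /concat ifT ?mulr0 //; lra.
- rewrite /concat ifF; last by lra.
  by rewrite (_ : 2 * 1 - 1 = 1) //; lra.
Qed.

Lemma path_rev (x y : X) f : path_from_to x y f -> path_from_to y x (rev_path f).
Proof.
move=> [fc f0 f1]; split; rewrite /Defs.rev_path ?subr0 ?subrr //.
refine (within_eq (f := fun t : R => f (-1 * t + 1)) _ _) => [t _|].
  by congr f; ring.
by apply: within_affine => // t /=; rewrite in_itv /=; lra.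
Qed.

Lemma path_reparam (a : R -> R) f : {within I, continuous f} ->
  {within I, continuous a} -> (forall t, 0 <= t <= 1 -> 0 <= a t <= 1) ->
  path_from_to (f (a 0)) (f (a 1)) (f \o a).
Proof.
move=> fc ac aI; split=> //; apply: within_comp ac _ fc.
by move=> t; rewrite /= !in_itv; exact: aI.
Qed.

Lemma hom_eq f g : {within I, continuous f} ->
  (forall t, 0 <= t <= 1 -> f t = g t) -> homotopic f g.
Proof.
move=> fc fg; exists (fun p => f p.2); split.
- refine (@within_comp _ _ _ _ I snd f _ _ _) => //; first exact: within_snd.
  by move=> -[s t] [].
- by move=> t; rewrite I01E => /fg.
- by [].
Qed.

Lemma hom_refl f : {within I, continuous f} -> homotopic f f.
Proof. by move=> fc; apply: hom_eq. Qed.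

Lemma hom_ends f g : homotopic f g -> f 0 = g 0 /\ f 1 = g 1.
Proof.
have I0 : (0 : R) \in `[0, 1]%R by rewrite I01E lexx ler01.
have I1 : (1 : R) \in `[0, 1]%R by rewrite I01E lexx ler01.
move=> [H [_ Hs Ht]].
have [_ <-] := Hs _ I0; have [_ <-] := Hs _ I1.
by have [-> ->] := Ht _ I1.
Qed.

Lemma hom_sym f g : homotopic f g -> homotopic g f.
Proof.
move=> fg; have [e0 e1] := hom_ends fg; have [H [Hc Hs Ht]] := fg.
exists (fun p => H (1 - p.1, p.2)); split.
- refine (@within_comp _ _ _ _ (I `*` I : set (R * R)) (fun p : R * R => (1 - p.1, p.2)) H _ _ _) => //.
    by wcont.
  by move=> [s t] [/=]; rewrite !in_itv /=; split=> //; lra.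
- by move=> t tI; rewrite /= subr0 subrr; have [-> ->] := Hs _ tI.
- move=> s; rewrite I01E => sI /=; rewrite -e0 -e1; apply: Ht.
  by rewrite I01E; lra.
Qed.

Lemma closed_II : closed (I `*` I).
Proof.
have -> : I `*` I = fst @^-1` I `&` snd @^-1` I :> set (R * R).
  by apply/seteqP; split.
apply: closedI; apply: closed_comp; try exact: closed_I.
  by move=> x _; exact: cvg_fst.
by move=> x _; exact: cvg_snd.
Qed.

Lemma hom_trans g f k : homotopic f g -> homotopic g k -> homotopic f k.
Proof.
move=> fg gk; have [e0 e1] := hom_ends fg.
have [H [Hc Hs Ht]] := fg; have [K [Kc Ks Kt]] := gk.
exists (fun p => if p.1 <= 2^-1 then H (2 * p.1, p.2) else K (2 * p.1 - 1, p.2)).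
split.
- apply: (@within_paste R _ _ (I `*` I) fst); first by move=> x; exact: cvg_fst.
  + exact: closed_II.
  + refine (@within_comp _ _ _ _ (I `*` I : set (R * R)) (fun p : R * R => (2 * p.1, p.2)) H _ _ _) => //.
      by wcont.
    by move=> [s t] [[/=]]; rewrite !in_itv /= => ? ? ?; split=> //; lra.
  + refine (@within_comp _ _ _ _ (I `*` I : set (R * R)) (fun p : R * R => (2 * p.1 - 1, p.2)) K _ _ _) => //.
      by wcont.
    by move=> [s t] [[/=]]; rewrite !in_itv /= => ? ? ?; split=> //; lra.
  + move=> [s t] [/= _ tI] ->; rewrite mulfV ?pnatr_eq0 // subrr.
    by have [_ ->] := Hs _ tI; have [-> _] := Ks _ tI.
- move=> t tI /=; rewrite ifT; last by lra.
  rewrite ifF; last by lra.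
  rewrite mulr0 (_ : 2 * 1 - 1 = 1); last by lra.
  by have [-> _] := Hs _ tI; have [_ ->] := Ks _ tI.
- move=> s; rewrite I01E => sI /=; case: ifPn => s2.
    by apply: Ht; rewrite I01E; lra.
  by rewrite e0 e1; apply: Kt; rewrite I01E; lra.
Qed.

Lemma hom_concat f f' g g' : homotopic f f' -> homotopic g g' -> f 1 = g 0 ->
  homotopic (concat f g) (concat f' g').
Proof.
move=> [H [Hc Hs Ht]] [K [Kc Ks Kt]] fg.
exists (fun p => if p.2 <= 2^-1 then H (p.1, 2 * p.2) else K (p.1, 2 * p.2 - 1)).
split.
- apply: (@within_paste R _ _ (I `*` I) snd); first by move=> x; exact: cvg_snd.
  + exact: closed_II.
  + refine (@within_comp _ _ _ _ (I `*` I : set (R * R)) (fun p : R * R => (p.1, 2 * p.2)) H _ _ _) => //.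
      by wcont.
    by move=> [s t] [[/=]]; rewrite !in_itv /= => ? ? ?; split=> //; lra.
  + refine (@within_comp _ _ _ _ (I `*` I : set (R * R)) (fun p : R * R => (p.1, 2 * p.2 - 1)) K _ _ _) => //.
      by wcont.
    by move=> [s t] [[/=]]; rewrite !in_itv /= => ? ? ?; split=> //; lra.
  + move=> [s t] [/= sI _] ->; rewrite mulfV ?pnatr_eq0 // subrr.
    by have [_ ->] := Ht _ sI; have [-> _] := Kt _ sI.
- move=> t; rewrite I01E /concat /= => tI; case: ifPn => t2.
    by apply: Hs; rewrite I01E; lra.
  by apply: Ks; rewrite I01E; lra.
- move=> s sI; rewrite /concat /=.
  have -> : (0 <= 2^-1 :> R) = true by lra.
  have -> : (1 <= 2^-1 :> R) = false by lra.
  rewrite mulr0 (_ : 2 * 1 - 1 = 1); last by lra.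
  by have [-> _] := Ht _ sI; have [_ ->] := Kt _ sI.
Qed.

Lemma hom_rev f g : homotopic f g -> homotopic (rev_path f) (rev_path g).
Proof.
move=> [H [Hc Hs Ht]]; exists (fun p => H (p.1, 1 - p.2)); split.
- refine (@within_comp _ _ _ _ (I `*` I : set (R * R)) (fun p : R * R => (p.1, 1 - p.2)) H _ _ _) => //.
    by wcont.
  by move=> [s t] [/=]; rewrite !in_itv /=; split=> //; lra.
- by move=> t; rewrite I01E /Defs.rev_path => tI; apply: (Hs (1 - t)); rewrite I01E; lra.
- move=> s sI; rewrite /Defs.rev_path subr0 subrr.
  by have [-> ->] := Ht _ sI.
Qed.

(** The straight-line homotopy stays in [Q] by convexity, and it fixes the ends because a segment
    with equal ends is constant. *)
Lemma hom_convex (F : R * R -> X) (Q : set (R * R)) (a b : R -> R * R) :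
  {within Q, continuous F} -> convex2 Q ->
  {within I, continuous a} -> {within I, continuous b} ->
  (forall t, 0 <= t <= 1 -> Q (a t)) -> (forall t, 0 <= t <= 1 -> Q (b t)) ->
  a 0 = b 0 -> a 1 = b 1 -> homotopic (F \o a) (F \o b).
Proof.
move=> Fc Qc ac bc aQ bQ ab0 ab1.
exists (F \o (fun p => lin (a p.2) (b p.2) p.1)); split.
- apply: within_comp _ Fc.
    apply: within_lin.
    + refine (@within_comp _ _ _ _ I snd a _ _ _) => //; first exact: within_snd.
      by move=> ? [].
    + refine (@within_comp _ _ _ _ I snd b _ _ _) => //; first exact: within_snd.
      by move=> ? [].
    + exact: within_fst.
  move=> [s t] [/=]; rewrite !in_itv /= => sI tI.
  by apply: Qc => //; [exact: aQ|exact: bQ].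
- by move=> t _ /=; rewrite lin0 lin1.
- have linxx p s : lin p p s = p :> R * R.
    by case: p => u w; rewrite /lin /=; congr (_, _); ring.
  by move=> s _ /=; rewrite -ab0 -ab1 !linxx.
Qed.

Lemma hom_line (F : R -> X) (Q : set R) (a b : R -> R) :
  {within Q, continuous F} ->
  (forall x y z : R, Q x -> Q y -> x <= z <= y -> Q z) ->
  {within I, continuous a} -> {within I, continuous b} ->
  (forall t, 0 <= t <= 1 -> Q (a t)) -> (forall t, 0 <= t <= 1 -> Q (b t)) ->
  a 0 = b 0 -> a 1 = b 1 -> homotopic (F \o a) (F \o b).
Proof.
move=> Fc Qc ac bc aQ bQ ab0 ab1.
apply: (@hom_convex (F \o fst) [set p | Q p.1] (fun t => (a t, 0)) (fun t => (b t, 0))).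
- by apply: within_comp _ Fc; [exact: within_fst|].
- move=> p q s /= Qp Qq s01; case: (leP p.1 q.1) => pq.
    by apply: (Qc _ _ _ Qp Qq); nra.
  by apply: (Qc _ _ _ Qq Qp); nra.
- by wcont.
- by wcont.
- by [].
- by [].
- by rewrite ab0.
- by rewrite ab1.
Qed.

Lemma hom_reparam f (a b : R -> R) : {within I, continuous f} ->
  {within I, continuous a} -> {within I, continuous b} ->
  (forall t, 0 <= t <= 1 -> 0 <= a t <= 1) ->
  (forall t, 0 <= t <= 1 -> 0 <= b t <= 1) ->
  a 0 = b 0 -> a 1 = b 1 -> homotopic (f \o a) (f \o b).
Proof.
move=> fc ac bc aI bI; apply: (@hom_line f I a b) => //.
- by move=> x y z /=; rewrite !in_itv /=; lra.
Qed.

Lemma within_piecewise (a b c d m : R) : a * m + b = c * m + d ->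
  {within I, continuous (fun t => if t <= m then a * t + b else c * t + d)}.
Proof.
move=> e; apply: (@within_paste R _ _ I (fun t => t)).
- by move=> t; exact: cvg_id.
- exact: closed_I.
- by wcont.
- by wcont.
- by move=> t _ ->.
Qed.

Lemma hom_assoc (x y z w : X) f g k : path_from_to x y f -> path_from_to y z g ->
  path_from_to z w k ->
  homotopic (concat (concat f g) k) (concat f (concat g k)).
Proof.
move=> pf pg pk.
have pfg := path_concat pf pg; have pl := path_concat pfg pk.
have pr := path_concat pf (path_concat pg pk).
have [lc _ _] := pl; have [rc _ _] := pr.
(* [b] sends 0, 1/2, 3/4, 1 to 0, 1/4, 1/2, 1: it turns the schedule of the left bracketing into
   that of the right one. *)
pose b (t : R) : R := if t <= 2^-1 then 2^-1 * t + 0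
                      else if t <= 3 / 4 then 1 * t + - 4^-1 else 2 * t + -1.
have bc : {within I, continuous b}.
  apply: (@within_paste R _ _ I (fun t => t)).
  - by move=> t; exact: cvg_id.
  - exact: closed_I.
  - by wcont.
  - by apply: within_sub (@within_piecewise 1 (- 4^-1) 2 (-1) (3/4) _); [move=> ? []|lra].
  - by move=> t _ ->; rewrite ifT; lra.
apply: hom_sym; apply: (@hom_trans ((concat (concat f g) k) \o b)).
  apply: hom_eq => // t t01; rewrite /concat /= /b.
  case: (leP t (2^-1)) => t2.
    rewrite ifT; last by lra.
    rewrite ifT; last by lra.
    by congr f; lra.
  case: (leP t (3/4)) => t34.
    rewrite ifT; last by lra.
    rewrite ifT; last by lra.
    rewrite ifF; last by lra.
    by congr g; lra.
  rewrite ifF; last by lra.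
  rewrite ifF; last by lra.
  by congr k; lra.
apply: (@hom_reparam _ b id) => //; rewrite /b.
- exact: within_id.
- by move=> t t01; case: ifP => [|?]; [lra|case: ifP; lra].
- by rewrite ifT; lra.
- by rewrite !ifF; lra.
Qed.

Lemma hom_idr (x y : X) f : path_from_to x y f -> homotopic (concat f (fun=> y)) f.
Proof.
move=> [fc f0 f1].
pose b (t : R) : R := if t <= 2^-1 then 2 * t + 0 else 0 * t + 1.
have bc : {within I, continuous b} by apply: within_piecewise; lra.
have b01 t : 0 <= t <= 1 -> 0 <= b t <= 1 by rewrite /b; case: ifP; lra.
apply: (@hom_trans (f \o b)).
  apply: hom_sym; apply: hom_eq.
    by have [] := path_reparam fc bc b01.
  move=> t t01; rewrite /= /concat /b; case: ifP => _; first by rewrite addr0.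
  by rewrite mul0r add0r f1.
apply: (@hom_reparam f b id) => //; rewrite /b.
- exact: within_id.
- by rewrite ifT; lra.
- by rewrite ifF; lra.
Qed.

Lemma hom_idl (x y : X) f : path_from_to x y f -> homotopic (concat (fun=> x) f) f.
Proof.
move=> [fc f0 f1].
pose b (t : R) : R := if t <= 2^-1 then 0 * t + 0 else 2 * t + -1.
have bc : {within I, continuous b} by apply: within_piecewise; lra.
have b01 t : 0 <= t <= 1 -> 0 <= b t <= 1 by rewrite /b; case: ifP; lra.
apply: (@hom_trans (f \o b)).
  apply: hom_sym; apply: hom_eq.
    by have [] := path_reparam fc bc b01.
  move=> t t01; rewrite /= /concat /b; case: ifP => _; last by [].
  by rewrite mul0r add0r f0.
apply: (@hom_reparam f b id) => //; rewrite /b.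
- exact: within_id.
- by rewrite ifT; lra.
- by rewrite ifF; lra.
Qed.

Lemma hom_inv (x y : X) f : path_from_to x y f ->
  homotopic (concat f (rev_path f)) (fun=> x).
Proof.
move=> [fc f0 f1].
(* [b] goes from 0 to 1 and back, and is contracted to the constant 0 inside the interval of
   parameters. *)
pose b (t : R) : R := if t <= 2^-1 then 2 * t + 0 else -2 * t + 2.
have bc : {within I, continuous b} by apply: within_piecewise; lra.
have b01 t : 0 <= t <= 1 -> 0 <= b t <= 1 by rewrite /b; case: ifP; lra.
apply: (@hom_trans (f \o b)).
  apply: hom_sym; apply: hom_eq.
    by have [] := path_reparam fc bc b01.
  move=> t t01; rewrite /= /concat /b /Defs.rev_path; case: ifP => _.
    by rewrite addr0.
  by congr f; ring.
rewrite -f0.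
apply: (@hom_reparam f b (fun=> 0)) => //; rewrite /b.
- exact: within_cst.
- by move=> *; rewrite lexx ler01.
- by rewrite ifT; lra.
- by rewrite ifF; lra.
Qed.

Lemma rev_concat (x y z : X) f g : path_from_to x y f -> path_from_to y z g ->
  rev_path (concat f g) = concat (rev_path g) (rev_path f).
Proof.
move=> [_ _ f1] [_ g0 _]; apply/funext => t; rewrite /Defs.rev_path /concat.
case: (ltgtP t 2^-1) => t2.
- by rewrite ifF; [congr g; ring|lra].
- by rewrite ifT; [congr f; ring|lra].
- rewrite t2 ifT; last by lra.
  rewrite (_ : 2 * (1 - 2^-1) = 1); last by lra.
  rewrite (_ : 1 - 2 * 2^-1 = 0); last by lra.
  by rewrite f1 g0.
Qed.

Lemma rev_pathK f : rev_path (rev_path f) = f.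
Proof. by apply/funext => t; rewrite /Defs.rev_path; congr f; ring. Qed.

Lemma hom_invl (x y : X) f : path_from_to x y f ->
  homotopic (concat (rev_path f) f) (fun=> y).
Proof. by move=> pf; rewrite -{2}(rev_pathK f); apply: hom_inv (path_rev pf). Qed.

(** Insert [g^-1 g] after [f] and contract the loop [f g^-1]. *)
Lemma simply_connected_hom (x y : X) f g : simply_connected R X ->
  path_from_to x y f -> path_from_to x y g -> homotopic f g.
Proof.
move=> [_ sc] pf pg; have pg' := path_rev pg.
have [fc _ _] := pf; have [gc _ _] := pg.
have l : loop_at x (concat f (rev_path g)) by apply: path_concat pf _.
apply: hom_trans (hom_sym (hom_idr pf)) _.
have gg := hom_sym (hom_invl pg).
apply: hom_trans (hom_concat (hom_refl fc) gg _) _; first by case: pf.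
apply: hom_trans (hom_sym (hom_assoc pf pg' pg)) _.
apply: hom_trans (hom_concat (sc _ _ l) (hom_refl gc) _) (hom_idl pg).
by case: l => _ _ ->; case: pg.
Qed.

End Homotopy.

Section HomotopyComp.
Variables (R : realType) (X Y : topologicalType) (F : X -> Y).

Lemma comp_concat (f g : R -> X) : F \o concat f g = concat (F \o f) (F \o g).
Proof. by apply/funext => t; rewrite /concat /=; case: ifP. Qed.

Lemma comp_rev (f : R -> X) : F \o rev_path f = rev_path (F \o f).
Proof. by []. Qed.

Lemma path_comp (x y : X) (f : R -> X) : continuous F -> path_from_to x y f ->
  path_from_to (F x) (F y) (F \o f).
Proof.
move=> Fc [fc f0 f1]; split; rewrite /= ?f0 ?f1 //.
by refine (@within_comp _ _ _ _ setT f F fc _ _) => //; exact: continuous_subspaceT.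
Qed.

Lemma hom_comp (f g : R -> X) : continuous F -> homotopic f g ->
  homotopic (F \o f) (F \o g).
Proof.
move=> Fc [H [Hc Hs Ht]]; exists (F \o H); split.
- by refine (@within_comp _ _ _ _ setT H F Hc _ _) => //; exact: continuous_subspaceT.
- by move=> t /Hs [/= -> ->].
- by move=> s /Ht [/= -> ->].
Qed.

End HomotopyComp.

(** * Coverings and Sperner's lemma *)

Section Bisection.
Variable R : realType.

(** Induction along an interval: let [s] be the supremum of the [x] with [P a x]; local validity at
    [s] and transitivity give [P a y] for some [y] beyond [s], unless [s = b]. It replaces every
    subdivision into small pieces. *)
Lemma interval_bisection (P : R -> R -> Prop) (a b : R) : a <= b ->
  (forall x y z, a <= x <= y -> y <= z <= b -> P x y -> P y z -> P x z) ->
  (forall t, a <= t <= b -> exists2 e : R, 0 < e & forall x y,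
     a <= x <= y -> y <= b -> `|x - t| < e -> `|y - t| < e -> P x y) ->
  P a b.
Proof.
move=> ab Ptr Ploc.
pose A := [set x | a <= x <= b /\ P a x].
have Aa : A a.
  split; first by rewrite lexx.
  have [|e e0 Pe] := Ploc a; first by rewrite lexx.
  by apply: Pe; rewrite ?lexx ?subrr ?normr0.
have Aub : ubound A b by move=> x [/andP[]].
have hsA : has_sup A by split; [exists a|exists b].
pose s := sup A.
have as_ : a <= s by apply: sup_upper_bound.
have sb : s <= b by apply: ge_sup => //; exists a.
have [|e e0 Pe] := Ploc s; first by rewrite as_.
have [x [/andP[ax xb] Pax] xs] := sup_adherent e0 hsA.
have xs' : x <= s by apply: sup_upper_bound => //; split; rewrite // ax.
pose y := Num.min b (s + e / 2).
have ys : s <= y by rewrite le_min sb; lra.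
have ye : y <= s + e / 2 by rewrite ge_min lexx orbT.
have yb : y <= b by rewrite ge_min lexx.
have Pay : P a y.
  apply: (Ptr a x y) => //.
  - by rewrite lexx.
  - by rewrite yb (le_trans xs').
  - apply: Pe => //; first by rewrite ax (le_trans xs').
      by rewrite ler0_norm; rewrite -/s in xs; lra.
    by rewrite ger0_norm; lra.
have : y <= s by apply: sup_upper_bound => //; split; rewrite // yb (le_trans as_).
rewrite /y; case: (leP b (s + e / 2)) => sbe; last by lra.
by move=> bs; have -> : b = y by rewrite /y min_l.
Qed.

Lemma near_interval (X : topologicalType) (A : set R) (f : R -> X) (U : set X) t :
  {within A, continuous f} -> open U -> A t -> U (f t) ->
  exists2 e : R, 0 < e & forall s, A s -> `|s - t| < e -> U (f s).
Proof.
move=> /subspace_continuousP fc Uo At Uft.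
have Un : nbhs (f t) U by apply: open_nbhs_nbhs.
have fU : nbhs t [set s | A s -> U (f s)] := fc _ At _ Un.
have [e /= e0 be] := (nbhs_ballP _ _).1 fU.
by exists e => // s As st; apply: be => //; rewrite /ball /= distrC.
Qed.

End Bisection.

Section Coverings.
Variables (R : realType) (E X : topologicalType) (p : E -> X).
Hypothesis p_cov : covering_map p.

Lemma covering_section e : exists U N s,
  [/\ open U /\ open N, U (p e) /\ N e,
      forall e', N e' -> U (p e') /\ s (p e') = e',
      forall x, U x -> p (s x) = x & {within U, continuous s}].
Proof.
have [pc [_ pe]] := p_cov; have [U [Uo Ux [W [Ww _ WU]]]] := pe (p e).
have : (p @^-1` U) e by [].
rewrite -WU => -[w Ww' we]; have [wo [s [pw sp _ sc]]] := Ww _ Ww'.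
exists U, w, s; split=> //.
- by move=> e' we'; split; [rewrite -pw; exists e'|exact: sp].
- by move=> x; rewrite -pw => -[e' we' <-]; rewrite sp.
Qed.

Lemma covering_lift x y (f : R -> X) e : path_from_to x y f -> p e = x ->
  exists l e', path_from_to e e' l /\
               forall t, 0 <= t <= 1 -> p (l t) = f t.
Proof.
move=> [fc f0 f1] pe.
(* The starting point of the lift is left free, which makes [P] transitive over adjacent
   intervals. *)
pose P (a b : R) := forall e, p e = f a -> exists l : R -> E,
  [/\ {within `[a, b], continuous l}, l a = e &
      forall t, a <= t <= b -> p (l t) = f t].
suff /(_ e) : P 0 1.
  rewrite f0 => /(_ pe) [l [lc l0 pl]].
  by exists l, (l 1); split.
apply: interval_bisection; first exact: ler01.
- move=> a b c /andP[a0 ab] /andP[bc c1] Pab Pbc e0 pe0.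
  have [l [lc l0 pl]] := Pab _ pe0.
  have [|m [mc m0 pm]] := Pbc (l b); first by apply: pl; rewrite ab lexx.
  exists (fun t => if t <= b then l t else m t); split; last first.
  + move=> t /andP[at_ tc]; case: (leP t b) => tb; first by apply: pl; rewrite at_.
    by apply: pm; rewrite ltW.
  + by rewrite ab.
  + apply: (@within_paste R _ _ _ (fun t : R => t)).
    * by move=> t; exact: cvg_id.
    * exact: interval_closed.
    * apply: within_sub lc => t [/=]; rewrite !in_itv /=.
      by move=> /andP[-> _] ->.
    * apply: within_sub mc => t [/=]; rewrite !in_itv /=.
      by move=> /andP[_ ->] ->.
    * by move=> t _ ->.
- move=> t t01.
  have [_ [_ pe']] := p_cov; have [U [Uo Ux [W [Ww _ WU]]]] := pe' (f t).
  have [|e1 e10 fU] := near_interval fc Uo _ Ux; first by rewrite /= in_itv.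
  exists e1 => // a b /andP[a0 ab] b1 at_ bt e2 pe2.
  have abU s : a <= s <= b -> U (f s).
    move=> /andP[as_ sb]; apply: fU; first by rewrite /= in_itv /=; lra.
    move: at_ bt; rewrite !ltr_norml => /andP[? ?] /andP[? ?].
    by apply/andP; split; lra.
  have : (p @^-1` U) e2 by rewrite /= pe2; apply: abU; rewrite lexx.
  rewrite -WU => -[w Ww' we]; have [wo [s [pw sp _ sc]]] := Ww _ Ww'.
  exists (s \o f); split.
  + apply: within_comp _ sc.
      by apply: within_sub fc => u; rewrite /= !in_itv /=; lra.
    by move=> u; rewrite /= in_itv => /abU.
  + by rewrite /= -pe2 sp.
  + move=> u /abU; rewrite -pw => -[e' we'] /= fu.
    by rewrite -fu sp.
Qed.

(** A loop inside an evenly covered open set is lifted to a loop of [E] by a section, and its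
    contraction projects down. *)
Lemma covering_null_loop x : simply_connected R E ->
  exists2 U, open U /\ U x & forall y (f : R -> X), loop_at y f ->
    (forall t, 0 <= t <= 1 -> U (f t)) -> homotopic f (fun=> y).
Proof.
move=> sc; have [pc [pr _]] := p_cov.
have : range p x by rewrite pr.
move=> [e _ <-]; have [U [N [s [[Uo _] [Ue _] _ ps sc']]]] := covering_section e.
exists U => // y f [fc f0 f1] fU.
have l : loop_at (s y) (s \o f).
  split; rewrite /= ?f0 ?f1 //.
  by apply: within_comp fc _ sc' => t; rewrite /= in_itv => /fU.
have := hom_comp pc (sc.2 _ _ l).
have -> : p \o (fun=> s y) = fun _ : R => y.
  by apply/funext => t /=; rewrite -f0 ps // ; apply: fU; rewrite lexx ler01.
apply: hom_trans; apply: hom_eq => // t t01 /=.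
by rewrite ps //; apply: fU.
Qed.

End Coverings.

Definition grid_edge (a b : nat) := ((a == 0) && (b == 1) || (a == 1) && (b == 0))%N.

(** Checked on the 81 colourings: a closed cycle that misses one of the three colours has an even
    number of edges with colours 0 and 1. *)
Lemma square_parity (a b c d : nat) : (a < 3 -> b < 3 -> c < 3 -> d < 3 ->
  grid_edge a b (+) grid_edge c d (+) grid_edge a c (+) grid_edge b d ->
  [/\ 0 \in [:: a; b; c; d], 1 \in [:: a; b; c; d] & 2 \in [:: a; b; c; d]])%N.
Proof.
by move: a b c d => [|[|[|a]]] [|[|[|b]]] [|[|[|c]]] [|[|[|d]]].
Qed.

(* The number of edges with colours 0 and 1 is odd along the bottom side and
   vanishes along the top side, and consecutive rows can only differ across a
   square with an odd boundary. *)
Lemma sperner_grid (N : nat) (col : nat -> nat -> nat) :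
  (forall i j, col i j < 3)%N ->
  (forall i, i <= N -> [/\ col 0 i = 0, col N i <> 0, col i 0 <> 2 &
                           col i N <> 1])%N ->
  exists i j, [/\ (i < N)%N, (j < N)%N & forall k, (k < 3)%N ->
    k \in [:: col i j; col i.+1 j; col i j.+1; col i.+1 j.+1]].
Proof.
move=> col3 colb.
pose row m j := \big[addb/false]_(0 <= i < m) grid_edge (col i j) (col i.+1 j).
pose sq i j := grid_edge (col i j) (col i.+1 j) (+)
  grid_edge (col i j.+1) (col i.+1 j.+1) (+) grid_edge (col i j) (col i j.+1)
  (+) grid_edge (col i.+1 j) (col i.+1 j.+1).
have [|nosq] := pselect (exists i j, [/\ (i < N)%N, (j < N)%N & sq i j]).
  move=> [i [j [iN jN /square_parity[] // *]]]; exists i, j; split=> //.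
  by case=> [|[|[|]]].
exfalso.
have sqF i j : (i < N)%N -> (j < N)%N -> sq i j = false.
  by move=> iN jN; apply/negP => sij; apply: nosq; exists i, j.
have rowE m j : (m <= N)%N -> (j < N)%N -> row m j (+) row m j.+1 =
    grid_edge (col 0%N j) (col 0%N j.+1) (+) grid_edge (col m j) (col m j.+1).
  move=> mN jN; elim: m mN => [|m IH] mN.
    by rewrite /row !big_geq //= addbb.
  rewrite /row !big_nat_recr //= -/(row m j) -/(row m j.+1).
  (* Adding one square with an even boundary moves the right end of both rows from one vertical edge
     to the next. *)
  have xorE (r1 r2 e1 e2 e3 e4 z : bool) : e1 (+) e2 (+) e3 (+) e4 = false ->
      r1 (+) r2 = z (+) e3 -> (r1 (+) e1) (+) (r2 (+) e2) = z (+) e4.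
    by case: r1 r2 e1 e2 e3 e4 z => -[] [] [] [] [] [].
  exact: xorE (sqF m j mN jN) (IH (ltnW mN)).
(* The vertical sides contain no edge with colours 0 and 1: the left one has only the colour 0, the
   right one never has it. *)
have rowN j : (j <= N)%N -> row N j = row N 0%N.
  elim: j => // j IH jN; rewrite -IH ?(ltnW jN) //.
  have := rowE N j (leqnn N) jN.
  have [-> c1 _ _] := colb _ (ltnW jN); have [-> c2 _ _] := colb _ jN.
  have -> : grid_edge 0 0 (+) grid_edge (col N j) (col N j.+1) = false.
    by rewrite /grid_edge; move/eqP/negPf: c1 => ->; move/eqP/negPf: c2 => ->; rewrite andbF.
  by case: (row N j) (row N j.+1) => -[].
have rowT : row N N = false.
  rewrite /row big_nat_cond big1 // => i /andP[/andP[_ iN] _].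
  have [_ _ _ /eqP/negPf c1] := colb _ (ltnW iN).
  have [_ _ _ /eqP/negPf c2] := colb _ iN.
  by rewrite /grid_edge c1 c2 andbF.
(* Without colour 2 on the bottom side, the parity counts the changes between 0 and 1, starting from
   0. *)
have rowB m : (m <= N)%N -> row m 0%N = (col m 0 != 0)%N.
  elim: m => [|m IH] mN.
    by rewrite /row big_geq //; have [-> _ _ _] := colb 0%N (leq0n _).
  rewrite /row big_nat_recr //= -/(row m 0) IH ?(ltnW mN) //.
  have [_ _ + _] := colb _ (ltnW mN); have [_ _ + _] := colb _ mN.
  have := col3 m 0%N; have := col3 m.+1 0%N.
  by case: (col m 0%N) (col m.+1 0%N) => [|[|[|?]]] [|[|[|?]]].
have := rowB N (leqnn N); rewrite -(rowN N) // rowT.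
by have [_ /eqP-> _ _] := colb _ (leq0n N).
Qed.

Definition in_square (R : realType) (p : R * R) := 0 <= p.1 <= 1 /\ 0 <= p.2 <= 1.

(** Small squares with all three colours, taken in finer and finer grids, accumulate at a point of
    the compact square. *)
Lemma sperner_point (R : realType) (col : R * R -> nat) :
  (forall p, col p < 3)%N ->
  (forall t, 0 <= t <= 1 -> [/\ col (0, t) = 0%N, col (1, t) <> 0%N,
     col (t, 0) <> 2%N & col (t, 1) <> 1%N]) ->
  exists2 p, in_square p & forall U, nbhs p U -> forall k, (k < 3)%N ->
    exists q, [/\ U q, in_square q & col q = k].
Proof.
move=> col3 colb.
pose g (N i : nat) : R := i%:R / N.+1%:R.
have gN N : g N N.+1 = 1 by rewrite /g mulfV ?pnatr_eq0.
have g01 N i : (i <= N.+1)%N -> 0 <= g N i <= 1.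
  move=> iN; rewrite /g divr_ge0 ?ler0n //= ler_pdivrMr ?ltr0n //.
  by rewrite mul1r ler_nat.
have gS N i : g N i.+1 = g N i + N.+1%:R^-1 by rewrite /g -natr1 mulrDl mul1r.
have grid N : exists ij : nat * nat, [/\ (ij.1 < N.+1)%N, (ij.2 < N.+1)%N & forall k, (k < 3)%N ->
    exists i' j', [/\ (ij.1 <= i' <= ij.1.+1)%N, (ij.2 <= j' <= ij.2.+1)%N &
                      col (g N i', g N j') = k]].
  have [||i [j [iN jN kk]]] := @sperner_grid N.+1 (fun i j => col (g N i, g N j)).
  - by move=> *; exact: col3.
  - move=> i iN; have := colb _ (g01 _ _ iN).
    by rewrite (_ : g N 0 = 0) ?gN // /g mul0r.
  exists (i, j); split=> // k /kk; rewrite !inE => /or4P[] /eqP->.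
  - by exists i, j; rewrite !leqnn !leqnSn.
  - by exists i.+1, j; rewrite !leqnn !leqnSn.
  - by exists i, j.+1; rewrite !leqnn !leqnSn.
  - by exists i.+1, j.+1; rewrite !leqnn !leqnSn.
have [ij ijP] := choice grid.
pose pt N : R * R := (g N (ij N).1, g N (ij N).2).
pose Q := (`[0, 1] `*` `[0, 1])%classic : set (R * R).
have Qc : compact Q by apply: compact_setX; exact: segment_compact.
have [|p [Qp clp]] := Qc (pt @ \oo) _.
  exists 0%N => // N _; have [iN jN _] := ijP N.
  by split; rewrite /= in_itv; apply: g01; rewrite ltnW.
exists p; first by case: Qp; rewrite /= !in_itv.
move=> U Up k k3.
have [e /= e0 be] := (nbhs_ballP _ _).1 Up.
have e20 : 0 < e / 2 by rewrite divr_gt0.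
(* One half of [e] is for the distance from the grid point to [p], the other for the mesh of the
   grid. *)
have [M Me] : exists M : nat, M.+1%:R^-1 < e / 2.
  exists (Num.truncn ((e / 2)^-1)).
  by rewrite -[ltRHS]invrK ltf_pV2 ?posrE ?invr_gt0 ?ltr0n // truncnS_gt.
have [||N] := clp [set pt N | N in [set N | (M <= N)%N]] (ball p (e / 2)).
- exists M => // N MN; exists N => //.
- exact: nbhsx_ballx.
move=> [[N' MN <-] bN].
have [iN jN /(_ k k3) [i' [j' [ii' jj' ck]]]] := ijP N'.
exists (g N' i', g N' j'); split=> //; last first.
  split; apply: g01; first by case/andP: ii' => _ /leq_trans; apply.
  by case/andP: jj' => _ /leq_trans; apply.
have Ne : N'.+1%:R^-1 < e / 2.
  by apply: le_lt_trans Me; rewrite lef_pV2 ?posrE ?ltr0n // ler_nat.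
have close i a : (i <= a <= i.+1)%N -> `|g N' i - g N' a| < e / 2.
  case/andP=> ia ai; have : a = i \/ a = i.+1.
    move: ai; rewrite leq_eqVlt ltnS => /orP[/eqP|ai]; first by right.
    by left; apply/eqP; rewrite eqn_leq ai.
  case=> ->; first by rewrite subrr normr0.
  by rewrite gS opprD addrA subrr sub0r normrN gtr0_norm // invr_gt0 ltr0n.
apply: be; apply: (ball_split bN).
by split=> /=; rewrite /ball /=; apply: close.
Qed.

(** * Boundary charts and boundary loops *)

Section MoreContinuity.
Variable R : realType.

Lemma within_norm (T : topologicalType) (A : set T) (f : T -> R) :
  {within A, continuous f} -> {within A, continuous (fun x => `|f x|)}.
Proof.
move=> /subspace_continuousP fc.
by apply/subspace_continuousP => x Ax; apply: cvg_norm; exact: fc.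
Qed.

Lemma withinV (T : topologicalType) (A : set T) (f : T -> R) :
  {within A, continuous f} -> (forall x, A x -> f x != 0) ->
  {within A, continuous (fun x => (f x)^-1)}.
Proof.
move=> /subspace_continuousP fc f0.
by apply/subspace_continuousP => x Ax; apply: cvgV; [exact: f0|exact: fc].
Qed.

Lemma within_max (T : topologicalType) (A : set T) (f g : T -> R) :
  {within A, continuous f} -> {within A, continuous g} ->
  {within A, continuous (fun x => Num.max (f x) (g x))}.
Proof.
move=> fc gc.
refine (within_eq (f := fun x => (f x + g x + `|f x + - g x|) * 2^-1) _ _).
  by move=> x _; rewrite maxr_absE.
apply: withinM; last exact: within_cst.
apply: withinD; first exact: withinD.
by apply: within_norm; apply: withinD => //; exact: withinN.
Qed.

Lemma within_min (T : topologicalType) (A : set T) (f g : T -> R) :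
  {within A, continuous f} -> {within A, continuous g} ->
  {within A, continuous (fun x => Num.min (f x) (g x))}.
Proof.
move=> fc gc.
refine (within_eq (f := fun x => - Num.max (- f x) (- g x)) _ _).
  by move=> x _; rewrite oppr_max !opprK.
by apply: withinN; apply: within_max; apply: withinN.
Qed.

Lemma within_near (T U : topologicalType) (A : set T) (f : T -> U) (W : set U) x :
  {within A, continuous f} -> A x -> open W -> W (f x) ->
  nbhs x [set z | A z -> W (f z)].
Proof.
move=> /subspace_continuousP fc Ax Wo Wf.
by apply: (fc _ Ax); apply: open_nbhs_nbhs.
Qed.

Lemma open_within_preimage (T U : topologicalType) (A : set T) (f : T -> U)
    (W : set U) :
  {within A, continuous f} -> open A -> open W -> open (A `&` f @^-1` W).
Proof.
move=> fc Ao Wo; rewrite openE => x [Ax Wx].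
have := within_near fc Ax Wo Wx; have : nbhs x A by apply: open_nbhs_nbhs.
by move=> H1 H2; apply: filterS2 H1 H2 => z Az /(_ Az).
Qed.

(** Carries the inequality defining a Sperner colour over to the accumulation point. *)
Lemma within_le_limit (T : topologicalType) (A : set T) (f : T -> R) x b :
  {within A, continuous f} -> A x ->
  (forall U, nbhs x U -> exists q, [/\ U q, A q & f q <= b]) -> f x <= b.
Proof.
move=> fc Ax H; rewrite leNgt; apply/negP => bf.
have bo : open [set y : R | b < y] by exact: open_gt.
have [q [Uq Aq]] := H _ (within_near fc Ax bo bf).
by rewrite leNgt (Uq Aq).
Qed.

Lemma within_ge_limit (T : topologicalType) (A : set T) (f : T -> R) x b :
  {within A, continuous f} -> A x ->
  (forall U, nbhs x U -> exists q, [/\ U q, A q & b <= f q]) -> b <= f x.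
Proof.
move=> fc Ax H; rewrite -lerN2.
apply: (within_le_limit (withinN fc) Ax) => U /H [q [Uq Aq bq]].
by exists q; split; rewrite ?lerN2.
Qed.

Definition box (z : R * R) (r : R) : set (R * R) :=
  [set w | `|w.1 - z.1| < r /\ `|w.2 - z.2| < r].

Lemma boxE z r : box z r = ball z r.
Proof.
apply/seteqP; split=> w [w1 w2]; split; rewrite /ball /= distrC //.
Qed.

Lemma box_sub z (U : set (R * R)) : nbhs z U ->
  exists2 r, 0 < r & box z r `<=` U.
Proof.
by move=> /nbhs_ballP[r /= r0 bU]; exists r => //; rewrite boxE.
Qed.

Lemma open_box z r : open (box z r).
Proof.
rewrite boxE openE => w zw; rewrite /interior.
have -> : ball z r = (ball z.1 r `*` ball z.2 r : set (R * R)) by [].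
case: zw => w1 w2; exists (ball z.1 r, ball z.2 r) => //; split => /=.
- by apply: open_nbhs_nbhs; split => //; exact: ball_open.
- by apply: open_nbhs_nbhs; split => //; exact: ball_open.
Qed.

Lemma convex_lt (x y c s : R) : 0 <= s <= 1 -> x < c -> y < c ->
  (1 - s) * x + s * y < c.
Proof.
move=> /andP[s0 s1] xc yc; rewrite -subr_gt0.
rewrite (_ : _ - _ = (1 - s) * (c - x) + s * (c - y)); last by ring.
have [s1'|s1'] := ltP s 1.
  by rewrite ltr_pwDl ?mulr_gt0 ?mulr_ge0 ?subr_gt0 ?subr_ge0 // ltW.
by rewrite ltr_wpDl ?mulr_gt0 ?mulr_ge0 ?subr_gt0 ?subr_ge0 ?(lt_le_trans _ s1') // ltW.
Qed.

Lemma box_convex z r : convex2 (box z r).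
Proof.
move=> p q s [p1 p2] [q1 q2] s01; rewrite /lin.
have H (x y c : R) : `|x - c| < r -> `|y - c| < r ->
    `|(1 - s) * x + s * y - c| < r.
  rewrite !ltr_norml => /andP[x1 x2] /andP[y1 y2].
  have H1 := @convex_lt x y (c + r) s s01.
  have H2 := @convex_lt (- x) (- y) (r - c) s s01.
  by apply/andP; split; [have := H2 _ _|have := H1 _ _]; lra.
by split=> /=; exact: H.
Qed.

Lemma half_plane_convex : convex2 (@half_plane R).
Proof. by move=> p q s; rewrite /half_plane /lin /=; nra. Qed.

(** A convex model of neighbourhoods that serves at interior and at boundary points alike;
    homotopies inside it are straight. *)
Definition half_box z r := box z r `&` @half_plane R.

Lemma half_box_convex z r : convex2 (half_box z r).
Proof.
move=> p q s [p1 p2] [q1 q2] s01.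
by split; [exact: box_convex|exact: half_plane_convex].
Qed.

Lemma box_center z r : 0 < r -> box z r z.
Proof. by move=> r0; split; rewrite subrr normr0. Qed.

End MoreContinuity.

Section Charts.
Variables (R : realType) (S : surface R).
Implicit Types (c k : chart R S) (x : S).

Lemma chart_inj c x y : surf_atlas c -> chart_dom c x -> chart_dom c y ->
  chart_fun c x = chart_fun c y -> x = y.
Proof.
move=> /surf_chart[_ [Om _ [_ inv _ _]]] /inv e /inv e' xy.
by rewrite -e -e' xy.
Qed.

Lemma chart_funK c x : surf_atlas c -> chart_dom c x ->
  chart_inv c (chart_fun c x) = x.
Proof. by move=> /surf_chart[_ [Om _ [_ inv _ _]]] /inv. Qed.

Lemma chart_half c x : surf_atlas c -> chart_dom c x -> half_plane (chart_fun c x).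
Proof.
move=> /surf_chart[_ [Om _ [im _ _ _]]] cx.
have : (chart_fun c @` chart_dom c) (chart_fun c x) by exists x.
by rewrite im => -[].
Qed.

(** Shrinks a chart around [x] until its image is convex and its source lies in [W]. The open set
    [V] is there for continuity arguments: whatever stays in [V] is seen inside the half-box. *)
Lemma chart_box c x (W : set S) : surf_atlas c -> chart_dom c x -> open W -> W x ->
  exists2 r, 0 < r & let Q := half_box (chart_fun c x) r in
    [/\ forall z, Q z -> [/\ chart_dom c (chart_inv c z), W (chart_inv c z) &
                             chart_fun c (chart_inv c z) = z],
        {within Q, continuous (chart_inv c)} &
        exists V, [/\ open V, V x &
          forall x', V x' -> [/\ chart_dom c x', W x' & Q (chart_fun c x')]]].
Proof.
move=> ca cx Wo Wx; have [do_ [Om Omo [im inv fc ic]]] := surf_chart ca.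
have : (chart_fun c @` chart_dom c) (chart_fun c x) by exists x.
rewrite im => Oz; have [Oz1 Hz] := Oz.
have Wi : W (chart_inv c (chart_fun c x)) by rewrite chart_funK.
have n1 := within_near ic Oz Wo Wi.
have n2 : nbhs (chart_fun c x) Om by apply: open_nbhs_nbhs.
have [r r0 rO] := box_sub (filterI n1 n2).
exists r => // Q.
have QO z : Q z -> (Om `&` @half_plane R) z by move=> [/rO[_ ?] ?].
have QP z : Q z -> [/\ chart_dom c (chart_inv c z), W (chart_inv c z) &
                             chart_fun c (chart_inv c z) = z].
  move=> Qz; have := QO _ Qz; rewrite -im => -[y cy yz].
  have Wz : W (chart_inv c z) by case: Qz => /rO[/= + ? ?]; apply.
  by move: Wz; rewrite -yz inv.
split=> //; first by apply: within_sub ic => z /QO.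
exists (chart_dom c `&` chart_fun c @^-1` (box (chart_fun c x) r)); split.
- refine (open_within_preimage fc do_ _); exact: open_box.
- by split=> //; exact: box_center.
- move=> x' [cx' bx'].
  have Qx' : Q (chart_fun c x') by split=> //; exact: chart_half.
  by have [_ + _] := QP _ Qx'; rewrite chart_funK.
Qed.

(* If the image of x in the chart k were off the boundary line, a small square
   loop around it could be filled in without meeting it, by coning its image in
   the half-disc given by a chart in which x is on the boundary line. *)
Lemma boundary_chart x k : boundary x -> surf_atlas k -> chart_dom k x ->
  (chart_fun k x).2 = 0.
Proof.
move=> [c ca [cx a2]] ka kx; set a := chart_fun c x in a2; set y := chart_fun k x.
have y0 : 0 <= y.2 := chart_half ka kx.
apply/eqP; rewrite eq_le y0 andbT leNgt; apply/negP => ypos.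
have [do_k _] := surf_chart ka.
have [rc rc0 [Qc cic [V [Vo Vx VQ]]]] := chart_box ca cx do_k kx.
have [rk rk0 [Qk kic _]] := chart_box ka kx Vo Vx.
rewrite -/a in Qc cic VQ; rewrite -/y in Qk kic.
pose r := Num.min rk y.2 / 2.
have r0 : 0 < r by rewrite divr_gt0 // lt_min rk0.
have rrk : r < rk.
  have : Num.min rk y.2 <= rk by rewrite ge_min lexx.
  by rewrite /r; lra.
have ry : r < y.2.
  have : Num.min rk y.2 <= y.2 by rewrite ge_min lexx orbT.
  by rewrite /r; lra.
pose apex : R * R := (a.1, rc / 2).
have Qapex : half_box a rc apex.
  split; last by rewrite /half_plane /=; lra.
  by split; rewrite /= ?subrr ?normr0 // a2 subr0 ger0_norm; lra.
pose sq : set (R * R) := [set p | in_square p].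
(* The square is recentred at 0, with sup norm [m]. Where [m >= 1/2], [pt] is the radial projection
   to the square of radius [r] around [y], and [s] cones its image in the chart [c] to [apex]. Where
   [m <= 1/2], [s = 1] makes [v] constant, and the lower bound in [d] avoids a division by zero. *)
pose w1 (p : R * R) := 2 * p.1 - 1; pose w2 (p : R * R) := 2 * p.2 - 1.
pose m p := Num.max `|w1 p| `|w2 p|.
pose d p := Num.max (m p) 2^-1.
pose pt p := (y.1 + r * (w1 p / d p), y.2 + r * (w2 p / d p)).
pose s p := Num.min 1 (2 - 2 * m p).
pose u p := chart_fun c (chart_inv k (pt p)).
pose v p := lin (u p) apex (s p).
pose G p := chart_fun k (chart_inv c (v p)).
have w1n p : in_square p -> `|w1 p| <= 1.
  by move=> [p1 p2]; rewrite ler_norml /w1; lra.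
have w2n p : in_square p -> `|w2 p| <= 1.
  by move=> [p1 p2]; rewrite ler_norml /w2; lra.
have m1 p : in_square p -> m p <= 1 by move=> sp; rewrite ge_max w1n // w2n.
have d0 p : 0 < d p by rewrite lt_max invr_gt0 ltr0n orbT.
have md p : m p <= d p by rewrite le_max lexx.
have s01 p : in_square p -> 0 <= s p <= 1.
  by move=> /m1 mp; rewrite ge_min lexx /= andbT le_min ler01; lra.
have ptQ p : half_box y rk (pt p).
  have q1 : `|r * (w1 p / d p)| < rk.
    rewrite normrM (gtr0_norm r0) normf_div (gtr0_norm (d0 p)).
    apply: le_lt_trans rrk; rewrite ler_piMr ?(ltW r0) // ler_pdivrMr // mul1r.
    by apply: le_trans (md p); rewrite le_max lexx.
  have q2 : `|r * (w2 p / d p)| <= r.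
    rewrite normrM (gtr0_norm r0) normf_div (gtr0_norm (d0 p)).
    rewrite ler_piMr ?(ltW r0) // ler_pdivrMr // mul1r.
    by apply: le_trans (md p); rewrite le_max lexx orbT.
  split; first split; rewrite /= ?[_ + _ - _]addrAC ?subrr ?add0r //.
    exact: le_lt_trans rrk.
  by move: q2; rewrite /half_plane /= ler_norml; lra.
have uQ p : half_box a rc (u p).
  by have [_ /VQ[]] := Qk _ (ptQ p).
have vQ p : in_square p -> half_box a rc (v p).
  by move=> sp; apply: half_box_convex => //; exact: s01.
have kcv p : in_square p -> chart_dom k (chart_inv c (v p)).
  by move=> sp; have [] := Qc _ (vQ _ sp).
have Gc : {within sq, continuous G}.
  have [_ [_ _ [_ _ kfc _]]] := surf_chart ka.
  have [_ [_ _ [_ _ cfc _]]] := surf_chart ca.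
  have w1c : {within sq, continuous w1} by wcont.
  have w2c : {within sq, continuous w2} by wcont.
  have mc : {within sq, continuous m} by apply: within_max; apply: within_norm.
  have dc : {within sq, continuous d}.
    by apply: within_max => //; exact: within_cst.
  have dVc : {within sq, continuous (fun p => (d p)^-1)}.
    by apply: withinV => // p _; rewrite gt_eqF.
  have ptc : {within sq, continuous pt}.
    by apply: within_pair; apply: withinD; try exact: within_cst;
      apply: withinM; try exact: within_cst; apply: withinM.
  have sc : {within sq, continuous s}.
    apply: within_min; first exact: within_cst.
    apply: withinD; first exact: within_cst.
    by apply: withinN; apply: withinM => //; exact: within_cst.
  have uc : {within sq, continuous u}.
    refine (@within_comp _ _ _ sq (chart_dom c) (chart_inv k \o pt) _ _ _ _) => //.
      refine (@within_comp _ _ _ sq (half_box y rk) pt _ _ _ _) => //.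
    by move=> p _ /=; have [_ /VQ[]] := Qk _ (ptQ p).
  have vc : {within sq, continuous v}.
    by apply: within_lin => //; exact: within_cst.
  refine (@within_comp _ _ _ sq (chart_dom k) (chart_inv c \o v) _ _ _ _) => //.
  refine (@within_comp _ _ _ sq (half_box a rc) v _ _ _ _) => //.
(* [apex] has positive height, so [v p] can be on the boundary line only if [s p = 0], that is on
   the outer side, where [G] runs along the square loop around [y]. *)
have Gy p : in_square p -> G p <> y.
  move=> sp Gp; have va : v p = a.
    have [_ _ <-] := Qc _ (vQ _ sp).
    by congr (chart_fun c); apply: (chart_inj ka) => //; exact: kcv.
  have s0 : s p = 0.
    have /(congr1 snd) /= := va; rewrite a2 => e.
    have [_ up] := uQ p; move: up (s01 _ sp) rc0; rewrite /half_plane /=; nra.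
  have mp1 : m p = 1.
    have := m1 _ sp; move: s0; rewrite /s.
    by case: (leP 1 (2 - 2 * m p)); lra.
  have ua : u p = a by rewrite -va /v s0 lin0.
  have xpt : chart_inv k (pt p) = x.
    apply: (chart_inj ca) => //.
    by have [_ /VQ[]] := Qk _ (ptQ p).
  have pty : pt p = y by have [_ _ <-] := Qk _ (ptQ p); rewrite xpt.
  have d1 : d p = 1 by rewrite /d mp1 max_l //; lra.
  have /(congr1 fst) /= := pty; have /(congr1 snd) /= := pty.
  rewrite d1 !divr1 => e2 e1.
  have z1 : w1 p = 0 by nra.
  have z2 : w2 p = 0 by nra.
  by move: mp1; rewrite /m z1 z2 normr0 maxxx; lra.
have Gb p : in_square p -> m p = 1 -> G p = (y.1 + r * w1 p, y.2 + r * w2 p).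
  move=> sp mp1.
  have s0 : s p = 0 by rewrite /s mp1 min_r; lra.
  have d1 : d p = 1 by rewrite /d mp1 max_l //; lra.
  have [ck Vk kk] := Qk _ (ptQ p).
  rewrite /G /v s0 lin0 /u chart_funK //; last by have [] := VQ _ Vk.
  by rewrite kk /pt d1 !divr1.
(* The colours 0, 1, 2 mean left of [y], below [y] and not to its left, and the rest: where all
   three accumulate, [G] takes the value [y]. *)
pose col p := if (G p).1 < y.1 then 0%N else if (G p).2 < y.2 then 1%N else 2%N.
have [||p sp clp] := @sperner_point R col.
- by move=> p; rewrite /col; case: ifP => // _; case: ifP.
- move=> t t01.
  have sq0 : in_square (0 : R, t) by split; rewrite /= ?t01 // lexx ler01.
  have sq1 : in_square (1 : R, t) by split; rewrite /= ?t01 // lexx ler01.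
  have sq2 : in_square (t : R, 0 : R) by split; rewrite /= ?t01 // lexx ler01.
  have sq3 : in_square (t : R, 1 : R) by split; rewrite /= ?t01 // lexx ler01.
  have n1 : `|2 * t - 1| <= 1 by rewrite ler_norml; lra.
  have e0 : `|2 * 0 - 1| = 1 :> R by rewrite mulr0 sub0r normrN normr1.
  have e1 : `|2 * 1 - 1| = 1 :> R by rewrite (_ : 2 * 1 - 1 = 1) ?normr1 //; lra.
  have G0 : G (0, t) = (y.1 + r * w1 (0, t), y.2 + r * w2 (0, t)).
    by apply: Gb; rewrite // /m /w1 /w2 /= e0 max_l.
  have G1 : G (1, t) = (y.1 + r * w1 (1, t), y.2 + r * w2 (1, t)).
    by apply: Gb; rewrite // /m /w1 /w2 /= e1 max_l.
  have G2 : G (t, 0) = (y.1 + r * w1 (t, 0), y.2 + r * w2 (t, 0)).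
    by apply: Gb; rewrite // /m /w1 /w2 /= e0 max_r.
  have G3 : G (t, 1) = (y.1 + r * w1 (t, 1), y.2 + r * w2 (t, 1)).
    by apply: Gb; rewrite // /m /w1 /w2 /= e1 max_r.
  split; rewrite /col ?G0 ?G1 ?G2 ?G3 /w1 /w2 /=.
  + by rewrite ifT //; lra.
  + by rewrite ifF; [case: ifP|lra].
  + by case: ifP => // _; rewrite ifT //; lra.
  + by case: ifP => // _; rewrite ifF //; lra.
have G1c : {within sq, continuous (fst \o G)}.
  by refine (@within_comp _ _ _ _ setT _ _ Gc _ _) => //; exact: within_fst.
have G2c : {within sq, continuous (snd \o G)}.
  by refine (@within_comp _ _ _ _ setT _ _ Gc _ _) => //; exact: within_snd.
have le1 : (G p).1 <= y.1.
  apply: (within_le_limit G1c sp) => U Up.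
  have [q [Uq sq_q]] := clp U Up 0%N isT; rewrite /col.
  by case: ifP => [/ltW ?|_]; [exists q|case: ifP].
have ge1 : y.1 <= (G p).1.
  apply: (within_ge_limit G1c sp) => U Up.
  have [q [Uq sq_q]] := clp U Up 1%N isT; rewrite /col.
  by case: ifPn => //; rewrite -leNgt; exists q.
have le2 : (G p).2 <= y.2.
  apply: (within_le_limit G2c sp) => U Up.
  have [q [Uq sq_q]] := clp U Up 1%N isT; rewrite /col.
  by case: ifP => // _; case: ifP => // /ltW; exists q.
have ge2 : y.2 <= (G p).2.
  apply: (within_ge_limit G2c sp) => U Up.
  have [q [Uq sq_q]] := clp U Up 2%N isT; rewrite /col.
  by case: ifP => // _; case: ifPn => //; rewrite -leNgt; exists q.
apply: (Gy p sp); move: le1 ge1 le2 ge2; case: (G p) => g1 g2 /= le1 ge1 le2 ge2.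
by rewrite [y]surjective_pairing; congr (_, _); apply/eqP; rewrite eq_le ?le1 ?ge1 ?le2 ?ge2.
Qed.

End Charts.

Lemma exists_smaller (R : realType) (s : seq R) : all (fun x => 0 < x) s ->
  exists2 e, 0 < e & all (fun x => e < x) s.
Proof.
elim: s => [|x s IH] /=; first by exists 1.
move=> /andP[x0 /IH[e e0 es]]; exists (Num.min x e / 2).
  by rewrite divr_gt0 // lt_min x0.
have m0 : 0 < Num.min x e by rewrite lt_min x0.
have mx : Num.min x e <= x by rewrite ge_min lexx.
have me : Num.min x e <= e by rewrite ge_min lexx orbT.
apply/andP; split; first by lra.
by apply: sub_all es => y; apply: lt_trans; lra.
Qed.

Section PeriodicExtension.
Variables (R : realType) (S : surface R).
Implicit Types (c : R -> S) (k : chart R S) (u w : R) (N : int).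

(** The loop is unrolled on the line, so that arcs crossing its base point, or making several turns,
    are arcs of one function. *)
Definition periodic c (u : R) : S := c (u - (Num.floor u)%:~R).

Lemma frac_itv u : 0 <= u - (Num.floor u)%:~R < 1.
Proof. by have := floor_itv u; rewrite intrD; lra. Qed.

Lemma periodicD c u N : periodic c (u + N%:~R) = periodic c u.
Proof.
rewrite /periodic.
have -> : Num.floor (u + N%:~R) = Num.floor u + N.
  by apply: floor_def; have := floor_itv u; rewrite !intrD; lra.
by congr c; rewrite intrD; ring.
Qed.

(** The right end of the period is included because the loop closes up. *)
Lemma periodic_on c u N : c 0 = c 1 -> N%:~R <= u <= N%:~R + 1 ->
  periodic c u = c (u - N%:~R).
Proof.
move=> c01 /andP[Nu]; rewrite le_eqVlt => /orP[/eqP->|uN].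
  have -> : N%:~R + 1 = 0 + (N + 1)%:~R :> R by rewrite intrD; ring.
  rewrite periodicD /periodic floor0 subr0 c01; congr c.
  by rewrite intrD; ring.
rewrite /periodic (@floor_def _ u N) // intrD; exact/andP.
Qed.

Lemma periodic_itv c u : exists2 t, 0 <= t < 1 & periodic c u = c t.
Proof. by exists (u - (Num.floor u)%:~R); rewrite ?frac_itv. Qed.

Lemma periodic_continuous c : loop_at (c 0) c -> continuous (periodic c).
Proof.
move=> [cc _ c1] u W Wu; set N := Num.floor u.
have c01 : c 0 = c 1 by [].
(* Two periods, so that [A] is a neighbourhood of [u] even when [u] is the integer [N]. *)
pose A : set R := `[N%:~R - 1, N%:~R + 1]%classic.
have uN : N%:~R <= u < N%:~R + 1 by have := floor_itv u; rewrite -/N intrD; lra.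
have Ac : {within A, continuous (periodic c)}.
  refine (within_eq (f := fun t : R => if t <= N%:~R then c (1 * t + (1 - N%:~R))
      else c (1 * t + - N%:~R)) _ _).
    move=> t; rewrite /A /= in_itv /= => tA; case: ifPn => tN.
      rewrite (@periodic_on _ _ (N - 1)) // intrB; last by lra.
      by congr c; ring.
    by rewrite (@periodic_on _ _ N) //; [congr c; ring|lra].
  apply: (@within_paste R _ _ _ (fun t : R => t)).
  - by move=> t; exact: cvg_id.
  - exact: interval_closed.
  - by apply: within_affine => // t [+ /=]; rewrite /A /= in_itv /=; lra.
  - by apply: within_affine => // t [+ /=]; rewrite /A /= in_itv /=; lra.
  - move=> t _ ->; rewrite !mul1r subrr (_ : _ + _ = 1) ?c1 //; ring.
have An : nbhs u A.
  apply/nbhs_ballP; exists (Num.min 1 (N%:~R + 1 - u)) => /=.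
    by rewrite lt_min ltr01 /=; lra.
  move=> t; rewrite /ball /= lt_min => /andP[t1 t2]; rewrite /A /= in_itv /=.
  by move: t1 t2; rewrite !ltr_norml; lra.
move/subspace_continuousP: Ac => /(_ u (nbhs_singleton An) W Wu) AW.
have AW' : nbhs u [set t | A t -> W (periodic c t)] by exact: AW.
by apply: filterS2 An AW' => t At; apply.
Qed.

Variable c : R -> S.
Hypothesis c_bd : boundary_loop c.
Local Notation p := (periodic c).

Let c_loop : loop_at (c 0) c.
Proof. by have [] := c_bd. Qed.

Let c01 : c 0 = c 1.
Proof. by have [_ _ ->] := c_loop. Qed.

Lemma periodic_boundary u : boundary (p u).
Proof.
have [t t01 ->] := periodic_itv c u; have [_ _ + _] := c_bd; apply.
by rewrite in_itv /=; lra.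
Qed.

Lemma periodic_inj u w : p u = p w -> exists N, w = u + N%:~R.
Proof.
move=> e; have [_ inj _ _] := c_bd.
have := frac_itv u; have := frac_itv w; move: e; rewrite /periodic => e fw fu.
exists (Num.floor w - Num.floor u).
have : u - (Num.floor u)%:~R = w - (Num.floor w)%:~R.
  by apply: inj => //; rewrite in_itv.
by rewrite intrB; lra.
Qed.

Lemma periodic_range_closed : closed (range p).
Proof.
apply: compact_closed; first exact: surf_hausdorff.
have -> : range p = c @` `[0, 1]%classic.
  apply/seteqP; split=> [_ [u _ <-]|_ [t t01 <-]].
    by have [t t01 ->] := periodic_itv c u; exists t; rewrite //= in_itv /=; lra.
  exists t => //; rewrite (@periodic_on c t 0) ?subr0 // add0r.
  by move: t01; rewrite /= in_itv.
apply: continuous_compact; first by have [] := c_loop.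
exact: segment_compact.
Qed.

(** The orientation of boundary loops, seen on the unrolled loop: it makes the first coordinate of a
    chart a strictly monotone parameter, hence invertible on the arc. *)
Definition descends k u w :=
  (forall t, u <= t <= w -> chart_dom k (p t)) /\
  (forall s t, u <= s -> s < t -> t <= w ->
     (chart_fun k (p t)).1 < (chart_fun k (p s)).1).

Lemma descends_cat k u w t : u <= w <= t -> descends k u w -> descends k w t ->
  descends k u t.
Proof.
move=> /andP[uw wt] [d1 m1] [d2 m2]; split.
  move=> s /andP[us st]; case: (leP s w) => sw; first by apply: d1; rewrite us.
  by apply: d2; rewrite ltW.
move=> s r us sr rt; case: (leP r w) => rw; first exact: m1.
case: (leP w s) => ws; first exact: m2.
by apply: lt_trans (m2 w r _ _ _) (m1 s w _ _ _).
Qed.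

Lemma descends_shift k u w N : descends k u w ->
  descends k (u + N%:~R) (w + N%:~R).
Proof.
have sh t : p t = p (t - N%:~R) by rewrite -[t in LHS](subrK N%:~R) periodicD.
move=> [d m]; split=> [t tuw|s t us st tw].
  by rewrite sh; apply: d; lra.
by rewrite (sh s) (sh t); apply: m; lra.
Qed.

Lemma descends_sub k u w u' w' : u <= u' -> w' <= w -> descends k u w ->
  descends k u' w'.
Proof.
move=> uu ww [d m]; split=> [t /andP[ut tw]|s t us st tw].
  by apply: d; rewrite (le_trans uu) ?(le_trans tw).
by apply: m => //; [exact: le_trans us|exact: le_trans ww].
Qed.

Lemma descends_local k u : surf_atlas k -> chart_dom k (p u) ->
  exists2 e : R, 0 < e & descends k (u - e) (u + e).
Proof.
move=> ka ku; have [_ _ _ cm] := c_bd.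
have pc := periodic_continuous c_loop.
have [ko _] := surf_chart ka.
have : nbhs u (p @^-1` chart_dom k) by apply: pc; apply: open_nbhs_nbhs.
move=> /nbhs_ballP[e1 /= e10 be1].
set N := Num.floor u.
have uN : N%:~R <= u < N%:~R + 1 by have := floor_itv u; rewrite -/N intrD; lra.
have pN s : N%:~R <= s <= N%:~R + 1 -> p s = c (s - N%:~R).
  by move=> ?; apply: periodic_on.
have pN1 s : N%:~R - 1 <= s <= N%:~R -> p s = c (s - N%:~R + 1).
  move=> ?; rewrite (@periodic_on c s (N - 1)) // intrB; last by lra.
  by congr c; ring.
have pu : p u = c (u - N%:~R) by apply: pN; lra.
have [||e2 e20 m2] := cm k (u - N%:~R) _ ka; rewrite -?pu //.
  by rewrite in_itv /=; lra.
have dec_r s t : N%:~R <= s -> s < t -> t <= N%:~R + 1 -> `|s - u| < e2 ->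
    `|t - u| < e2 -> (chart_fun k (p t)).1 < (chart_fun k (p s)).1.
  move=> Ns st tN su tu; rewrite !pN; try lra.
  apply: m2; rewrite ?in_itv /=; try lra.
    by rewrite (_ : _ - _ = s - u) //; ring.
  by rewrite (_ : _ - _ = t - u) //; ring.
(* At an integer [u] the two sides of [u] come from the two ends of [c], with the parameters 1 and
   0. *)
case: (ltgtP N%:~R u) => Nu; last 2 first.
- by move: uN; lra.
- have p1 : p u = c 1 by rewrite pu -Nu subrr c01.
  have [||e3 e30 m3] := cm k 1 _ ka; rewrite -?p1 //.
    by rewrite in_itv /=; lra.
  have dec_l s t : N%:~R - 1 <= s -> s < t -> t <= N%:~R -> `|s - u| < e3 ->
      `|t - u| < e3 -> (chart_fun k (p t)).1 < (chart_fun k (p s)).1.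
    move=> Ns st tN su tu; rewrite !pN1; try lra.
    apply: m3; rewrite ?in_itv /=; try lra.
      by rewrite (_ : _ - _ = s - u) // -Nu; ring.
    by rewrite (_ : _ - _ = t - u) // -Nu; ring.
  have [|e e0 /and5P[ee1 ee2 ee3 ee4 _]] := @exists_smaller R [:: e1; e2; e3; 1].
    by rewrite /= e10 e20 e30 ltr01.
  exists e => //; split.
    by move=> t ?; apply: be1; rewrite /ball /= ltr_norml; lra.
  have nr s : u - e <= s <= u + e -> `|s - u| < e2 by rewrite ltr_norml; lra.
  have nl s : u - e <= s <= u + e -> `|s - u| < e3 by rewrite ltr_norml; lra.
  move=> s t us st tu; case: (leP t u) => tu'.
    by apply: dec_l; rewrite ?nl //; lra.
  case: (leP u s) => us'; first by apply: dec_r; rewrite ?nr //; lra.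
  apply: (@lt_trans _ _ (chart_fun k (p u)).1).
    by apply: dec_r; rewrite ?nr //; lra.
  by apply: dec_l; rewrite ?nl //; lra.
have [|e e0 /and5P[ee1 ee2 ee3 ee4 _]] :=
    @exists_smaller R [:: e1; e2; u - N%:~R; N%:~R + 1 - u].
  by rewrite /= e10 e20 !subr_gt0 Nu /= andbT; lra.
exists e => //; split.
  by move=> t ?; apply: be1; rewrite /ball /= ltr_norml; lra.
by move=> s t us st tu; apply: dec_r; rewrite ?ltr_norml; lra.
Qed.

Lemma periodic_coord_continuous k u w : surf_atlas k -> descends k u w ->
  {within `[u, w], continuous (fun t => (chart_fun k (p t)).1)}.
Proof.
move=> ka [d _]; have [_ [_ _ [_ _ kc _]]] := surf_chart ka.
refine (@within_comp _ _ _ _ setT (fun t => chart_fun k (p t)) fst _ _ _) => //.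
  refine (@within_comp _ _ _ _ (chart_dom k) p _ _ _ _) => //.
  by apply: continuous_subspaceT; exact: periodic_continuous.
exact: within_fst.
Qed.

Lemma chart_boundary_point k x : surf_atlas k -> boundary x -> chart_dom k x ->
  chart_fun k x = ((chart_fun k x).1, 0).
Proof.
by move=> ka bx kx; rewrite -(boundary_chart bx ka kx) -surjective_pairing.
Qed.

(* The periodic extension of a boundary loop can be followed in a chart as long
   as the boundary line stays in that chart. *)
Lemma boundary_travel k (z : R * R) r a b u : surf_atlas k ->
  (forall q, half_box z r q -> chart_dom k (chart_inv k q) /\
                               chart_fun k (chart_inv k q) = q) ->
  {within half_box z r, continuous (chart_inv k)} ->
  half_box z r (a, 0) -> half_box z r (b, 0) ->
  p u = chart_inv k (a, 0) ->
  exists2 w, p w = chart_inv k (b, 0) &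
    (b <= a -> u <= w /\ descends k u w) /\ (a < b -> w <= u /\ descends k w u).
Proof.
move=> ka Qk ic.
pose line (s : R) : S := chart_inv k (s, 0).
(* Both directions of travel are treated together, and from every parameter above the starting
   point, so that adjacent intervals compose. *)
pose P (s1 s2 : R) :=
  (forall u, p u = line s2 -> exists w, [/\ p w = line s1, u <= w & descends k u w]) /\
  (forall u, p u = line s1 -> exists w, [/\ p w = line s2, w <= u & descends k w u]).
have key lo hi : lo <= hi -> half_box z r (lo, 0) -> half_box z r (hi, 0) ->
    P lo hi.
  move=> lohi Ql Qh.
  have Qs s : lo <= s <= hi -> half_box z r (s, 0).
    move: Ql Qh => [[/= l1 l2] _] [[/= h1 _] _] sl; split; last first.
      by rewrite /half_plane /= lexx.
    by split=> //=; move: l1 h1; rewrite !ltr_norml; lra.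
  apply: interval_bisection => //.
    move=> x y t _ _ [xy1 xy2] [yt1 yt2]; split=> v pv.
      have [w [pw vw d1]] := yt1 _ pv; have [w' [pw' ww' d2]] := xy1 _ pw.
      exists w'; split=> //; first exact: le_trans ww'.
      by apply: descends_cat d1 d2; rewrite vw.
    have [w [pw vw d1]] := xy2 _ pv; have [w' [pw' ww' d2]] := yt2 _ pw.
    exists w'; split=> //; first exact: le_trans vw.
    by apply: descends_cat d2 d1; rewrite ww'.
  move=> t tlh; have Qt := Qs _ tlh.
  (* If the loop passes through the point, the intermediate value theorem inverts its coordinate
     nearby. If not, it avoids a neighbourhood, its image being closed, and [P] holds vacuously
     there. *)
  have [[v pv]|nv] := pselect (exists v, p v = line t).
    have [kt kkt] := Qk _ Qt.
    have kv : chart_dom k (p v) by rewrite pv.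
    have [e e0 de] := descends_local ka kv.
    have [dd mm] := de; pose f w := (chart_fun k (p w)).1.
    have fv : f v = t by rewrite /f pv kkt.
    have f1 : t < f (v - e) by rewrite -fv; apply: mm; lra.
    have f2 : f (v + e) < t by rewrite -fv; apply: mm; lra.
    have fc := periodic_coord_continuous ka de.
    have inv_f s : f (v + e) <= s <= f (v - e) ->
        exists2 w, v - e <= w <= v + e & p w = line s /\ f w = s.
      move=> sv; have [||w] := @IVT R f (v - e) (v + e) s _ fc.
      - by lra.
      - by rewrite min_r ?max_l //; lra.
      - rewrite in_itv /= => wv fw; exists w => //; split=> //.
        have kw := dd _ wv.
        rewrite -(chart_funK ka kw).
        by rewrite (chart_boundary_point ka (periodic_boundary w) kw) -/(f w) fw.
    exists (Num.min (f (v - e) - t) (t - f (v + e))); first by rewrite lt_min; lra.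
    move=> s1 s2 s12 s2h; rewrite !lt_min !ltr_norml => s1e s2e.
    have [|w1 w1e [pw1 fw1]] := inv_f s1; first by lra.
    have [|w2 w2e [pw2 fw2]] := inv_f s2; first by lra.
    have w21 : w2 <= w1.
      rewrite leNgt; apply/negP => w12.
      have : f w2 < f w1 by apply: mm; lra.
      by rewrite fw1 fw2; lra.
    have d12 : descends k w2 w1 by apply: descends_sub de; lra.
    split=> u0 pu0.
      have [|N ->] := @periodic_inj w2 u0; first by rewrite pu0 pw2.
      exists (w1 + N%:~R); split; [by rewrite periodicD|lra|].
      exact: descends_shift.
    have [|N ->] := @periodic_inj w1 u0; first by rewrite pu0 pw1.
    exists (w2 + N%:~R); split; [by rewrite periodicD|lra|].
    exact: descends_shift.
  have lc : {within `[lo, hi], continuous line}.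
    refine (@within_comp _ _ _ _ (half_box z r) (fun s : R => (s, 0)) _ _ _ _) => //.
    by apply: within_pair; [exact: within_id|exact: within_cst].
  have Wo : open (~` range p) by rewrite openC; exact: periodic_range_closed.
  have [||e e0 ne] := near_interval (t := t) lc Wo.
  - by rewrite /= in_itv.
  - by move=> [v _ pv]; apply: nv; exists v.
  exists e => // s1 s2 s12 s2h s1e s2e; split=> u0 pu0.
    by case: (ne s2); rewrite /= ?in_itv /=; [lra|exact: s2e|exists u0].
  by case: (ne s1); rewrite /= ?in_itv /=; [lra|exact: s1e|exists u0].
move=> Qa Qb pu; case: (leP b a) => ba.
  have [+ _] := key _ _ ba Qb Qa.
  by move=> /(_ _ pu) [w [pw uw d]]; exists w => //; split=> // ?; lra.
have [_ +] := key _ _ (ltW ba) Qa Qb.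
by move=> /(_ _ pu) [w [pw uw d]]; exists w => //; split=> // ?; lra.
Qed.

End PeriodicExtension.

Section Subpaths.
Variables (R : realType) (X : topologicalType).

(** The case [b < a] is allowed: reversed arcs are subpaths too. *)
Definition subpath (F : R -> X) (a b : R) : R -> X := fun s => F (a + s * (b - a)).

Lemma subpath_line_within (a b : R) (A : set R) :
  {within A, continuous (fun s => a + s * (b - a))}.
Proof.
by apply: withinD; [exact: within_cst|apply: withinM; [exact: within_id|exact: within_cst]].
Qed.

Lemma path_subpath (F : R -> X) (Q : set R) a b : {within Q, continuous F} ->
  (forall s, 0 <= s <= 1 -> Q (a + s * (b - a))) ->
  path_from_to (F a) (F b) (subpath F a b).
Proof.
move=> Fc Qab; split; rewrite /subpath.
- refine (@within_comp _ _ _ _ Q (fun s : R => a + s * (b - a)) F _ _ _) => //.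
  exact: subpath_line_within.
- by rewrite mul0r addr0.
- by rewrite mul1r addrC subrK.
Qed.

Lemma subpath_concat (F : R -> X) (Q : set R) a b c : {within Q, continuous F} ->
  (forall x y z : R, Q x -> Q y -> x <= z <= y -> Q z) ->
  Q a -> Q b -> Q c ->
  homotopic (concat (subpath F a b) (subpath F b c)) (subpath F a c).
Proof.
move=> Fc Qc Qa Qb Qc'.
have Qs x y (s : R) : Q x -> Q y -> 0 <= s <= 1 -> Q (x + s * (y - x)).
  move=> Qx Qy s01; case: (leP x y) => xy; first by apply: (Qc x y) => //; nra.
  by apply: (Qc y x) => //; nra.
have pl (x y : R) : path_from_to x y (fun s => x + s * (y - x)).
  by split; [exact: subpath_line_within|ring|ring].
have pc := path_concat (pl a b) (pl b c); have [pcc pc0 pc1] := pc.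
have e : F \o concat (fun s => a + s * (b - a)) (fun s => b + s * (c - b)) =
    concat (subpath F a b) (subpath F b c) by rewrite comp_concat.
rewrite -e; apply: (@hom_line _ _ F Q) => //.
- exact: subpath_line_within.
- by move=> t t01; rewrite /concat; case: ifP => t2; apply: Qs => //; lra.
- by move=> t t01; apply: Qs.
- by rewrite pc0 mul0r addr0.
- by rewrite pc1 mul1r addrC subrK.
Qed.

End Subpaths.

Section ChartHomotopies.
Variables (R : realType) (S : surface R) (k : chart R S) (z : R * R) (r : R).
Hypothesis ka : surf_atlas k.
Local Notation Q := (half_box z r).
Hypothesis ic : {within Q, continuous (chart_inv k)}.

Lemma chart_homotopic (f g : R -> S) :
  {within `[0, 1], continuous f} -> {within `[0, 1], continuous g} ->
  (forall s, 0 <= s <= 1 -> chart_dom k (f s) /\ Q (chart_fun k (f s))) ->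
  (forall s, 0 <= s <= 1 -> chart_dom k (g s) /\ Q (chart_fun k (g s))) ->
  f 0 = g 0 -> f 1 = g 1 -> homotopic f g.
Proof.
have [_ [_ _ [_ _ kc _]]] := surf_chart ka.
have kfc (h : R -> S) : {within `[0, 1], continuous h} ->
    (forall s, 0 <= s <= 1 -> chart_dom k (h s) /\ Q (chart_fun k (h s))) ->
    {within `[0, 1], continuous (chart_fun k \o h)}.
  move=> fc fQ; apply: within_comp fc _ kc.
  by move=> t; rewrite /= in_itv => /fQ[].
have e (h : R -> S) :
    (forall s, 0 <= s <= 1 -> chart_dom k (h s) /\ Q (chart_fun k (h s))) ->
    forall s, 0 <= s <= 1 -> h s = (chart_inv k \o (chart_fun k \o h)) s.
  by move=> fQ s /fQ[kf _] /=; rewrite chart_funK.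
move=> fc gc fQ gQ f0 f1.
apply: (hom_trans (hom_eq fc (e _ fQ))); apply: hom_sym.
apply: (hom_trans (hom_eq gc (e _ gQ))); apply: hom_sym.
apply: (hom_convex ic) => //=.
- exact: half_box_convex.
- exact: kfc.
- exact: kfc.
- by move=> t /fQ[].
- by move=> t /gQ[].
- by rewrite f0.
- by rewrite f1.
Qed.

(** By monotonicity the arc stays between its ends in the chart, hence in the half-box, where it can
    be deformed freely. The strict bounds in the last clause serve to count the turns of a second
    boundary loop. *)
Lemma boundary_travel_path (c : R -> S) a b u : boundary_loop c ->
  (forall q, Q q -> chart_dom k (chart_inv k q) /\
                    chart_fun k (chart_inv k q) = q) ->
  Q (a, 0) -> Q (b, 0) -> periodic c u = chart_inv k (a, 0) ->
  exists w, [/\ periodic c w = chart_inv k (b, 0),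
    forall s, 0 <= s <= 1 -> chart_dom k (subpath (periodic c) u w s) /\
       Q (chart_fun k (subpath (periodic c) u w s)),
    b < a -> u < w &
    forall v, u < v < w -> chart_dom k (periodic c v) /\
                           b < (chart_fun k (periodic c v)).1 < a].
Proof.
move=> cb Qk Qa Qb pu; have [w pw [wba wab]] := boundary_travel cb ka Qk ic Qa Qb pu.
set p := periodic c in pu pw wba wab *.
have fu : (chart_fun k (p u)).1 = a by rewrite pu; have [_ ->] := Qk _ Qa.
have fw : (chart_fun k (p w)).1 = b by rewrite pw; have [_ ->] := Qk _ Qb.
have mono v v' : descends c k v v' -> forall t, v <= t <= v' ->
    (chart_fun k (p v')).1 <= (chart_fun k (p t)).1 <= (chart_fun k (p v)).1.
  move=> [d m] t /andP[]; rewrite le_eqVlt => /orP[/eqP <-|vt].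
    rewrite lexx andbT le_eqVlt => /orP[/eqP ->|vv]; first exact: lexx.
    by apply/ltW/m.
  rewrite le_eqVlt => /orP[/eqP tv|tv].
    by rewrite -tv lexx /= ltW // m // tv.
  by apply/andP; split; apply/ltW/m => //; exact: ltW.
have inQ t : chart_dom k (p t) ->
    Num.min a b <= (chart_fun k (p t)).1 <= Num.max a b -> Q (chart_fun k (p t)).
  move=> kt tab; rewrite (chart_boundary_point ka (periodic_boundary cb t) kt).
  move: Qa Qb => [[/= a1 a2] _] [[/= b1 _] _]; split; last first.
    by rewrite /half_plane /= lexx.
  split=> //=; move: a1 b1 tab; rewrite !ltr_norml.
  by case: (leP a b) => ab; lra.
exists w; split=> //.
- move=> s s01; rewrite /subpath; set t := u + _.
  case: (leP b a) => ba.
    have [uw d] := wba ba; have tuw : u <= t <= w by rewrite /t; nra.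
    have kt := d.1 _ tuw; split=> //; apply: inQ => //.
    by have := mono _ _ d _ tuw; rewrite fu fw min_r // max_l.
  have [wu d] := wab ba; have twu : w <= t <= u by rewrite /t; nra.
  have kt := d.1 _ twu; split=> //; apply: inQ => //.
  by have := mono _ _ d _ twu; rewrite fu fw min_l ?max_r // ltW.
- move=> ba; have [uw d] := wba (ltW ba); rewrite lt_neqAle uw andbT.
  by apply/eqP => e; move: ba; rewrite -fu -fw e ltxx.
- move=> v /andP[uv vw]; case: (leP b a) => ba; last first.
    by have [wu _] := wab ba; move: (lt_trans uv vw); rewrite ltNge wu.
  have [uw [d m]] := wba ba; split; first by apply: d; rewrite !ltW.
  by rewrite -{1}fw -fu !m // ?ltW // lexx.
Qed.

End ChartHomotopies.

Section FollowBoundary.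
Variables (R : realType) (S : surface R).
Implicit Types (c : R -> S).

Lemma subpath01 (X : topologicalType) (f : R -> X) : subpath f 0 1 = f.
Proof. by apply/funext => s; rewrite /subpath subr0 mulr1 add0r. Qed.

Lemma path_periodic c u w : boundary_loop c ->
  path_from_to (periodic c u) (periodic c w) (subpath (periodic c) u w).
Proof.
move=> [cl _ _ _]; apply: (@path_subpath _ _ _ setT) => //.
by apply: continuous_subspaceT; exact: periodic_continuous.
Qed.

Lemma periodic_concat c u w t : boundary_loop c ->
  homotopic (concat (subpath (periodic c) u w) (subpath (periodic c) w t))
            (subpath (periodic c) u t).
Proof.
move=> [cl _ _ _]; apply: (@subpath_concat _ _ _ setT) => //.
by apply: continuous_subspaceT; exact: periodic_continuous.
Qed.

(** Following [c2] along the unrolled [c] ends at [u + N] with [N > 0]. If [N] were at least 2, the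
    parameter [u + 1] would be passed on the way, and [c2] would meet its base point strictly
    between 0 and 1, against injectivity. *)
Lemma boundary_follow c c2 u : boundary_loop c -> boundary_loop c2 ->
  periodic c u = c2 0 -> homotopic c2 (subpath (periodic c) u (u + 1)).
Proof.
move=> cb c2b; have [[c2c _ c21] c2inj c2bd c2m] := c2b.
set p := periodic c.
(* The last clause records that every intermediate point of the unrolled loop is visited by [c2] at
   an intermediate time. *)
pose P a b := forall u, p u = c2 a -> exists w,
  [/\ p w = c2 b, (a < b -> u < w) /\ (a = b -> u = w),
      homotopic (subpath c2 a b) (subpath p u w) &
      forall v, u < v < w -> exists2 t, a < t < b & c2 t = p v].
have P01 : P 0 1.
  apply: interval_bisection; first exact: ler01.
    move=> x y z /andP[x0 xy] /andP[yz z1] Pxy Pyz v pv.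
    have [w [pw [lt1 eq1] h1 s1]] := Pxy _ pv.
    have [t [pt [lt2 eq2] h2 s2]] := Pyz _ pw.
    exists t; split=> //.
    - split; last by move=> xz; rewrite eq1 ?eq2 //; lra.
      move: xy yz; rewrite !le_eqVlt => /orP[/eqP xy|xy] /orP[/eqP yz|yz].
      + by rewrite xy yz ltxx.
      + by rewrite (eq1 xy) => _; apply: lt2.
      + by rewrite -(eq2 yz) => _; apply: lt1.
      + by move=> _; apply: lt_trans (lt1 xy) (lt2 yz).
    - apply: hom_trans (periodic_concat _ w _ cb).
      apply: hom_trans (hom_concat h1 h2 _); last first.
        by rewrite /subpath mul1r mul0r addr0 addrC subrK.
      apply: hom_sym; apply: (@subpath_concat _ _ _ `[0, 1]%classic) => //;
        by rewrite /= ?in_itv /=; try move=> ? ? ?; rewrite ?in_itv /=; lra.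
    - move=> v' /andP[vv' v't]; case: (ltgtP v' w) => v'w.
      + have [|s /andP[xs sy] e] := s1 v'; first by rewrite vv'.
        by exists s; rewrite // xs (lt_le_trans sy).
      + have [|s /andP[ys sz] e] := s2 v'; first by rewrite v'w.
        by exists s; rewrite // sz (le_lt_trans xy).
      + exists y; last by rewrite v'w.
        apply/andP; split; rewrite lt_neqAle.
          rewrite xy andbT; apply/eqP => /eq1 e.
          by move: vv'; rewrite v'w e ltxx.
        by rewrite yz andbT; apply/eqP => /eq2 e; move: v't; rewrite v'w e ltxx.
  move=> t t01; have [k ka kt] := surf_cover (c2 t).
  have [r r0 [Qk ic [V [Vo Vt VQ]]]] := chart_box ka kt openT Logic.I.
  have tI : (t : R) \in `[0, 1]%R by rewrite in_itv.
  have [e1 e10 V1] := near_interval c2c Vo tI Vt.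
  have [e2 e20 m2] := c2m k t tI ka kt.
  exists (Num.min e1 e2); first by rewrite lt_min e10.
  move=> a b /andP[a0 ab] b1; rewrite !lt_min => /andP[a1 a2] /andP[b1' b2] v pv.
  have near s : a <= s <= b -> [/\ s \in `[0, 1]%R, `|s - t| < e1 & `|s - t| < e2].
    move=> sab; split; first by rewrite in_itv /=; lra.
      by move: a1 b1'; rewrite !ltr_norml; lra.
    by move: a2 b2; rewrite !ltr_norml; lra.
  have c2V s : a <= s <= b -> V (c2 s) by move=> /near[? ? _]; apply: V1.
  pose f s := (chart_fun k (c2 s)).1.
  have fE s : a <= s <= b -> chart_fun k (c2 s) = (f s, 0).
    move=> sab; have [sI _ _] := near _ sab; have [ks _ _] := VQ _ (c2V _ sab).
    by apply: chart_boundary_point => //; apply: c2bd.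
  have aab : a <= a <= b by rewrite lexx.
  have bab : a <= b <= b by rewrite ab lexx.
  have Qf s : a <= s <= b -> half_box (chart_fun k (c2 t)) r (f s, 0).
    by move=> sab; rewrite -fE //; have [] := VQ _ (c2V _ sab).
  have invf s : a <= s <= b -> chart_inv k (f s, 0) = c2 s.
    move=> sab; have [ks _ _] := VQ _ (c2V _ sab).
    by rewrite -fE // chart_funK.
  have sc : {within `[0, 1], continuous (subpath c2 a b)}.
    have [] // := @path_subpath _ _ c2 `[0, 1]%classic a b c2c.
    by move=> s s01; rewrite /= in_itv /=; nra.
  have : a = b \/ a < b by move: ab; rewrite le_eqVlt => /orP[/eqP|]; [left|right].
  case=> [eab|ltab].
    exists v; split=> //; rewrite -?eab //.
    - by rewrite ltxx.
    - by rewrite /subpath !subrr; under eq_fun do rewrite mulr0 addr0;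
        under [X in homotopic _ X]eq_fun do rewrite mulr0 addr0;
        rewrite pv; apply: hom_refl; exact: within_cst.
    - by move=> w /andP[vw wv]; move: (lt_trans vw wv); rewrite ltxx.
  have fba : f b < f a.
    by have [? _ ?] := near _ aab; have [? _ ?] := near _ bab; apply: m2.
  have pva : p v = chart_inv k (f a, 0) by rewrite invf.
  have [|w [pw sw lt sub]] := boundary_travel_path ka ic cb _ (Qf _ aab) (Qf _ bab) pva.
    by move=> q /Qk[].
  have pw' : p w = c2 b by rewrite /p pw invf.
  exists w; split=> //.
  - by split=> [_|e]; [exact: lt|move: ltab; rewrite e ltxx].
  - apply: (chart_homotopic ka ic) => //.
    + by have [] := path_periodic v w cb.
    + move=> s s01; have sab : a <= a + s * (b - a) <= b by nra.
      have [ks _ _] := VQ _ (c2V _ sab).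
      by rewrite /subpath; split=> //; rewrite (fE _ sab); exact: Qf.
    + by rewrite /subpath !mul0r !addr0.
    + by rewrite /subpath !mul1r ![_ + (_ - _)]addrC !subrK.
  - move=> v' /sub[kv' /andP[bv' v'a]].
    have fc : {within `[a, b], continuous f}.
      have [_ [_ _ [_ _ kc _]]] := surf_chart ka.
      refine (@within_comp _ _ _ _ setT (fun s => chart_fun k (c2 s)) fst _ _ _) => //;
        last exact: within_fst.
      refine (@within_comp _ _ _ _ (chart_dom k) c2 _ _ _ _) => //.
        by apply: within_sub c2c => s; rewrite /= !in_itv /=; lra.
      by move=> s; rewrite /= in_itv => sab; have [] := VQ _ (c2V _ sab).
    have [|s] := IVT ab fc (v := (chart_fun k (p v')).1).
      by rewrite min_r ?max_l ?(ltW fba) // !ltW.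
    rewrite in_itv /= => sab fs; exists s.
      apply/andP; split; rewrite lt_neqAle; case/andP: sab => as_ sb.
        rewrite as_ andbT; apply/eqP => e; move: v'a.
        by rewrite -fs -e ltxx.
      rewrite sb andbT; apply/eqP => e; move: bv'.
      by rewrite -fs e ltxx.
    have [ks _ _] := VQ _ (c2V _ sab).
    apply: (chart_inj ka) => //.
    rewrite (fE _ sab) fs -(chart_boundary_point ka _ kv') //.
    exact: periodic_boundary.
move=> pu; have [w [pw [ltuw _] hc sub]] := P01 _ pu.
have uw : u < w by apply: ltuw; exact: ltr01.
have [|N wN] := @periodic_inj _ _ _ cb u w; first by rewrite -/p pu pw.
have N0 : 0 < N by rewrite -(ltr0z R); lra.
have N1 : N = 1.
  apply/eqP; rewrite eq_le -gtz0_ge1 N0 andbT leNgt; apply/negP => N2.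
  have N2' : 1 < N%:~R :> R by rewrite ltr1z.
  have [|t t01 pt] := sub (u + 1); first by rewrite wN; lra.
  have : t = 0.
    apply: c2inj; rewrite ?in_itv /= ?lexx ?ltr01 //; first lra.
    by rewrite pt -pu -[1]/(1%:~R) /p periodicD.
  by lra.
have <- : w = u + 1 by rewrite wN N1.
by rewrite -(subpath01 c2).
Qed.

End FollowBoundary.

(** * Homotopies in the double *)

Section Double.
Variables (R : realType) (S D : surface R) (j0 j1 : S -> D) (j : D -> D).
Hypothesis dbl : is_double j0 j1 j.

Let j0c : continuous j0. Proof. by have [[]] := dbl. Qed.
Let j1c : continuous j1. Proof. by have [[]] := dbl. Qed.

Lemma double_glue x : boundary x -> j0 x = j1 x.
Proof. by have [_ _ [_ H] _ _] := dbl => bx; apply/H. Qed.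

(** The two copies meet only where [j0] and [j1] agree, so folding is well defined. It is continuous
    since the preimage of a closed set is the union of two compact images in a Hausdorff space. *)
Lemma double_fold : exists r : D -> S,
  [/\ continuous r, forall x, r (j0 x) = x & forall x, r (j1 x) = x].
Proof.
have [_ [inj0 inj1] [cov glue] _ _] := dbl.
have ex y : exists x, y = j0 x \/ y = j1 x.
  have : (range j0 `|` range j1) y by rewrite cov.
  by case=> -[x _ <-]; exists x; [left|right].
have [r rP] := choice ex.
have r0 x : r (j0 x) = x.
  by case: (rP (j0 x)) => [/inj0|/glue[]].
have r1 x : r (j1 x) = x.
  by case: (rP (j1 x)) => [/esym/glue[->]|/inj1].
exists r; split=> //; apply/continuous_closedP => A Acl.
have -> : r @^-1` A = j0 @` A `|` j1 @` A.
  apply/seteqP; split=> [y /= Ay|y [] [x Ax <-] /=]; rewrite ?r0 ?r1 //.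
  by case: (rP y) => e; [left|right]; exists (r y).
have Ac : compact A.
  by apply: (@subclosed_compact _ _ [set: S]) => //; exact: surf_compact.
apply: closedU; apply: compact_closed; try exact: surf_hausdorff;
  by apply: continuous_compact => //; exact: continuous_subspaceT.
Qed.

Lemma closed_range_double (f : S -> D) : continuous f -> closed (range f).
Proof.
move=> fc; apply: compact_closed; first exact: surf_hausdorff.
apply: continuous_compact; last exact: surf_compact.
exact: continuous_subspaceT.
Qed.

Definition square : set (R * R) := [set p | in_square p].

Lemma square_convex : convex2 square.
Proof.
move=> p q s [/andP[p1 p2] /andP[p3 p4]] [/andP[q1 q2] /andP[q3 q4]] s01.
by rewrite /lin; split => /=; nra.
Qed.

Lemma squareE : square = `[0, 1]%classic `*` `[0, 1]%classic.
Proof. by apply/seteqP; split=> p [p1 p2]; split; move: p1 p2; rewrite /= !in_itv. Qed.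

Lemma path_lin (p q : R * R) : path_from_to p q (fun s : R => lin p q s).
Proof.
split; rewrite ?lin0 ?lin1 //; apply: within_lin; try exact: within_cst.
exact: within_id.
Qed.

Section Mirror.
Variables (c1 c2 k : R -> S).
Hypotheses (c1b : boundary_loop c1) (c2b : boundary_loop c2).
Hypothesis kp : path_from_to (c1 0) (c2 0) k.
Local Notation p := (periodic c1).

(* [H] contracts the arc [k] in one copy of the surface to its mirror image;
   by the Sperner argument the preimage of the common boundary joins the two
   sides of the square on which [H] is constant, and along it the folded
   homotopy deforms [k] into the boundary. *)
Lemma mirror_homotopic_boundary : homotopic (j0 \o k) (j1 \o k) ->
  exists u, p u = c2 0 /\ homotopic k (subpath p 0 u).
Proof.
move=> [H [Hc Hs Ht]].
have [kc k0 k1] := kp.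
have [r [rc r0 r1]] := double_fold.
have [_ _ [cov glue] _ _] := dbl.
have b1 : boundary (c1 0) by have [_ _ + _] := c1b; apply; rewrite in_itv /= lexx ler01.
have b2 : boundary (c2 0) by have [_ _ + _] := c2b; apply; rewrite in_itv /= lexx ler01.
pose F := r \o H.
have Hc' : {within square, continuous H} by rewrite squareE.
have Fc : {within square, continuous F}.
  by refine (@within_comp _ _ _ _ setT H r Hc' _ _) => //; exact: continuous_subspaceT.
have Hl t : 0 <= t <= 1 -> H (0, t) = j0 (k t) /\ H (1, t) = j1 (k t).
  by move=> t01; apply: Hs; rewrite in_itv.
have Hb s : 0 <= s <= 1 -> H (s, 0) = j0 (c1 0) /\ H (s, 1) = j0 (c2 0).
  move=> s01; have := Ht s; rewrite in_itv => /(_ s01); by rewrite /= k0 k1.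
have p0 : p 0 = c1 0 by rewrite /periodic floor0 subr0.
pose K := [set m : R * R | [/\ in_square m, range j0 (H m) & range j1 (H m)]].
(* The folded homotopy along a path from the corner to [m] deforms into the boundary. Quantifying
   over all paths costs nothing in a convex square and allows the path to be chosen at each use. *)
pose Good (m : R * R) := exists2 u, p u = F m & forall a : R -> R * R,
  path_from_to (0, 0) m a -> (forall t, 0 <= t <= 1 -> in_square (a t)) ->
  homotopic (F \o a) (subpath p 0 u).
have KF m : K m -> boundary (F m) /\ j0 (F m) = H m.
  move=> [_ [x _ xm] [y _ ym]]; rewrite /F /= -xm r0; split=> //.
  by have /glue[] : j0 x = j1 y by rewrite xm.
have path_sq (m m' : R * R) t : in_square m -> in_square m' -> 0 <= t <= 1 ->
    in_square (lin m m' t).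
  by move=> sm sm'; apply: square_convex.
have sq00 : in_square (0 : R, 0 : R) by split; rewrite /= lexx ler01.
(* Near [m0] the folded image stays in one half-box; two points of [K] go to the boundary line
   there, and travelling along that line extends the deformation from one to the other. *)
have local m0 : exists rho : R, 0 < rho /\ (K m0 -> forall m m',
    box m0 rho m -> box m0 rho m' -> K m -> K m' -> Good m -> Good m').
  have [Km0|nK] := pselect (K m0); last by exists 1; split.
  have [sm0 _ _] := Km0; have [ch ca cx] := surf_cover (F m0).
  have [r2 r20 [Qk ic [V [Vo Vx VQ]]]] := chart_box ca cx openT Logic.I.
  have [rho rho0 bV] := box_sub (within_near Fc sm0 Vo Vx).
  exists rho; split=> // _ m m' bm bm' Km Km' [u pu gu].
  have [sm _ _] := Km; have [sm' _ _] := Km'.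
  have bnd n : box m0 rho n -> K n ->
      half_box (chart_fun ch (F m0)) r2 ((chart_fun ch (F n)).1, 0) /\
      F n = chart_inv ch ((chart_fun ch (F n)).1, 0).
    move=> bn Kn; have [sn _ _] := Kn; have [cn _ Qn] := VQ _ (bV _ bn sn).
    have e := chart_boundary_point ca (KF _ Kn).1 cn.
    by rewrite -e; split=> //; rewrite chart_funK.
  have [Qa ea] := bnd _ bm Km; have [Qb eb] := bnd _ bm' Km'.
  have [|w [pw sw _ _]] := boundary_travel_path ca ic c1b _ Qa Qb (etrans pu ea).
    by move=> q /Qk[].
  exists w => [|a' [a'c a'0 a'1] a's]; first by rewrite eb.
  pose a0 (t : R) := lin (0, 0) m t; pose a1 (t : R) := lin m m' t.
  have pa0 := path_lin (0, 0) m; have pa1 := path_lin m m'.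
  have [pcc pc0 pc1] := path_concat pa0 pa1.
  apply: (@hom_trans _ _ (F \o concat a0 a1)).
    apply: (hom_convex Fc square_convex) => //; rewrite ?a'0 ?pc0 ?a'1 ?pc1 //.
    by move=> t t01; rewrite /concat; case: ifP => t2; apply: path_sq => //; lra.
  rewrite comp_concat; apply: hom_trans (periodic_concat 0 u w c1b).
  apply: hom_concat; last by rewrite /a0 /a1 /= lin1 lin0.
    by apply: gu => // t; apply: path_sq.
  have [pc _ _] := path_periodic u w c1b.
  have Fa1 : {within `[0, 1], continuous (F \o a1)}.
    refine (@within_comp _ _ _ _ square a1 F _ _ Fc); first by case: pa1.
    by move=> t; rewrite /= in_itv => t01; apply: path_sq.
  apply: (chart_homotopic ca ic Fa1 pc _ sw).
  - move=> s s01.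
    have [|? _ ?] := VQ (F (a1 s)); last by [].
    by apply: bV; [apply: box_convex|apply: path_sq].
  - by rewrite /= /a1 lin0 -pu /subpath mul0r addr0.
  - by rewrite /= /a1 lin1 eb -pw /subpath mul1r addrC subrK.
have [rho rhoP] := choice local.
have rho0 m : 0 < rho m by have [] := rhoP m.
(* Half radii: if two such boxes meet, the centre of one lies in the full box of the other,
   whichever radius is larger. *)
pose O (q : R * R) := exists m, [/\ K m, Good m & box m (rho m / 2) q].
(* Where the vertical sides are sent to the common boundary, both copies are possible; the two
   vertical sides are assigned by convention so that Sperner's condition holds. *)
pose in0 (q : R * R) := q.1 = 0 \/ (q.1 <> 1 /\ range j0 (H q)).
pose col (q : R * R) := if `[< in0 q >] then 0%N else if `[< O q >] then 1%N else 2%N.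
have in0P q : in_square q -> in0 q -> range j0 (H q).
  move=> [_ s2] [q1|[]] //; rewrite (surjective_pairing q) q1.
  by have [-> _] := Hl _ s2; exists (k q.2).
have nin0P q : in_square q -> ~ in0 q -> range j1 (H q).
  move=> [_ s2] nq; have [q1|q1] := pselect (q.1 = 1).
    by rewrite (surjective_pairing q) q1; have [_ ->] := Hl _ s2; exists (k q.2).
  have : (range j0 `|` range j1) (H q) by rewrite cov.
  by case=> // rq; case: nq; right.
have Kbot t : 0 <= t <= 1 -> K (t, 0) /\ Good (t, 0).
  move=> t01; have [h0 _] := Hb _ t01.
  have st : in_square (t, 0 : R) by split; rewrite /= ?lexx ?ler01 ?t01.
  split.
    by split=> //; rewrite h0; exists (c1 0) => //; rewrite double_glue.
  exists 0; first by rewrite /F /= h0 r0.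
  move=> a [ac a0 a1] as_.
  have [lc _ _] := path_lin (0, 0) (t, 0).
  apply: (@hom_trans _ _ (F \o (fun s : R => lin (0, 0) (t, 0) s))).
    apply: (hom_convex Fc square_convex) => //; rewrite ?lin0 ?lin1 //.
    by move=> s; apply: path_sq.
  apply: hom_eq.
    refine (@within_comp _ _ _ _ square (fun s : R => lin (0, 0) (t, 0) s) F _ _ _) => //.
    by move=> s; rewrite /= in_itv => s01; apply: path_sq.
  move=> s s01; rewrite /subpath subrr mulr0 addr0 p0 /F /= /lin /=.
  rewrite !mulr0 !add0r; have [|-> _] := Hb (s * t); last by rewrite r0.
  nra.
have Ktop t : 0 <= t <= 1 -> K (t, 1).
  move=> t01; have [_ h1] := Hb _ t01.
  split; first by split; rewrite /= ?lexx ?ler01 ?t01.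
    by rewrite h1; exists (c2 0).
  by rewrite h1 double_glue //; exists (c2 0).
(* The path up the left side and then along the top folds to [k] followed by a constant, so a good
   point of the top side gives the conclusion. *)
have [[t t01 [u pu gu]]|ntop] := pselect (exists2 t, 0 <= t <= 1 & Good (t, 1)).
  have [_ h1] := Hb _ t01.
  exists u; split; first by rewrite pu /F /= h1 r0.
  pose a0 (s : R) : R * R := lin (0, 0) (0, 1) s.
  pose a1 (s : R) : R * R := lin (0, 1) (t, 1) s.
  have pa := path_concat (path_lin (0, 0) (0, 1)) (path_lin (0, 1) (t, 1)).
  have sq01 : in_square (0 : R, 1 : R) by split; rewrite /= lexx ler01.
  have sqt1 : in_square (t : R, 1 : R) by split; rewrite /= ?t01 ?lexx ?ler01.
  have := gu _ pa; rewrite comp_concat => gu'.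
  apply: (@hom_trans _ _ (concat (F \o a0) (F \o a1))); last first.
    apply: gu' => s s01; rewrite /concat; case: ifP => s2; apply: path_sq => //; lra.
  apply: hom_trans (hom_sym (hom_idr kp)) _.
  apply: hom_concat; last by rewrite k1.
    apply: hom_eq => // s s01; rewrite /F /= /a0 /lin /=.
    by rewrite !mulr0 add0r mulr1 add0r; have [-> _] := Hl _ s01; rewrite r0.
  apply: hom_eq; first exact: within_cst.
  move=> s s01; rewrite /F /= /a1 /lin /= mulr0 add0r !mulr1 subrK.
  have [|_ ->] := Hb (s * t); last by rewrite r0.
  nra.
exfalso.
have half m : 0 < rho m / 2 by rewrite divr_gt0.
have [||m sm cm] := @sperner_point R col.
- by move=> q; rewrite /col; case: ifP => // _; case: ifP.
- move=> t t01; split; rewrite /col.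
  + by rewrite asboolT //; left.
  + rewrite asboolF; first by case: ifP.
    move=> [/= e|[]] //; by move: (@ltr01 R); rewrite e ltxx.
  + case: ifP => // _; rewrite asboolT //.
    have [K0 G0] := Kbot _ t01; exists (t, 0); split=> //.
    exact: box_center.
  + case: ifP => // _; case: ifP => // /asboolP[m [Km Gm bm]] _.
    apply: ntop; exists t => //; have [_ /(_ Km m (t, 1))] := rhoP m.
    apply=> //; first exact: box_center.
      by case: bm => b3 b4; split; [apply: lt_trans b3 _|apply: lt_trans b4 _];
        have := rho0 m; lra.
    exact: Ktop.
have Km : K m.
  split=> //.
  - have [//|nr] := pselect (range j0 (H m)).
    have oc : open (~` range j0) by rewrite openC; exact: closed_range_double.
    have [q [nq sq]] := cm _ (within_near Hc' sm oc nr) 0%N isT.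
    rewrite /col; case: ifPn => [/asboolP /(in0P _ sq) rq _|_]; last by case: ifP.
    by case: (nq sq).
  - have [//|nr] := pselect (range j1 (H m)).
    have oc : open (~` range j1) by rewrite openC; exact: closed_range_double.
    have [q [nq sq]] := cm _ (within_near Hc' sm oc nr) 1%N isT.
    rewrite /col; case: ifPn => // /asboolPn /(nin0P _ sq) rq _.
    by case: (nq sq).
have nb e : 0 < e -> nbhs m (box m e).
  by move=> e0; apply: open_nbhs_nbhs; split; [exact: open_box|exact: box_center].
(* If [m] is good, no colour 2 occurs in its half box. If not, a point of colour 1 nearby belongs to
   the half box of a good [m'], and goodness passes from [m'] to [m]. *)
have [Gm|nGm] := pselect (Good m).
  have [q [bq sq]] := cm _ (nb _ (half m)) 2%N isT; rewrite /col.
  case: ifP => // _; case: ifPn => // /asboolPn nO _.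
  by apply: nO; exists m.
have [q [bq sq]] := cm _ (nb _ (half m)) 1%N isT; rewrite /col.
case: ifP => // _; case: ifPn => // /asboolP[m' [Km' Gm' bq']] _.
apply: nGm.
have near_ (e : R) : rho m <= e -> rho m' <= e -> `|m.1 - m'.1| < e /\ `|m.2 - m'.2| < e.
  move=> e1 e2; move: bq bq' => [+ +] [+ +]; rewrite !ltr_norml => x1 x2 x3 x4.
  by split; lra.
case: (leP (rho m) (rho m')) => le.
  have [_ /(_ Km' m' m)] := rhoP m'; apply=> //; first exact: box_center.
  by apply: near_; rewrite ?lexx.
have [_ /(_ Km m' m)] := rhoP m; apply=> //; last exact: box_center.
have [] := near_ (rho m); rewrite ?lexx ?ltW // => n1 n2.
by split; rewrite distrC.
Qed.

End Mirror.

(** The arc [q1^-1 q2] slides into the boundary as an arc [m] of the unrolled [c1]. Then [q2] is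
    [q1 m], [c2] is the turn [n] starting at the end of [m], and [m n m^-1] is again [c1]. *)
Lemma mirror_homotopic_conj (v : S) (q1 q2 c1 c2 : R -> S) :
  boundary_loop c1 -> boundary_loop c2 ->
  path_from_to v (c1 0) q1 -> path_from_to v (c2 0) q2 ->
  homotopic (j0 \o concat (rev_path q1) q2) (j1 \o concat (rev_path q1) q2) ->
  homotopic (lasso q1 c1) (lasso q2 c2).
Proof.
move=> b1 b2 p1 p2 hk.
have pr1 := path_rev p1; have pk := path_concat pr1 p2.
have [u [pu hu]] := mirror_homotopic_boundary b1 b2 pk hk.
have hc2 := boundary_follow b1 b2 pu.
set p := periodic c1 in pu hu hc2.
have p0 : p 0 = c1 0 by rewrite /p /periodic floor0 subr0.
have p01 := path_periodic 0 u b1; rewrite -/p p0 in p01.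
have pn := path_periodic u (u + 1) b1; rewrite -/p in pn.
have pu1 : p (u + 1) = p u by rewrite /p -[1]/(1%:~R) periodicD.
have [c1p _ _ _] := b1; have [c2p _ _ _] := b2.
rewrite pu1 in pn; have pu' := p01; rewrite pu in pu'.
set m := subpath p 0 u in hu p01 pu'; set n := subpath p u (u + 1) in hc2 pn.
have prm := path_rev p01.
have [q1c q10 q11] := p1; have [q2c q20 q21] := p2.
have [c1c c10 c11] := c1p; have [c2c c20 c21] := c2p.
have [mc m0 m1] := p01.
have q2m : homotopic q2 (concat q1 m).
  apply: hom_trans (hom_concat (hom_refl q1c) hu _); last by have [_ -> _] := pk.
  apply: hom_sym; apply: hom_trans (hom_sym (hom_assoc p1 pr1 p2)) _.
  apply: hom_trans (hom_concat (hom_inv p1) (hom_refl q2c) _) (hom_idl p2).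
  by rewrite q20; have [_ _ ->] := path_concat p1 pr1.
have mnm : homotopic (concat (concat m n) (rev_path m)) c1.
  have -> : c1 = subpath c1 0 1 by rewrite subpath01.
  apply: (@hom_trans _ _ (subpath p 0 1)); last first.
    apply: hom_eq; first by have [] := path_periodic 0 1 b1.
    move=> t t01; rewrite /subpath subr0 mulr1 add0r /p (@periodic_on _ _ c1 t 0) //.
      by rewrite subr0.
    by rewrite add0r.
  apply: hom_trans (periodic_concat 0 (u + 1) 1 b1); apply: hom_concat.
  - exact: periodic_concat.
  - have -> : rev_path m = subpath p (u + 1) 1.
      apply/funext => t; rewrite /m /Defs.rev_path /subpath.
      rewrite -[LHS](periodicD c1 _ 1) -/p; congr p.
      by rewrite -[1%:~R]/(1 : R); ring.
    by apply: hom_refl; have [] := path_periodic (u + 1) 1 b1.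
  - by have [_ _ ->] := path_concat p01 pn; have [_ -> _] := prm.
have pmn := path_concat p01 pn.
have pmnm := path_concat pmn prm.
apply: hom_sym; rewrite /lasso.
have e1 : concat (concat q2 c2) (rev_path q2) 1 = v.
  by have [_ _ ->] := path_concat (path_concat p2 c2p) (path_rev p2).
apply: (@hom_trans _ _ (concat (concat (concat q1 m) n) (rev_path (concat q1 m)))).
  apply: hom_concat; last 2 first.
  - exact: hom_rev.
  - by have [_ _ ->] := path_concat p2 c2p; have [_ -> _] := path_rev p2.
  by apply: hom_concat => //; rewrite q21 c20.
rewrite (rev_concat p1 p01).
have pq1m := path_concat p1 p01; have pq1mn := path_concat pq1m pn.
apply: hom_trans (hom_sym (hom_assoc pq1mn prm pr1)) _.
apply: hom_concat; last 2 first.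
- by apply: hom_refl; case: pr1.
- by have [_ _ ->] := path_concat pq1mn prm; have [_ -> _] := pr1.
apply: (@hom_trans _ _ (concat (concat q1 (concat m n)) (rev_path m))).
  apply: hom_concat; last 2 first.
  - by apply: hom_refl; case: prm.
  - by have [_ _ ->] := pq1mn; have [_ -> _] := prm.
  exact: hom_assoc p1 p01 pn.
apply: hom_trans (hom_assoc p1 pmn prm) _.
apply: hom_concat => //; first exact: hom_refl.
by have [_ -> _] := pmnm.
Qed.

End Double.

Section HomotopyWords.
Variables (R : realType) (X : topologicalType).
Implicit Types (x y z w : X).

Lemma hom_concatl x y z (f f' g : R -> X) : path_from_to x y f ->
  path_from_to y z g -> homotopic f f' -> homotopic (concat f g) (concat f' g).
Proof.
move=> [_ _ f1] [gc g0 _] ff; apply: hom_concat => //; first exact: hom_refl.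
by rewrite f1.
Qed.

Lemma hom_concatr x y z (f g g' : R -> X) : path_from_to x y f ->
  path_from_to y z g -> homotopic g g' -> homotopic (concat f g) (concat f g').
Proof.
move=> [fc _ f1] [_ g0 _] gg; apply: hom_concat => //; first exact: hom_refl.
by rewrite f1.
Qed.

Lemma hom_cancel_mid x y z w (f g k : R -> X) : path_from_to x y f ->
  path_from_to z y g -> path_from_to y w k ->
  homotopic (concat (concat f (rev_path g)) (concat g k)) (concat f k).
Proof.
move=> pf pg pk; have pg' := path_rev pg; have pgk := path_concat pg pk.
apply: hom_trans (hom_assoc pf pg' pgk) _.
apply: hom_concatr pf (path_concat pg' pgk) _.
apply: hom_trans (hom_sym (hom_assoc pg' pg pk)) _.
apply: hom_trans (hom_idl pk).
exact: hom_concatl (path_concat pg' pg) pk (hom_invl pg).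
Qed.

End HomotopyWords.

(** [P] and its negation are both relatively open in [A]. It lets a mirror loop be followed along a
    boundary component of the universal cover, which is given as a connected component. *)
Lemma connected_locally_constant (T : topologicalType) (A : set T) (P : T -> Prop) x0 :
  connected A ->
  (forall x, A x -> exists V, nbhs x V /\ forall x', V x' -> A x' -> (P x <-> P x')) ->
  A x0 -> P x0 -> forall x, A x -> P x.
Proof.
move=> Aconn loc Ax0 Px0.
have side (Q : T -> Prop) : (forall x, A x -> exists V, nbhs x V /\
    forall x', V x' -> A x' -> (Q x <-> Q x')) ->
    exists2 C, open C & A `&` Q = A `&` C.
  move=> locQ.
  exists (\bigcup_(V in [set V : set T | open V /\ forall x', V x' -> A x' -> Q x']) V).
    by apply: bigcup_open => V [].
  apply/seteqP; split=> x [Ax]; last first.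
    by move=> [V [_ VQ] Vx]; split=> //; exact: VQ.
  move=> Qx; split=> //; have [V [Vn VQ]] := locQ _ Ax.
  move: Vn; rewrite nbhsE => -[W [Wo Wx] WV].
  exists W => //; split=> // x' Wx' Ax'.
  by apply/(VQ _ (WV _ Wx') Ax').
have [C1 C1o e1] := side P loc.
have [|C2 C2o e2] := side (fun x => ~ P x).
  move=> x Ax; have [V [Vn VP]] := loc _ Ax; exists V; split=> // x' Vx' Ax'.
  by have [] := VP _ Vx' Ax'; tauto.
have : A `&` P = A.
  apply: Aconn; first by exists x0.
    by exists C1.
  exists (~` C2); first by rewrite closedC.
  apply/seteqP; split=> x [Ax].
    move=> Px; split=> // C2x; have : (A `&` C2) x by [].
    by rewrite -e2 => -[_].
  move=> nC2; split=> //; apply: contrapT => nP.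
  have : (A `&` (fun x => ~ P x)) x by [].
  by rewrite e2 => -[].
by move=> e x; rewrite -[X in X x]e => -[].
Qed.

(** * Symplectic matrices and representations of a fundamental group *)

Section SymplecticForm.
Variables (R : realType) (n : nat).
Local Notation J := (sympl_form R n).

Lemma sympl_form_sqr : J *m J = - 1%:M.
Proof.
rewrite /sympl_form mulmx_block !mulmx0 !mul0mx !mulmxN !mulNmx !mul1mx.
by rewrite !addr0 add0r (@scalar_mx_block _ n n 1) opp_block_mx !oppr0.
Qed.

Lemma Sp_unit (g : 'M[R]_(n + n)) : Sp g -> g \in unitmx.
Proof.
move=> gS; have e : (- (J *m g^T *m J)) *m g = 1%:M.
  have gS' : g^T *m J *m g = J := gS.
  by rewrite mulNmx -[J *m g^T *m J]mulmxA -mulmxA gS' sympl_form_sqr opprK.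
by have [] := mulmx1_unit e.
Qed.

End SymplecticForm.

Section Representations.
Variables (R : realType) (X : topologicalType) (x : X) (n : nat).
Variable rho : (R -> X) -> 'M[R]_(n + n).
Hypothesis rhoP : representation x rho.

Lemma repr_unit f : loop_at x f -> rho f \in unitmx.
Proof. by move=> lf; apply: Sp_unit; have [] := rhoP; move=> /(_ _ lf). Qed.

Lemma repr_cst : rho (fun=> x) = 1%:M.
Proof.
have [_ rhom rmul] := rhoP; have l : loop_at x (fun _ : R => x) := @path_cst R X x.
have u := repr_unit l; apply: (can_inj (mulKmx u)); rewrite mulmx1 -rmul //.
by apply: rhom => //; [exact: (path_concat l l)|exact: (hom_idr l)].
Qed.

Lemma repr_rev f : loop_at x f -> rho f *m rho (rev_path f) = 1%:M.
Proof.
have [_ rhom rmul] := rhoP => lf; have lr := path_rev lf.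
rewrite -rmul // -repr_cst; apply: rhom; first exact: path_concat lf lr.
  exact: path_cst.
exact: hom_inv lf.
Qed.

Lemma repr_null f : loop_at x f -> homotopic f (fun=> x) -> rho f = 1%:M.
Proof.
have [_ rhom _] := rhoP => lf h; rewrite -repr_cst; apply: rhom => //.
exact: path_cst.
Qed.

End Representations.

(** * Mirror loops in the double *)

Section MirrorLoops.
Variables (R : realType) (S D : surface R) (j0 j1 : S -> D) (j : D -> D).
Hypothesis dbl : is_double j0 j1 j.
Variable v : S.
Hypothesis v_bd : boundary v.

Let j0c : continuous j0. Proof. by have [[]] := dbl. Qed.
Let j1c : continuous j1. Proof. by have [[]] := dbl. Qed.

Definition mirror (k : R -> S) : R -> D :=
  concat (j0 \o k) (rev_path (j1 \o k)).

Lemma double_j0 (k : R -> S) : j \o (j0 \o k) = j1 \o k.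
Proof. by apply/funext => t /=; have [_ _ _ _ /(_ (k t))[]] := dbl. Qed.

Lemma double_j1 (k : R -> S) : j \o (j1 \o k) = j0 \o k.
Proof. by apply/funext => t /=; have [_ _ _ _ /(_ (k t))[]] := dbl. Qed.

Lemma path_j1 x y (k : R -> S) : boundary x -> boundary y ->
  path_from_to x y k -> path_from_to (j0 x) (j0 y) (j1 \o k).
Proof.
by move=> bx byy pk; rewrite (double_glue dbl bx) (double_glue dbl byy); apply: path_comp.
Qed.

Lemma loop_mirror x y k : boundary x -> boundary y -> path_from_to x y k ->
  loop_at (j0 x) (mirror k).
Proof.
move=> bx byy pk; apply: path_concat (path_comp j0c pk) _.
exact: path_rev (path_j1 bx byy pk).
Qed.

(** The source of the involutions: [Drho] turns [j] into conjugation by [s0], so the inverse of a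
    mirror element is its conjugate by [s0]. *)
Lemma rev_mirror x y k : boundary x -> boundary y -> path_from_to x y k ->
  rev_path (mirror k) = j \o mirror k.
Proof.
move=> bx byy pk.
rewrite (rev_concat (path_comp j0c pk) (path_rev (path_j1 bx byy pk))) rev_pathK.
by rewrite comp_concat comp_rev double_j0 double_j1.
Qed.

Lemma mirror_hom x k k' : boundary x -> k 1 = x ->
  homotopic k k' -> homotopic (mirror k) (mirror k').
Proof.
move=> bx k1 kk; apply: hom_concat; first exact: hom_comp.
  by apply: hom_rev; exact: hom_comp.
by rewrite /Defs.rev_path /= subr0 k1 (double_glue dbl).
Qed.

Lemma mirror_concat_hom x y z k l : path_from_to x y k -> boundary x ->
  boundary y -> boundary z -> path_from_to y z l ->
  homotopic (mirror (concat k l))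
    (concat (concat (j0 \o k) (mirror l)) (rev_path (j1 \o k))).
Proof.
move=> pk bx byy bz pl.
have pk0 := path_comp j0c pk; have pk1 := path_rev (path_j1 bx byy pk).
have pl0 := path_comp j0c pl; have pl1 := path_rev (path_j1 byy bz pl).
rewrite /mirror !comp_concat (rev_concat (path_j1 bx byy pk) (path_j1 byy bz pl)).
apply: hom_trans (hom_sym (hom_assoc (path_concat pk0 pl0) pl1 pk1)) _.
apply: hom_concatl _ pk1 (hom_assoc pk0 pl0 pl1).
exact: path_concat (path_concat pk0 pl0) pl1.
Qed.

Lemma mirror_concat_null x y z k l : path_from_to x y k -> boundary x ->
  boundary y -> boundary z -> path_from_to y z l ->
  homotopic (mirror l) (fun=> j0 y) -> homotopic (mirror (concat k l)) (mirror k).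
Proof.
move=> pk bx byy bz pl ml.
have pk0 := path_comp j0c pk; have pk1 := path_rev (path_j1 bx byy pk).
have lm := loop_mirror byy bz pl.
apply: hom_trans (mirror_concat_hom pk bx byy bz pl) _.
apply: hom_concatl (path_concat pk0 lm) pk1 _.
exact: hom_trans (hom_concatr pk0 lm ml) (hom_idr pk0).
Qed.

(** Brings an equality of mirror loops into the form to which the Sperner argument applies, an arc
    homotopic to its mirror image. *)
Lemma mirror_eq_homotopic x y q1 q2 : path_from_to v x q1 -> path_from_to v y q2 ->
  boundary x -> boundary y -> homotopic (mirror q1) (mirror q2) ->
  homotopic (j0 \o concat (rev_path q1) q2) (j1 \o concat (rev_path q1) q2).
Proof.
move=> p1 p2 bx byy h; rewrite !comp_concat !comp_rev.
have p10 := path_comp j0c p1; have p11 := path_j1 v_bd bx p1.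
have p20 := path_comp j0c p2; have p21 := path_j1 v_bd byy p2.
have r10 := path_rev p10; have r11 := path_rev p11.
have l2 := loop_mirror v_bd byy p2; have l1 := loop_mirror v_bd bx p1.
(* j0 q2 = mirror q2 * j1 q2 and mirror q1 * j1 q1 = j0 q1 *)
have e2 : homotopic (concat (mirror q2) (j1 \o q2)) (j0 \o q2).
  apply: hom_trans (hom_assoc p20 (path_rev p21) p21) _.
  apply: hom_trans (hom_idr p20).
  exact: hom_concatr p20 (path_concat (path_rev p21) p21) (hom_invl p21).
apply: hom_trans (hom_concatr r10 p20 (hom_sym e2)) _.
apply: hom_trans (hom_concatr r10 (path_concat l2 p21)
  (hom_concatl l2 p21 (hom_sym h))) _.
apply: hom_trans (hom_sym (hom_assoc r10 l1 p21)) _.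
apply: hom_concatl (path_concat r10 l1) p21 _.
apply: hom_trans (hom_sym (hom_assoc r10 p10 r11)) _.
apply: hom_trans (hom_idl r11).
exact: hom_concatl (path_concat r10 p10) r11 (hom_invl p10).
Qed.

(** Insert [j(beta)^-1 j(beta)]: [D alpha] splits into two mirror loops, one for each reflection. *)
Lemma double_loop_hom x y beta alpha : path_from_to v x beta -> path_from_to x y alpha ->
  boundary x -> boundary y ->
  loop_at (j0 v) (double_loop j0 j beta alpha) /\
  homotopic (double_loop j0 j beta alpha)
            (concat (mirror (concat beta alpha)) (rev_path (mirror beta))).
Proof.
move=> pb pa bx byy; rewrite /double_loop double_j0.
have pb0 := path_comp j0c pb; have pb1 := path_j1 v_bd bx pb.
have pa0 := path_comp j0c pa; have pa1 := path_j1 bx byy pa.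
have rb0 := path_rev pb0; have ra1 := path_rev pa1; have rb1 := path_rev pb1.
have pba := path_concat pb0 pa0; have pbaa := path_concat pba ra1.
split; first exact: path_concat pbaa rb0.
rewrite (rev_mirror v_bd bx pb) /mirror [j \o _]comp_concat comp_rev double_j0 double_j1.
rewrite !comp_concat (rev_concat pb1 pa1).
apply: hom_sym.
have assoc := hom_assoc pba ra1 rb1.
have lw := path_concat pba (path_concat ra1 rb1).
apply: hom_trans (hom_concatl lw (path_concat pb1 rb0) (hom_sym assoc)) _.
exact: hom_cancel_mid pbaa pb1 rb0.
Qed.

End MirrorLoops.

(** * Mirror loops ending on the axis of a peripheral element *)

Section AxisMirror.
Variables (R : realType) (S D : surface R) (j0 j1 : S -> D) (j : D -> D).
Hypothesis dbl : is_double j0 j1 j.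
Variable v : S.
Hypothesis v_bd : boundary v.
Variables (E : univ_cover R v) (ED : univ_cover R (j0 v)) (n : nat).
Variables (rho : (R -> S) -> 'M[R]_(n + n)) (Drho : (R -> D) -> 'M[R]_(n + n)).
Variable s0 : 'M[R]_(n + n).
Hypothesis Drho_rep : representation (j0 v) Drho.
Hypothesis Drho_j0 : forall f, loop_at v f -> Drho (j0 \o f) = rho f.
Hypothesis Drho_j : forall f, loop_at (j0 v) f -> Drho (j \o f) = s0 *m Drho f *m s0.
Hypothesis s0_sqr : s0 *m s0 = 1%:M.
Local Notation pE := (@uc_proj _ _ _ E).
Local Notation bE := (pE @^-1` @boundary R S).

Let j0c : continuous j0. Proof. by have [[]] := dbl. Qed.
Let j1c : continuous j1. Proof. by have [[]] := dbl. Qed.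
Let pEc : continuous pE. Proof. by have [] := uc_covering E. Qed.

(** The segment between the two points in a chart is so short that both of its copies lie in one
    evenly covered open set of the double. *)
Lemma mirror_local x : bE x -> exists V, nbhs x V /\ forall x', V x' -> bE x' ->
  exists2 l, path_from_to x x' l & homotopic (mirror j0 j1 (pE \o l)) (fun=> j0 (pE x)).
Proof.
move=> bx.
have [W [Wo Wx] Wnull] :=
  covering_null_loop (uc_covering ED) (j0 (pE x)) (uc_simply_connected ED).
have [U [N [s [[Uo No] [Ux Nx] sN ps sc]]]] := covering_section (uc_covering E) x.
have [k ka kx] := surf_cover (pE x).
pose W' := U `&` (j0 @^-1` W `&` j1 @^-1` W).
have W'o : open W'.
  have o0 : open (j0 @^-1` W) by apply: open_comp => // ? _; exact: j0c.
  have o1 : open (j1 @^-1` W) by apply: open_comp => // ? _; exact: j1c.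
  by apply: openI => //; exact: openI.
have W'x : W' (pE x) by split=> //; split; rewrite /= ?(double_glue dbl bx) // -(double_glue dbl bx).
have [r r0 [Qk ic [V [Vo Vx VQ]]]] := chart_box ka kx W'o W'x.
exists (N `&` pE @^-1` V); split.
  apply: filterI; first exact: open_nbhs_nbhs.
  by apply: pEc; apply: open_nbhs_nbhs.
move=> x' [Nx' Vx'] bx'.
have [_ _ Q0] := VQ _ Vx; have [kx' _ Q1] := VQ _ Vx'.
set z0 := chart_fun k (pE x) in Qk ic VQ Q0.
set z1 := chart_fun k (pE x') in Q1.
pose m t := chart_inv k (lin z0 z1 t).
have Qm (t : R) : 0 <= t <= 1 -> half_box z0 r (lin z0 z1 t).
  by move=> t01; apply: half_box_convex.
have W'm (t : R) : 0 <= t <= 1 -> W' (m t) by move=> /Qm /Qk[].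
have mc : {within `[0, 1], continuous m}.
  refine (@within_comp _ _ _ _ (half_box z0 r) (fun t : R => lin z0 z1 t) _ _ _ _) => //.
  by have [] := path_lin z0 z1.
have m0 : m 0 = pE x by rewrite /m lin0 chart_funK.
have m1 : m 1 = pE x' by rewrite /m lin1 chart_funK.
have pm : path_from_to (pE x) (pE x') m by [].
have pl : path_from_to x x' (s \o m).
  split.
  - apply: within_comp mc _ sc.
    by move=> t; rewrite /= in_itv => /W'm[].
  - by rewrite /= m0; have [] := sN _ Nx.
  - by rewrite /= m1; have [] := sN _ Nx'.
have pm' : path_from_to (pE x) (pE x') (pE \o (s \o m)) by apply: path_comp.
exists (s \o m) => //; apply: Wnull; first exact: (loop_mirror dbl bx bx').
have pt t : 0 <= t <= 1 -> W (j0 (pE (s (m t)))) /\ W (j1 (pE (s (m t)))).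
  by move=> /W'm[Um [? ?]]; rewrite ps.
move=> t t01; rewrite /mirror /concat /Defs.rev_path /=; case: ifP => t2.
  by have [|] := pt (2 * t); first lra.
by have [|] := pt (1 - (2 * t - 1)); first lra.
Qed.

Let base_path x : exists b : R -> E, path_from_to (uc_base E) x b.
Proof. by have [pc _] := uc_simply_connected E; exact: pc. Qed.

Lemma path_proj x (b : R -> E) : path_from_to (uc_base E) x b -> path_from_to v (pE x) (pE \o b).
Proof. move=> [bc b0 b1]; have [pc p0 p1] := path_comp pEc (And3 bc b0 b1).
by split=> //; rewrite p0 uc_baseP. Qed.

Lemma mirror_indep x (b b' : R -> E) : bE x -> path_from_to (uc_base E) x b ->
  path_from_to (uc_base E) x b' ->
  Drho (mirror j0 j1 (pE \o b)) = Drho (mirror j0 j1 (pE \o b')).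
Proof.
move=> bx pb pb'; have [_ rhom _] := Drho_rep; apply: rhom.
- exact: (loop_mirror dbl v_bd bx (path_proj pb)).
- exact: (loop_mirror dbl v_bd bx (path_proj pb')).
- apply: (mirror_hom dbl bx); first by have [_ _ ->] := path_proj pb.
  by apply: hom_comp => //; exact: simply_connected_hom (uc_simply_connected E) pb pb'.
Qed.

(** The mirror element [M] is the same for all ends on [A]. Choosing the end [e] with [d e = x], and
    the path [d] followed by one to [e], gives [M = rho(d) M Drho(j(d))^-1], where
    [Drho(j(d)) = s0 rho(d) s0]. *)
Lemma mirror_axis_commute d A x (b : R -> E) : loop_at v d -> axis d A -> A x ->
  path_from_to (uc_base E) x b ->
  bE x /\
  rho d *m (Drho (mirror j0 j1 (pE \o b)) *m s0) =
  (Drho (mirror j0 j1 (pE \o b)) *m s0) *m rho d.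
Proof.
move=> dl [[x0 bx0 Ae] Ad] Ax pb.
have Aconn : connected A by rewrite Ae; exact: component_connected.
have AbE y : A y -> bE y by rewrite Ae; apply: connected_component_sub.
split; first exact: AbE.
have [B BP] := choice base_path.
pose M y := Drho (mirror j0 j1 (pE \o B y)).
have Mloc y : A y -> exists V, nbhs y V /\ forall y', V y' -> A y' -> (M y = M x <-> M y' = M x).
  move=> Ay; have [V [Vn Vl]] := mirror_local (AbE _ Ay); exists V; split=> // y' Vy' Ay'.
  have [l pl ml] := Vl _ Vy' (AbE _ Ay').
  suff -> : M y' = M y by [].
  have pBl := path_concat (BP y) pl.
  rewrite /M (mirror_indep (AbE _ Ay') (BP y') pBl) comp_concat.
  have [_ rhom _] := Drho_rep; apply: rhom.
  - by rewrite -comp_concat; exact: (loop_mirror dbl v_bd (AbE _ Ay') (path_proj pBl)).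
  - exact: (loop_mirror dbl v_bd (AbE _ Ay) (path_proj (BP y))).
  - apply: (mirror_concat_null dbl (path_proj (BP y)) v_bd (AbE _ Ay) (AbE _ Ay')) => //.
    exact: path_comp.
have Mconst := connected_locally_constant Aconn Mloc Ax erefl.
have [e Ae' [q [l [pq pl hl]]]] : [set e' | exists2 e, A e & deck d e e'] x by rewrite Ad.
have be := AbE _ Ae'; have bx := AbE _ Ax.
have pq' := path_proj pq; have pl' := path_proj pl; have pb' := path_proj pb.
have dq := path_concat dl pq'.
have [_ rhom rmul] := Drho_rep.
have dl0 : loop_at (j0 v) (j0 \o d) by apply: path_comp.
have dl1 : loop_at (j0 v) (j1 \o d) by apply: (path_j1 dbl).
have lq := loop_mirror dbl v_bd be pq'.
have Me : Drho (mirror j0 j1 (pE \o b)) =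
    rho d *m Drho (mirror j0 j1 (pE \o b)) *m Drho (rev_path (j1 \o d)).
  rewrite -[in RHS](mirror_indep bx (BP x) pb) -/(M x) -(Mconst _ Ae') /M.
  rewrite (mirror_indep be (BP e) pq) -Drho_j0 // -!rmul //; last 2 first.
  - exact: path_concat dl0 lq.
  - exact: path_rev.
  rewrite (mirror_indep bx pb pl); apply: rhom.
  - exact: (loop_mirror dbl v_bd bx pl').
  - exact: path_concat (path_concat dl0 lq) (path_rev dl1).
  - apply: hom_trans (mirror_hom dbl bx _ hl) _; first by have [_ _ ->] := pl'.
    exact: (mirror_concat_hom dbl dl v_bd v_bd be pq').
have rj1 : Drho (rev_path (j1 \o d)) *m (s0 *m rho d *m s0) = 1%:M.
  rewrite -Drho_j0 // -Drho_j // (double_j0 dbl).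
  by apply: mulmx1C; exact: (repr_rev Drho_rep).
rewrite mulmxA; have -> : rho d *m Drho (mirror j0 j1 (pE \o b)) =
    Drho (mirror j0 j1 (pE \o b)) *m (s0 *m rho d *m s0).
  by rewrite [in RHS]Me -mulmxA rj1 mulmx1.
by rewrite !mulmxA -[_ *m s0 *m s0]mulmxA s0_sqr mulmx1.
Qed.

Lemma mirror_s0_sqr x k : path_from_to v x k -> boundary x ->
  (Drho (mirror j0 j1 k) *m s0) *m (Drho (mirror j0 j1 k) *m s0) = 1%:M.
Proof.
move=> pk bx; have l := loop_mirror dbl v_bd bx pk.
rewrite -[LHS]mulmxA [s0 *m _]mulmxA -Drho_j // -(rev_mirror dbl v_bd bx pk).
exact: (repr_rev Drho_rep).
Qed.

End AxisMirror.

(** * Complex matrices *)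

Section ComplexMatrices.
Variable R : realType.
Local Notation C := R[i].

Definition adjmx (m p : nat) (M : 'M[C]_(m, p)) : 'M[C]_(p, m) := (conj_mx M)^T.

Lemma cplxM m p q (A : 'M[R]_(m, p)) (B : 'M[R]_(p, q)) :
  cplx_mx (A *m B) = cplx_mx A *m cplx_mx B.
Proof. exact: map_mxM. Qed.

Lemma cplxD m p (A B : 'M[R]_(m, p)) : cplx_mx (A + B) = cplx_mx A + cplx_mx B.
Proof. exact: map_mxD. Qed.

Lemma cplxN m p (A : 'M[R]_(m, p)) : cplx_mx (- A) = - cplx_mx A.
Proof. exact: map_mxN. Qed.

Lemma cplxT m p (A : 'M[R]_(m, p)) : cplx_mx A^T = (cplx_mx A)^T.
Proof. by rewrite /cplx_mx map_trmx. Qed.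

Lemma cplx1 m : cplx_mx (1%:M : 'M[R]_m) = 1%:M.
Proof. exact: map_mx1. Qed.

Lemma cplx0 m p : cplx_mx (0 : 'M[R]_(m, p)) = 0.
Proof. exact: map_mx0. Qed.

Lemma cplxV m (A : 'M[R]_m) : cplx_mx (invmx A) = invmx (cplx_mx A).
Proof. exact: map_invmx. Qed.

Lemma cplx_unit m (A : 'M[R]_m) : (cplx_mx A \in unitmx) = (A \in unitmx).
Proof. exact: map_unitmx. Qed.

Lemma cplxZ m p a (A : 'M[R]_(m, p)) : cplx_mx (a *: A) = (real_complex R a) *: cplx_mx A.
Proof. exact: map_mxZ. Qed.

Lemma cplx_inj m p : injective (@cplx_mx R m p).
Proof. by move=> A B /matrixP e; apply/matrixP => i j; have := e i j; rewrite !mxE => -[]. Qed.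

Lemma conjM m p q (A : 'M[C]_(m, p)) (B : 'M[C]_(p, q)) :
  conj_mx (A *m B) = conj_mx A *m conj_mx B.
Proof. exact: map_mxM. Qed.

Lemma conjD m p (A B : 'M[C]_(m, p)) : conj_mx (A + B) = conj_mx A + conj_mx B.
Proof. exact: map_mxD. Qed.

Lemma conjN m p (A : 'M[C]_(m, p)) : conj_mx (- A) = - conj_mx A.
Proof. exact: map_mxN. Qed.

Lemma conjT m p (A : 'M[C]_(m, p)) : conj_mx A^T = (conj_mx A)^T.
Proof. by rewrite /conj_mx map_trmx. Qed.

Lemma conj1 m : conj_mx (1%:M : 'M[C]_m) = 1%:M.
Proof. exact: map_mx1. Qed.

Lemma conjV m (A : 'M[C]_m) : conj_mx (invmx A) = invmx (conj_mx A).
Proof. exact: map_invmx. Qed.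

Lemma conj_unit m (A : 'M[C]_m) : (conj_mx A \in unitmx) = (A \in unitmx).
Proof. exact: map_unitmx. Qed.

Lemma conjZ m p a (A : 'M[C]_(m, p)) : conj_mx (a *: A) = (conjc a) *: conj_mx A.
Proof. exact: map_mxZ. Qed.

Lemma conj_mxK m p : involutive (@conj_mx R m p).
Proof. by move=> A; apply/matrixP => i j; rewrite !mxE conjcK. Qed.

Lemma conj_cplx m p (A : 'M[R]_(m, p)) : conj_mx (cplx_mx A) = cplx_mx A.
Proof. by apply/matrixP => i j; rewrite !mxE conjc_real. Qed.

Lemma adjmxM m p q (A : 'M[C]_(m, p)) (B : 'M[C]_(p, q)) :
  adjmx (A *m B) = adjmx B *m adjmx A.
Proof. by rewrite /adjmx conjM trmx_mul. Qed.

Lemma adjmxK m p (A : 'M[C]_(m, p)) : adjmx (adjmx A) = A.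
Proof. by rewrite /adjmx conjT trmxK conj_mxK. Qed.

Lemma adjmx_cplx m p (A : 'M[R]_(m, p)) : adjmx (cplx_mx A) = cplx_mx A^T.
Proof. by rewrite /adjmx conj_cplx cplxT. Qed.

Lemma adjmx1 m : adjmx (1%:M : 'M[C]_m) = 1%:M.
Proof. by rewrite /adjmx conj1 trmx1. Qed.

Lemma adjmxN m p (A : 'M[C]_(m, p)) : adjmx (- A) = - adjmx A.
Proof. by rewrite /adjmx conjN linearN. Qed.

Lemma adjmxD m p (A B : 'M[C]_(m, p)) : adjmx (A + B) = adjmx A + adjmx B.
Proof. by rewrite /adjmx conjD linearD. Qed.

Lemma adjmxV m (A : 'M[C]_m) : adjmx (invmx A) = invmx (adjmx A).
Proof. by rewrite /adjmx conjV trmx_inv. Qed.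

Lemma adjmx_unit m (A : 'M[C]_m) : (adjmx A \in unitmx) = (A \in unitmx).
Proof. by rewrite /adjmx unitmx_tr conj_unit. Qed.

Lemma adjmxE m p (A : 'M[C]_(m, p)) : adjmx A = map_mx Num.conj A^T.
Proof. by apply/matrixP => i j; rewrite !mxE. Qed.

Lemma unit_of_ker (F : fieldType) m (A : 'M[F]_m) :
  (forall x : 'rV[F]_m, x *m A = 0 -> x = 0) -> A \in unitmx.
Proof.
move=> kA; rewrite -row_free_unit -kermx_eq0; apply/rowV0P => x /sub_kermxP.
exact: kA.
Qed.

Lemma invmxM (F : comUnitRingType) m (A B : 'M[F]_m) : A \in unitmx -> B \in unitmx ->
  invmx (A *m B) = invmx B *m invmx A.
Proof.
move=> uA uB; have uAB : A *m B \in unitmx by rewrite unitmx_mul uA.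
by apply: (can_inj (mulKmx uAB)); rewrite mulmxV // mulmxA mulmxK // mulmxV.
Qed.

Lemma complexmxE m p (A : 'M[C]_(m, p)) :
  A = cplx_mx (map_mx (@complex.Re R) A) + 'i%C *: cplx_mx (Im_mx A).
Proof. by apply/matrixP => i j; rewrite !mxE; exact: complexE. Qed.

Definition cpd (m : nat) (H : 'M[C]_m) : Prop :=
  adjmx H = H /\ forall x : 'rV[C]_m, x != 0 -> 0 < (x *m H *m adjmx x) 0 0.

Lemma cpd_unit m (H : 'M[C]_m) : cpd H -> H \in unitmx.
Proof.
move=> [_ pos]; apply: unit_of_ker => x xH; apply/eqP; apply: contraT => /pos.
by rewrite xH mul0mx mxE ltxx.
Qed.

Lemma congr_mulmx m (H P V : 'M[C]_m) :
  V *m P *m H *m adjmx (V *m P) = V *m (P *m H *m adjmx P) *m adjmx V.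
Proof. by rewrite adjmxM !mulmxA. Qed.

Lemma adjmx_congr m (H P : 'M[C]_m) : adjmx H = H ->
  adjmx (P *m H *m adjmx P) = P *m H *m adjmx P.
Proof. by move=> hH; rewrite !adjmxM adjmxK hH mulmxA. Qed.

Lemma cpd_congr m (H P : 'M[C]_m) : P \in unitmx -> cpd H -> cpd (P *m H *m adjmx P).
Proof.
move=> uP [hH pos]; split; first exact: adjmx_congr.
move=> x x0; have : x *m P != 0.
  by apply: contraNneq x0 => e; rewrite -[x](mulmxK uP) e mul0mx.
by move=> /pos; rewrite adjmxM !mulmxA.
Qed.

Lemma cpd_of_pos_def m (Y : 'M[R]_m) : pos_def Y -> cpd (cplx_mx Y).
Proof.
move=> [sY pos]; split; first by rewrite adjmx_cplx sY.
move=> x x0; pose a := map_mx (@complex.Re R) x; pose b := Im_mx x.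
have xe : x = cplx_mx a + 'i%C *: cplx_mx b := complexmxE x.
have xa : adjmx x = cplx_mx a^T - 'i%C *: cplx_mx b^T.
  rewrite {1}xe adjmxD adjmx_cplx /adjmx conjZ conj_cplx linearZ /= -cplxT.
  congr (_ + _); apply/matrixP => i j; rewrite !mxE.
  by apply/eqP; rewrite eq_complex /= !mul0r !mulr0; apply/andP; split; apply/eqP; ring.
(* With [x = a + i b], symmetry of [Y] cancels the mixed terms and leaves the sum of two real
   forms. *)
have sym : b *m Y *m a^T = a *m Y *m b^T.
  apply/matrixP => i j; rewrite !ord1 -[in LHS](trmxK (b *m Y *m a^T)) [in LHS]mxE.
  by rewrite !trmx_mul trmxK sY mulmxA.
have -> : x *m cplx_mx Y *m adjmx x = cplx_mx (a *m Y *m a^T + b *m Y *m b^T).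
  rewrite xa {1}xe !mulmxDl !mulmxDr -!scalemxAl !mulmxN -!scalemxAr -!cplxM.
  rewrite sym cplxD scalerN scalerA.
  have -> : 'i%C * 'i%C = -1 :> C by rewrite -expr2 sqr_i.
  by rewrite scaleN1r opprK addrA subrK.
rewrite mxE ltcE /= eqxx mxE /=.
have pos' (c : 'rV[R]_m) : 0 <= (c *m Y *m c^T) 0 0.
  by have [->|/pos/ltW//] := eqVneq c 0; rewrite !mul0mx mxE.
have [a0|/pos pa] := eqVneq a 0; last by rewrite ltr_pwDl.
have [b0|/pos pb] := eqVneq b 0; last by rewrite ltr_wpDl.
by move: x0; rewrite xe a0 b0 !cplx0 scaler0 addr0 eqxx.
Qed.

Lemma hermitian_diag m (H : 'M[C]_m) : adjmx H = H ->
  exists (U : 'M[C]_m) (d : 'rV[R]_m),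
    U *m adjmx U = 1%:M /\ U *m H *m adjmx U = diag_mx (cplx_mx d).
Proof.
move=> hH; have herm : H \is hermsymmx.
  apply/is_hermitianmxP; rewrite expr0 scale1r -adjmxE; exact/esym.
have nH := hermitian_normalmx herm.
have /orthomx_spectralP e := nH.
have dr := hermitian_spectral_diag_real herm.
set U := spectralmx H in e *; set d := spectral_diag H in e dr *.
have UU : U *m adjmx U = 1%:M.
  by rewrite adjmxE; apply/eqP; have := spectral_unitarymx H; rewrite qualifE.
have uU : U \in unitmx by have [] := mulmx1_unit UU.
have iU : invmx U = adjmx U by apply: (can_inj (mulKmx uU)); rewrite mulmxV.
exists U, (map_mx (@complex.Re R) d); split=> //.
have -> : cplx_mx (map_mx (@complex.Re R) d) = d.
  apply/matrixP => i j; rewrite !mxE; apply: RRe_real.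
  by move: dr => /mxOverP.
by rewrite [X in U *m X]e iU !mulmxA UU mul1mx -mulmxA UU mulmx1.
Qed.

Lemma cpd_diag m (d : 'rV[R]_m) : cpd (diag_mx (cplx_mx d)) -> forall i, 0 < d 0 i.
Proof.
move=> [_ pos] i; have : delta_mx 0 i != 0 :> 'rV[C]_m.
  by apply/eqP => /matrixP /(_ 0 i) /eqP; rewrite !mxE !eqxx oner_eq0.
move=> /pos.
have -> : adjmx (delta_mx 0 i : 'rV[C]_m) = delta_mx i 0.
  rewrite /adjmx /conj_mx map_delta_mx trmx_delta //.
by rewrite -rowE -colE !mxE eqxx mulr1n ltcE /= => /andP[].
Qed.

(** An eigenbasis of [H1], rescaled by inverse square roots of the eigenvalues, makes [H1] the
    identity; a unitary change of basis then diagonalises [H2] and keeps the identity. *)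
Lemma cpd_simultaneous m (H1 H2 : 'M[C]_m) : cpd H1 -> adjmx H2 = H2 ->
  exists (P : 'M[C]_m) (d : 'rV[R]_m),
    [/\ P \in unitmx, P *m H1 *m adjmx P = 1%:M &
        P *m H2 *m adjmx P = diag_mx (cplx_mx d)].
Proof.
move=> pd1 h2; have [h1 _] := pd1; have [U [l [UU dU]]] := hermitian_diag h1.
have uU : U \in unitmx by have [] := mulmx1_unit UU.
have l0 : forall i, 0 < l 0 i by apply: cpd_diag; rewrite -dU; exact: cpd_congr.
pose s : 'rV[R]_m := \row_i (Num.sqrt (l 0 i))^-1.
pose S := cplx_mx (diag_mx s).
have aS : adjmx S = S by rewrite adjmx_cplx tr_diag_mx.
have SlS : S *m diag_mx (cplx_mx l) *m S = 1%:M.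
  have -> : diag_mx (cplx_mx l) = cplx_mx (diag_mx l) by rewrite /cplx_mx map_diag_mx.
  rewrite /S -!cplxM -cplx1; congr cplx_mx; rewrite !mulmx_diag.
  apply/matrixP => i k; rewrite !mxE; case: (eqVneq i k) => [->|//].
  have sl : Num.sqrt (l 0 k) * Num.sqrt (l 0 k) = l 0 k.
    by rewrite -expr2 sqr_sqrtr // ltW.
  have s0 : Num.sqrt (l 0 k) != 0 by rewrite gt_eqF // sqrtr_gt0.
  by rewrite -[in X in _ * X * _]sl !mulr1n; field.
pose P0 := S *m U.
have P01 : P0 *m H1 *m adjmx P0 = 1%:M.
  by rewrite /P0 adjmxM aS -!mulmxA [H1 *m _]mulmxA [U *m _]mulmxA [U *m _]mulmxA dU mulmxA.
have h2' : adjmx (P0 *m H2 *m adjmx P0) = P0 *m H2 *m adjmx P0.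
  exact: adjmx_congr.
have [V [d [VV dV]]] := hermitian_diag h2'.
exists (V *m P0), d; split.
- rewrite unitmx_mul; have [-> _] := mulmx1_unit VV.
  have [] := mulmx1_unit P01; rewrite unitmx_mul => /andP[] //.
- by rewrite congr_mulmx P01 mulmx1.
- by rewrite congr_mulmx dV.
Qed.

Lemma spectrum_sum (r m : nat) (M : 'M[C]_r) (d : 'rV[C]_m) (f : C -> R) :
  char_poly M = char_poly (diag_mx d) ->
  \sum_(x <- spectrum M) f x = \sum_i f (d 0 i).
Proof.
move=> e.
have pe : perm_eq (spectrum M) [seq d 0 i | i <- enum 'I_m].
  apply: prod_XsubC_eq; rewrite /spectrum; case: closed_field_poly_normal => s /= sE.
  have : \prod_(x <- s) ('X - x%:P) = char_poly M.
    by rewrite [RHS]sE (monicP (char_poly_monic M)) scale1r.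
  move=> ->; rewrite e char_poly_trig; last exact: diag_mx_is_trig.
  by rewrite big_map big_enum /=; apply: eq_bigr => i _; rewrite mxE eqxx mulr1n.
by rewrite (perm_big _ pe) big_map big_enum.
Qed.

(** The two sizes are only propositionally equal because [cross_ratio] is a matrix of size
    [\rank l1]. *)
Lemma char_poly_sim (r m : nat) (S : 'M[C]_(r, m)) (S' : 'M[C]_(m, r)) (M : 'M[C]_m) :
  r = m -> S' *m S = 1%:M -> char_poly (S *m M *m S') = char_poly M.
Proof.
move=> rm; subst r => SS.
have uS : S \in unitmx by have [] := mulmx1_unit SS.
have iS : S' = invmx S by apply: (can_inj (mulmxK uS)); rewrite SS mulVmx.
rewrite iS /char_poly /char_poly_mx !map_mxM map_invmx.
set SP := map_mx _ S; set MP := map_mx _ M.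
have uP : SP \in unitmx by rewrite map_unitmx.
have -> : 'X%:M - SP *m MP *m invmx SP = SP *m ('X%:M - MP) *m invmx SP.
  by rewrite mulmxBr mulmxBl scalar_mxC -[X in _ = X - _]mulmxA mulmxV // mulmx1.
by rewrite !det_mulmx mulrAC -det_mulmx mulmxV // det1 mul1r.
Qed.

End ComplexMatrices.

(** * The Siegel space *)

Section Pairing.
Variables (R : realType) (n : nat).
Local Notation C := R[i].
Local Notation J := (sympl_form R n).
Local Notation frame := 'M[C]_(n, n + n).
Implicit Types (l a b : frame) (X Z : 'M[C]_n) (g h : 'M[R]_(n + n)).

Definition pair l l' : 'M[C]_n := l *m cplx_mx J *m l'^T.

Lemma cplx_J : cplx_mx J = block_mx 0 1%:M (- 1%:M) 0.
Proof. by rewrite /cplx_mx map_block_mx !map_mx0 map_mxN !map_mx1. Qed.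

Lemma J_tr : J^T = - J.
Proof. by rewrite /sympl_form tr_block_mx opp_block_mx !linear0 linearN /= trmx1 opprK ?oppr0. Qed.

Lemma pairMl U l l' : pair (U *m l) l' = U *m pair l l'.
Proof. by rewrite /pair !mulmxA. Qed.

Lemma pairMr V l l' : pair l (V *m l') = pair l l' *m V^T.
Proof. by rewrite /pair trmx_mul !mulmxA. Qed.

Lemma pair_tr l l' : (pair l l')^T = - pair l' l.
Proof. by rewrite /pair !trmx_mul trmxK -cplxT J_tr cplxN mulNmx mulmxN mulmxA. Qed.

Lemma pair_lag X Z : pair (lag_of X) (lag_of Z) = X^T - Z.
Proof.
rewrite /pair cplx_J /lag_of mul_row_block tr_row_mx mul_row_col trmxK trmx1.
by rewrite !mulmx0 !mulmx1 mul1mx addr0 add0r mulNmx mul1mx addrC.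
Qed.

Lemma pair_inf_lag Z : pair (cplx_mx (lag_infty R n)) (lag_of Z) = 1%:M.
Proof.
rewrite /pair cplx_J /lag_of /lag_infty /cplx_mx map_row_mx map_mx1 map_mx0.
rewrite mul_row_block tr_row_mx mul_row_col trmxK trmx1.
by rewrite !mul1mx !mul0mx !addr0 mul0mx add0r mulmx1.
Qed.

Lemma pair_Sp g l l' : Sp g ->
  pair (l *m (cplx_mx g)^T) (l' *m (cplx_mx g)^T) = pair l l'.
Proof.
move=> gS; have gS' : g^T *m J *m g = J := gS.
rewrite /pair trmx_mul trmxK !mulmxA -[l *m _ *m _]mulmxA -[l *m _ *m _]mulmxA.
by rewrite -cplxT -!cplxM gS'.
Qed.

(** The Gram matrix of [(l, l')] against [(l', l)] is block triangular with invertible diagonal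
    blocks. *)
Lemma unit_col_mx l l' : pair l' l' = 0 -> pair l l' \in unitmx ->
  col_mx l l' \in unitmx.
Proof.
move=> p0 pu.
have : col_mx l l' *m (cplx_mx J *m row_mx l'^T l^T) \in unitmx.
  rewrite mulmxA mul_col_mx mul_col_row -!/(pair _ _) p0.
  have pu' : pair l' l \in unitmx.
    by rewrite -unitmx_tr pair_tr -scaleN1r unitmxZ // unitrN1.
  by rewrite unitmxE det_ublock unitrM -!unitmxE pu.
by rewrite unitmx_mul => /andP[].
Qed.

Lemma row_free_pair l l' : pair l l' \in unitmx -> row_free l.
Proof.
move=> pu; apply/row_freeP; exists (cplx_mx J *m l'^T *m invmx (pair l l')).
by rewrite !mulmxA -/(pair l l') mulmxV.
Qed.

(** The right-hand side kills [l'], which is isotropic, and is the identity on [l]; together they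
    span. *)
Lemma projE l l' : pair l' l' = 0 -> pair l l' \in unitmx ->
  Defs.proj l l' = cplx_mx J *m l'^T *m invmx (pair l l') *m l.
Proof.
move=> p0 pu; have uB := unit_col_mx p0 pu.
have cap0 : (genmx l :&: genmx l')%MS = 0.
  apply/eqP/rowV0P => x; rewrite sub_capmx !genmxE => /andP[/submxP[s xs] /submxP[t xt]].
  have : s *m pair l l' = 0.
    by rewrite /pair !mulmxA -xs xt -!mulmxA [l' *m _]mulmxA -/(pair l' l') p0 mulmx0.
  by move=> /(congr1 (mulmx^~ (invmx (pair l l')))); rewrite mulmxK // mul0mx xs => ->; rewrite mul0mx.
apply: (can_inj (mulKmx uB)); rewrite /Defs.proj !mul_col_mx; congr col_mx.
- by rewrite proj_mx_id ?genmxE // !mulmxA -/(pair l l') mulmxV // mul1mx.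
- by rewrite proj_mx_0 ?genmxE // !mulmxA -/(pair l' l') p0 !mul0mx.
Qed.

Definition cross_mx l1 l2 l3 l4 : 'M[C]_n :=
  pair l1 l3 *m invmx (pair l4 l3) *m pair l4 l2 *m invmx (pair l1 l2).

(** [S] and [S'] change between [row_base l1], the basis used by the definition, and the rows of
    [l1], in which only pairings occur. *)
Lemma cross_ratioE l1 l2 l3 l4 : pair l2 l2 = 0 -> pair l3 l3 = 0 ->
  pair l1 l2 \in unitmx -> pair l4 l3 \in unitmx ->
  exists (S : 'M[C]_(\rank l1, n)) (S' : 'M[C]_(n, \rank l1)),
    [/\ \rank l1 = n, S' *m S = 1%:M, S *m S' = 1%:M &
        cross_ratio l1 l2 l3 l4 = S *m cross_mx l1 l2 l3 l4 *m S'].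
Proof.
move=> p2 p3 p12 p43; have f1 := row_free_pair p12.
have rk : \rank l1 = n by move: f1; rewrite /row_free => /eqP.
pose rb := row_base l1; have frb : row_free rb by exact: row_base_free.
pose S := rb *m pinvmx l1; pose S' := l1 *m pinvmx rb.
have Sl : S *m l1 = rb by rewrite /S mulmxKpV // eq_row_base.
have S'rb : S' *m rb = l1 by rewrite /S' mulmxKpV // eq_row_base.
exists S, S'; split=> //.
- by apply: (row_free_inj f1); rewrite -mulmxA Sl S'rb mul1mx.
- by apply: (row_free_inj frb); rewrite -mulmxA S'rb Sl mul1mx.
have e : rb *m (Defs.proj l4 l3 *m Defs.proj l1 l2) =
    S *m cross_mx l1 l2 l3 l4 *m l1.
  by rewrite -Sl !projE // /cross_mx /pair !mulmxA.
by rewrite /cross_ratio /conjmx -/rb e /S' !mulmxA.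
Qed.

Lemma Sp_mul g h : Sp g -> Sp h -> Sp (g *m h).
Proof.
rewrite /Sp /= => gS hS; rewrite trmx_mul !mulmxA -[h^T *m _ *m _]mulmxA.
by rewrite -[h^T *m _ *m _]mulmxA gS hS.
Qed.

Lemma Sp_inv g : Sp g -> Sp (invmx g).
Proof.
move=> gS; have u := Sp_unit gS; have gS' : g^T *m J *m g = J := gS.
rewrite /Sp /= -{1}gS' !mulmxA -trmx_mul mulmxV // trmx1 mul1mx.
by rewrite mulmxK.
Qed.

(** The automorphy factor [C Z + D]; [mfac] is the numerator [A Z + B]. *)
Definition nfac g Z : 'M[C]_n :=
  dlsubmx (cplx_mx g) *m Z + drsubmx (cplx_mx g).

Definition mfac g Z : 'M[C]_n :=
  ulsubmx (cplx_mx g) *m Z + ursubmx (cplx_mx g).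

Lemma siegel_actE g Z : siegel_act g Z = mfac g Z *m invmx (nfac g Z).
Proof. by []. Qed.

Lemma lag_mul g Z : lag_of Z *m (cplx_mx g)^T = row_mx (mfac g Z)^T (nfac g Z)^T.
Proof.
rewrite -{1}[cplx_mx g]submxK tr_block_mx /lag_of mul_row_block !mul1mx.
by rewrite -!trmx_mul -!linearD.
Qed.

Lemma lag_act g Z : nfac g Z \in unitmx ->
  lag_of Z *m (cplx_mx g)^T = (nfac g Z)^T *m lag_of (siegel_act g Z).
Proof.
move=> u; rewrite lag_mul /lag_of mul_mx_row mulmx1 siegel_actE; congr row_mx.
by rewrite -trmx_mul mulmxKV.
Qed.

Lemma SiegelP Z : Siegel Z -> Z^T = Z /\ cpd (cplx_mx (Im_mx Z)).
Proof. by move=> [sZ pZ]; split=> //; exact: cpd_of_pos_def. Qed.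

Lemma Im_mx_conj Z : 2%:R *: ('i%C *: cplx_mx (Im_mx Z)) = Z - conj_mx Z.
Proof.
apply/matrixP => i j; rewrite !mxE subcJ.
by rewrite (mulrC 'i%C) mulrA.
Qed.

(** On the frame of [Z] the Hermitian form obtained from [J] is [2 i Im Z], and [g] preserves it. A
    vector killed by the factor would be carried into [l_infty], where that form vanishes. *)
Lemma nfac_unit g Z : Sp g -> Siegel Z -> nfac g Z \in unitmx.
Proof.
move=> gS /SiegelP[sZ [_ pos]]; rewrite -unitmx_tr; apply: unit_of_ker => x xN.
pose l := lag_of Z *m (cplx_mx g)^T.
have xl : x *m l = row_mx (x *m (mfac g Z)^T) 0 by rewrite /l lag_mul mul_mx_row xN.
have cl : conj_mx l = lag_of (conj_mx Z) *m (cplx_mx g)^T.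
  rewrite /l conjM conjT conj_cplx /lag_of; congr (_ *m _).
  by rewrite /conj_mx map_row_mx map_mx1 -map_trmx.
have e : x *m (2%:R *: ('i%C *: cplx_mx (Im_mx Z))) *m adjmx x = 0.
  have -> : 2%:R *: ('i%C *: cplx_mx (Im_mx Z)) = pair l (conj_mx l).
    by rewrite Im_mx_conj cl pair_Sp // pair_lag sZ.
  have -> : x *m pair l (conj_mx l) *m adjmx x =
      (x *m l) *m cplx_mx J *m adjmx (x *m l).
    by rewrite /pair adjmxM /adjmx !mulmxA.
  rewrite xl cplx_J mul_row_block !mulmx0 mul0mx !addr0 mulmx1.
  rewrite /adjmx /conj_mx map_row_mx tr_row_mx mul_row_col mul0mx add0r.
  by rewrite map_mx0 linear0 mulmx0.
apply/eqP; apply: contraT => /pos.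
move: e; rewrite -!scalemxAr -!scalemxAl => /eqP.
rewrite !scaler_eq0 pnatr_eq0 /= eq_complex /= eqxx oner_eq0 /=.
by move=> /eqP->; rewrite mxE ltxx.
Qed.

Lemma siegel_act_sub g X Z : nfac g X \in unitmx -> nfac g Z \in unitmx -> Sp g ->
  (siegel_act g X)^T - siegel_act g Z =
  invmx (nfac g X)^T *m (X^T - Z) *m invmx (nfac g Z).
Proof.
move=> uX uZ gS; have := pair_Sp (lag_of X) (lag_of Z) gS.
rewrite (lag_act uX) (lag_act uZ) pairMl pairMr trmxK !pair_lag => <-.
by rewrite !mulmxA mulVmx ?unitmx_tr // mul1mx mulmxK.
Qed.

Lemma nfac_conj g Z : nfac g (conj_mx Z) = conj_mx (nfac g Z).
Proof.
have e1 : dlsubmx (cplx_mx g) = cplx_mx (dlsubmx g) by rewrite /cplx_mx map_dlsubmx.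
have e2 : drsubmx (cplx_mx g) = cplx_mx (drsubmx g) by rewrite /cplx_mx map_drsubmx.
by rewrite /nfac e1 e2 conjD conjM !conj_cplx.
Qed.

Lemma mfac_conj g Z : mfac g (conj_mx Z) = conj_mx (mfac g Z).
Proof.
have e1 : ulsubmx (cplx_mx g) = cplx_mx (ulsubmx g) by rewrite /cplx_mx map_ulsubmx.
have e2 : ursubmx (cplx_mx g) = cplx_mx (ursubmx g) by rewrite /cplx_mx map_ursubmx.
by rewrite /mfac e1 e2 conjD conjM !conj_cplx.
Qed.

Lemma siegel_act_conj g Z : siegel_act g (conj_mx Z) = conj_mx (siegel_act g Z).
Proof. by rewrite !siegel_actE nfac_conj mfac_conj conjM conjV. Qed.

(** This is the difference formula applied to a point and its conjugate. *)
Lemma siegel_act_Im g Z : Sp g -> Siegel Z ->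
  cplx_mx (Im_mx (siegel_act g Z)) =
  (invmx (nfac g Z)^T) *m cplx_mx (Im_mx Z) *m adjmx (invmx (nfac g Z)^T).
Proof.
move=> gS SZ; have u := nfac_unit gS SZ; have [sZ _] := SZ.
have gs : (siegel_act g Z)^T = siegel_act g Z.
  apply/eqP; rewrite -subr_eq0 siegel_act_sub // sZ subrr mulmx0 mul0mx //.
have : 2%:R *: ('i%C *: cplx_mx (Im_mx (siegel_act g Z))) = 2%:R *: ('i%C *: (
  (invmx (nfac g Z)^T) *m cplx_mx (Im_mx Z) *m adjmx (invmx (nfac g Z)^T))).
  rewrite Im_mx_conj -siegel_act_conj -{1}gs siegel_act_sub ?nfac_conj ?conj_unit //.
  rewrite sZ -Im_mx_conj -!scalemxAr -!scalemxAl; congr (_ *: (_ *: (_ *m _))).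
  by rewrite adjmxV /adjmx conjT trmxK.
have n2 : (2%:R : C) != 0 by rewrite pnatr_eq0.
have ni : 'i%C != 0 :> C by rewrite eq_complex /= eqxx oner_eq0.
by move=> /(scalerI n2) /(scalerI ni).
Qed.

Lemma pos_def_of_cpd (Y : 'M[R]_n) : cpd (cplx_mx Y) -> pos_def Y.
Proof.
move=> [hY pos]; split; first by apply: cplx_inj; rewrite -adjmx_cplx.
move=> x x0; have : cplx_mx x != 0.
  by apply: contraNneq x0 => e; apply/eqP/(@cplx_inj R); rewrite e cplx0.
by move=> /pos; rewrite adjmx_cplx -!cplxM mxE ltcE /= => /andP[].
Qed.

Lemma siegel_act_Siegel g Z : Sp g -> Siegel Z -> Siegel (siegel_act g Z).
Proof.
move=> gS SZ; have u := nfac_unit gS SZ; have [sZ cZ] := SiegelP SZ; split.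
  by apply/eqP; rewrite -subr_eq0 siegel_act_sub // sZ subrr mulmx0 mul0mx.
apply: pos_def_of_cpd; rewrite (siegel_act_Im gS SZ); apply: (cpd_congr _ cZ).
by rewrite unitmx_inv unitmx_tr.
Qed.

(** The action and the cocycle relation both follow from moving the frame [(Z, 1)] in two ways. *)
Lemma siegel_act_comp g h Z : Sp g -> Sp h -> Siegel Z ->
  siegel_act (g *m h) Z = siegel_act g (siegel_act h Z) /\
  nfac (g *m h) Z = nfac g (siegel_act h Z) *m nfac h Z.
Proof.
move=> gS hS SZ; have uh := nfac_unit hS SZ.
have ShZ := siegel_act_Siegel hS SZ; have ug := nfac_unit gS ShZ.
have ugh := nfac_unit (Sp_mul gS hS) SZ.
have := lag_act ugh; rewrite cplxM trmx_mul mulmxA (lag_act uh) -mulmxA (lag_act ug).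
rewrite /lag_of !mul_mx_row !mulmx1 => /eq_row_mx[e1 e2].
have e3 : nfac (g *m h) Z = nfac g (siegel_act h Z) *m nfac h Z.
  by apply: trmx_inj; rewrite trmx_mul.
split=> //; apply: trmx_inj.
have uT : (nfac (g *m h) Z)^T \in unitmx by rewrite unitmx_tr.
by apply: (can_inj (mulKmx uT)); rewrite -e1 -e2; exact: mulmxA.
Qed.

Lemma siegel_act1 Z : siegel_act 1%:M Z = Z.
Proof.
rewrite /siegel_act cplx1 (@scalar_mx_block _ n n 1).
rewrite block_mxKul block_mxKur block_mxKdl block_mxKdr.
by rewrite mul1mx mul0mx addr0 add0r invmx1 mulmx1.
Qed.

Lemma siegel_actK g Z : Sp g -> Siegel Z -> siegel_act (invmx g) (siegel_act g Z) = Z.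
Proof.
move=> gS SZ; have [<- _] := siegel_act_comp (Sp_inv gS) gS SZ.
by rewrite mulVmx ?siegel_act1 // Sp_unit.
Qed.

Lemma siegel_actKV g Z : Sp g -> Siegel Z -> siegel_act g (siegel_act (invmx g) Z) = Z.
Proof.
move=> gS SZ; have [<- _] := siegel_act_comp gS (Sp_inv gS) SZ.
by rewrite mulmxV ?siegel_act1 // Sp_unit.
Qed.

Lemma Siegel_unit Z : Siegel Z -> Z \in unitmx.
Proof.
move=> /SiegelP[sZ [_ pos]]; apply: unit_of_ker => x xZ.
apply/eqP; apply: contraT => /pos.
have e : x *m (2%:R *: ('i%C *: cplx_mx (Im_mx Z))) *m adjmx x = 0.
  rewrite Im_mx_conj mulmxBr xZ sub0r mulNmx -mulmxA.
  have -> : conj_mx Z *m adjmx x = (conj_mx (x *m Z))^T.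
    by rewrite conjM trmx_mul -conjT sZ.
  by rewrite xZ /conj_mx map_mx0 linear0 mulmx0 oppr0.
move: e; rewrite -!scalemxAr -!scalemxAl => /eqP.
rewrite !scaler_eq0 pnatr_eq0 /= eq_complex /= eqxx oner_eq0 /=.
by move=> /eqP->; rewrite mxE ltxx.
Qed.

Definition imag (Y : 'M[R]_n) : 'M[C]_n := 'i%C *: cplx_mx Y.

Lemma Im_imag Y : Im_mx (imag Y) = Y.
Proof. by apply/matrixP => i j; rewrite !mxE /= mul0r mul1r add0r. Qed.

Lemma conj_imag Y : conj_mx (imag Y) = - imag Y.
Proof.
rewrite /imag conjZ conj_cplx -scaleNr; congr (_ *: _).
by apply/eqP; rewrite eq_complex /= oppr0 !eqxx.
Qed.

Lemma Siegel_imag Y : pos_def Y -> Siegel (imag Y).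
Proof.
move=> pY; split; last by rewrite Im_imag.
by rewrite /imag linearZ /= -cplxT; case: pY => ->.
Qed.

Lemma conj_lag Z : conj_mx (lag_of Z) = lag_of (conj_mx Z).
Proof. by rewrite /lag_of /conj_mx map_row_mx map_mx1 map_trmx. Qed.

End Pairing.

Lemma eqmx_frame (F : fieldType) (m p : nat) (a l : 'M[F]_(m, p)) :
  row_free l -> (a :=: l)%MS -> exists2 U, U \in unitmx & a = U *m l.
Proof.
move=> fl e; exists (a *m pinvmx l); last by rewrite mulmxKpV // e.
have fa : row_free a by rewrite /row_free e.
apply: unit_of_ker => x xU; apply: (row_free_inj fa).
by rewrite -[a](mulmxKpV (B := l)) ?e // mulmxA xU !mul0mx.
Qed.

(** * Matrix identities for cross-ratios *)

Section MatrixIdentities.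
Variables (F : fieldType) (n : nat).
Implicit Types (A B D P S T U V N : 'M[F]_n).

(** [S], [T], [U], [V] stand for the automorphy factors that surround the four differences in a
    cross-ratio; all of them but [S] cancel. *)
Lemma cross4_conj S T U V A B A' B' : S \in unitmx -> T \in unitmx ->
  U \in unitmx -> V \in unitmx -> B \in unitmx -> B' \in unitmx ->
  (S *m A *m U) *m invmx (T *m B *m U) *m (T *m A' *m V) *m invmx (S *m B' *m V) =
  S *m (A *m invmx B *m A' *m invmx B') *m invmx S.
Proof.
move=> uS uT uU uV uB uB'.
have uTB : T *m B \in unitmx by rewrite unitmx_mul uT.
have uSB : S *m B' \in unitmx by rewrite unitmx_mul uS.
rewrite (invmxM uTB uU) (invmxM uT uB) (invmxM uSB uV) (invmxM uS uB') !mulmxA.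
by rewrite (mulmxK uU) (mulmxKV uT) (mulmxK uV).
Qed.

Lemma cross_frame U V A A' N N' : U \in unitmx -> V \in unitmx -> A \in unitmx ->
  N \in unitmx -> N' \in unitmx ->
  U *m (A' *m invmx N') *m invmx (V *m invmx N') *m (V *m invmx N) *m
    invmx (U *m (A *m invmx N)) = U *m (A' *m invmx A) *m invmx U.
Proof.
move=> uU uV uA uN uN'; have uiN : invmx N \in unitmx by rewrite unitmx_inv.
have uiN' : invmx N' \in unitmx by rewrite unitmx_inv.
have uAN : A *m invmx N \in unitmx by rewrite unitmx_mul uA.
rewrite (invmxM uV uiN') (invmxM uU uAN) (invmxM uA uiN) !invmxK !mulmxA.
by rewrite (mulmxKV uN') (mulmxKV uV) (mulmxKV uN).
Qed.

Lemma conj_eqN1 (r : nat) (S : 'M[F]_(r, n)) (S' : 'M[F]_(n, r)) A :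
  S' *m S = 1%:M -> S *m S' = 1%:M -> S *m A *m S' = - 1%:M <-> A = - 1%:M.
Proof.
move=> SS' S'S; split=> [e|->].
  rewrite -[A]mul1mx -[A]mulmx1 -SS' !mulmxA -[S' *m S *m A]mulmxA -[LHS]mulmxA.
  rewrite [_ *m (S' *m S)]mulmxA -[S' *m _ *m S']mulmxA e mulmxN mulNmx mulmx1.
  by rewrite SS'.
by rewrite mulmxN mulNmx mulmx1 S'S.
Qed.

Lemma unitmx_invT N : N \in unitmx -> invmx N^T \in unitmx.
Proof. by move=> uN; rewrite unitmx_inv unitmx_tr. Qed.

Lemma unitmx_invV N : N \in unitmx -> invmx N \in unitmx.
Proof. by move=> uN; rewrite unitmx_inv. Qed.

Lemma scale_cross (i : F) A B : i != 0 -> B \in unitmx ->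
  (i *: A) *m invmx (- i *: B) *m (- i *: A) *m invmx (i *: B) =
  (A *m invmx B) *m (A *m invmx B).
Proof.
move=> i0 uB; have ui : i \is a GRing.unit by rewrite unitfE.
have uNi : - i \is a GRing.unit by rewrite unitrN.
rewrite !invmxZ ?unitmxZ // !(=^~ scalemxAl, =^~ scalemxAr) !scalerA !mulmxA.
by rewrite (_ : _ * _ = 1) ?scale1r //; field; rewrite i0 oppr_eq0 i0.
Qed.

Lemma cayley_conj P P' A B D : P \in unitmx -> P' \in unitmx ->
  P *m A *m P' = 1%:M -> P *m B *m P' = D -> 1%:M + D \in unitmx ->
  A + B \in unitmx /\
  (A - B) *m invmx (A + B) = invmx P *m ((1%:M - D) *m invmx (1%:M + D)) *m P.
Proof.
move=> uP uP' e1 e2 uD.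
have s1 : P *m (A + B) *m P' = 1%:M + D by rewrite mulmxDr mulmxDl e1 e2.
have s2 : P *m (A - B) *m P' = 1%:M - D by rewrite mulmxBr mulmxBl e1 e2.
have uAB : A + B \in unitmx.
  by move: uD; rewrite -s1 !unitmx_mul => /andP[/andP[]].
have uPAB : P *m (A + B) \in unitmx by rewrite unitmx_mul uP.
split=> //; rewrite -s1 -s2 (invmxM uPAB uP') (invmxM uP uAB) !mulmxA.
by rewrite (mulmxK uP') mulVmx // mul1mx (mulmxKV uP).
Qed.

End MatrixIdentities.

(** The square root is [(x - 1) / (x + 1)], so the number [lambda] attached to this eigenvalue is
    [x] itself. *)
Lemma cayley_sqrt (R : realType) (x : R) : 1 <= x ->
  (1 + Num.sqrt (((1 - x) / (1 + x)) ^+ 2)) /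
  (1 - Num.sqrt (((1 - x) / (1 + x)) ^+ 2)) = x.
Proof.
move=> x1; rewrite sqrtr_sqr ler0_norm.
  by field; apply/andP; split; rewrite gt_eqF; lra.
by rewrite ler_pdivrMr ?mul0r; lra.
Qed.

(** * Tubes and the Finsler distance in coordinates *)

Section TubesAndDistance.
Variables (R : realType) (n : nat).
Local Notation C := R[i].
Implicit Types (X Z : 'M[C]_n) (g h : 'M[R]_(n + n)) (Y : 'M[R]_n).

Lemma pair_act h Z (l : 'M[C]_(n, n + n)) : Sp h -> nfac h Z \in unitmx ->
  pair (l *m (cplx_mx h)^T) (lag_of (siegel_act h Z)) =
  pair l (lag_of Z) *m invmx (nfac h Z).
Proof.
move=> hS u; have := pair_Sp l (lag_of Z) hS.
by rewrite (lag_act u) pairMr trmxK => <-; rewrite mulmxK.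
Qed.

Lemma cplx_lag (X : 'M[R]_n) : cplx_mx (lag_of X) = lag_of (cplx_mx X).
Proof. by rewrite /lag_of /cplx_mx map_row_mx map_mx1 map_trmx. Qed.

Lemma lag_of_free (F : fieldType) (X : 'M[F]_n) : row_free (lag_of X).
Proof.
apply/row_freeP; exists (col_mx 0 1%:M).
by rewrite /lag_of mul_row_col mulmx0 mulmx1 add0r.
Qed.

Lemma lag_infty_free : row_free (lag_infty R n).
Proof.
apply/row_freeP; exists (col_mx 1%:M 0).
by rewrite /lag_infty mul_row_col mulmx0 mulmx1 addr0.
Qed.

Lemma row_freeM (F : fieldType) (m p : nat) (l : 'M[F]_(m, p)) (g : 'M[F]_p) :
  row_free l -> g \in unitmx -> row_free (l *m g).
Proof. by move=> fl ug; rewrite /row_free mxrankMfree ?row_free_unit. Qed.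

Lemma pair_lag0 Z : Z^T = Z -> pair (lag_of Z) (lag_of Z) = 0.
Proof. by move=> sZ; rewrite pair_lag sZ subrr. Qed.

Lemma SiegelB X Z : Siegel X -> Siegel Z -> X - conj_mx Z \in unitmx.
Proof.
move=> [sX [pX1 pX2]] [sZ [pZ1 pZ2]]; apply: Siegel_unit; split.
  by rewrite linearB /= sX -conjT sZ.
have -> : Im_mx (X - conj_mx Z) = Im_mx X + Im_mx Z.
  by apply/matrixP => i j; rewrite !mxE; case: (X i j) (Z i j) => [a b] [c d] /=; ring.
split; first by rewrite linearD /= pX1 pZ1.
by move=> x x0; rewrite mulmxDr mulmxDl mxE addr_gt0 ?pX2 ?pZ2.
Qed.

(** Moved back by [h], the cross-ratio is similar to [conj_mx Z' *m invmx Z'], so that the condition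
    says that [Z'] is purely imaginary. *)
Lemma tubeP h a b : Sp h -> (a :=: lag_of (0 : 'M[R]_n) *m h^T)%MS ->
  (b :=: lag_infty R n *m h^T)%MS ->
  tube a b = [set Z | exists2 Y, pos_def Y & Z = siegel_act h (imag Y)].
Proof.
move=> hS ea eb; have uhT : h^T \in unitmx by rewrite unitmx_tr Sp_unit.
have [U uU aU] := eqmx_frame (row_freeM (lag_of_free 0) uhT) ea.
have [V uV bV] := eqmx_frame (row_freeM lag_infty_free uhT) eb.
have key Z' : Siegel Z' -> let Z := siegel_act h Z' in
    cross_ratio (cplx_mx a) (lag_of Z) (conj_mx (lag_of Z)) (cplx_mx b) = - 1%:M <->
    conj_mx Z' = - Z'.
  move=> SZ' Z; have SZ : Siegel Z by exact: siegel_act_Siegel.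
  have u := nfac_unit hS SZ'; have [sZ _] := SZ.
  have uc : nfac h (conj_mx Z') \in unitmx by rewrite nfac_conj conj_unit.
  have cZ : conj_mx (lag_of Z) = lag_of (siegel_act h (conj_mx Z')).
    by rewrite conj_lag siegel_act_conj.
  have uZ' := Siegel_unit SZ'.
  have ca : cplx_mx a = cplx_mx U *m (lag_of 0 *m (cplx_mx h)^T).
    by rewrite aU !cplxM cplx_lag cplx0 cplxT.
  have cb : cplx_mx b = cplx_mx V *m (cplx_mx (lag_infty R n) *m (cplx_mx h)^T).
    by rewrite bV !cplxM cplxT.
  have p12 : pair (cplx_mx a) (lag_of Z) = cplx_mx U *m (- Z' *m invmx (nfac h Z')).
    by rewrite ca pairMl (pair_act _ hS u) pair_lag linear0 sub0r.
  have p13 : pair (cplx_mx a) (conj_mx (lag_of Z)) =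
      cplx_mx U *m (- conj_mx Z' *m invmx (nfac h (conj_mx Z'))).
    by rewrite ca cZ pairMl (pair_act _ hS uc) pair_lag linear0 sub0r.
  have p42 : pair (cplx_mx b) (lag_of Z) = cplx_mx V *m invmx (nfac h Z').
    by rewrite cb pairMl (pair_act _ hS u) pair_inf_lag mul1mx.
  have p43 : pair (cplx_mx b) (conj_mx (lag_of Z)) =
      cplx_mx V *m invmx (nfac h (conj_mx Z')).
    by rewrite cb cZ pairMl (pair_act _ hS uc) pair_inf_lag mul1mx.
  have cU : cplx_mx U \in unitmx by rewrite cplx_unit.
  have cV : cplx_mx V \in unitmx by rewrite cplx_unit.
  have uN : - Z' \in unitmx by rewrite -scaleN1r unitmxZ // unitrN1.
  have crE : cross_mx (cplx_mx a) (lag_of Z) (conj_mx (lag_of Z)) (cplx_mx b) =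
      cplx_mx U *m (- conj_mx Z' *m invmx (- Z')) *m invmx (cplx_mx U).
    by rewrite /cross_mx p12 p13 p42 p43; exact: (cross_frame _ cU cV uN u uc).
  have [|||| S [S' [rk SS' S'S ->]]] := @cross_ratioE R n (cplx_mx a) (lag_of Z) (conj_mx (lag_of Z)) (cplx_mx b).
  - exact: pair_lag0.
  - by rewrite conj_lag; apply: pair_lag0; rewrite -conjT sZ.
  - rewrite p12 unitmx_mul cU unitmx_mul uN; exact: (unitmx_invV u).
  - rewrite p43 unitmx_mul cV; exact: (unitmx_invV uc).
  rewrite crE (conj_eqN1 _ SS' S'S) (conj_eqN1 _ (mulVmx cU) (mulmxV cU)); split=> e.
    have := congr1 (mulmx^~ (- Z')) e; rewrite mulmxKV // mulNmx mul1mx.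
    by move=> /(congr1 -%R); rewrite !opprK.
  by rewrite e opprK -{1}[Z']opprK mulNmx mulmxV.
apply/seteqP; split=> Z /=.
  move=> [SZ]; have SZ' := siegel_act_Siegel (Sp_inv hS) SZ.
  set Z' := siegel_act (invmx h) Z in SZ'.
  have ZE : Z = siegel_act h Z' by rewrite /Z' siegel_actKV.
  rewrite {1 2}ZE => /(key _ SZ') cZ; exists (Im_mx Z'); first by case: SZ'.
  rewrite ZE; congr siegel_act; have n2 : (2%:R : C) != 0 by rewrite pnatr_eq0.
  apply: (scalerI n2); rewrite /imag Im_mx_conj cZ opprK.
  by rewrite -mulr2n scaler_nat.
move=> [Y pY ->]; have SY := Siegel_imag pY; split; first exact: siegel_act_Siegel.
by apply/(key _ SY); rewrite conj_imag.
Qed.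

(** Rescaling [b] by the inverse of its Gram matrix [G] with [a] makes [(G^-1 b, a)] a symplectic
    basis. *)
Lemma transverse_Sp (a b : 'M[R]_(n, n + n)) : Lagrangian a -> Lagrangian b ->
  transverse a b -> exists h, [/\ Sp h, (a :=: lag_of (0 : 'M[R]_n) *m h^T)%MS &
    (b :=: lag_infty R n *m h^T)%MS].
Proof.
move=> [fa la] [fb lb] tab; set J := sympl_form R n in la lb.
have uB : col_mx a b \in unitmx.
  rewrite -row_free_unit /row_free -addsmxE; apply/eqP.
  have := mxrank_sum_cap a b; rewrite tab mxrank0 addn0 => ->.
  by move: fa fb; rewrite /row_free => /eqP-> /eqP->.
have uJ : J \in unitmx.
  have : J *m (- J) = 1%:M by rewrite mulmxN sympl_form_sqr opprK.
  by case/mulmx1_unit.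
set G := b *m J *m a^T.
have Gt : a *m J *m b^T = - G^T.
  by rewrite /G !trmx_mul trmxK J_tr mulNmx mulmxN opprK mulmxA.
have uG : G \in unitmx.
  have : col_mx a b *m (J *m row_mx b^T a^T) \in unitmx.
    by rewrite !unitmx_mul uB uJ -tr_col_mx unitmx_tr -row_free_unit
      /row_free -addsmxE addsmxC addsmxE -/(row_free _) row_free_unit.
  rewrite mulmxA mul_col_mx mul_col_row lb la Gt unitmxE det_lblock unitrM.
  by rewrite -!unitmxE => /andP[].
pose h := (col_mx (invmx G *m b) a)^T.
have e1 : lag_of (0 : 'M[R]_n) *m h^T = a.
  by rewrite /h trmxK /lag_of mul_row_col linear0 mul0mx add0r mul1mx.
have e2 : lag_infty R n *m h^T = invmx G *m b.
  by rewrite /h trmxK /lag_infty mul_row_col mul1mx mul0mx addr0.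
exists h; split; last 2 first.
- by rewrite e1.
- by rewrite e2; apply/eqmxP; rewrite submxMl -{1}[b](mulKVmx uG) submxMl.
rewrite /Sp /= -/J /h trmxK mul_col_mx tr_col_mx mul_col_row trmx_mul.
rewrite la -!mulmxA [b *m _]mulmxA [b *m J *m _]mulmxA lb mul0mx mulmx0.
rewrite [b *m (J *m _)]mulmxA -/G mulVmx // [a *m _]mulmxA [a *m J *m _]mulmxA Gt.
by rewrite mulNmx trmx_inv mulmxV ?unitmx_tr.
Qed.

Definition siegel_cross X Z : 'M[C]_n :=
  (X - Z) *m invmx (conj_mx X - Z) *m (conj_mx X - conj_mx Z) *m
  invmx (X - conj_mx Z).

Lemma dF_char_poly X Z : Siegel X -> Siegel Z ->
  char_poly (cross_ratio (lag_of X) (lag_of (conj_mx Z)) (lag_of Z) (lag_of (conj_mx X)))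
  = char_poly (siegel_cross X Z).
Proof.
move=> SX SZ; have [sX _] := SX; have [sZ _] := SZ.
have u := SiegelB SX SZ.
have u' : conj_mx X - Z \in unitmx.
  by rewrite -[Z]conj_mxK -conjN -conjD conj_unit.
have sXc : (conj_mx X)^T = conj_mx X by rewrite -conjT sX.
have sZc : (conj_mx Z)^T = conj_mx Z by rewrite -conjT sZ.
have [|||| S [S' [rk SS' S'S ->]]] := @cross_ratioE R n (lag_of X) (lag_of (conj_mx Z)) (lag_of Z) (lag_of (conj_mx X)).
- exact: pair_lag0.
- exact: pair_lag0.
- by rewrite pair_lag sX.
- by rewrite pair_lag sXc.
rewrite (char_poly_sim _ rk SS') /cross_mx !pair_lag sX sXc; congr char_poly.
Qed.

Lemma dF_diag X Z (d : 'rV[R]_n) : Siegel X -> Siegel Z ->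
  char_poly (siegel_cross X Z) = char_poly (diag_mx (cplx_mx d)) ->
  dF X Z = 2^-1 * \sum_i ln ((1 + Num.sqrt (d 0 i)) / (1 - Num.sqrt (d 0 i))).
Proof.
move=> SX SZ e; rewrite /dF; congr (_ * _).
rewrite (spectrum_sum (d := cplx_mx d)); first by apply: eq_bigr => i _; rewrite mxE.
by rewrite dF_char_poly.
Qed.

Lemma dF_act g X Z : Sp g -> Siegel X -> Siegel Z ->
  dF (siegel_act g X) (siegel_act g Z) = dF X Z.
Proof.
move=> gS SX SZ; have SgX := siegel_act_Siegel gS SX; have SgZ := siegel_act_Siegel gS SZ.
rewrite /dF; congr (_ * _).
suff e : char_poly (siegel_cross (siegel_act g X) (siegel_act g Z)) =
    char_poly (siegel_cross X Z).
  by rewrite /spectrum (dF_char_poly SgX SgZ) e -(dF_char_poly SX SZ).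
have uX := nfac_unit gS SX; have uZ := nfac_unit gS SZ.
have [sX _] := SX; have [sgX _] := SgX.
have sXc : (conj_mx X)^T = conj_mx X by rewrite -conjT sX.
have sgXc : (siegel_act g (conj_mx X))^T = siegel_act g (conj_mx X).
  by rewrite siegel_act_conj -conjT sgX.
have ucX : nfac g (conj_mx X) \in unitmx by rewrite nfac_conj conj_unit.
have ucZ : nfac g (conj_mx Z) \in unitmx by rewrite nfac_conj conj_unit.
have e1 := siegel_act_sub uX uZ gS; rewrite sX sgX in e1.
have e2 := siegel_act_sub ucX uZ gS; rewrite sXc sgXc in e2.
have e3 := siegel_act_sub ucX ucZ gS; rewrite sXc sgXc in e3.
have e4 := siegel_act_sub uX ucZ gS; rewrite sX sgX in e4.
have u := SiegelB SX SZ.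
have u' : conj_mx X - Z \in unitmx by rewrite -[Z]conj_mxK -conjN -conjD conj_unit.
pose S := invmx (nfac g X)^T.
have uS : S \in unitmx := unitmx_invT uX.
have -> : siegel_cross (siegel_act g X) (siegel_act g Z) =
    S *m siegel_cross X Z *m invmx S.
  rewrite /siegel_cross -!siegel_act_conj e1 e2 e3 e4.
  exact: (cross4_conj _ _ uS (unitmx_invT ucX) (unitmx_invV uZ) (unitmx_invV ucZ) u' u).
by apply: char_poly_sim => //; rewrite mulVmx.
Qed.

(** On purely imaginary points the cross-ratio is the square of the Cayley transform
    [(Y1 - Y2) (Y1 + Y2)^-1], which [P] diagonalises with the eigenvalues [(1 - d) / (1 + d)]. *)
Lemma dF_imag (P : 'M[C]_n) (d : 'rV[R]_n) Y1 Y2 : pos_def Y1 -> pos_def Y2 ->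
  P \in unitmx -> P *m cplx_mx Y1 *m adjmx P = 1%:M ->
  P *m cplx_mx Y2 *m adjmx P = diag_mx (cplx_mx d) -> (forall i, 1 <= d 0 i) ->
  dF (imag Y1) (imag Y2) = 2^-1 * \sum_i ln (d 0 i).
Proof.
move=> p1 p2 uP e1 e2 d1; pose D := diag_mx (cplx_mx d).
have nz i : 1 + d 0 i != 0.
  by rewrite gt_eqF // (lt_le_trans ltr01) // lerDl (le_trans ler01).
pose D' := diag_mx (\row_i ((1 + d 0 i)^-1)%:C%C) : 'M[C]_n.
have D1 : (1%:M + D) *m D' = 1%:M.
  have -> : 1%:M + D = diag_mx (\row_i (1 + d 0 i)%:C%C).
    apply/matrixP => i k; rewrite !mxE; case: eqP => [->|_]; rewrite ?mulr1n ?mulr0n ?addr0 //.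
    by rewrite rmorphD rmorph1.
  rewrite mulmx_diag; apply/matrixP => i k; rewrite !mxE.
  case: eqP => [->|_]; rewrite ?mulr1n ?mulr0n //.
  by rewrite -rmorphM mulfV // rmorph1.
have [uD _] := mulmx1_unit D1.
have iD : invmx (1%:M + D) = D'.
  by apply: (can_inj (mulKmx uD)); rewrite mulmxV.
have uPa : adjmx P \in unitmx by rewrite adjmx_unit.
have [uS q1] := cayley_conj uP uPa e1 e2 uD.
rewrite (dF_diag (d := \row_i ((1 - d 0 i) / (1 + d 0 i)) ^+ 2)
  (Siegel_imag p1) (Siegel_imag p2)).
  by congr (_ * _); apply: eq_bigr => i _; rewrite mxE cayley_sqrt.
set A := cplx_mx Y1 in e1 uS q1 *; set B := cplx_mx Y2 in e2 uS q1 *.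
have -> : siegel_cross (imag Y1) (imag Y2) =
    ((A - B) *m invmx (A + B)) *m ((A - B) *m invmx (A + B)).
  rewrite /siegel_cross !conj_imag /imag -/A -/B.
  have -> : 'i%C *: A - 'i%C *: B = 'i%C *: (A - B) by rewrite scalerBr.
  have -> : - ('i%C *: A) - 'i%C *: B = (- 'i%C) *: (A + B).
    by rewrite scaleNr scalerDr opprD.
  have -> : - ('i%C *: A) - - ('i%C *: B) = (- 'i%C) *: (A - B).
    by rewrite scaleNr scalerBr opprB opprK addrC.
  have -> : 'i%C *: A - - ('i%C *: B) = 'i%C *: (A + B) by rewrite opprK scalerDr.
  have ii : ('i%C : C) != 0 by rewrite eq_complex /= eqxx oner_eq0.
  exact: scale_cross.
rewrite q1; set Q := (1%:M - D) *m _.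
have -> : invmx P *m Q *m P *m (invmx P *m Q *m P) = invmx P *m (Q *m Q) *m P.
  by rewrite !mulmxA (mulmxK uP).
rewrite (char_poly_sim _ erefl (mulmxV uP)).
congr char_poly; rewrite /Q iD.
have -> : 1%:M - D = diag_mx (\row_i (1 - d 0 i)%:C%C).
  apply/matrixP => i k; rewrite !mxE; case: eqP => [->|_]; rewrite ?mulr1n ?mulr0n ?subr0 //.
  by rewrite rmorphB rmorph1.
rewrite !mulmx_diag.
apply/matrixP => i k; rewrite !mxE; case: eqP => [->|_]; rewrite ?mulr1n ?mulr0n //.
by rewrite -!rmorphM.
Qed.

End TubesAndDistance.

(** * Comparison of the Finsler distance with determinants *)

Section HermitianCayley.
Variables (F : fieldType) (n : nat) (P P' b b' Y W : 'M[F]_n) (c : F).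
Hypotheses (uP : P \in unitmx) (uP' : P' \in unitmx).
Hypotheses (ub : b \in unitmx) (ub' : b' \in unitmx).
Hypothesis YE : Y = invmx P *m invmx P'.
Let K := invmx P' *m invmx b *m invmx P.
Let K' := invmx P' *m invmx b' *m invmx P.

Lemma cayley_left : 1%:M - c *: K = invmx P' *m invmx b *m (b - c *: Y) *m P'.
Proof.
rewrite mulmxBr mulmxBl (mulmxKV ub) mulVmx // -scalemxAr -scalemxAl YE.
by congr (_ - _ *: _); rewrite /K !mulmxA (mulmxKV uP').
Qed.

Lemma cayley_right : 1%:M + c *: K' = invmx P' *m invmx b' *m (b' + c *: Y) *m P'.
Proof.
rewrite mulmxDr mulmxDl (mulmxKV ub') mulVmx // -scalemxAr -scalemxAl YE.
by congr (_ + _ *: _); rewrite /K' !mulmxA (mulmxKV uP').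
Qed.

(** To be read with [P'], [b'], [K'] the adjoints of [P], [b], [K], with [Y] the imaginary part of
    [Z] and [c = 2i]: the two factors are then adjoint to each other, and the cross-ratio is similar
    to a Hermitian matrix [Q Q^*]. *)
Lemma cayley_cross :
  (b - c *: Y) *m invmx b' *m (b' + c *: Y) *m invmx b =
  (b *m P') *m ((1%:M - c *: K) *m (1%:M + c *: K')) *m invmx (b *m P').
Proof.
rewrite cayley_left cayley_right (invmxM ub uP'); move: (b - _) (b' + _) => a a'.
rewrite !mulmxA (mulmxK uP' b) (mulmxV ub) mul1mx (mulmxK uP' a).
by rewrite (mulmxK uP').
Qed.

(** The scalar [- c^2] is 4 for [c = 2i], and [W] is the imaginary part of [X]: [1 - Q Q^*] is
    congruent to a positive matrix. *)
Lemma cayley_sub1 : b' - b = - (c *: (W + Y)) ->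
  1%:M - (1%:M - c *: K) *m (1%:M + c *: K') =
  (- (c * c)) *: ((invmx P' *m invmx b) *m W *m (invmx b' *m invmx P)).
Proof.
move=> bb.
have e1 : K - K' = invmx P' *m invmx b *m (b' - b) *m (invmx b' *m invmx P).
  rewrite mulmxBr mulmxBl (mulmxKV ub) !mulmxA (mulmxK ub') //.
have e2 : K *m K' = invmx P' *m invmx b *m Y *m (invmx b' *m invmx P).
  by rewrite /K /K' YE !mulmxA.
rewrite mulmxDr mulmx1 mulmxBl mul1mx -!scalemxAr -scalemxAl scalerA.
have -> : 1%:M - (1%:M - c *: K + (c *: K' - (c * c) *: (K *m K'))) =
    c *: (K - K') + (c * c) *: (K *m K').
  by rewrite scalerBr !opprD !opprK !addrA subrr add0r.
rewrite e1 e2 bb mulmxN mulNmx -scalemxAr -scalemxAl scalerN scalerA -scaleNr.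
rewrite mulmxDr mulmxDl scalerDr -addrA -[X in _ + X = _]scalerDl.
by rewrite addNr scale0r addr0.
Qed.

End HermitianCayley.

Section DeterminantBound.
Variables (R : realType) (n : nat).
Local Notation C := R[i].

Lemma adjmxZ (m p : nat) (c : C) (A : 'M[C]_(m, p)) : adjmx (c *: A) = conjc c *: adjmx A.
Proof. by rewrite /adjmx conjZ linearZ. Qed.

Lemma det_adjmx (A : 'M[C]_n) : \det (adjmx A) = conjc (\det A).
Proof. by rewrite /adjmx det_tr /conj_mx det_map_mx. Qed.

Lemma det_cplx (A : 'M[R]_n) : \det (cplx_mx A) = (\det A)%:C%C.
Proof. by rewrite /cplx_mx det_map_mx. Qed.

Lemma mul_adjmx_diag (m : nat) (B : 'M[C]_(n, m)) i : 0 <= (B *m adjmx B) i i.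
Proof. by rewrite mxE sumr_ge0 // => k _; rewrite !mxE mulcJ_ge0. Qed.

Lemma quadratic_bound (x s : R) : 0 <= s ->
  (forall t, 0 <= 1 + 2 * t * x + t ^+ 2 * s ^+ 2) -> - x <= s.
Proof.
move=> s0 H; rewrite leNgt; apply/negP => sx.
have x0 : x < 0 by lra.
have := H (- x^-1); have -> : 1 + 2 * - x^-1 * x + (- x^-1) ^+ 2 * s ^+ 2 =
    (s ^+ 2 - x ^+ 2) / x ^+ 2 by field; rewrite lt_eqF.
rewrite leNgt => /negP; apply.
have x2 : 0 < x ^+ 2 by rewrite exprn_even_gt0 //= lt_eqF.
by rewrite ltr_pdivrMr // mul0r; nra.
Qed.

Lemma det_unitary_congr (U H : 'M[C]_n) : U *m adjmx U = 1%:M ->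
  \det (U *m H *m adjmx U) = \det H.
Proof.
move=> UU; rewrite det_mulmx [\det (U *m H)]det_mulmx mulrAC -det_mulmx UU.
by rewrite det1 mul1r.
Qed.

(** The trace is at most [n], so the inequality of arithmetic and geometric means bounds the product
    of the eigenvalues by 1. *)
Lemma det_le1 (B : 'M[C]_n) : (forall i, (B *m adjmx B) i i <= 1) ->
  exists2 r : R, \det (B *m adjmx B) = r%:C%C & r <= 1.
Proof.
move=> diag1; set H := B *m adjmx B.
have hH : adjmx H = H by rewrite /H adjmxM adjmxK.
have [U [e [UU dU]]] := hermitian_diag hH.
have e0 i : 0 <= e 0 i.
  have := mul_adjmx_diag (U *m B) i.
  rewrite adjmxM !mulmxA -[U *m B *m _]mulmxA -/H dU !mxE eqxx mulr1n.
  by rewrite lecE /= => /andP[].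
have detE : \det H = (\prod_i e 0 i)%:C%C.
  by rewrite -(det_unitary_congr H UU) dU det_diag rmorph_prod; apply: eq_bigr => i _; rewrite mxE.
exists (\prod_i e 0 i) => //.
have tr_e : \sum_i e 0 i <= n%:R.
  rewrite -lecR rmorph_sum /= rmorph_nat.
  have -> : \sum_i (e 0 i)%:C%C = \tr H.
    have : \tr (U *m H *m adjmx U) = \tr H.
      by rewrite mxtrace_mulC mulmxA (mulmx1C UU) mul1mx.
    move=> <-; rewrite dU mxtrace_diag; apply: eq_bigr => i _; by rewrite mxE.
  rewrite /mxtrace -[n in n%:R]card_ord -sumr_const; apply: ler_sum => i _; exact: diag1.
have := leif_AGM (A := predT) (E := fun i : 'I_n => e 0 i) (fun i _ => e0 i).
move=> /leif_le; rewrite card_ord => /le_trans; apply.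
rewrite exprn_ile1 ?divr_ge0 ?sumr_ge0 ?ler0n //.
case: (posnP n) => n0; last by rewrite ler_pdivrMr ?mul1r ?ltr0n.
by have -> : n%:R = 0 :> R; rewrite ?n0 // invr0 mulr0 ler01.
Qed.

(** The triangle inequality for rows of norms 1 and [s i]; the mixed term is bounded because the
    squared norm of [U_i + t V_i] is nonnegative for all real [t]. *)
Lemma unitary_row_bound (U V : 'M[C]_n) (d : 'rV[R]_n) (s : 'I_n -> R) i :
  U *m adjmx U = 1%:M -> V *m adjmx V = diag_mx (cplx_mx d) ->
  d 0 i = s i ^+ 2 -> 0 <= s i ->
  ((U - V) *m adjmx (U - V)) i i <= ((1 + s i) ^+ 2)%:C%C.
Proof.
move=> UU VV ds s0; pose z := (U *m adjmx V) i i.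
have zc : (V *m adjmx U) i i = conjc z.
  by rewrite /z -[V in LHS]adjmxK -adjmxM !mxE.
have form (t : R) : ((U + t%:C%C *: V) *m adjmx (U + t%:C%C *: V)) i i =
    (1 + 2 * t * complex.Re z + t ^+ 2 * s i ^+ 2)%:C%C.
  have -> : adjmx (U + t%:C%C *: V) = adjmx U + t%:C%C *: adjmx V.
    by rewrite adjmxD /adjmx conjZ conjc_real linearZ.
  rewrite mulmxDl !mulmxDr -!scalemxAl -!scalemxAr scalerA UU VV.
  rewrite [LHS]mxE [X in X + _]mxE [X in _ + X]mxE.
  rewrite [X in _ + X + _]mxE -/z [X in _ + (X + _)]mxE zc !mxE eqxx -ds.
  rewrite !mulr1n; case: z {zc} => [a b]; apply/eqP; rewrite eq_complex /=.
  by apply/andP; split; apply/eqP; ring.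
have bound : - complex.Re z <= s i.
  apply: quadratic_bound => // t.
  have := mul_adjmx_diag (U + t%:C%C *: V) i.
  by rewrite form lecE /= => /andP[].
have -> : U - V = U + (-1)%:C%C *: V by rewrite rmorphN1 scaleN1r.
by rewrite form lecR; nra.
Qed.

(* Hadamard's inequality for the rows of [U (1 - Q)], of norms at most
   [1 + sqrt (d 0 i)] *)
Lemma det_sub_le (Q U : 'M[C]_n) (d : 'rV[R]_n) : U *m adjmx U = 1%:M ->
  U *m (Q *m adjmx Q) *m adjmx U = diag_mx (cplx_mx d) -> (forall i, 0 <= d 0 i) ->
  exists2 r : R, \det ((1%:M - Q) *m adjmx (1%:M - Q)) = r%:C%C &
    r <= \prod_i (1 + Num.sqrt (d 0 i)) ^+ 2.
Proof.
move=> UU dQ d0; pose s i := Num.sqrt (d 0 i).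
have s0 i : 0 <= s i by exact: sqrtr_ge0.
have s1 i : 0 < 1 + s i by have := s0 i; lra.
have ds i : d 0 i = s i ^+ 2 by rewrite sqr_sqrtr.
pose T := U *m (1%:M - Q); pose V := U *m Q.
have TE : T = U - V by rewrite /T mulmxBr mulmx1.
have VV : V *m adjmx V = diag_mx (cplx_mx d) by rewrite -dQ /V adjmxM !mulmxA.
have Tii i : (T *m adjmx T) i i <= ((1 + s i) ^+ 2)%:C%C.
  by rewrite TE; exact: (unitary_row_bound UU VV).
(* Rescales the rows of [T] to norm at most 1. *)
pose D : 'M[C]_n := diag_mx (cplx_mx (\row_i (1 + s i)^-1)).
have aD : adjmx D = D.
  by rewrite /D -[diag_mx _](map_diag_mx (real_complex R)) adjmx_cplx tr_diag_mx.
have [|r re r1] := @det_le1 (D *m T).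
  move=> i; have -> : (D *m T) *m adjmx (D *m T) = D *m (T *m adjmx T) *m D.
    by rewrite adjmxM aD !mulmxA.
  have := Tii i; move: (T *m adjmx T) => W; rewrite /D.
  rewrite mul_mx_diag mul_diag_mx !mxE; set w := W i i => wle.
  have si := s1 i.
  rewrite mulrAC -rmorphM; set k := (1 + s i)^-1 / (1 + s i).
  have k0 : 0 <= k%:C%C :> C by rewrite (@lecR _ 0) mulr_ge0 ?invr_ge0 // ltW.
  apply: le_trans (ler_wpM2l k0 wle) _; rewrite -rmorphM /k expr2.
  by rewrite (_ : _ * _ = 1) ?rmorph1 //; field; rewrite gt_eqF.
exists (r * \prod_i (1 + s i) ^+ 2); last first.
  by rewrite ger_pMl // prodr_gt0 // => i _; rewrite exprn_gt0.
have dD : \det D = (\prod_i (1 + s i)^-1)%:C%C.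
  by rewrite det_diag rmorph_prod; apply: eq_bigr => i _; rewrite !mxE.
have e : \det ((1%:M - Q) *m adjmx (1%:M - Q)) = \det (T *m adjmx T).
  have -> : T *m adjmx T = U *m ((1%:M - Q) *m adjmx (1%:M - Q)) *m adjmx U.
    by rewrite /T adjmxM !mulmxA.
  by rewrite det_unitary_congr.
have P0 : \prod_i (1 + s i) != 0.
  by rewrite gt_eqF // prodr_gt0.
rewrite e; have -> : (r * \prod_i (1 + s i) ^+ 2)%:C%C = r%:C%C * (\prod_i (1 + s i) ^+ 2)%:C%C :> C.
  by rewrite -rmorphM.
rewrite -re.
have -> : (D *m T) *m adjmx (D *m T) = D *m (T *m adjmx T) *m D.
  by rewrite adjmxM aD !mulmxA.
move: (T *m adjmx T) => W; rewrite det_mulmx [\det (D *m W)]det_mulmx dD.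
set p := (\prod_i (1 + s i)^-1)%:C%C.
have pp : p * p * (\prod_i (1 + s i) ^+ 2)%:C%C = 1.
  rewrite /p -!rmorphM -[RHS](rmorph1 (real_complex R)) prodfV prodrXl /=.
  by congr (_ %:C%C); field.
by rewrite -[LHS]mulr1 -pp; ring.
Qed.

Lemma pos_def_det (Y : 'M[R]_n) : pos_def Y -> 0 < \det Y.
Proof.
move=> pY; have cY := cpd_of_pos_def pY; have [hY _] := cY.
have [U [d [UU dU]]] := hermitian_diag hY.
have uU : U \in unitmx by have [] := mulmx1_unit UU.
have d0 : forall i, 0 < d 0 i by apply: cpd_diag; rewrite -dU; exact: cpd_congr.
have -> : \det Y = \prod_i d 0 i.
  apply: complexI; rewrite -det_cplx.
  by rewrite -(det_unitary_congr _ UU) dU det_diag rmorph_prod; apply: eq_bigr => i _; rewrite mxE.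
by apply: prodr_gt0.
Qed.

Lemma sum_ln (f : 'I_n -> R) : (forall i, 0 < f i) ->
  \sum_i ln (f i) = ln (\prod_i f i).
Proof.
move=> f0; rewrite -[RHS](_ : ln (\prod_i expR (ln (f i))) = _).
  by rewrite -expR_sum expRK.
by congr ln; apply: eq_bigr => i _; rewrite lnK // posrE.
Qed.

Lemma cpdZ (c : R) (M : 'M[C]_n) : 0 < c -> cpd M -> cpd (c%:C%C *: M).
Proof.
move=> c0 [h1 h2]; split; first by rewrite adjmxZ conjc_real h1.
move=> x /h2 x0; rewrite -scalemxAr -scalemxAl mxE mulr_gt0 //.
by rewrite (@ltcR _ 0).
Qed.

(** Let [d] be the eigenvalues of [Q Q^*], hence of the cross-ratio. Determinants give [det (Im Z) /
    det (Im X) = r / prod (1 - d)] with [r] the squared modulus of [det (1 - Q)]. By Hadamard [r] is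
    at most [prod (1 + sqrt d)^2], and [(1 + sqrt d)^2 / (1 - d)] is exactly the [lambda] of the
    Finsler distance. *)
Lemma dF_ge (X Z : 'M[C]_n) : Siegel X -> Siegel Z ->
  2^-1 * ln (\det (Im_mx Z) / \det (Im_mx X)) <= dF X Z.
Proof.
move=> SX SZ; have [sX pX] := SX; have [sZ pZ] := SZ.
have cX := cpd_of_pos_def pX; have cZ := cpd_of_pos_def pZ.
set YX := Im_mx X in pX cX *; set Y := Im_mx Z in pZ cZ *.
have [P [_ [uP P1 _]]] := cpd_simultaneous cZ (adjmx1 R n).
set a := X - Z; set b := X - conj_mx Z.
have ub : b \in unitmx := SiegelB SX SZ.
have adjE (M : 'M[C]_n) : M^T = M -> adjmx M = conj_mx M by move=> sM; rewrite /adjmx -conjT sM.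
have sb : b^T = b by rewrite linearB /= sX -conjT sZ.
have ab : adjmx b = conj_mx b := adjE _ sb.
have cb : conj_mx b = conj_mx X - Z by rewrite conjD conjN conj_mxK.
have ba : b - a = (2%:R * 'i%C) *: cplx_mx Y.
  by rewrite /b /a opprB addrC addrA subrK -Im_mx_conj scalerA.
have bdiff : adjmx b - b = - ((2%:R * 'i%C) *: (cplx_mx YX + cplx_mx Y)).
  rewrite ab scalerDr -!scalerA !Im_mx_conj /b conjD conjN conj_mxK.
  rewrite [- (X - conj_mx Z)]opprB [RHS]opprD !opprB addrACA [RHS]addrACA; congr (_ + _); exact: addrC.
have cross0 : siegel_cross X Z = a *m invmx (adjmx b) *m adjmx a *m invmx b.
  have sa : a^T = a by rewrite /a linearB /= sX sZ.
  by rewrite /siegel_cross ab cb (adjE _ sa) /a conjD conjN.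
clearbody a b.
have uPa : adjmx P \in unitmx by rewrite adjmx_unit.
have uiP : invmx P \in unitmx by rewrite unitmx_inv.
have uiPa : invmx (adjmx P) \in unitmx by rewrite unitmx_inv.
have uba : adjmx b \in unitmx by rewrite adjmx_unit.
pose K := invmx (adjmx P) *m invmx b *m invmx P.
have uK : K \in unitmx by rewrite !unitmx_mul uiPa uiP unitmx_inv ub.
have aK : adjmx K = invmx (adjmx P) *m invmx (adjmx b) *m invmx P.
  by rewrite /K !adjmxM !adjmxV adjmxK mulmxA.
pose Q := 1%:M - (2%:R * 'i%C) *: K.
have Yc : cplx_mx Y = invmx P *m invmx (adjmx P).
  by rewrite -[LHS](mulKmx uP) -[P *m _](mulmxK uPa) P1 mul1mx.
have i2 : (2%:R * 'i%C : C) != 0.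
  by rewrite mulf_neq0 ?pnatr_eq0 // eq_complex /= eqxx oner_eq0.
have aE : a = b - (2%:R * 'i%C) *: cplx_mx Y by rewrite -ba opprB addrC subrK.
have conj2i : conjc (2%:R * 'i%C : C) = - (2%:R * 'i%C).
  by rewrite rmorphM rmorph_nat /= -mulrN; congr (_ * _); apply/eqP; rewrite eq_complex /= oppr0 !eqxx.
have aQ : adjmx Q = 1%:M + (2%:R * 'i%C) *: adjmx K.
  by rewrite /Q adjmxD adjmx1 adjmxN adjmxZ conj2i scaleNr opprK.
have aaE : adjmx a = adjmx b + (2%:R * 'i%C) *: cplx_mx Y.
  rewrite aE adjmxD adjmxN adjmxZ conj2i scaleNr opprK adjmx_cplx.
  by case: pZ => -> _.
have crossE : siegel_cross X Z = (b *m adjmx P) *m (Q *m adjmx Q) *m invmx (b *m adjmx P).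
  have := @cayley_cross _ _ P _ _ _ _ (2%:R * 'i%C) uPa ub uba Yc.
  by rewrite cross0 aQ aK aaE aE => ->.
(* Used twice: its positivity gives [d < 1], and its determinant brings in [det (Im X)]. *)
have QQ1 : 1%:M - Q *m adjmx Q =
    4%:R%:C%C *: (K *m P *m cplx_mx YX *m adjmx (K *m P)).
  have cc : - ((2%:R * 'i%C) * (2%:R * 'i%C)) = 4%:R%:C%C :> C.
    by rewrite mulrACA -expr2 -expr2 sqr_i mulrN1 opprK -natrX rmorph_nat.
  have kp : K *m P = invmx (adjmx P) *m invmx b by rewrite /K (mulmxKV uP).
  have kpa : adjmx (K *m P) = invmx (adjmx b) *m invmx P.
    by rewrite kp adjmxM !adjmxV adjmxK.
  by rewrite aQ aK kpa kp -cc; exact: (cayley_sub1 ub uba Yc bdiff).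
have e3 : 1%:M - Q = (2%:R * 'i%C) *: K by rewrite /Q opprB addrC subrK.
clearbody Q K.
have hQ : adjmx (Q *m adjmx Q) = Q *m adjmx Q by rewrite adjmxM adjmxK.
have [U [d [UU dU]]] := hermitian_diag hQ.
have d0 i : 0 <= d 0 i.
  have := mul_adjmx_diag (U *m Q) i.
  rewrite adjmxM !mulmxA -[U *m Q *m _]mulmxA dU !mxE eqxx mulr1n.
  by rewrite lecE /= => /andP[].
have [r rE r_le] := det_sub_le UU dU d0.
have uU : U \in unitmx by have [] := mulmx1_unit UU.
have iU : invmx U = adjmx U by apply: (can_inj (mulKmx uU)); rewrite mulmxV.
have dd1 : diag_mx (cplx_mx (\row_i (1 - d 0 i))) = U *m (1%:M - Q *m adjmx Q) *m adjmx U.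
  rewrite mulmxBr mulmxBl mulmx1 UU dU; apply/matrixP => i k; rewrite !mxE.
  by case: eqP => [->|_]; rewrite ?mulr1n ?mulr0n ?subr0 // rmorphB rmorph1.
have detPY : \det P * conjc (\det P) * (\det Y)%:C%C = 1.
  by rewrite -det_adjmx -det_cplx mulrAC -!det_mulmx P1 det1.
have det1Q : (\prod_i (1 - d 0 i))%:C%C =
    4%:R ^+ n * (\det K * conjc (\det K)) * (\det P * conjc (\det P)) * (\det YX)%:C%C.
  have -> : (\prod_i (1 - d 0 i))%:C%C = \det (diag_mx (cplx_mx (\row_i (1 - d 0 i)))) :> C.
    by rewrite det_diag rmorph_prod; apply: eq_bigr => i _; rewrite !mxE.
  rewrite dd1 (det_unitary_congr _ UU) QQ1 detZ rmorph_nat !det_mulmx det_adjmx det_mulmx.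
  by rewrite rmorphM det_cplx; ring.
have rE' : r%:C%C = 4%:R ^+ n * (\det K * conjc (\det K)) :> C.
  rewrite -rE e3 adjmxZ conj2i -scalemxAl -scalemxAr scalerA detZ det_mulmx det_adjmx.
  congr (_ ^+ _ * _).
  by rewrite mulrN mulrACA -expr2 -expr2 sqr_i mulrN1 opprK -natrX.
have dY := pos_def_det pZ; have dYX := pos_def_det pX.
have ratio : r * \det YX = \prod_i (1 - d 0 i) * \det Y.
  apply: complexI; transitivity (r%:C%C * (\det YX)%:C%C : C); first exact: rmorphM.
  transitivity ((\prod_i (1 - d 0 i))%:C%C * (\det Y)%:C%C : C); last by rewrite -rmorphM.
  by rewrite det1Q rE' -[LHS]mulr1 -detPY; ring.
have posd i : 0 < 1 - d 0 i.
  have kp : K *m P \in unitmx by rewrite unitmx_mul uK.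
  have c4 : cpd (diag_mx (cplx_mx (\row_i (1 - d 0 i)))).
    rewrite dd1 QQ1; apply: (cpd_congr uU).
    exact: (cpdZ (ltr0Sn R 3) (cpd_congr kp cX)).
  by have := cpd_diag c4 i; rewrite mxE.
have s1 i : Num.sqrt (d 0 i) < 1.
  by rewrite -(@ltr_pXn2r _ 2) ?nnegrE ?sqrtr_ge0 // sqr_sqrtr // expr1n; have := posd i; lra.
rewrite (dF_diag (d := d) SX SZ); last first.
  have ubp : b *m adjmx P \in unitmx by rewrite unitmx_mul ub.
  rewrite crossE (char_poly_sim _ erefl (mulVmx ubp)).
  have -> : Q *m adjmx Q = adjmx U *m diag_mx (cplx_mx d) *m U.
    rewrite -dU !mulmxA -iU mulVmx // mul1mx -[RHS]mulmxA mulVmx // mulmx1 //.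
  by apply: char_poly_sim.
rewrite ler_pM2l ?invr_gt0 ?ltr0n // sum_ln; last first.
  by move=> i; rewrite divr_gt0 ?subr_gt0 //; have := sqrtr_ge0 (d 0 i); lra.
have Pd : 0 < \prod_i (1 - d 0 i) by apply: prodr_gt0.
have -> : \prod_i ((1 + Num.sqrt (d 0 i)) / (1 - Num.sqrt (d 0 i))) =
    (\prod_i (1 + Num.sqrt (d 0 i)) ^+ 2) / \prod_i (1 - d 0 i).
  rewrite -prodf_div; apply: eq_bigr => i _.
  have ds : d 0 i = Num.sqrt (d 0 i) ^+ 2 by rewrite sqr_sqrtr.
  rewrite [X in _ = _ / (1 - X)]ds; have := s1 i; have := sqrtr_ge0 (d 0 i).
  set s := Num.sqrt _ => s0 sl; field; rewrite -/s.
  by rewrite !gt_eqF //; nra.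
have ratio' : \det Y / \det YX = r / \prod_i (1 - d 0 i).
  have nz1 : \prod_i (1 - d 0 i) != 0 by rewrite gt_eqF.
  have nz2 : \det YX != 0 by rewrite gt_eqF.
  by apply: (mulIf nz2); rewrite mulfVK // mulrAC ratio mulrAC mulfV // mul1r.
rewrite ratio' ler_ln ?posrE.
- by rewrite ler_pM2r ?invr_gt0.
- by rewrite -ratio' divr_gt0.
- rewrite divr_gt0 // prodr_gt0 // => i _; rewrite exprn_gt0 //.
Qed.

End DeterminantBound.

(** * Orthogonal tubes *)

Section Reflections.
Variables (R : realType) (n : nat).
Local Notation C := R[i].

(** The Sherman-Morrison formula applied to the row [w]; invertibility of both matrices forces the
    denominator to be nonzero. *)
Lemma rank_one_inverse (F : fieldType) (N K : 'M[F]_n) (w : 'rV[F]_n) (t : F) :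
  let N' := N + t *: (K *m (w^T *m w)) in let k := (w *m invmx N *m K *m w^T) 0 0 in
  N \in unitmx -> N' \in unitmx ->
  1 + t * k != 0 /\ w *m invmx N' = (1 + t * k)^-1 *: (w *m invmx N).
Proof.
move=> N' k uN uN'; pose v := w *m invmx N'; pose b := (v *m K *m w^T) 0 0.
have vN' : v *m N' = w by rewrite mulmxKV.
have vE : v = (1 - t * b) *: (w *m invmx N).
  apply: (can_inj (mulmxK uN)); rewrite -scalemxAl mulmxKV // scalerBl scale1r.
  have e : v *m K *m w^T = b%:M by exact: mx11_scalar.
  by rewrite -[X in X - _]vN' mulmxDr -scalemxAr !mulmxA e mul_scalar_mx scalerA addrK.
have bE : b = (1 - t * b) * k.
  by rewrite {1}/b vE -!scalemxAl mxE.
have e : (1 - t * b) * (1 + t * k) = 1.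
  by rewrite mulrDr mulr1 mulrCA -bE subrK.
have nz : 1 + t * k != 0.
  by apply/eqP => z; move: e; rewrite z mulr0 => /eqP; rewrite eq_sym oner_eq0.
split=> //; rewrite -/v vE; congr (_ *: _).
by apply: (mulIf nz); rewrite e mulVf.
Qed.

Lemma is_derive_of_slope (f g : R -> R) (l : R) :
  (\forall t \near (0 : R), f t = f 0 + t * g t) -> {for 0, continuous g} -> g 0 = l ->
  is_derive (0 : R) (1 : R) f l.
Proof.
move=> fg cg <-.
have c : (fun t : R => t^-1 *: (f (t *: 1 + 0) - f 0)) @ 0^' --> g 0.
  apply: cvg_trans (cvg_within_filter _ cg); apply: near_eq_cvg; near=> t.
  have t0 : t != 0 by near: t; exact: nbhs_dnbhs_neq.
  have e : f t = f 0 + t * g t by near: t; exact: cvg_within fg.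
  rewrite addr0 [t *: 1]mulr1 e addrC addKr.
  by rewrite -[RHS]/(t^-1 * (t * g t)) mulKf.
by apply: DeriveDef; [apply/cvg_ex; exists (g 0)|apply: cvg_lim].
Unshelve. all: by end_near.
Qed.

(** Multiplying by the conjugate of the denominator leaves the real denominator [d t], the squared
    modulus of [1 + i t k], equal to 1 at 0. *)
Lemma complex_slope (k : C) (a : C) (c : R -> C) :
  (\forall t \near (0 : R), 1 + ('i%C * t%:C%C) * k != 0 /\
     c t = c 0 + 'i%C * t%:C%C / (1 + ('i%C * t%:C%C) * k) * a) ->
  is_derive (0 : R) (1 : R) (fun t : R => complex.Re (c t) : R) (complex.Re ('i%C * a)) /\
  is_derive (0 : R) (1 : R) (fun t : R => complex.Im (c t) : R) (complex.Im ('i%C * a)).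
Proof.
case: k a => [p q] [a b] H.
pose d (t : R) := (1 - t * q) ^+ 2 + (t * p) ^+ 2.
have cont (u v : R) : {for (0 : R), continuous (fun t : R => (u + t * v) / d t)}.
  have caff (x y : R) : {for (0 : R), continuous (fun t : R => x + t * y)}.
    by apply: cvgD; [exact: cvg_cst|apply: cvgMl; exact: cvg_id].
  have -> : d = fun t => (1 + t * - q) * (1 + t * - q) + (0 + t * p) * (0 + t * p).
    by apply/funext => t; rewrite /d; ring.
  apply: cvgM; first exact: caff.
  apply: cvgV; first by rewrite !mul0r !addr0 !mulr0 addr0 mulr1 oner_eq0.
  by apply: cvgD; apply: cvgM; exact: caff.
have d0 : d 0 = 1 by rewrite /d !mul0r subr0 expr1n expr0n addr0.
have frac t : 1 + ('i%C * t%:C%C) * (p +i* q)%C != 0 -> d t != 0 /\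
    'i%C * t%:C%C / (1 + ('i%C * t%:C%C) * (p +i* q)%C) * (a +i* b)%C =
    ((t * ((- b + t * (p * a + q * b)) / d t)) +i* (t * ((a + t * (p * b - q * a)) / d t)))%C.
  have -> : 1 + ('i%C * t%:C%C) * (p +i* q)%C = ((1 - t * q) +i* (t * p))%C.
    by apply/eqP; rewrite eq_complex /=; apply/andP; split; apply/eqP; ring.
  move=> nz; have dt : d t != 0.
    apply: contra nz; rewrite /d paddr_eq0 ?sqr_ge0 // !sqrf_eq0 eq_complex /=.
    by [].
  split=> //; apply: (mulIf nz); rewrite mulrAC divfK //.
  apply/eqP; rewrite eq_complex /=.
  have dd : (1 - t * q) ^+ 2 + (t * p) ^+ 2 = d t by [].
  apply/andP; split; apply/eqP; rewrite -dd; field; exact: dt.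
split.
- apply: (@is_derive_of_slope _ (fun t => (- b + t * (p * a + q * b)) / d t)).
  + apply: filterS H => t [/frac[_ e] ->]; rewrite e; by case: (c 0).
  + exact: cont.
  + by rewrite d0 divr1 /=; ring.
- apply: (@is_derive_of_slope _ (fun t => (a + t * (p * b - q * a)) / d t)).
  + apply: filterS H => t [/frac[_ e] ->]; rewrite e; by case: (c 0).
  + exact: cont.
  + by rewrite d0 divr1 /=; ring.
Qed.

(** With [v = w Y^-1], the Cauchy-Schwarz inequality for [Y] bounds the perturbation at [x] by
    [|t| B v v] times [B x x]. *)
Lemma pos_def_rank_one (Y : 'M[R]_n) (w : 'rV[R]_n) : pos_def Y ->
  \forall t \near (0 : R), pos_def (Y + t *: (w^T *m w)).
Proof.
move=> pY; have [sY pos] := pY.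
have uY : Y \in unitmx by rewrite -cplx_unit cpd_unit //; exact: cpd_of_pos_def.
pose v := w *m invmx Y; pose B (x y : 'rV[R]_n) := (x *m Y *m y^T) 0 0.
have BC x y : B x y = B y x.
  rewrite /B -[x *m Y *m y^T]trmxK [LHS]mxE; congr (_ 0 0).
  by rewrite !trmx_mul trmxK sY mulmxA.
have BD x y z : B (x + y) z = B x z + B y z by rewrite /B !mulmxDl mxE.
have BZ c x y : B (c *: x) y = c * B x y by rewrite /B -!scalemxAl mxE.
have B0 x : 0 <= B x x.
  have [->|/pos/ltW//] := eqVneq x 0; by rewrite /B mul0mx mul0mx mxE.
have wE x : (x *m w^T) 0 0 = B x v.
  by rewrite /B /v trmx_mul trmx_inv sY mulmxA mulmxK.
have cs x : B x v ^+ 2 <= B x x * B v v.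
  have [s0|s0] := eqVneq (B v v) 0.
    have -> : v = 0 by apply/eqP; apply: contraT => /pos; rewrite -/(B v v) s0 ltxx.
    by have B0z z : B 0 z = 0 by [rewrite /B !mul0mx mxE]; rewrite BC !B0z mulr0 expr0n.
  have sp : 0 < B v v by rewrite lt_def s0 B0.
  have := B0 (B v v *: x + (- B x v) *: v).
  rewrite !(BD, BZ) ![B _ (_ + _)]BC !(BD, BZ) (BC v x) => H.
  by rewrite -(ler_pM2l sp); nra.
have near0 : \forall t \near (0 : R), `|t| * B v v < 1.
  have c : (fun t : R => `|t| * B v v) @ (0 : R) --> `|0 : R| * B v v.
    by apply: cvgMl; exact: (cvg_norm cvg_id).
  by apply: (cvgr_lt _ c); rewrite normr0 mul0r ltr01.
apply: filterS near0 => t t1; split.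
  by rewrite linearD /= linearZ /= trmx_mul trmxK sY.
move=> x x0; have q0 : 0 < B x x := pos x x0.
have -> : (x *m (Y + t *: (w^T *m w)) *m x^T) 0 0 = B x x + t * B x v ^+ 2.
  rewrite mulmxDr mulmxDl mxE -/(B x x) -scalemxAr -scalemxAl; congr (_ + _).
  have sE : x *m w^T = (B x v)%:M by rewrite -wE; exact: mx11_scalar.
  rewrite mxE mulmxA sE -mulmxA -[w *m x^T]trmxK trmx_mul trmxK sE tr_scalar_mx.
  by rewrite -scalar_mxM mxE mulr1n expr2.
have := cs x; have := sqr_ge0 (B x v); have := B0 v; have := ler_norm (- t).
rewrite normrN; move: (B x v ^+ 2) (B x x) (B v v) q0 t1 => b q s q0 t1 ta s0 b0 bqs.
have h1 : - t * b <= `|t| * b by apply: ler_wpM2r.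
have h2 : `|t| * b <= `|t| * (q * s) by apply: ler_wpM2l.
have h3 : `|t| * s * q < 1 * q by rewrite ltr_pM2r.
lra.
Qed.

Lemma siegel_act_diff (g : 'M[R]_(n + n)) (X Z : 'M[C]_n) :
  Sp g -> Siegel X -> Siegel Z ->
  siegel_act g X - siegel_act g Z =
  invmx (nfac g X)^T *m (X - Z) *m invmx (nfac g Z).
Proof.
move=> gS SX SZ; have := siegel_act_sub (nfac_unit gS SX) (nfac_unit gS SZ) gS.
by have [-> _] := siegel_act_Siegel gS SX; have [-> _] := SX.
Qed.

Lemma rank_one_step (F : fieldType) (A A0 N N' : 'M[F]_n) (w : 'rV[F]_n) (c k : F) :
  let u := w *m invmx N in
  A - A0 = invmx N'^T *m (c *: (w^T *m w)) *m invmx N ->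
  w *m invmx N' = (1 + c * k)^-1 *: u ->
  A = A0 + (c / (1 + c * k)) *: (u^T *m u).
Proof.
move=> u e ue; rewrite -[LHS](subrK A0) addrC e; congr (_ + _).
rewrite -scalemxAr -scalemxAl !mulmxA.
have -> : invmx N'^T *m w^T = (w *m invmx N')^T by rewrite trmx_mul trmx_inv.
by rewrite ue linearZ /= -!scalemxAl -mulmxA scalerA.
Qed.

(** Along [Y + t w^T w] the automorphy factor changes by a matrix of rank one, so the curve is an
    explicit rational one. These tangent vectors suffice to exploit orthogonality. *)
Lemma tangent_rank_one (h : 'M[R]_(n + n)) (Y : 'M[R]_n) (w : 'rV[R]_n) :
  Sp h -> pos_def Y ->
  let u := cplx_mx w *m invmx (nfac h (imag Y)) in
  tangent [set Z | exists2 Y', pos_def Y' & Z = siegel_act h (imag Y')]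
    (siegel_act h (imag Y)) ('i%C *: (u^T *m u)).
Proof.
move=> hS pY u; pose Yt t := Y + t *: (w^T *m w).
have near_pos := pos_def_rank_one w pY.
exists (fun t => siegel_act h (imag (Yt t))); split.
- by rewrite /Yt scale0r addr0.
- by apply: filterS near_pos => t pt; exists (Yt t).
pose K := dlsubmx (cplx_mx h); pose wc := cplx_mx w.
pose k := (u *m K *m wc^T) 0 0.
have uN : nfac h (imag Y) \in unitmx := nfac_unit hS (Siegel_imag pY).
suff main t : pos_def (Yt t) -> 1 + ('i%C * t%:C%C) * k != 0 /\
    siegel_act h (imag (Yt t)) = siegel_act h (imag Y) +
      ('i%C * t%:C%C / (1 + ('i%C * t%:C%C) * k)) *: (u^T *m u).
  move=> i l; rewrite [('i%C *: (u^T *m u)) i l]mxE; apply: (@complex_slope k).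
  apply: filterS near_pos => t /main[nz e]; split=> //; rewrite e /Yt scale0r addr0.
  by rewrite mxE [X in _ + X]mxE.
move=> pt; have uNt : nfac h (imag (Yt t)) \in unitmx := nfac_unit hS (Siegel_imag pt).
have imE : imag (Yt t) = imag Y + ('i%C * t%:C%C) *: (wc^T *m wc).
  by rewrite /imag /Yt cplxD cplxZ cplxM cplxT scalerDr scalerA.
have NE : nfac h (imag (Yt t)) = nfac h (imag Y) + ('i%C * t%:C%C) *: (K *m (wc^T *m wc)).
  rewrite imE /nfac mulmxDr addrAC; congr (_ + _).
  by rewrite [RHS]scalemxAr.
have [nz ue] := @rank_one_inverse _ (nfac h (imag Y)) K wc ('i%C * t%:C%C) uN
  (eq_ind _ (fun M => M \in unitmx) uNt _ NE).
split; first exact: nz.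
apply: (rank_one_step _ ue).
rewrite (siegel_act_diff hS (Siegel_imag pt) (Siegel_imag pY)) -NE.
by congr (_ *m _ *m _); rewrite imE [LHS]addrC addKr.
Qed.

Lemma metric_rank_one (X : 'M[C]_n) (u u' : 'rV[C]_n) : Siegel X ->
  siegel_metric X ('i%C *: (u^T *m u)) ('i%C *: (u'^T *m u')) =
  complex.Re (((u *m cplx_mx (invmx (Im_mx X)) *m adjmx u') 0 0) ^+ 2).
Proof.
move=> [_ [sY _]]; rewrite /siegel_metric; congr (complex.Re _).
set Yi := cplx_mx _; have sYi : Yi^T = Yi by rewrite /Yi -cplxT trmx_inv sY.
have ii : conjc 'i%C * 'i%C = 1 :> C.
  by apply/eqP; rewrite eq_complex /=; apply/andP; split; apply/eqP; ring.
set s := (u *m Yi *m adjmx u') 0 0.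
have sE : u *m Yi *m adjmx u' = s%:M by exact: mx11_scalar.
rewrite conjZ conjM conjT -!scalemxAr -!scalemxAl scalerA mxtraceZ ii mul1r.
rewrite -[(conj_mx u')^T]/(adjmx u').
rewrite !mulmxA -(mulmxA _ u Yi) -(mulmxA _ (u *m Yi)) sE.
rewrite mul_mx_scalar -scalemxAl mxtraceZ expr2; congr (_ * _).
rewrite mxtrace_mulC mulmxA -mxtrace_tr !trmx_mul trmxK sYi mulmxA -/(adjmx u') sE.
by rewrite mxtrace_scalar.
Qed.

Lemma complexmx_inj (m p : nat) (A B A' B' : 'M[R]_(m, p)) :
  cplx_mx A + 'i%C *: cplx_mx B = cplx_mx A' + 'i%C *: cplx_mx B' -> A = A' /\ B = B'.
Proof.
move=> e; split; apply/matrixP => i j; have /matrixP/(_ i j) := e; rewrite !mxE => /eqP;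
  rewrite eq_complex /= => /andP[/eqP e1 /eqP e2]; lra.
Qed.

(** For fixed [x] the linear forms [x (A - B) y^T] and [x (A + B) y^T] have zero product, so one of
    them vanishes: a vector space is not the union of two proper subspaces. The same argument in [x]
    concludes. *)
Lemma bilinear_sqr_eq (A B : 'M[R]_n) :
  (forall x y : 'rV[R]_n, ((x *m A *m y^T) 0 0) ^+ 2 = ((x *m B *m y^T) 0 0) ^+ 2) ->
  A = B \/ A = - B.
Proof.
move=> H.
have rowP (x : 'rV[R]_n) : x *m (A - B) = 0 \/ x *m (A + B) = 0.
  have [|n1] := eqVneq (x *m (A - B)) 0; [by left|right].
  apply/eqP; apply: contraT => n2; exfalso.
  have nz (z : 'rV[R]_n) : z != 0 -> exists y : 'rV[R]_n, (z *m y^T) 0 0 != 0.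
    move=> z0; have [i zi] : exists i, z 0 i != 0 by apply/rV0Pn.
    by exists (delta_mx 0 i); rewrite trmx_delta -colE mxE.
  have [y1 h1] := nz _ n1; have [y2 h2] := nz _ n2.
  have prod0 (y : 'rV[R]_n) : ((x *m (A - B)) *m y^T) 0 0 * ((x *m (A + B)) *m y^T) 0 0 = 0.
    have := H x y; rewrite mulmxBr mulmxDr mulmxBl mulmxDl !mxE => /eqP.
    by rewrite -subr_eq0 subr_sqr => /eqP.
  have z1 : ((x *m (A + B)) *m y1^T) 0 0 = 0.
    by apply/eqP; have /eqP := prod0 y1; rewrite mulf_eq0 (negPf h1).
  have z2 : ((x *m (A - B)) *m y2^T) 0 0 = 0.
    by apply/eqP; have /eqP := prod0 y2; rewrite mulf_eq0 (negPf h2) orbF.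
  have := prod0 (y1 + y2); have -> : (y1 + y2)^T = y1^T + y2^T by rewrite linearD.
  move: z1 z2 h1 h2; move: (x *m (A - B)) (x *m (A + B)) => a b z1 z2 h1 h2.
  rewrite !mulmxDr mxE [X in _ * X]mxE z1 z2.
  by rewrite addr0 add0r => /eqP; rewrite mulf_eq0 (negPf h1) (negPf h2).
have [|nA] := eqVneq (A - B) 0; first by move=> /subr0_eq; left.
have [|nB] := eqVneq (A + B) 0; first by move=> /addr0_eq ?; right; apply/eqP; rewrite -eqr_oppLR; apply/eqP.
have nz (M : 'M[R]_n) : M != 0 -> exists x : 'rV[R]_n, x *m M != 0.
  move=> /matrix0Pn[i [k ik]]; exists (delta_mx 0 i); rewrite -rowE.
  by apply/matrix0Pn; exists 0, k; rewrite mxE.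
have [x1 h1] := nz _ nA; have [x2 h2] := nz _ nB.
have z1 : x1 *m (A + B) = 0 by case: (rowP x1) => // e; rewrite e eqxx in h1.
have z2 : x2 *m (A - B) = 0 by case: (rowP x2) => // e; rewrite e eqxx in h2.
exfalso; case: (rowP (x1 + x2)); rewrite mulmxDl ?z1 ?z2 ?addr0 ?add0r => e.
  by rewrite e eqxx in h1.
by rewrite e eqxx in h2.
Qed.

Definition axis_refl : 'M[R]_(n + n) := block_mx 1%:M 0 0 (- 1%:M).
Lemma axis_refl_tr : axis_refl^T = axis_refl.
Proof. by rewrite /axis_refl tr_block_mx !trmx0 linearN /= trmx1. Qed.

(** Acts by [Z |-> Y Z^-1 Y]; its eigen-Lagrangians are [Y] and [-Y]. *)
Definition imag_refl (Y : 'M[R]_n) : 'M[R]_(n + n) := block_mx 0 Y (invmx Y) 0.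

(* If [N1^-1 N = (1 - i e) M] with [M] real, the frames [(i Y, 1) h^T] and
   [(i Y1, 1) h1^T] of the common point differ by [(1 - i e) M^T]; real and
   imaginary parts give [h1^-1 h]. *)
Lemma orthogonal_reflection (h h1 : 'M[R]_(n + n)) (Y Y1 : 'M[R]_n) :
  Sp h -> Sp h1 -> pos_def Y -> pos_def Y1 ->
  siegel_act h (imag Y) = siegel_act h1 (imag Y1) ->
  (forall U V,
    tangent [set Z | exists2 Y', pos_def Y' & Z = siegel_act h (imag Y')]
      (siegel_act h (imag Y)) U ->
    tangent [set Z | exists2 Y', pos_def Y' & Z = siegel_act h1 (imag Y')]
      (siegel_act h (imag Y)) V -> siegel_metric (siegel_act h (imag Y)) U V = 0) ->
  exists2 e : R, e * e = 1 &
    h1 *m axis_refl *m invmx h1 = e *: (h *m imag_refl Y *m invmx h).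
Proof.
move=> hS h1S pY pY1 eX orth; set X := siegel_act h (imag Y) in eX orth.
pose N := nfac h (imag Y); pose N1 := nfac h1 (imag Y1).
have SX : Siegel X := siegel_act_Siegel hS (Siegel_imag pY).
have uN : N \in unitmx := nfac_unit hS (Siegel_imag pY).
have uN1 : N1 \in unitmx := nfac_unit h1S (Siegel_imag pY1).
have [sY _] := pY.
have uY : Y \in unitmx by rewrite -cplx_unit cpd_unit //; exact: cpd_of_pos_def.
pose Q := invmx N1 *m N; pose G := cplx_mx (invmx Y) *m adjmx Q.
have ImX : cplx_mx (invmx (Im_mx X)) = N *m cplx_mx (invmx Y) *m adjmx N.
  have := siegel_act_Im hS (Siegel_imag pY); rewrite Im_imag -/X -/N => e.
  have uNT : invmx N^T \in unitmx by exact: unitmx_invT.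
  have uc : cplx_mx Y \in unitmx by rewrite cplx_unit.
  rewrite -[LHS]conj_cplx cplxV e invmxM ?unitmx_mul ?uNT ?adjmx_unit //.
  rewrite (invmxM uNT uc) invmxK adjmxV invmxK !conjM conjV conj_cplx -cplxV mulmxA.
  by rewrite /adjmx !conjT !trmxK conj_mxK.
have form (w w1 : 'rV[R]_n) : complex.Re
    (((cplx_mx w *m G *m (cplx_mx w1)^T) 0 0) ^+ 2) = 0.
  have t1 := tangent_rank_one w1 h1S pY1; rewrite -eX in t1.
  have := orth _ _ (tangent_rank_one w hS pY) t1.
  rewrite (metric_rank_one _ _ SX) ImX => <-; congr (complex.Re ((_ 0 0) ^+ 2)).
  rewrite -/N -/N1 adjmxM adjmx_cplx cplxT !mulmxA (mulmxKV uN) /G /Q adjmxM !mulmxA.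
  by [].
have GQ : G = cplx_mx (invmx Y) *m adjmx Q by [].
have NQ : N = N1 *m Q by rewrite mulKVmx.
clearbody G Q.
pose Gr := map_mx (@complex.Re R) G; pose Gi := Im_mx G.
have GE : G = cplx_mx Gr + 'i%C *: cplx_mx Gi by exact: complexmxE.
clearbody Gr Gi.
(* The real part of [(x + i y)^2] is [x^2 - y^2]: the forms of [Gr] and [Gi] have equal squares, and
   [e] is the sign that remains. *)
have [e [ee eG]] : exists e : R, e * e = 1 /\ Gi = e *: Gr.
  have [w w1|->|->] := @bilinear_sqr_eq Gi Gr.
  - have := form w w1; rewrite GE mulmxDr mulmxDl -scalemxAr -scalemxAl.
    rewrite -cplxT -!cplxM mxE [X in _ + X]mxE [cplx_mx _ _ _]mxE [X in 'i%C * X]mxE.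
    set a := (w *m Gr *m _) 0 0; set b := (w *m Gi *m _) 0 0; rewrite expr2 /= => H.
    by rewrite !expr2; lra.
  - by exists 1; rewrite mulr1 scale1r.
  - by exists (- 1); rewrite mulrNN mulr1 scaleN1r.
exists e => //; pose M := Gr^T *m Y.
have QE : Q = (1 - e%:C%C * 'i%C) *: cplx_mx M.
  have aQ : adjmx Q = cplx_mx Y *m G by rewrite GQ cplxV (mulKVmx (etrans (cplx_unit Y) uY)).
  have conj_e : conjc (1 + 'i%C * e%:C%C) = 1 - e%:C%C * 'i%C :> C.
    by apply/eqP; rewrite eq_complex /=; apply/andP; split; apply/eqP; ring.
  have gE : G = (1 + 'i%C * e%:C%C) *: cplx_mx Gr.
    rewrite GE eG cplxZ; move: (cplx_mx Gr) => g.
    by rewrite scalerDl scale1r scalerA.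
  rewrite -[Q]adjmxK aQ gE -scalemxAr adjmxZ conj_e -cplxM adjmx_cplx.
  by rewrite trmx_mul sY.
pose a (Z : 'M[R]_n) : 'M[R]_(n, n + n) := row_mx Z 0; pose b : 'M[R]_(n, n + n) := row_mx 0 1%:M.
have lagE Z : Z^T = Z -> lag_of (imag Z) = cplx_mx b + 'i%C *: cplx_mx (a Z).
  move=> sZ; rewrite /lag_of /imag linearZ /= -cplxT sZ /a /b /cplx_mx !map_row_mx map_mx0 map_mx1.
  by rewrite scale_row_mx scaler0 add_row_mx add0r addr0.
have frame : lag_of (imag Y) *m (cplx_mx h)^T =
    (1 - e%:C%C * 'i%C) *: (cplx_mx M^T *m (lag_of (imag Y1) *m (cplx_mx h1)^T)).
  rewrite (lag_act uN) (lag_act uN1) -/X -eX -/N -/N1.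
  by rewrite NQ QE -scalemxAr linearZ /= trmx_mul cplxT -scalemxAl mulmxA.
have [sY1 _] := pY1.
have [bE aE] : b *m h^T = M^T *m (b + e *: a Y1) *m h1^T /\
    a Y *m h^T = M^T *m (a Y1 - e *: b) *m h1^T.
  apply: complexmx_inj; rewrite !lagE // in frame.
  move: frame; rewrite -!cplxT !mulmxDl mulmxDr -!scalemxAl -!scalemxAr -!cplxM !mulmxA => ->.
  rewrite mulmxDr mulmxBr !mulmxDl mulNmx -!scalemxAr -!scalemxAl !(cplxD, cplxN, cplxZ).
  move: (cplx_mx _) (cplx_mx _) => A B.
  rewrite scalerBl scale1r !scalerDr !scalerA -mulrA -expr2 sqr_i mulrN1 scaleNr.
  by rewrite opprD opprK scalerN scalerA [e%:C%C * 'i%C]mulrC [- _ + _ *: A]addrC addrACA.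
pose k := invmx h1 *m h.
have uh1 := Sp_unit h1S; have uh := Sp_unit hS.
have ht (A B : 'M[R]_(n, n + n)) : A *m h^T = B *m h1^T -> A *m k^T = B.
  by move=> E; rewrite /k trmx_mul mulmxA E -mulmxA -trmx_mul mulVmx // trmx1 mulmx1.
have bk := ht _ _ bE; have ak := ht _ _ aE.
have uab : col_mx (a Y) b \in unitmx.
  by rewrite -[col_mx _ _]/(block_mx _ _ _ _) unitmxE det_ublock det1 mulr1 -unitmxE.
(* Checked on the basis [(a Y, b)]: [imag_refl Y] exchanges its two blocks, and after [k^T] the
   matrix [axis_refl] fixes the [a] parts and negates the [b] parts. *)
have comm : e *: ((imag_refl Y)^T *m k^T) = k^T *m axis_refl.
  apply: (can_inj (mulKmx uab)); rewrite -scalemxAr !mulmxA !mul_col_mx scale_col_mx.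
  have aW : a Y *m (imag_refl Y)^T = b.
    rewrite /a /b /imag_refl tr_block_mx trmx_inv sY !trmx0 mul_row_block mulmxV //.
    by rewrite !mul0mx !mulmx0 !addr0.
  have bW : b *m (imag_refl Y)^T = a Y.
    rewrite /a /b /imag_refl tr_block_mx trmx_inv sY !trmx0 mul_row_block mul1mx.
    by rewrite !mul0mx !mulmx0 !add0r.
  have aR Z : a Z *m axis_refl = a Z.
    by rewrite /a /axis_refl mul_row_block mulmx1 !mul0mx mulmx0 !addr0.
  have bR : b *m axis_refl = - b.
    by rewrite /b /axis_refl mul_row_block !mul0mx mulmx0 mulmxN mulmx1 !add0r opp_row_mx oppr0.
  rewrite aW bW ak bk -!mulmxA !mulmxDl mulNmx -!scalemxAl aR bR !scalemxAr.
  rewrite !scalerDr !scalerN opprK !scalerA ee !scale1r.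
  by rewrite [e *: b + _]addrC [- b + _]addrC.
have kW : axis_refl *m k = e *: (k *m imag_refl Y).
  apply: trmx_inj; rewrite trmx_mul axis_refl_tr -comm -trmx_mul.
  by apply/matrixP => i l; rewrite !mxE.
have -> : invmx h1 = k *m invmx h by rewrite /k mulmxK.
by rewrite -mulmxA [axis_refl *m _]mulmxA kW -scalemxAl -scalemxAr /k !mulmxA mulmxV // mul1mx.
Qed.

End Reflections.

(** * Translations along a tube *)

Section Translations.
Variables (R : realType) (n : nat).
Local Notation C := R[i].
Local Notation J := (sympl_form R n).
Implicit Types (h g t : 'M[R]_(n + n)) (Y A B X : 'M[R]_n) (a b c : 'M[R]_(n, n + n)).

Definition levi A : 'M[R]_(n + n) := block_mx A 0 0 (invmx A)^T.

Lemma levi_Sp A : A \in unitmx -> Sp (levi A).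
Proof.
move=> uA; rewrite /Sp /= /levi /sympl_form tr_block_mx !trmx0 trmxK !mulmx_block.
rewrite !(mul0mx, mulmx0, mulmx1, mulmxN, mul1mx, mulNmx, oppr0, addr0, add0r).
by rewrite -trmx_mul mulVmx // trmx1.
Qed.

Lemma siegel_act_levi A (Z : 'M[C]_n) : A \in unitmx ->
  siegel_act (levi A) Z = cplx_mx A *m Z *m (cplx_mx A)^T.
Proof.
move=> uA; rewrite siegel_actE /mfac /nfac /levi /cplx_mx map_block_mx !map_mx0.
rewrite block_mxKul block_mxKur block_mxKdl block_mxKdr mul0mx addr0 add0r.
by rewrite -map_trmx map_invmx -trmx_inv invmxK.
Qed.

Lemma lag_levi A X : A \in unitmx ->
  lag_of X *m (levi A)^T = invmx A *m lag_of (A *m X *m A^T).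
Proof.
move=> uA; rewrite /lag_of /levi tr_block_mx !trmx0 trmxK mul_row_block mul_mx_row.
by rewrite !mulmx0 addr0 add0r mul1mx mulmx1 !trmx_mul trmxK mulKmx.
Qed.

(** As for two inversions of the half-plane centred at 0, the composite is a translation along the
    imaginary axis. *)
Lemma imag_reflM Y1 Y2 : Y1^T = Y1 -> Y2^T = Y2 -> Y1 \in unitmx -> Y2 \in unitmx ->
  imag_refl Y2 *m imag_refl Y1 = levi (Y2 *m invmx Y1).
Proof.
move=> s1 s2 u1 u2; rewrite /imag_refl /levi mulmx_block !(mulmx0, mul0mx, addr0, add0r).
by rewrite invmxM ?unitmx_inv // invmxK trmx_mul trmx_inv s1 s2.
Qed.

Lemma leviZ (e : R) A : e * e = 1 -> A \in unitmx -> e *: levi A = levi (e *: A).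
Proof.
move=> ee uA; have ue : e \is a GRing.unit by apply/unitrP; exists e.
have -> : levi (e *: A) = block_mx (e *: A) 0 0 (e^-1 *: invmx A)^T by rewrite /levi invmxZ // unitmxZ.
have -> : e^-1 = e by apply: (mulrI ue); rewrite divrr // ee.
by rewrite /levi scale_block_mx !scaler0 linearZ.
Qed.

Lemma pos_def_unit Y : pos_def Y -> Y \in unitmx.
Proof. by move=> pY; rewrite -cplx_unit cpd_unit //; exact: cpd_of_pos_def. Qed.

Lemma pos_def_congr Y A : pos_def Y -> A \in unitmx -> pos_def (A *m Y *m A^T).
Proof.
move=> pY uA; apply: pos_def_of_cpd; rewrite !cplxM cplxT -[in X in _ *m X](conj_cplx A).
by apply: cpd_congr; rewrite ?cplx_unit //; exact: cpd_of_pos_def.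
Qed.

Lemma invmx_diag (F : fieldType) (d : 'rV[F]_n) : diag_mx d \in unitmx ->
  (forall i, d 0 i != 0) /\ invmx (diag_mx d) = diag_mx (\row_i (d 0 i)^-1).
Proof.
move=> ud; have nz i : d 0 i != 0.
  have := ud; rewrite unitmxE det_diag unitfE; apply: contra => /eqP di.
  by rewrite (bigD1 i) //= di mul0r.
split=> //; apply: (can_inj (mulKmx ud)); rewrite mulmxV // mulmx_diag.
rewrite -diag_const_mx; congr diag_mx; apply/rowP => i; rewrite !mxE.
by rewrite mulfV.
Qed.

Lemma invmx_of_congr (F : fieldType) (P Y P' : 'M[F]_n) :
  P *m Y *m P' = 1%:M -> invmx Y = P' *m P.
Proof.
move=> /mulmx1C; rewrite mulmxA => e; have [_ uY] := mulmx1_unit e.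
by apply: (can_inj (mulmxK uY)); rewrite mulVmx.
Qed.

Lemma congr_chain (F : fieldType) (P X P' Y : 'M[F]_n) :
  P *m (Y *m (P' *m P) *m X *m (P' *m P *m Y)) *m P' =
  (P *m Y *m P') *m (P *m X *m P') *m (P *m Y *m P').
Proof. by rewrite !mulmxA. Qed.

Lemma congrZ (F : fieldType) (c : F) (B Z : 'M[F]_n) :
  (c *: B) *m Z *m (c *: B)^T = (c * c) *: (B *m Z *m B^T).
Proof. by rewrite linearZ /= -!scalemxAl -scalemxAr scalerA. Qed.

Section Eigenvalues.
Variables (P : 'M[C]_n) (mu : 'rV[R]_n) (Y1 Y2 : 'M[R]_n).
Hypotheses (pY1 : pos_def Y1) (pY2 : pos_def Y2) (uP : P \in unitmx).
Hypothesis PY1 : P *m cplx_mx Y1 *m adjmx P = 1%:M.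
Hypothesis PY2 : P *m cplx_mx Y2 *m adjmx P = diag_mx (cplx_mx mu).
Local Notation A := (Y2 *m invmx Y1).

Lemma ratio_unit : A \in unitmx.
Proof. by rewrite unitmx_mul unitmx_inv !pos_def_unit. Qed.

Lemma mu_gt0 i : 0 < mu 0 i.
Proof.
by apply: cpd_diag; rewrite -PY2; apply: (cpd_congr uP); exact: cpd_of_pos_def.
Qed.

Lemma congr_ratio (X : 'M[R]_n) (d : 'rV[R]_n) :
  P *m cplx_mx X *m adjmx P = cplx_mx (diag_mx d) ->
  P *m cplx_mx (A *m X *m A^T) *m adjmx P =
  cplx_mx (diag_mx (\row_i (mu 0 i ^+ 2 * d 0 i))).
Proof.
have [s1 _] := pY1; have [s2 _] := pY2.
move=> PX; rewrite trmx_mul trmx_inv s1 s2 !cplxM cplxV (invmx_of_congr PY1).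
rewrite congr_chain PX PY2 -[diag_mx (cplx_mx mu)](map_diag_mx (real_complex R)) -!cplxM !mulmx_diag.
by congr (cplx_mx (diag_mx _)); apply/rowP => i; rewrite !mxE; ring.
Qed.

Lemma ratio_conj : P *m cplx_mx A = diag_mx (cplx_mx mu) *m P.
Proof. by rewrite -PY2 cplxM cplxV (invmx_of_congr PY1) !mulmxA. Qed.

Lemma ratio_eigenvalue (e : R) (x : C) : e * e = 1 ->
  eigenvalue (cplx_mx (e *: A)) x -> exists i, `|x| = (mu 0 i)%:C%C.
Proof.
move=> ee /eigenvalueP[v vA v0]; pose w := v *m invmx P.
have wA : w *m diag_mx (cplx_mx mu) = (x * e%:C%C) *: w.
  rewrite /w -[diag_mx _](mulmxK uP) -ratio_conj !mulmxA mulmxKV //.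
  have -> : v *m cplx_mx A = (x * e%:C%C) *: v.
    rewrite mulrC -scalerA -vA cplxZ -scalemxAr scalerA -rmorphM ee.
    by rewrite scale1r.
  by rewrite -scalemxAl.
have /matrix0Pn[i [k wk]] : w != 0.
  apply: contra v0 => /eqP w0; rewrite -(mulmxKV uP v) -/w w0 mul0mx //.
exists k; have E : (mu 0 k)%:C%C = x * e%:C%C.
  apply: (mulIf wk); move/matrixP/(_ i k) : wA; rewrite mul_mx_diag mxE [RHS]mxE => <-.
  by rewrite [cplx_mx mu 0 k]mxE mulrC.
have ne : `|e%:C%C| = 1 :> C.
  have : `|e| ^+ 2 = 1 by rewrite real_normK ?num_real // expr2.
  move/eqP; rewrite sqrf_eq1 => /orP[/eqP e1|/eqP e1].
    by rewrite normc_def /= expr0n addr0 sqrtr_sqr e1.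
  by have := normr_ge0 e; rewrite e1 oppr_ge0 ler10.
have m0 := mu_gt0 k.
rewrite -[LHS]mulr1 -ne -normrM -E ger0_norm //.
by rewrite (@lecR _ 0) ltW.
Qed.

Lemma det_ratio : \det A = \prod_i mu 0 i.
Proof.
apply: complexI; rewrite -det_cplx rmorph_prod.
have dP : \det P != 0 by rewrite -unitfE -unitmxE.
apply: (mulfI dP); rewrite -det_mulmx ratio_conj det_mulmx mulrC; congr (_ * _).
by rewrite det_diag; apply: eq_bigr => i _; rewrite mxE.
Qed.

(** In the frame [h], [t] acts by [Z |-> A Z A^T], where the sign [e] cancels. It moves [i Y1] by
    half the sum of the [ln (mu^2)], which is twice the distance from [i Y1] to [i Y2], and no point
    is moved less, since [det (Im Z)] is multiplied by [(det A)^2]. *)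
Lemma translation_length h (e : R) t : Sp h -> e * e = 1 -> (forall i, 1 < mu 0 i) ->
  t = e *: (h *m (imag_refl Y2 *m imag_refl Y1) *m invmx h) ->
  is_tube_of t [set Z | exists2 Y, pos_def Y & Z = siegel_act h (imag Y)] /\
  2 * dF (siegel_act h (imag Y1)) (siegel_act h (imag Y2)) = lF t.
Proof.
move=> hS ee mu1 tE; have [s1 _] := pY1; have [s2 _] := pY2.
have uA := ratio_unit.
have ueA : e *: A \in unitmx.
  by rewrite unitmxZ //; apply/unitrP; exists e.
have {}tE : t = h *m levi (e *: A) *m invmx h.
  by rewrite tE imag_reflM ?pos_def_unit // scalemxAl scalemxAr leviZ.
have mu0 i : 0 < mu 0 i by exact: mu_gt0.
split.
  exists (lag_of (0 : 'M[R]_n) *m h^T), (lag_infty R n *m h^T); split; last first.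
    by rewrite (tubeP hS (eqmx_refl _) (eqmx_refl _)).
  exists h, (e *: A); split=> //.
  by move=> x /(ratio_eigenvalue ee)[i ->]; rewrite ltcR.
have SiY1 := Siegel_imag pY1; have SiY2 := Siegel_imag pY2.
rewrite (dF_act hS SiY1 SiY2) (dF_imag pY1 pY2 uP PY1 PY2 (fun i => ltW (mu1 i))).
rewrite mulrA mulfV ?pnatr_eq0 // mul1r.
have lS := levi_Sp ueA; have hV := Sp_inv hS.
have tX (X : 'M[C]_n) : Siegel X -> siegel_act t (siegel_act h X) =
    siegel_act h (cplx_mx A *m X *m (cplx_mx A)^T).
  move=> SX; have ShX := siegel_act_Siegel hS SX.
  rewrite tE (siegel_act_comp (Sp_mul hS lS) hV ShX).1 siegel_actK //.
  rewrite (siegel_act_comp hS lS SX).1 (siegel_act_levi _ ueA) cplxZ congrZ.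
  by rewrite -rmorphM ee scale1r.
have attained : dF (siegel_act h (imag Y1)) (siegel_act t (siegel_act h (imag Y1))) =
    \sum_i ln (mu 0 i).
  have iE : cplx_mx A *m imag Y1 *m (cplx_mx A)^T = imag (A *m Y1 *m A^T).
    by rewrite /imag !(cplxM, cplxT) -scalemxAr -scalemxAl.
  have pAY := pos_def_congr pY1 uA.
  rewrite (tX _ SiY1) iE (dF_act hS SiY1 (Siegel_imag pAY)).
  have := @congr_ratio Y1 (const_mx 1); rewrite diag_const_mx cplx1 => /(_ PY1) PA.
  rewrite /cplx_mx map_diag_mx -/(cplx_mx _) in PA.
  rewrite (dF_imag pY1 pAY uP PY1 PA).
    rewrite mulr_sumr; apply: eq_bigr => i _; rewrite !mxE mulr1 lnXn //.
    by rewrite mulr2n; field.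
  by move=> i; rewrite !mxE mulr1 exprn_ege1 // ltW.
have lower (X : 'M[C]_n) : Siegel X -> \sum_i ln (mu 0 i) <= dF X (siegel_act t X).
  move=> SX; pose X' := siegel_act (invmx h) X.
  have SX' : Siegel X' := siegel_act_Siegel hV SX.
  have -> : X = siegel_act h X' by rewrite siegel_actKV.
  have SAX : Siegel (cplx_mx A *m X' *m (cplx_mx A)^T).
    by rewrite -(siegel_act_levi _ uA); exact: (siegel_act_Siegel (levi_Sp uA) SX').
  rewrite (tX _ SX') (dF_act hS SX' SAX); apply: le_trans (dF_ge SX' SAX).
  have dX := pos_def_det SX'.2.
  have -> : Im_mx (cplx_mx A *m X' *m (cplx_mx A)^T) = A *m Im_mx X' *m A^T.
    have [_ i] : map_mx (@complex.Re R) (cplx_mx A *m X' *m (cplx_mx A)^T) = A *m map_mx (@complex.Re R) X' *m A^T /\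
        Im_mx (cplx_mx A *m X' *m (cplx_mx A)^T) = A *m Im_mx X' *m A^T; last exact: i.
    apply: complexmx_inj; rewrite -complexmxE [in LHS](complexmxE X').
    by rewrite mulmxDr mulmxDl -scalemxAr -scalemxAl -cplxT -!cplxM.
  rewrite [\det (_ *m A^T)]det_mulmx [\det (A *m Im_mx X')]det_mulmx det_tr mulrAC mulfK ?gt_eqF // det_ratio.
  have Pm : 0 < \prod_i mu 0 i by rewrite prodr_gt0.
  by rewrite -expr2 lnXn // -sum_ln // -[X in _ <= _ * X]mulr_natl mulKf ?pnatr_eq0.
apply/eqP; rewrite eq_le; apply/andP; split.
- apply: lb_le_inf; first by exists (dF (siegel_act h (imag Y1)) (siegel_act t (siegel_act h (imag Y1)))), (siegel_act h (imag Y1)) => //; exact: siegel_act_Siegel.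
  by move=> _ [X SX <-]; exact: lower.
- rewrite -attained; apply: ge_inf.
    by exists (\sum_i ln (mu 0 i)) => _ [X SX <-]; exact: lower.
  by exists (siegel_act h (imag Y1)) => //; exact: siegel_act_Siegel.
Qed.

End Eigenvalues.

End Translations.

(** * Maximal triples along the orbit of a Lagrangian *)

Section MaximalTriples.
Variables (R : realType) (n : nat).
Local Notation C := R[i].
Local Notation J := (sympl_form R n).
Implicit Types (h g t : 'M[R]_(n + n)) (Y A B X : 'M[R]_n) (a b c : 'M[R]_(n, n + n)).

Definition omega a b : 'M[R]_n := a *m J *m b^T.

Lemma omegaM U V a b : omega (U *m a) (V *m b) = U *m omega a b *m V^T.
Proof. by rewrite /omega trmx_mul !mulmxA. Qed.

Lemma omega_Sp h a b : Sp h -> omega (a *m h^T) (b *m h^T) = omega a b.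
Proof.
move=> hS; have hS' : h^T *m J *m h = J := hS.
by rewrite /omega trmx_mul trmxK !mulmxA -(mulmxA a) -(mulmxA a) hS'.
Qed.

Lemma omega_lag X Z : omega (lag_of X) (lag_of Z) = X^T - Z.
Proof.
rewrite /omega /lag_of /sympl_form mul_row_block tr_row_mx mul_row_col trmxK trmx1.
by rewrite !mulmx0 mulmx1 mulmxN add0r addr0 mul1mx mulmx1 mulNmx addrC mul1mx.
Qed.

Lemma omega_infty Z : omega (lag_infty R n) (lag_of Z) = 1%:M.
Proof.
rewrite /omega /lag_infty /lag_of /sympl_form mul_row_block tr_row_mx mul_row_col trmxK trmx1.
by rewrite !(mulmx0, mul0mx, mul1mx, addr0, add0r).
Qed.

(** Up to changes of basis the three pairings are those of the model [(l_infty, 0, Id)], namely 1, 1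
    and -1. *)
Lemma maximal_frames h X0 X1 X2 a b c : Sp h ->
  X0^T = X0 -> X1^T = X1 -> maximal_triple a b c ->
  (a :=: lag_of X0 *m h^T)%MS -> (b :=: lag_of X1 *m h^T)%MS ->
  (c :=: lag_of X2 *m h^T)%MS ->
  exists U V W, [/\ U \in unitmx, V \in unitmx, W \in unitmx &
    [/\ X0 - X1 = U *m V^T, X0 - X2 = U *m W^T & X1 - X2 = - (V *m W^T)]].
Proof.
move=> hS s0 s1 [g gS [ea eb ec]] ea' eb' ec'.
have ug : g^T \in unitmx by rewrite unitmx_tr Sp_unit.
have [U uU UE] := eqmx_frame (row_freeM (lag_infty_free R n) ug) (eqmx_trans (eqmx_sym ea') ea).
have [V uV VE] := eqmx_frame (row_freeM (lag_of_free _) ug) (eqmx_trans (eqmx_sym eb') eb).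
have [W uW WE] := eqmx_frame (row_freeM (lag_of_free _) ug) (eqmx_trans (eqmx_sym ec') ec).
exists U, V, W; split=> //; split.
- rewrite -{1}s0 -omega_lag -(omega_Sp _ _ hS) UE VE omegaM omega_Sp // omega_infty.
  by rewrite mulmx1.
- rewrite -{1}s0 -omega_lag -(omega_Sp _ _ hS) UE WE omegaM omega_Sp // omega_infty.
  by rewrite mulmx1.
- rewrite -{1}s1 -omega_lag -(omega_Sp _ _ hS) VE WE omegaM omega_Sp // omega_lag.
  by rewrite trmx0 sub0r mulmxN mulmx1 mulNmx.
Qed.

(** The relations make [(X1 - X2) (X0 - X2)^-1 (X0 - X1)] equal to [- V V^T], which is negative
    definite; [P] diagonalises it. *)
Lemma frames_sign (P : 'M[C]_n) (d01 d02 d12 : 'rV[R]_n) X0 X1 X2 (U V W : 'M[R]_n) :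
  P \in unitmx -> U \in unitmx -> V \in unitmx -> W \in unitmx ->
  X0 - X1 = U *m V^T -> X0 - X2 = U *m W^T -> X1 - X2 = - (V *m W^T) ->
  P *m cplx_mx (X0 - X1) *m adjmx P = cplx_mx (diag_mx d01) ->
  P *m cplx_mx (X0 - X2) *m adjmx P = cplx_mx (diag_mx d02) ->
  P *m cplx_mx (X1 - X2) *m adjmx P = cplx_mx (diag_mx d12) ->
  forall i, d12 0 i * (d02 0 i)^-1 * d01 0 i < 0.
Proof.
move=> uP uU uV uW e01 e02 e12 D01 D02 D12 i.
have uPa : adjmx P \in unitmx by rewrite adjmx_unit.
have u02 : X0 - X2 \in unitmx by rewrite e02 unitmx_mul uU unitmx_tr.
have ud : diag_mx d02 \in unitmx by rewrite -cplx_unit -D02 !unitmx_mul uP uPa cplx_unit u02.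
have [_ id02] := invmx_diag ud.
have key : (X1 - X2) *m invmx (X0 - X2) *m (X0 - X1) = - (V *m V^T).
  rewrite e01 e02 e12 invmxM ?unitmx_tr // !mulNmx !mulmxA mulmxK ?unitmx_tr //.
  by rewrite mulmxKV.
have cj : P *m cplx_mx ((X1 - X2) *m invmx (X0 - X2) *m (X0 - X1)) *m adjmx P =
    cplx_mx (diag_mx d12 *m invmx (diag_mx d02) *m diag_mx d01).
  rewrite !cplxM !cplxV -D01 -D02 -D12; have := u02; rewrite -cplx_unit.
  move: (cplx_mx (X0 - X1)) (cplx_mx (X0 - X2)) (cplx_mx (X1 - X2)) => a b c ub.
  rewrite !invmxM ?unitmx_mul ?uP // !mulmxA.
  by rewrite (mulmxK uPa) (mulmxKV uP).
have c1 : cpd (diag_mx (cplx_mx (\row_i - (d12 0 i * (d02 0 i)^-1 * d01 0 i)))).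
  have -> : diag_mx (cplx_mx (\row_i - (d12 0 i * (d02 0 i)^-1 * d01 0 i))) =
      - cplx_mx (diag_mx d12 *m invmx (diag_mx d02) *m diag_mx d01).
    rewrite id02 !mulmx_diag -cplxN -(map_diag_mx (real_complex R)); congr cplx_mx.
    by rewrite -linearN; congr diag_mx; apply/rowP => k; rewrite !mxE.
  rewrite -cj key cplxN mulmxN mulNmx opprK cplxM cplxT.
  have -> : P *m (cplx_mx V *m (cplx_mx V)^T) *m adjmx P =
      (P *m cplx_mx V) *m 1%:M *m adjmx (P *m cplx_mx V).
    by rewrite mulmx1 adjmxM adjmx_cplx cplxT !mulmxA.
  apply: cpd_congr; first by rewrite unitmx_mul uP cplx_unit.
  split; first exact: adjmx1.
  move=> x x0; rewrite mulmx1 lt_def mul_adjmx_diag andbT; apply/eqP => xx0.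
  case/eqP: x0; apply/rowP => k; rewrite [RHS]mxE.
  move: xx0; rewrite mxE => /eqP; rewrite psumr_eq0; last first.
    by move=> l _; rewrite !mxE mulcJ_ge0.
  move/allP/(_ k); rewrite mem_index_enum => /(_ isT) /=.
  by rewrite !mxE mulf_eq0 conjc_eq0 orbb => /eqP.
by have := cpd_diag c1 i; rewrite mxE oppr_gt0.
Qed.

(** The orbit has the eigenvalues [eta], [eta m^2], [eta m^4]; the expression is [eta (m - 1)] times
    a negative factor. In the other cyclic order, treated next, the factor is positive. *)
Lemma sign_increasing (eta m : R) : eta * eta = 1 -> 0 < m ->
  eta * (m ^+ 2 - m ^+ 4) * (eta * (1 - m ^+ 4))^-1 * (eta * (1 - m ^+ 2)) < 0 ->
  0 < eta * (m - 1).
Proof.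
move=> ee m0; have [->|m1] := eqVneq m 1; first by rewrite !expr1n subrr !mulr0 ltxx.
have e0 : eta != 0 by apply/eqP => z; move: ee; rewrite z mulr0 => /eqP; rewrite eq_sym oner_eq0.
have n1 : 1 - m != 0 by rewrite subr_eq0 eq_sym.
have m4 : 1 - m ^+ 4 = (1 - m) * ((1 + m) * (1 + m ^+ 2)) by ring.
have q : 0 < (1 + m) * (1 + m ^+ 2) by rewrite mulr_gt0 ?ltr_wpDr ?sqr_ge0 // ltW.
have q2 : 0 < (1 + m) ^+ 2 * m ^+ 2 / ((1 + m) * (1 + m ^+ 2)).
  by rewrite divr_gt0 // mulr_gt0 ?exprn_gt0 // ltr_wpDr // ltW.
have -> : eta * (m ^+ 2 - m ^+ 4) * (eta * (1 - m ^+ 4))^-1 * (eta * (1 - m ^+ 2)) =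
   - (((1 + m) ^+ 2 * m ^+ 2 / ((1 + m) * (1 + m ^+ 2))) * (eta * (m - 1))).
  rewrite m4; field; have m2 := sqr_ge0 m.
  by do ?[apply/andP; split]; rewrite // gt_eqF //; lra.
by rewrite oppr_lt0 pmulr_rgt0.
Qed.

Lemma sign_decreasing (eta m : R) : eta * eta = 1 -> 0 < m ->
  eta * (m ^+ 4 - m ^+ 2) * (eta * (1 - m ^+ 2))^-1 * (eta * (1 - m ^+ 4)) < 0 ->
  eta * (m - 1) < 0.
Proof.
move=> ee m0; have [->|m1] := eqVneq m 1; first by rewrite !expr1n subrr !mulr0 ltxx.
have e0 : eta != 0 by apply/eqP => z; move: ee; rewrite z mulr0 => /eqP; rewrite eq_sym oner_eq0.
have n1 : 1 - m != 0 by rewrite subr_eq0 eq_sym.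
have m2 : 1 - m ^+ 2 = (1 - m) * (1 + m) by ring.
have p1 : 0 < 1 + m by rewrite ltr_wpDr // ltW.
have q : 0 < (1 + m) * (1 + m ^+ 2) * m ^+ 2 by rewrite !mulr_gt0 ?exprn_gt0 // ltr_wpDr ?sqr_ge0.
have -> : eta * (m ^+ 4 - m ^+ 2) * (eta * (1 - m ^+ 2))^-1 * (eta * (1 - m ^+ 4)) =
   ((1 + m) * (1 + m ^+ 2) * m ^+ 2) * (eta * (m - 1)).
  by rewrite m2; field; rewrite e0 n1 gt_eqF.
by rewrite pmulr_rlt0.
Qed.

Lemma imag_refl_eigen h Y (e d : R) a : Sp h -> pos_def Y -> row_free a ->
  e * e = 1 -> d * d = 1 -> a *m (e *: (h *m imag_refl Y *m invmx h))^T = d *: a ->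
  (a :=: lag_of ((d * e) *: Y) *m h^T)%MS.
Proof.
move=> hS pY fa ee dd as1; have uY := pos_def_unit pY; have [sY _] := pY.
have uhT : h^T \in unitmx by rewrite unitmx_tr Sp_unit.
pose r := a *m invmx h^T.
have rW : r *m (imag_refl Y)^T = (d * e) *: r.
  apply: (can_inj (mulmxK uhT)); rewrite -[in RHS]scalemxAl mulmxKV //.
  rewrite mulrC -scalerA -as1 linearZ /= -scalemxAr scalerA ee scale1r.
  by rewrite !trmx_mul trmx_inv !mulmxA.
pose U := lsubmx r; pose V := rsubmx r.
have rE : r = row_mx U V by rewrite hsubmxK.
have UE : U = (d * e) *: (V *m Y).
  have : V *m Y = (d * e) *: U.
    move: rW; rewrite rE /imag_refl tr_block_mx !trmx0 sY mul_row_block scale_row_mx.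
    by rewrite !mulmx0 add0r => /eq_row_mx[].
  by move=> ->; rewrite scalerA mulrACA dd ee mulr1 scale1r.
have aE : a = V *m (lag_of ((d * e) *: Y) *m h^T).
  rewrite -[a](mulmxKV uhT) -/r rE UE mulmxA; congr (_ *m _).
  by rewrite /lag_of linearZ /= sY mul_mx_row mulmx1 -scalemxAr.
have fV : row_full V.
  rewrite row_full_unit -row_free_unit /row_free eqn_leq rank_leq_row /=.
  by move: fa; rewrite /row_free => /eqP {1}<-; rewrite aE mxrankM_maxl.
by rewrite aE; exact: eqmxMfull.
Qed.

Lemma lag_translate h B X X' a b : Sp h -> B \in unitmx -> X' = B *m X *m B^T ->
  (a :=: lag_of X *m h^T)%MS -> (b :=: a *m (h *m levi B *m invmx h)^T)%MS ->
  (b :=: lag_of X' *m h^T)%MS.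
Proof.
move=> hS uB -> ea eb; apply: eqmx_trans eb _; apply: eqmx_trans (eqmxMr _ ea) _.
have uhT : h^T \in unitmx by rewrite unitmx_tr Sp_unit.
rewrite !trmx_mul trmx_inv !mulmxA mulmxK // lag_levi //.
set L := lag_of _; rewrite -mulmxA.
by apply: eqmxMfull; rewrite row_full_unit unitmx_inv.
Qed.

Lemma pos_def_inv Y : pos_def Y -> pos_def (invmx Y).
Proof.
move=> pY; have uY := pos_def_unit pY; have [sY _] := pY.
have uV : invmx Y \in unitmx by rewrite unitmx_inv.
have := pos_def_congr pY uV.
by rewrite trmx_inv sY mulVmx // mul1mx.
Qed.

Lemma J_Sp : Sp J.
Proof. by rewrite /Sp /= J_tr mulNmx sympl_form_sqr opprK mul1mx. Qed.

(** [J] exchanges the ends 0 and [l_infty] of the tube, which turns translations with all [mu < 1]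
    into ones with all [mu > 1]. *)
Lemma siegel_act_J h Y : Sp h -> pos_def Y ->
  siegel_act (h *m J) (imag (invmx Y)) = siegel_act h (imag Y).
Proof.
move=> hS pY; have uY := pos_def_unit pY.
rewrite (siegel_act_comp hS J_Sp (Siegel_imag (pos_def_inv pY))).1; congr siegel_act.
rewrite siegel_actE /mfac /nfac cplx_J block_mxKul block_mxKur block_mxKdl block_mxKdr.
rewrite mul0mx add0r addr0 mul1mx mulNmx mul1mx /imag -scaleNr cplxV.
have uc : cplx_mx Y \in unitmx by rewrite cplx_unit.
have i0 : (- 'i%C : C) \is a GRing.unit.
  by rewrite unitfE oppr_eq0 eq_complex /= eqxx oner_eq0.
rewrite invmxZ ?unitmxZ ?unitmx_inv // invmxK; congr (_ *: _).
apply: (mulIr i0); rewrite mulVr // mulrN -expr2 sqr_i opprK //.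
Qed.

Lemma imag_refl_J h Y1 Y2 : Sp h -> Y1 \in unitmx -> Y2 \in unitmx ->
  h *m J *m (imag_refl (invmx Y2) *m imag_refl (invmx Y1)) *m invmx (h *m J) =
  h *m (imag_refl Y2 *m imag_refl Y1) *m invmx h.
Proof.
move=> hS u1 u2.
have JW Y : J *m imag_refl (invmx Y) = - (imag_refl Y *m J).
  rewrite /imag_refl /sympl_form invmxK !mulmx_block opp_block_mx.
  by rewrite !(mul0mx, mulmx0, mulmx1, mul1mx, addr0, add0r, mulmxN, mulNmx, oppr0, opprK).
have uJ := Sp_unit J_Sp.
rewrite (invmxM (Sp_unit hS) uJ) -[h *m J *m _]mulmxA [J *m (_ *m _)]mulmxA JW mulNmx.
rewrite -[imag_refl Y2 *m J *m _]mulmxA JW !mulmxN opprK !mulmxA.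
by rewrite (mulmxK uJ).
Qed.

Lemma sym_congr A X : X^T = X -> (A *m X *m A^T)^T = A *m X *m A^T.
Proof. by move=> sX; rewrite !trmx_mul trmxK sX mulmxA. Qed.

Lemma lag_of_inj h X X' : Sp h -> (lag_of X *m h^T :=: lag_of X' *m h^T)%MS -> X = X'.
Proof.
move=> hS e; have uhT : h^T \in unitmx by rewrite unitmx_tr Sp_unit.
have [U _] := eqmx_frame (row_freeM (lag_of_free _) uhT) e.
rewrite mulmxA => /(can_inj (mulmxK uhT)); rewrite /lag_of mul_mx_row mulmx1.
by move=> /eq_row_mx[E U1]; apply: trmx_inj; rewrite E -U1 mul1mx.
Qed.

Section TwoReflections.
Variables (h s1 s2 : 'M[R]_(n + n)) (Y1 Y2 : 'M[R]_n) (e1 e2 d : R).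
Variable a : 'M[R]_(n, n + n).
Hypotheses (hS : Sp h) (pY1 : pos_def Y1) (pY2 : pos_def Y2).
Hypotheses (ee1 : e1 * e1 = 1) (ee2 : e2 * e2 = 1) (dd : d * d = 1).
Hypothesis s1E : s1 = e1 *: (h *m imag_refl Y1 *m invmx h).
Hypothesis s2E : s2 = e2 *: (h *m imag_refl Y2 *m invmx h).
Hypotheses (fa : row_free a) (as1 : a *m s1^T = d *: a).

Let A := Y2 *m invmx Y1.
Let e := e2 * e1.
Let eta := d * e1.
Let X0 := eta *: Y1.
Let X1 := A *m X0 *m A^T.
Let X2 := A *m X1 *m A^T.

Let u1 : Y1 \in unitmx := pos_def_unit pY1.
Let u2 : Y2 \in unitmx := pos_def_unit pY2.
Let ee : e * e = 1. Proof. by rewrite /e mulrACA ee1 ee2 mulr1. Qed.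
Let eta2 : eta * eta = 1. Proof. by rewrite /eta mulrACA ee1 dd mulr1. Qed.

Let tE : s2 *m s1 = e *: (h *m (imag_refl Y2 *m imag_refl Y1) *m invmx h).
Proof.
by rewrite s1E s2E -scalemxAr -scalemxAl scalerA mulrC /e !mulmxA (mulmxKV (Sp_unit hS)).
Qed.

Let uA : A \in unitmx. Proof. by rewrite unitmx_mul u2 unitmx_inv. Qed.

Let uB : e *: A \in unitmx.
Proof. by rewrite unitmxZ //; apply/unitrP; exists e. Qed.

Let tB : s2 *m s1 = h *m levi (e *: A) *m invmx h.
Proof.
by rewrite tE (imag_reflM pY1.1 pY2.1) // scalemxAl scalemxAr leviZ.
Qed.

Let ea : (a :=: lag_of X0 *m h^T)%MS.
Proof. by apply: (imag_refl_eigen hS pY1 fa ee1 dd); rewrite -s1E. Qed.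

Let eb b : (b :=: a *m (s2 *m s1)^T)%MS -> (b :=: lag_of X1 *m h^T)%MS.
Proof. by rewrite tB; apply: (lag_translate hS uB _ ea); rewrite congrZ ee scale1r. Qed.

Let ec b c : (b :=: a *m (s2 *m s1)^T)%MS -> (c :=: b *m (s2 *m s1)^T)%MS ->
  (c :=: lag_of X2 *m h^T)%MS.
Proof.
by move=> /eb b1; rewrite tB; apply: (lag_translate hS uB _ b1); rewrite congrZ ee scale1r.
Qed.

Let sX0 : X0^T = X0. Proof. by rewrite linearZ /= pY1.1. Qed.
Let sX1 : X1^T = X1. Proof. exact: sym_congr. Qed.
Let sX2 : X2^T = X2. Proof. exact: sym_congr. Qed.

Let congr_X (P : 'M[C]_n) (mu : 'rV[R]_n) : P *m cplx_mx Y1 *m adjmx P = 1%:M ->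
  P *m cplx_mx Y2 *m adjmx P = diag_mx (cplx_mx mu) ->
  [/\ P *m cplx_mx X0 *m adjmx P = cplx_mx (diag_mx (\row_i eta)),
      P *m cplx_mx X1 *m adjmx P = cplx_mx (diag_mx (\row_i (eta * mu 0 i ^+ 2))) &
      P *m cplx_mx X2 *m adjmx P = cplx_mx (diag_mx (\row_i (eta * mu 0 i ^+ 4)))].
Proof.
move=> PY1 PY2.
have D0 : P *m cplx_mx X0 *m adjmx P = cplx_mx (diag_mx (\row_i eta)).
  rewrite /X0 cplxZ -scalemxAr -scalemxAl PY1 -cplx1 -cplxZ -diag_const_mx -linearZ.
  by congr (cplx_mx (diag_mx _)); apply/rowP => i; rewrite !mxE mulr1.
have D1 := congr_ratio pY1 pY2 PY1 PY2 D0; rewrite -/A -/X1 in D1.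
have D2 := congr_ratio pY1 pY2 PY1 PY2 D1; rewrite -/A -/X2 in D2.
split=> //; rewrite ?D1 ?D2; congr (cplx_mx (diag_mx _)); apply/rowP => i; rewrite !mxE; ring.
Qed.

(** The second translate has the eigenvalues [eta mu^4]; if it is the first Lagrangian, every
    positive [mu] is 1, so [Y1 = Y2] and [s2 s1] is 1 or -1. *)
Lemma translation_sqr : (a *m (s2 *m s1)^T *m (s2 *m s1)^T :=: a)%MS ->
  (s2 *m s1) *m (s2 *m s1) = 1%:M.
Proof.
move=> fixa.
have [P [mu [uP PY1 PY2]]] := cpd_simultaneous (cpd_of_pos_def pY1) (cpd_of_pos_def pY2).1.
have X20 : X2 = X0.
  apply: (lag_of_inj hS); apply: eqmx_trans (eqmx_sym (ec (eqmx_refl _) (eqmx_refl _))) _.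
  exact: eqmx_trans fixa ea.
have [D0 _ D2] := congr_X PY1 PY2; rewrite X20 D0 in D2.
have mu1 i : mu 0 i = 1.
  have m0 : 0 < mu 0 i := mu_gt0 pY2 uP PY2 i.
  have /matrixP/(_ i i) := cplx_inj D2; rewrite !mxE eqxx !mulr1n => E.
  have E4 : mu 0 i ^+ 4 = 1.
    transitivity (eta * (eta * mu 0 i ^+ 4)); first by rewrite mulrA eta2 mul1r.
    by rewrite -E.
  by apply/eqP; rewrite -(@pexpr_eq1 _ _ 4) ?E4 // ltW.
have Y12 : Y1 = Y2.
  apply: (@cplx_inj R); have uPa : adjmx P \in unitmx by rewrite adjmx_unit.
  apply: (can_inj (mulKmx uP)); apply: (can_inj (mulmxK uPa)).
  by rewrite PY1 PY2; apply/matrixP => i k; rewrite !mxE mu1.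
have uh := Sp_unit hS.
rewrite tB /A Y12 mulmxV //.
have -> : levi (e *: (1%:M : 'M[R]_n)) = e *: 1%:M.
  rewrite -leviZ ?unitmx1 // /levi invmx1 trmx1 -scalar_mx_block //.
rewrite -scalemxAr mulmx1 -scalemxAl mulmxV // -scalemxAl -scalemxAr mul1mx scalerA ee.
by rewrite scale1r.
Qed.

(* Writing [P Y1 P^* = 1] and [P Y2 P^* = diag mu], the translate of the fixed
   Lagrangian [eta Y1] has the eigenvalues [eta mu^2]; maximality decides on
   which side of 1 all the [mu] lie, and [J] exchanges the two cases. *)
Lemma double_translation b c : (b :=: a *m (s2 *m s1)^T)%MS ->
  (c :=: b *m (s2 *m s1)^T)%MS -> maximal_triple a b c \/ maximal_triple a c b ->
  is_tube_of (s2 *m s1) [set Z | exists2 Y, pos_def Y & Z = siegel_act h (imag Y)] /\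
  2 * dF (siegel_act h (imag Y1)) (siegel_act h (imag Y2)) = lF (s2 *m s1).
Proof.
move=> bE cE mt; have eb' := eb bE; have ec' := ec bE cE.
have [P [mu [uP PY1 PY2]]] := cpd_simultaneous (cpd_of_pos_def pY1) (cpd_of_pos_def pY2).1.
have [D0 D1 D2] := congr_X PY1 PY2.
have DB X X' r r' : P *m cplx_mx X *m adjmx P = cplx_mx (diag_mx r) ->
    P *m cplx_mx X' *m adjmx P = cplx_mx (diag_mx r') ->
    P *m cplx_mx (X - X') *m adjmx P = cplx_mx (diag_mx (r - r')).
  by move=> E E'; rewrite cplxD cplxN mulmxDr mulmxDl mulmxN mulNmx E E' -cplxN -cplxD linearB.
have D01 : P *m cplx_mx (X0 - X1) *m adjmx P = cplx_mx (diag_mx (\row_i (eta * (1 - mu 0 i ^+ 2)))).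
  by rewrite (DB _ _ _ _ D0 D1); congr (cplx_mx (diag_mx _)); apply/rowP => i; rewrite !mxE; ring.
have D02 : P *m cplx_mx (X0 - X2) *m adjmx P = cplx_mx (diag_mx (\row_i (eta * (1 - mu 0 i ^+ 4)))).
  by rewrite (DB _ _ _ _ D0 D2); congr (cplx_mx (diag_mx _)); apply/rowP => i; rewrite !mxE; ring.
have D12 : P *m cplx_mx (X1 - X2) *m adjmx P = cplx_mx (diag_mx (\row_i (eta * (mu 0 i ^+ 2 - mu 0 i ^+ 4)))).
  by rewrite (DB _ _ _ _ D1 D2); congr (cplx_mx (diag_mx _)); apply/rowP => i; rewrite !mxE; ring.
have D21 : P *m cplx_mx (X2 - X1) *m adjmx P = cplx_mx (diag_mx (\row_i (eta * (mu 0 i ^+ 4 - mu 0 i ^+ 2)))).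
  by rewrite (DB _ _ _ _ D2 D1); congr (cplx_mx (diag_mx _)); apply/rowP => i; rewrite !mxE; ring.
have m0 i : 0 < mu 0 i by exact: mu_gt0 pY2 uP PY2 i.
have side : (forall i, 0 < eta * (mu 0 i - 1)) \/ (forall i, eta * (mu 0 i - 1) < 0).
  case: mt => mt; [left|right] => i.
    have [U [V [W [uU uV uW [E01 E02 E12]]]]] := maximal_frames hS sX0 sX1 mt ea eb' ec'.
    have := frames_sign uP uU uV uW E01 E02 E12 D01 D02 D12 i.
    by do 3 rewrite [(\row__ _) 0 _]mxE; exact: sign_increasing.
  have [U [V [W [uU uV uW [E01 E02 E12]]]]] := maximal_frames hS sX0 sX2 mt ea ec' eb'.
  have := frames_sign uP uU uV uW E01 E02 E12 D02 D01 D21 i.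
  by do 3 rewrite [(\row__ _) 0 _]mxE; exact: sign_decreasing.
have {side} [gt1|lt1] : (forall i, 1 < mu 0 i) \/ (forall i, mu 0 i < 1).
  have [e_1|e_1] : eta = 1 \/ eta = - 1.
    have /eqP : eta ^+ 2 = 1 by rewrite expr2.
    by rewrite sqrf_eq1 => /orP[/eqP->|/eqP->]; [left|right].
    by rewrite e_1 in side; case: side => H; [left|right] => i; have := H i; lra.
  by rewrite e_1 in side; case: side => H; [right|left] => i; have := H i; lra.
  exact: (translation_length pY1 pY2 uP PY1 PY2 hS ee gt1 tE).
(* All [mu] are below 1: in the frame [h J] the matrices [Y1], [Y2] become their inverses, and so do
   the [mu]. *)
have hJ : Sp (h *m J) := Sp_mul hS J_Sp.
have uPa : adjmx P \in unitmx by rewrite adjmx_unit.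
pose P' := invmx (adjmx P); have uP' : P' \in unitmx by rewrite unitmx_inv.
have aP' : adjmx P' = invmx P by rewrite adjmxV adjmxK.
have PI1 : P' *m cplx_mx (invmx Y1) *m adjmx P' = 1%:M.
  by rewrite aP' cplxV (invmx_of_congr PY1) /P' mulKmx // mulmxV.
have ud : diag_mx (cplx_mx mu) \in unitmx by rewrite -PY2 !unitmx_mul uP uPa cplx_unit u2.
have PI2 : P' *m cplx_mx (invmx Y2) *m adjmx P' = diag_mx (cplx_mx (\row_i (mu 0 i)^-1)).
  have -> : diag_mx (cplx_mx (\row_i (mu 0 i)^-1)) = invmx (diag_mx (cplx_mx mu)).
    rewrite (invmx_diag ud).2; congr diag_mx; apply/rowP => i.
    by rewrite !mxE fmorphV.
  have uc : cplx_mx Y2 \in unitmx by rewrite cplx_unit.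
  by rewrite -PY2 !invmxM ?unitmx_mul ?uP // cplxV aP' mulmxA.
have [] := translation_length (pos_def_inv pY1) (pos_def_inv pY2) uP' PI1 PI2 hJ ee _
  (etrans tE (congr1 (fun M => e *: M) (esym (imag_refl_J hS u1 u2)))).
  by move=> i; rewrite mxE invf_gt1.
rewrite !siegel_act_J // => tt ll; split=> //.
suff -> : [set Z | exists2 Y, pos_def Y & Z = siegel_act h (imag Y)] =
    [set Z | exists2 Y, pos_def Y & Z = siegel_act (h *m J) (imag Y)] by [].
apply/seteqP; split=> Z [Y pY ->]; exists (invmx Y); try exact: pos_def_inv.
  by rewrite siegel_act_J.
by rewrite -[in LHS](invmxK Y) siegel_act_J //; exact: pos_def_inv.
Qed.

End TwoReflections.

End MaximalTriples.

(** * Shilov hyperbolic elements *)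

Section ShilovHyperbolic.
Variables (R : realType) (n : nat).
Hypothesis n_gt0 : (0 < n)%N.
Local Notation C := R[i].
Implicit Types (h g k t : 'M[R]_(n + n)) (A B X : 'M[R]_n) (a b c K : 'M[R]_(n, n + n)).

Lemma eigenvalue_tr (M : 'M[C]_n) x : eigenvalue M^T x = eigenvalue M x.
Proof.
rewrite !eigenvalue_root_char; congr (root _ x).
rewrite /char_poly -[in RHS]det_tr; congr (\det _).
by apply/matrixP => i j; rewrite !mxE eq_sym.
Qed.

(** After [A] is made triangular, each row of [P X], once the previous ones vanish, would be an
    eigenvector of [B] for an eigenvalue of [A]. *)
Lemma sylvester (A B X : 'M[C]_n) : A *m X = X *m B ->
  (forall x, eigenvalue A x -> ~~ eigenvalue B x) -> X = 0.
Proof.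
move=> AX disj; have [P uP tP] := Schur A n_gt0.
have {}uP := unitarymx_unit uP.
pose L := P *m A *m invmx P; pose Y := P *m X.
have {tP} trigL : is_trig_mx L by rewrite /L -(pinvmxE uP).
have eigL i : eigenvalue A (L i i).
  rewrite eigenvalue_root_char -(char_poly_sim _ erefl (mulVmx uP)).
  by rewrite (char_poly_trig trigL) /root horner_prod (bigD1 i) //= !hornerE subrr mul0r.
have LY : L *m Y = Y *m B by rewrite /L /Y !mulmxA (mulmxKV uP) -!mulmxA AX.
have YE : Y = P *m X by [].
clearbody L Y.
suff rowY m : forall i : 'I_n, (i < m)%N -> row i Y = 0.
  have Y0 : Y = 0 by apply/row_matrixP => i; rewrite (rowY n i) ?row0.
  by rewrite -[X](mulKmx uP) -YE Y0 mulmx0.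
elim: m => // m IH i; rewrite ltnS leq_eqVlt => /orP[/eqP im|/IH//].
have rB : row i Y *m B = L i i *: row i Y.
  rewrite -row_mul -LY; apply/rowP => k; rewrite !mxE (bigD1 i) //= big1 ?addr0 // => l li.
  have [lm|lm|/val_inj lm] := ltngtP l i; last by rewrite lm eqxx in li.
    have /rowP/(_ k) : row l Y = 0 by apply: IH; rewrite -im.
    by rewrite !mxE => ->; rewrite mulr0.
  by move/is_trig_mxP: trigL => ->; rewrite // mul0r.
apply/eqP; apply: contraT => nz.
by have /negP[] := disj _ (eigL i); apply/eigenvalueP; exists (row i Y).
Qed.

Definition expanding A : Prop :=
  forall x : C, eigenvalue (cplx_mx A) x -> 1 < `|x|.

Lemma contracting_inv A x : A \in unitmx -> expanding A ->
  eigenvalue (cplx_mx (invmx A)^T) x -> `|x| < 1.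
Proof.
move=> uA eA; rewrite cplxT eigenvalue_tr => /eigenvalueP[v vA v0].
have uc : cplx_mx A \in unitmx by rewrite cplx_unit.
have vE : v = x *: (v *m cplx_mx A).
  by rewrite scalemxAl -vA cplxV mulmxKV.
have x0 : x != 0 by apply: contra v0 => /eqP x0; rewrite vE x0 scale0r.
have : 1 < `|x^-1|.
  apply: eA; apply/eigenvalueP; exists v => //.
  by rewrite [in RHS]vE scalerA mulVf // scale1r.
by rewrite normfV invf_gt1 ?normr_gt0.
Qed.

Lemma cplx_sylvester A B X : A *m X = X *m B ->
  (forall x : C, eigenvalue (cplx_mx A) x -> ~~ eigenvalue (cplx_mx B) x) -> X = 0.
Proof.
move=> AX disj; apply: (@cplx_inj R); rewrite cplx0; apply: sylvester disj.
by rewrite -!cplxM AX.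
Qed.

(** The off-diagonal blocks of [k] intertwine an expanding matrix with a contracting one, hence
    vanish by Sylvester's theorem. *)
Lemma levi_commute A A' k : A \in unitmx -> expanding A -> A' \in unitmx -> expanding A' ->
  levi A *m k = k *m levi A' -> axis_refl R n *m k = k *m axis_refl R n.
Proof.
move=> uA eA uA' eA'; rewrite -[k]submxK.
set a := ulsubmx k; set b := ursubmx k; set c := dlsubmx k; set d := drsubmx k.
rewrite /levi !mulmx_block !(mulmx0, mul0mx, addr0, add0r) => /eq_block_mx[_ e1 e2 _].
have b0 : b = 0.
  apply: cplx_sylvester e1 _ => x /eA x1; apply/negP => /(contracting_inv uA' eA').
  by move=> x2; have := lt_trans x1 x2; rewrite ltxx.
have c0 : c = 0.
  apply: cplx_sylvester e2 _ => x /(contracting_inv uA eA) x1; apply/negP => /eA' x2.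
  by have := lt_trans x1 x2; rewrite ltxx.
by rewrite b0 c0 !(mulmx0, mul0mx, mulmxN, mulNmx, mulmx1, mul1mx, oppr0).
Qed.

Lemma sigma_frame h s : Sp h -> lag_of (0 : 'M[R]_n) *m h^T *m s^T = lag_of 0 *m h^T ->
  lag_infty R n *m h^T *m s^T = - (lag_infty R n *m h^T) ->
  s = - (h *m axis_refl R n *m invmx h).
Proof.
move=> hS e0 ei; have uh := Sp_unit hS.
have hs : h^T *m s^T = - (axis_refl R n *m h^T).
  have one : col_mx (lag_infty R n) (lag_of (0 : 'M[R]_n)) = 1%:M.
    by rewrite /lag_infty /lag_of trmx0 -[col_mx _ _]/(block_mx _ _ _ _) -scalar_mx_block.
  rewrite -[h^T *m s^T]mul1mx -one mul_col_mx !mulmxA e0 ei.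
  have aE : axis_refl R n = col_mx (lag_infty R n) (- lag_of (0 : 'M[R]_n)).
    by rewrite /axis_refl /lag_infty /lag_of trmx0 opp_row_mx oppr0.
  by rewrite aE mul_col_mx opp_col_mx mulNmx opprK.
have sh : s *m h = - (h *m axis_refl R n).
  by apply: trmx_inj; rewrite trmx_mul hs linearN /= trmx_mul axis_refl_tr.
by rewrite -[s](mulmxK uh) sh mulNmx.
Qed.

(** Two normal forms of [g] differ by a block diagonal matrix, so [sigma] does not depend on the
    frame. *)
Lemma is_sigmaE h A g s : Sp h -> A \in unitmx -> expanding A ->
  g = h *m levi A *m invmx h -> is_sigma g s ->
  s = - (h *m axis_refl R n *m invmx h).
Proof.
move=> hS uA eA gE [Lm [Lp [[h' [A' [h'S uA' eA' gE' [ep em]]]] sm sp]]].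
have uh := Sp_unit hS; have uh' := Sp_unit h'S.
have uh'T : h'^T \in unitmx by rewrite unitmx_tr.
have [U uU UE] := eqmx_frame (row_freeM (lag_infty_free R n) uh'T) ep.
have [V uV VE] := eqmx_frame (row_freeM (lag_of_free _) uh'T) em.
have -> : s = - (h' *m axis_refl R n *m invmx h').
  apply: sigma_frame => //.
    by apply: (can_inj (mulKmx uV)); rewrite -VE -[in RHS]sm VE !mulmxA.
  by apply: (can_inj (mulKmx uU)); rewrite mulmxN -UE -sp UE !mulmxA.
pose k := invmx h *m h'.
have hk : h' = h *m k by rewrite /k mulKVmx.
have lk : levi A *m k = k *m levi A'.
  apply: (can_inj (mulKmx uh)); apply: (can_inj (mulmxK (etrans (unitmx_inv h') uh'))).
  rewrite /k !mulmxA mulmxV // mul1mx -gE' gE.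
  by rewrite -!mulmxA mulmxV // mulmx1.
have ck := levi_commute uA eA uA' eA' lk.
have uk : k \in unitmx by rewrite unitmx_mul unitmx_inv uh.
clearbody k; by rewrite hk invmxM // !mulmxA -(mulmxA h k) -ck !mulmxA mulmxK.
Qed.

Lemma sigma_commute h A g s k : Sp h -> A \in unitmx -> expanding A ->
  g = h *m levi A *m invmx h -> s = - (h *m axis_refl R n *m invmx h) ->
  g *m k = k *m g -> s *m k = k *m s.
Proof.
move=> hS uA eA gE sE gk; have uh := Sp_unit hS.
pose k' := invmx h *m k *m h.
have kE : k = h *m k' *m invmx h by rewrite /k' !mulmxA mulmxV // mul1mx mulmxK.
have ck : levi A *m k' = k' *m levi A.
  have {}gk := congr1 (fun M => invmx h *m M *m h) gk.
  clearbody k'; move: gk; rewrite gE kE !mulmxA mulVmx // !mul1mx.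
  by rewrite !(mulmxKV uh).
have := levi_commute uA eA uA eA ck => c.
clearbody k'; rewrite sE kE mulNmx mulmxN !mulmxA !(mulmxKV uh).
by rewrite -(mulmxA h _ k') -(mulmxA h k') c.
Qed.

Lemma axis_refl_sqr : axis_refl R n *m axis_refl R n = 1%:M.
Proof.
rewrite /axis_refl mulmx_block !(mulmx0, mul0mx, addr0, add0r, mulmx1).
by rewrite mulmxN mulNmx opprK mulmx1 -scalar_mx_block.
Qed.

Lemma sigma_sqr h s : Sp h -> s = - (h *m axis_refl R n *m invmx h) -> s *m s = 1%:M.
Proof.
move=> hS ->; have uh := Sp_unit hS.
rewrite mulNmx mulmxN opprK !mulmxA (mulmxKV uh) -(mulmxA h) axis_refl_sqr.
by rewrite mulmx1 mulmxV.
Qed.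

Lemma sigma_lag_infty h s : Sp h -> s = - (h *m axis_refl R n *m invmx h) ->
  (lag_infty R n *m h^T) *m s^T = (- 1) *: (lag_infty R n *m h^T).
Proof.
move=> hS ->; have uhT : h^T \in unitmx by rewrite unitmx_tr Sp_unit.
rewrite linearN /= !trmx_mul trmx_inv axis_refl_tr mulmxN !mulmxA mulmxK // scaleN1r; congr (- (_ *m _)).
by rewrite /lag_infty /axis_refl mul_row_block !(mulmx0, mul0mx, addr0, mulmx1).
Qed.

Lemma sigma_lag0 h s : Sp h -> s = - (h *m axis_refl R n *m invmx h) ->
  (lag_of (0 : 'M[R]_n) *m h^T) *m s^T = 1 *: (lag_of 0 *m h^T).
Proof.
move=> hS ->; have uhT : h^T \in unitmx by rewrite unitmx_tr Sp_unit.
rewrite linearN /= !trmx_mul trmx_inv axis_refl_tr mulmxN !mulmxA mulmxK // scale1r.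
rewrite -mulNmx; congr (_ *m _).
rewrite /lag_of /axis_refl trmx0 mul_row_block !(mulmx0, mul0mx, addr0, add0r).
by rewrite mul1mx opp_row_mx oppr0 opprK.
Qed.

Lemma eqmx_eigen (s : 'M[R]_(n + n)) (d : R) a b : row_free b -> (a :=: b)%MS ->
  b *m s^T = d *: b -> a *m s^T = d *: a.
Proof.
move=> fb ab bs; have [U _ ->] := eqmx_frame fb ab.
by rewrite -mulmxA bs scalemxAr.
Qed.

(* [h^-1 k] intertwines [levi A] with a block triangular matrix, so by
   Sylvester's theorem its lower left block vanishes *)
Lemma expanding_lagrangian h A g k P Q P' K : Sp h -> A \in unitmx -> expanding A ->
  g = h *m levi A *m invmx h -> k \in unitmx -> expanding P ->
  g *m k = k *m block_mx P Q 0 P' -> (K :=: lag_infty R n *m k^T)%MS ->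
  (K :=: lag_infty R n *m h^T)%MS.
Proof.
move=> hS uA eA gE uk eP gk eK; have uh := Sp_unit hS.
pose m := invmx h *m k.
have hm : k = h *m m by rewrite /m mulKVmx.
have um : m \in unitmx by rewrite unitmx_mul unitmx_inv uh.
have lm : levi A *m m = m *m block_mx P Q 0 P'.
  have e : h *m (levi A *m m) = k *m block_mx P Q 0 P' by rewrite -gk gE /m !mulmxA.
  by apply: (can_inj (mulKmx uh)); rewrite e [in RHS]mulmxA -hm.
clearbody m.
have c0 : dlsubmx m = 0.
  move: lm; rewrite -{1 2}[m]submxK /levi !mulmx_block !(mulmx0, mul0mx, addr0, add0r).
  move=> /eq_block_mx[_ _ e _]; apply: cplx_sylvester e _.
  move=> x /(contracting_inv uA eA) x1; apply/negP => /eP x2.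
  by have := lt_trans x1 x2; rewrite ltxx.
apply: eqmx_trans eK _; rewrite hm trmx_mul mulmxA.
have -> : lag_infty R n *m m^T = (ulsubmx m)^T *m lag_infty R n.
  rewrite -[m in LHS]submxK c0 tr_block_mx /lag_infty mul_row_block mul_mx_row trmx0.
  by rewrite !mulmx0 !mul0mx !addr0 mul1mx mulmx1.
rewrite -mulmxA; apply: eqmxMfull; rewrite row_full_unit unitmx_tr.
have dm : \det m = \det (ulsubmx m) * \det (drsubmx m).
  by rewrite -[in LHS](submxK m) c0 det_ublock.
by move: um; rewrite !unitmxE dm unitrM => /andP[].
Qed.

End ShilovHyperbolic.

(** * Continuity through real and imaginary parts *)

Section ComplexContinuity.
Variables (R : realType) (T : topologicalType).
Local Notation C := R[i].
Implicit Types f g : T -> C.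

Definition ccontinuous_at (x : T) f : Prop :=
  {for x, continuous (fun y => complex.Re (f y) : R)} /\
  {for x, continuous (fun y => complex.Im (f y) : R)}.

Lemma ccontinuous_cst x (c : C) : ccontinuous_at x (fun=> c).
Proof. by split; exact: cvg_cst. Qed.

Lemma ccontinuous_real x (f : T -> R) : {for x, continuous f} -> ccontinuous_at x (fun y => (f y)%:C%C).
Proof. by move=> cf; split=> //=; exact: cvg_cst. Qed.

Lemma ccontinuousD x f g : ccontinuous_at x f -> ccontinuous_at x g ->
  ccontinuous_at x (fun y => f y + g y).
Proof.
move=> [f1 f2] [g1 g2]; split.
  have -> : (fun y => complex.Re (f y + g y)) = fun y => complex.Re (f y) + complex.Re (g y).
    by apply/funext => y; case: (f y) (g y) => [? ?] [].
  exact: cvgD.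
have -> : (fun y => complex.Im (f y + g y)) = fun y => complex.Im (f y) + complex.Im (g y).
  by apply/funext => y; case: (f y) (g y) => [? ?] [].
exact: cvgD.
Qed.

Lemma ccontinuousM x f g : ccontinuous_at x f -> ccontinuous_at x g ->
  ccontinuous_at x (fun y => f y * g y).
Proof.
move=> [f1 f2] [g1 g2]; split.
  have -> : (fun y => complex.Re (f y * g y)) =
      fun y => complex.Re (f y) * complex.Re (g y) - complex.Im (f y) * complex.Im (g y).
    by apply/funext => y; case: (f y) (g y) => [? ?] [].
  by apply: cvgB; exact: cvgM.
have -> : (fun y => complex.Im (f y * g y)) =
    fun y => complex.Re (f y) * complex.Im (g y) + complex.Im (f y) * complex.Re (g y).
  by apply/funext => y; case: (f y) (g y) => [? ?] [].
by apply: cvgD; exact: cvgM.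
Qed.

Lemma ccontinuous_conj x f : ccontinuous_at x f -> ccontinuous_at x (fun y => conjc (f y)).
Proof.
move=> [f1 f2]; split.
  by have -> : (fun y => complex.Re (conjc (f y))) = (fun y => complex.Re (f y)) by
    apply/funext => y; case: (f y).
have -> : (fun y => complex.Im (conjc (f y))) = (fun y => - complex.Im (f y)) by
  apply/funext => y; case: (f y).
exact: cvgN.
Qed.

Lemma ccontinuous_sum x (I : Type) (r : seq I) (F : I -> T -> C) :
  (forall i, ccontinuous_at x (F i)) -> ccontinuous_at x (fun y => \sum_(i <- r) F i y).
Proof.
move=> cF; elim: r => [|i r IH].
  by under eq_fun do rewrite big_nil; exact: ccontinuous_cst.
by under eq_fun do rewrite big_cons; exact: ccontinuousD.
Qed.

Lemma ccontinuous_mulmx x (p q r : nat) (F : T -> 'M[C]_(p, q)) (G : T -> 'M[C]_(q, r)) :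
  (forall i j, ccontinuous_at x (fun y => F y i j)) ->
  (forall i j, ccontinuous_at x (fun y => G y i j)) ->
  forall i j, ccontinuous_at x (fun y => (F y *m G y) i j).
Proof.
move=> cF cG i j; under eq_fun do rewrite mxE.
by apply: ccontinuous_sum => k; exact: ccontinuousM.
Qed.

Lemma ccontinuous_adjmx x (p q : nat) (F : T -> 'M[C]_(p, q)) :
  (forall i j, ccontinuous_at x (fun y => F y i j)) ->
  forall i j, ccontinuous_at x (fun y => adjmx (F y) i j).
Proof.
move=> cF i j; under eq_fun do rewrite !mxE.
exact: ccontinuous_conj.
Qed.

End ComplexContinuity.

(** * Lagrangians approached by an orbit *)

Section LimitLagrangian.
Variables (R : realType) (n : nat).
Hypothesis n_gt0 : (0 < n)%N.
Local Notation C := R[i].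
Implicit Types (h g k t : 'M[R]_(n + n)) (A B X M P Q : 'M[R]_n) (K : 'M[R]_(n, n + n)).


Lemma adjmx_cauchy_schwarz (p : nat) (u v : 'rV[C]_p) :
  `|(u *m adjmx v) 0 0| ^+ 2 <= (u *m adjmx u) 0 0 * (v *m adjmx v) 0 0.
Proof.
set c := (u *m adjmx v) 0 0; set a := (u *m adjmx u) 0 0; set s := (v *m adjmx v) 0 0.
have s0 : 0 <= s by exact: mul_adjmx_diag.
have cc : (v *m adjmx u) 0 0 = conjc c by rewrite /c -[v in LHS]adjmxK -adjmxM !mxE.
have [sz|sz] := eqVneq s 0.
  suff -> : c = 0 by rewrite normr0 expr0n sz mulr0.
  have v0 : v = 0.
    apply/rowP => k; rewrite [RHS]mxE; move/eqP: sz; rewrite /s mxE psumr_eq0; last first.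
      by move=> l _; rewrite !mxE mulcJ_ge0.
    move/allP/(_ k); rewrite mem_index_enum => /(_ isT) /=.
    by rewrite !mxE mulf_eq0 conjc_eq0 orbb => /eqP.
  by rewrite /c v0 /adjmx /conj_mx map_mx0 trmx0 mulmx0 mxE.
have sp : 0 < s by rewrite lt_def sz s0.
have sr : conjc s = s.
  by move: s0; rewrite lecE /= => /andP[/eqP e _]; case: (s) e => x y /= ->; rewrite oppr0.
have := mul_adjmx_diag (s *: u - c *: v) 0.
have -> : adjmx (s *: u - c *: v) = s *: adjmx u - conjc c *: adjmx v.
  by rewrite adjmxD adjmxN /adjmx !conjZ !linearZ sr.
rewrite mulmxBl !mulmxBr -!scalemxAl -!scalemxAr !scalerA.
have -> : (((s * s) *: (u *m adjmx u) - (s * conjc c) *: (u *m adjmx v)) -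
   ((c * s) *: (v *m adjmx u) - (c * conjc c) *: (v *m adjmx v))) 0 0 =
   s * (a * s - c * conjc c).
  have E (M1 M2 M3 M4 : 'M[C]_1) (x1 x2 x3 x4 : C) :
      (x1 *: M1 - x2 *: M2 - (x3 *: M3 - x4 *: M4)) 0 0 =
      x1 * M1 0 0 - x2 * M2 0 0 - (x3 * M3 0 0 - x4 * M4 0 0) by rewrite !mxE.
  by rewrite E -/a -/c -/s cc; ring.
by rewrite pmulr_rge0 // subr_ge0 -sqr_normc.
Qed.

(** Fixes [l_infty] and moves 0 to [Id]; it puts the third Lagrangian of a maximal triple at 0. *)
Definition shear : 'M[R]_(n + n) := block_mx 1%:M 1%:M 0 1%:M.

Lemma shear_Sp : Sp shear.
Proof.
rewrite /Sp /= /shear /sympl_form tr_block_mx !trmx0 !trmx1 !mulmx_block.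
by rewrite !(mul0mx, mulmx0, mulmx1, mulmxN, mul1mx, mulNmx, oppr0, addr0, add0r) addNr.
Qed.

Lemma affine_bound (q kap : C) (y : nat -> C) : 0 <= q -> q < 1 -> y 0 = 0 ->
  (forall m, y m.+1 = q * y m + kap) -> forall m, `|y m| <= `|kap| / (1 - q).
Proof.
move=> q0 q1 y0 yS; have d0 : 0 < 1 - q by rewrite subr_gt0.
elim=> [|m IH]; first by rewrite y0 normr0 divr_ge0 // ltW.
rewrite yS; apply: le_trans (ler_normD _ _) _; rewrite normrM (ger0_norm q0).
have -> : `|kap| / (1 - q) = q * (`|kap| / (1 - q)) + `|kap|.
  by field; rewrite gt_eqF.
by rewrite lerD2r ler_wpM2l.
Qed.

Lemma omega_lag_infty0 : omega (lag_of (0 : 'M[R]_n)) (lag_of 1%:M) = - 1%:M.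
Proof. by rewrite omega_lag trmx0 sub0r. Qed.

(** With the first Lagrangian at infinity and the third at 0, maximality says that the middle one is
    negative. *)
Lemma maximal_infty k M K L L0 : Sp k -> (K :=: lag_infty R n *m k^T)%MS ->
  (L :=: lag_of M *m k^T)%MS -> (L0 :=: lag_of (0 : 'M[R]_n) *m k^T)%MS ->
  maximal_triple K L L0 -> exists V : 'M[R]_n, M^T = - (V *m V^T).
Proof.
move=> kS eK eL eL0 [g gS [ea eb ec]].
have ug : g^T \in unitmx by rewrite unitmx_tr Sp_unit.
have [U uU UE] := eqmx_frame (row_freeM (lag_infty_free R n) ug) (eqmx_trans (eqmx_sym eK) ea).
have [V _ VE] := eqmx_frame (row_freeM (lag_of_free _) ug) (eqmx_trans (eqmx_sym eL) eb).
have [W _ WE] := eqmx_frame (row_freeM (lag_of_free _) ug) (eqmx_trans (eqmx_sym eL0) ec).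
have UV : U *m V^T = 1%:M.
  by rewrite -(omega_infty M) -(omega_Sp _ _ kS) UE VE omegaM omega_Sp // omega_infty mulmx1.
have UW : U *m W^T = 1%:M.
  by rewrite -(omega_infty 0) -(omega_Sp _ _ kS) UE WE omegaM omega_Sp // omega_infty mulmx1.
have WV : W^T = V^T by apply: (can_inj (mulKmx uU)); rewrite UV.
exists V; rewrite -[LHS]subr0 -omega_lag -(omega_Sp _ _ kS) VE WE omegaM omega_Sp //.
by rewrite omega_lag_infty0 mulmxN mulmx1 mulNmx WV.
Qed.

Lemma maximal_chart K L L0 : maximal_triple K L L0 ->
  exists k, [/\ Sp k, (K :=: lag_infty R n *m k^T)%MS & (L0 :=: lag_of (0 : 'M[R]_n) *m k^T)%MS].
Proof.
move=> [g gS [ea _ ec]]; exists (g *m shear); split; first exact: Sp_mul gS shear_Sp.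
  rewrite trmx_mul mulmxA; suff -> : lag_infty R n *m shear^T = lag_infty R n by [].
  rewrite /lag_infty /shear tr_block_mx !trmx0 !trmx1 mul_row_block.
  by rewrite !(mul1mx, mulmx0, mul0mx, addr0).
rewrite trmx_mul mulmxA; suff -> : lag_of (0 : 'M[R]_n) *m shear^T = lag_of 1%:M by [].
rewrite /lag_of /shear tr_block_mx !trmx0 !trmx1 mul_row_block.
by rewrite !(mul1mx, mulmx0, mul0mx, addr0, add0r).
Qed.

Lemma Sp_upper k : Sp k -> dlsubmx k = 0 -> exists P Q,
  P \in unitmx /\ k = block_mx P Q 0 (invmx P)^T.
Proof.
move=> kS c0; exists (ulsubmx k), (ursubmx k); have kE : k = block_mx (ulsubmx k) (ursubmx k) 0 (drsubmx k).
  by rewrite -[LHS]submxK c0.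
move: kS; rewrite /Sp /=; rewrite [in X in X -> _]kE; move: (ulsubmx k) (ursubmx k) (drsubmx k) kE => P Q D kE.
rewrite /sympl_form tr_block_mx !trmx0 !mulmx_block.
rewrite !(mul0mx, mulmx0, mulmx1, mulmxN, mul1mx, mulNmx, oppr0, addr0, add0r).
move=> /eq_block_mx[_ PD _ _]; have [uPT uD] := mulmx1_unit PD.
have uP : P \in unitmx by rewrite -unitmx_tr.
split=> //; rewrite kE; congr block_mx; apply: (can_inj (mulKmx uPT)).
by rewrite PD -trmx_mul mulVmx // trmx1.
Qed.

Lemma levi_spectrum h A x (u : 'rV[C]_(n + n)) : Sp h -> A \in unitmx -> expanding A ->
  u != 0 -> u *m (cplx_mx (h *m levi A *m invmx h))^T = x *: u ->
  1 < `|x| \/ `|x| < 1.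
Proof.
move=> hS uA eA u0 ux; have uh : (cplx_mx h)^T \in unitmx by rewrite unitmx_tr cplx_unit Sp_unit.
pose z := u *m invmx (cplx_mx h)^T.
have z0 : z != 0.
  by apply: contra u0 => /eqP z0; rewrite -(mulmxKV uh u) -/z z0 mul0mx.
have zx : z *m (cplx_mx (levi A))^T = x *: z.
  apply: (can_inj (mulmxK uh)); rewrite -[in RHS]scalemxAl /z mulmxKV // -ux.
  by rewrite !cplxM cplxV !trmx_mul trmx_inv !mulmxA.
move: z0 zx; rewrite -[z]hsubmxK; move: (lsubmx z) (rsubmx z) => z1 z2 z0.
rewrite /levi /cplx_mx map_block_mx !map_mx0 tr_block_mx !trmx0 mul_row_block.
rewrite !mulmx0 addr0 add0r scale_row_mx => /eq_row_mx[e1 e2].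
have [z10|z10] := eqVneq z1 0; [right|left].
  have z20 : z2 != 0 by apply: contra z0 => /eqP ->; rewrite z10 row_mx0.
  apply: (contracting_inv uA eA); rewrite -eigenvalue_tr.
  by apply/eigenvalueP; exists z2.
by apply: eA; rewrite -eigenvalue_tr; apply/eigenvalueP; exists z1.
Qed.

(* In a chart where [K] is at infinity and [L 0] at zero, [g] acts on the
   symmetric matrices of the [L m] by [M |-> P M P^T + P Q^T].  An eigenvector
   [v] of [P] with an eigenvalue inside the unit disc makes [v M v^*] bounded
   along the orbit, while [M^-1] comes arbitrarily close to 0 near [K]. *)
Lemma limit_lagrangian h A g K (L : nat -> 'M[R]_(n, n + n)) : Sp h ->
  A \in unitmx -> expanding A -> g = h *m levi A *m invmx h -> row_free K ->
  (K *m g^T :=: K)%MS -> (forall m, (L m.+1 :=: L m *m g^T)%MS) ->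
  (forall m, maximal_triple K (L m.+1) (L 0)) ->
  (forall U : set 'M[R]_(n, n + n), nbhs K U ->
    exists m, exists2 Z : 'M[R]_n, Z \in unitmx & U (Z *m L m.+1)) ->
  (K :=: lag_infty R n *m h^T)%MS.
Proof.
move=> hS uA eA gE fK Kg Lg mt acc.
have [k [kS eK eL0]] := maximal_chart (mt 0).
have uk := Sp_unit kS; have ukT : k^T \in unitmx by rewrite unitmx_tr.
have gS : Sp g by rewrite gE; apply: Sp_mul (Sp_inv hS); exact: Sp_mul (levi_Sp uA).
pose kg := invmx k *m g *m k.
have kgS : Sp kg by apply: (Sp_mul _ kS); exact: Sp_mul (Sp_inv kS) gS.
have kkg : g *m k = k *m kg by rewrite /kg !mulmxA mulmxV // mul1mx.
have dl0 : dlsubmx kg = 0.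
  have e : (lag_infty R n *m k^T *m g^T :=: lag_infty R n *m k^T)%MS.
    by apply: eqmx_trans (eqmxMr _ (eqmx_sym eK)) _; apply: eqmx_trans Kg _.
  have [Z _] := eqmx_frame (row_freeM (lag_infty_free R n) ukT) e.
  rewrite -mulmxA -trmx_mul kkg trmx_mul !mulmxA => /(can_inj (mulmxK ukT)).
  rewrite -[kg]submxK block_mxKdl tr_block_mx /lag_infty mul_row_block mul_mx_row.
  rewrite !(mul1mx, mul0mx, mulmx0, addr0) => /eq_row_mx[_ z].
  by apply: trmx_inj; rewrite z trmx0.
have [P [Q [uP kgE]]] := Sp_upper kgS dl0.
apply: (expanding_lagrangian n_gt0 hS uA eA gE uk _ (etrans kkg (congr1 (mulmx k) kgE)) eK).
(* A row eigenvector of [P^T], completed by 0 and moved by [k^T], is one of [g^T]; so no eigenvalue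
   of [P] lies on the unit circle. *)
have eP x : eigenvalue (cplx_mx P) x -> 1 < `|x| \/ `|x| < 1.
  rewrite -eigenvalue_tr => /eigenvalueP[u ux u0].
  pose w := row_mx u 0 *m (cplx_mx k)^T.
  have uck : (cplx_mx k)^T \in unitmx by rewrite unitmx_tr cplx_unit.
  apply: (@levi_spectrum h A x w hS uA eA).
    apply: contra u0 => /eqP w0; have : row_mx u 0 = 0 :> 'rV[C]_(n + n).
      by rewrite -[LHS](mulmxK uck) -/w w0 mul0mx.
    by rewrite -[RHS](row_mx0 _ _ n n) => /eq_row_mx[->].
  rewrite -gE /w -mulmxA -trmx_mul -cplxM kkg cplxM trmx_mul mulmxA scalemxAl; congr (_ *m _).
  rewrite kgE /cplx_mx map_block_mx map_mx0 tr_block_mx trmx0 mul_row_block.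
  by rewrite !(mul0mx, mulmx0, addr0) ux scale_row_mx scaler0.
move=> x xP; have [//|x1] := eP x xP; exfalso.
have /eigenvalueP[v vP v0] := xP.
pose M := fix M m := if m is m'.+1 then P *m M m' *m P^T + P *m Q^T else 0.
have eL m : (L m :=: lag_of (M m)^T *m k^T)%MS.
  elim: m => [|m IH]; first by rewrite /= trmx0.
  apply: eqmx_trans (Lg m) _; apply: eqmx_trans (eqmxMr _ IH) _.
  rewrite -mulmxA -trmx_mul kkg trmx_mul mulmxA.
  have -> : lag_of (M m)^T *m kg^T = invmx P *m lag_of (M m.+1)^T.
    rewrite kgE /lag_of !trmxK tr_block_mx trmx0 trmxK mul_row_block mul_mx_row /=.
    rewrite !(mul1mx, mulmx0, mulmx1, add0r) mulmxDr !mulmxA mulVmx // !mul1mx //.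
  by rewrite -mulmxA; apply: eqmxMfull; rewrite row_full_unit unitmx_inv.
have neg m : exists V : 'M[R]_n, M m.+1 = - (V *m V^T).
  have [V VE] := maximal_infty kS eK (eL m.+1) eL0 (mt m).
  by exists V; rewrite -VE trmxK.
(* As [v P = x v], this sequence satisfies [y (m + 1) = |x|^2 y m + kappa] with a constant [kappa],
   and a geometric series bounds it. *)
pose y m := (v *m cplx_mx (M m) *m adjmx v) 0 0.
have yB m : `|y m| <= `|(v *m cplx_mx (P *m Q^T) *m adjmx v) 0 0| / (1 - `|x| ^+ 2).
  apply: affine_bound; rewrite ?exprn_ge0 ?exprn_ilt1 //.
    by rewrite /y /= cplx0 mulmx0 mul0mx mxE.
  move=> l; rewrite /y /= cplxD mulmxDr mulmxDl [LHS]mxE; congr (_ + _).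
  have -> : v *m cplx_mx (P *m M l *m P^T) *m adjmx v =
      (v *m cplx_mx P) *m cplx_mx (M l) *m adjmx (v *m cplx_mx P).
    by rewrite adjmxM adjmx_cplx !cplxM !mulmxA.
  rewrite vP adjmxZ -!scalemxAl -scalemxAr scalerA [LHS]mxE; congr (_ * _).
  by rewrite sqr_normc.
set B := _ / _ in yB.
have [U0 uU0 U0E] := eqmx_frame (row_freeM (lag_infty_free R n) ukT) eK.
pose u := v *m invmx (cplx_mx U0).
pose X (l : 'M[R]_(n, n + n)) := u *m cplx_mx (l *m invmx k^T) *m cplx_mx (col_mx 1%:M 0).
pose Z (l : 'M[R]_(n, n + n)) := u *m cplx_mx (l *m invmx k^T) *m cplx_mx (col_mx 0 1%:M).
(* A test function that is defined on all frames and does not invert [M]. At [K] it is the fourth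
   power of the norm of [v]; on a frame of a member of the orbit it is [|p q^*|^2 - B |p|^2], which
   is at most 0 by Cauchy-Schwarz as [|q|^2 <= B]. *)
pose F l := complex.Re ((X l *m adjmx v) 0 0 * conjc ((X l *m adjmx v) 0 0) +
  B * (X l *m adjmx (Z l)) 0 0).
have FK : 0 < F K.
  have XK : X K = v.
    rewrite /X U0E mulmxA mulmxK // cplxM mulmxA /u mulmxKV ?cplx_unit //.
    rewrite -mulmxA -cplxM /lag_infty mul_row_col mulmx1 mul0mx addr0 cplx1 mulmx1 //.
  have ZK : Z K = 0.
    by rewrite /Z U0E mulmxA mulmxK // -mulmxA -cplxM /lag_infty
      -[U0 *m _ *m _]mulmxA mul_row_col mulmx0 mul0mx addr0 mulmx0 cplx0 mulmx0.
  rewrite /F XK ZK /adjmx /conj_mx map_mx0 trmx0 mulmx0 [X in B * X]mxE mulr0 addr0.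
  rewrite -/(conj_mx v) -/(adjmx v).
  have : 0 < (v *m adjmx v) 0 0.
    rewrite lt_def mul_adjmx_diag andbT; apply: contra v0 => /eqP; rewrite mxE => /eqP.
    rewrite psumr_eq0; last by move=> l _; rewrite !mxE mulcJ_ge0.
    move/allP => H; apply/eqP/rowP => l; have := H l; rewrite mem_index_enum => /(_ isT) /=.
    by rewrite !mxE mulf_eq0 conjc_eq0 orbb => /eqP.
  by rewrite ltcE /= => /andP[/eqP]; case: (_ 0 0) => a b /= -> a0; rewrite oppr0 mulr0 subr0 mulr_gt0.
have cF : {for K, continuous F}.
  have cl N i j : ccontinuous_at K (fun l : 'M[R]_(n, n + n) => (u *m cplx_mx (l *m invmx k^T) *m N) i j).
    apply: ccontinuous_mulmx => [{}i {}j|i' j']; last exact: ccontinuous_cst.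
    apply: ccontinuous_mulmx => [i' j'|{}i {}j]; first exact: ccontinuous_cst.
    under eq_fun do rewrite cplxM.
    apply: ccontinuous_mulmx => [{}i {}j|i' j']; last exact: ccontinuous_cst.
    under eq_fun do rewrite mxE.
    by apply: ccontinuous_real; exact: coord_continuous.
  have cX i j : ccontinuous_at K (fun l => X l i j) by exact: cl.
  have cZ i j : ccontinuous_at K (fun l => Z l i j) by exact: cl.
  have cXv : ccontinuous_at K (fun l => (X l *m adjmx v) 0 0).
    by apply: ccontinuous_mulmx; [exact: cX|move=> i j; exact: ccontinuous_cst].
  have [] : ccontinuous_at K (fun l => (X l *m adjmx v) 0 0 * conjc ((X l *m adjmx v) 0 0) +
    B * (X l *m adjmx (Z l)) 0 0); last by [].
  apply: ccontinuousD; first by apply: ccontinuousM => //; exact: ccontinuous_conj.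
  apply: ccontinuousM; first exact: ccontinuous_cst.
  by apply: ccontinuous_mulmx; [exact: cX|exact: ccontinuous_adjmx cZ].
have [m [W uW]] := acc _ (cvgr_gt _ cF _ FK).
have [V VE] := neg m.
have [W' W'E] := eqmx_frame (row_freeM (lag_of_free _) ukT) (eL m.+1).
move=> ->; rewrite mulmxA; move: (W *m W') => {uW}W.
pose z := u *m cplx_mx W; pose p := z *m cplx_mx V; pose q := v *m cplx_mx V.
have XE : X (W *m (lag_of (M m.+1)^T *m k^T)) = - (p *m cplx_mx V^T).
  rewrite /X mulmxA mulmxK // -mulmxA -cplxM -[W *m _ *m _]mulmxA /lag_of trmxK mul_row_col.
  by rewrite mulmx1 mulmx0 addr0 VE mulmxN cplxN mulmxN /p /z !cplxM !mulmxA.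
have ZE : Z (W *m (lag_of (M m.+1)^T *m k^T)) = z.
  rewrite /Z mulmxA mulmxK // -mulmxA -cplxM -[W *m _ *m _]mulmxA /lag_of mul_row_col.
  by rewrite mul1mx mulmx0 add0r mulmx1.
rewrite /F XE ZE.
have pE : adjmx p = cplx_mx V^T *m adjmx z by rewrite adjmxM adjmx_cplx.
have qE : adjmx q = cplx_mx V^T *m adjmx v by rewrite adjmxM adjmx_cplx.
have qv : q = v *m cplx_mx V by [].
clearbody p q z.
have e1 : - (p *m cplx_mx V^T) *m adjmx v = - (p *m adjmx q) by rewrite mulNmx qE mulmxA.
have e2 : - (p *m cplx_mx V^T) *m adjmx z = - (p *m adjmx p) by rewrite mulNmx pE mulmxA.
rewrite e1 e2 [in X in complex.Re X]mxE [(- (p *m adjmx p)) 0 0]mxE.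
rewrite rmorphN mulrNN mulrN -sqr_normc => F0.
have qB : (q *m adjmx q) 0 0 <= B.
  have := yB m.+1; rewrite /y VE cplxN mulmxN mulNmx cplxM.
  have -> : v *m (cplx_mx V *m cplx_mx V^T) *m adjmx v = q *m adjmx q.
    by rewrite qE qv !mulmxA.
  by rewrite mxE normrN ger0_norm // mul_adjmx_diag.
have := adjmx_cauchy_schwarz p q; set pq := `|_| ^+ 2 in F0 *.
move/le_trans => /(_ _ (ler_wpM2l (mul_adjmx_diag p 0) qB)).
rewrite mulrC -subr_ge0 lecE /= => /andP[_]; move: F0.
case: pq (B * _) => [a1 a2] [b1 b2] /=; lra.
Qed.

End LimitLagrangian.

(** * The circle at infinity *)

Section Circle.
Variable R : realType.
Local Notation C := R[i].
Implicit Types (t u x y r d : R) (z w : C).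

Lemma conjcM z w : conjc (z * w) = conjc z * conjc w.
Proof. exact: rmorphM. Qed.

Lemma conjcN z : conjc (- z) = - conjc z.
Proof. exact: rmorphN. Qed.

Lemma conjcD z w : conjc (z + w) = conjc z + conjc w.
Proof. exact: rmorphD. Qed.

Lemma conjcV z : conjc z^-1 = (conjc z)^-1.
Proof. exact: fmorphV. Qed.

Lemma cisD t u : cis (t + u) = cis t * cis u.
Proof. by rewrite /cis cosD sinD; apply/eqP; rewrite eq_complex /=; apply/andP; split; apply/eqP; ring. Qed.

Lemma cis_conj t : cis t * conjc (cis t) = 1.
Proof.
rewrite /cis; apply/eqP; rewrite eq_complex /=; apply/andP; split; apply/eqP; last by ring.
by rewrite mulrN opprK -!expr2 cos2Dsin2.
Qed.

Lemma cis_neq0 t : cis t != 0.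
Proof. by apply/eqP => z; have := cis_conj t; rewrite z mul0r => /eqP; rewrite eq_sym oner_eq0. Qed.

Lemma cis_surj z : z * conjc z = 1 -> exists2 t, 0 <= t < 2 * pi & z = cis t.
Proof.
case: z => x y /eqP; rewrite eq_complex /= mulrN opprK => /andP[/eqP xy _].
have xy2 : x ^+ 2 + y ^+ 2 = 1 by rewrite !expr2.
have x1 : -1 <= x <= 1 by apply/andP; split; nra.
have p0 := pi_gt0 R.
have [y0|y0] := leP 0 y.
  exists (acos x); first by rewrite acos_ge0 //=; apply: le_lt_trans (acos_lepi x1) _; lra.
  rewrite /cis acosK // sin_acos //; congr Complex.
  by rewrite (_ : 1 - x ^+ 2 = y ^+ 2) ?sqrtr_sqr ?ger0_norm //; lra.
have xlt1 : x < 1 by nra.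
have a0 : 0 < acos x by apply: acos_gt0; lra.
have api := acos_lepi x1.
exists (- acos x + pi *+ 2); first by rewrite -mulr_natl; lra.
rewrite /cis cosD2pi sinD2pi cosN sinN acosK // sin_acos //; congr Complex.
by rewrite (_ : 1 - x ^+ 2 = y ^+ 2) ?sqrtr_sqr ?ltr0_norm ?opprK //; lra.
Qed.

(* a point of the circle other than [cis t], with the coordinate [x] for which
   [cis t] is at infinity; [x] tends to [+oo] when [cis t] is approached from
   the right *)
Definition pt t x : R := t + (pi - 2 * atan x).

Lemma pt_bounds t x : t < pt t x < t + 2 * pi.
Proof.
have := atan_ltpi2 x; have := atan_gtNpi2 x; rewrite /pt => h1 h2.
by apply/andP; split; lra.
Qed.

Lemma pt_lt t x y : x < y -> pt t y < pt t x.
Proof. by move=> /lt_atan; rewrite /pt; lra. Qed.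

Lemma pt_near t (eps : R) : 0 < eps -> exists x0, forall x, x0 < x -> pt t x < t + eps.
Proof.
move=> e0; pose e := Num.min eps 1; have p0 := pi_gt0 R; have p2 := pi_ge2 R.
have e1 : 0 < e by rewrite lt_min e0 ltr01.
have e2 : e <= 1 by rewrite ge_min lexx orbT.
have e3 : e <= eps by rewrite ge_min lexx.
exists (tan (pi / 2 - e / 2)) => x /lt_atan; rewrite tanK.
  by rewrite /pt => h; lra.
by rewrite in_itv /=; apply/andP; split; lra.
Qed.

(** The coordinate is the Cayley one: the point is [cis t] times [(x + i) / (x - i)]. *)
Lemma cis_pt t x : cis (pt t x) * (Complex x (- 1)) = cis t * Complex x 1.
Proof.
rewrite /pt cisD -mulrA; congr (_ * _).
have [c0 cc] : 0 < cos (atan x) /\ cos (atan x) ^+ 2 * (1 + x ^+ 2) = 1.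
  have x0 : 0 < 1 + x ^+ 2 by rewrite ltr_wpDr ?sqr_ge0.
  rewrite cos_atan invr_gt0 sqrtr_gt0; split=> //.
  by rewrite exprVn sqr_sqrtr ?mulVf ?gt_eqF // ltW.
have sE : sin (atan x) = x * cos (atan x).
  by rewrite -{2}[x]atanK /tan mulfVK // gt_eqF.
have -> : pi - 2 * atan x = - (atan x + atan x) + pi by ring.
rewrite /cis cosDpi sinDpi cosN sinN cosD sinD sE.
move: (cos (atan x)) cc => c cc.
have c2 : c ^+ 2 = (1 + x ^+ 2)^-1.
  have nz : 1 + x ^+ 2 != 0 by rewrite gt_eqF // ltr_wpDr ?sqr_ge0.
  by apply: (mulIf nz); rewrite cc mulVf.
have nz : 1 + x ^+ 2 != 0 by rewrite gt_eqF // ltr_wpDr ?sqr_ge0.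
apply/eqP; rewrite eq_complex /=; apply/andP; split; apply/eqP.
  transitivity (x * (c ^+ 2 * (1 + x ^+ 2))); first by ring.
  by rewrite cc mulr1.
transitivity (c ^+ 2 * (1 + x ^+ 2)); first by ring.
exact: cc.
Qed.

Lemma Complex_unit x y : y != 0 -> Complex x y != 0.
Proof. by move=> y0; rewrite eq_complex /= (negPf y0) andbF. Qed.

Lemma pt_inj t x y : cis (pt t x) = cis (pt t y) -> x = y.
Proof.
move=> e; have N1 : -1 != 0 :> R by rewrite oppr_eq0 oner_eq0.
have := cis_pt t x; rewrite e => ex; have ey := cis_pt t y.
have : Complex x 1 * Complex y (- 1) = Complex y 1 * Complex x (- 1).
  apply: (mulfI (cis_neq0 t)); rewrite !mulrA -ex -ey; ring.
by move=> /eqP; rewrite eq_complex /= => /andP[_ /eqP]; lra.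
Qed.

Lemma cis_arc t z : z * conjc z = 1 -> z != cis t ->
  exists2 u, t < u < t + 2 * pi & z = cis u.
Proof.
move=> z1 zt; have [|u u0 uE] := @cis_surj (z * conjc (cis t)).
  by rewrite conjcM conjcK mulrACA z1 mul1r mulrC cis_conj.
have zE : z = cis (t + u).
  by rewrite cisD -uE mulrCA cis_conj mulr1.
exists (t + u) => //; have [u0'|u0'] := eqVneq u 0; last by move/eqP: u0'; lra.
by move: zt; rewrite zE u0' addr0 eqxx.
Qed.

Implicit Types ab : C * C.

Lemma mobius_circle ab t : SU11 ab -> exists u, mobius ab (cis t) = cis u.
Proof.
case: ab => a b; rewrite /SU11 /mobius /= => H.
have [|u _ ->] := @cis_surj ((a * cis t + b) / (conjc b * cis t + conjc a)); last by exists u.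
have cc := cis_conj t; set z := cis t in cc *.
have E : (a * z + b) * conjc (a * z + b) = (conjc b * z + conjc a) * conjc (conjc b * z + conjc a).
  rewrite !conjcD !conjcM !conjcK.
  transitivity (a * conjc a * (z * conjc z) + a * z * conjc b + b * conjc a * conjc z + b * conjc b); first by ring.
  by rewrite cc; transitivity (b * conjc b * (z * conjc z) + a * z * conjc b + b * conjc a * conjc z + a * conjc a); [rewrite cc; ring|ring].
have D0 : conjc b * z + conjc a != 0.
  apply/eqP => D0; have N0 : a * z + b = 0.
    by move: E; rewrite D0 mul0r => /eqP; rewrite mulf_eq0 conjc_eq0 orbb => /eqP.
  have bE : b = - (a * z) by apply/eqP; rewrite -addr_eq0 addrC N0.
  have : a * conjc a - b * conjc b = 0.
    by rewrite bE conjcN conjcM mulrNN mulrACA cc mulr1 subrr.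
  by rewrite H => /eqP; rewrite oner_eq0.
have cD0 : conjc (conjc b * z + conjc a) != 0 by rewrite conjc_eq0.
rewrite conjcM conjcV mulrACA E -invfM mulfV //.
by rewrite mulf_neq0.
Qed.

(** The algebra of the next lemma, with [a'], [b'] for the conjugates and [c] for the denominator at
    the fixed point [z]: in the Cayley coordinate the map is affine. *)
Lemma axis_action (F : fieldType) (a a' b b' c z w X X' i : F) :
  b = z * (c - a) -> b' * z = c - a' -> c * (a + a' - c) = 1 ->
  X' = c ^+ 2 * X + i * (a - a') * c -> w * (X - i) = z * (X + i) ->
  (a * w + b) * (X - i) * c ^+ 2 = z * (c * (X' + i)) /\
  (b' * w + a') * (X - i) * c ^+ 2 = c * (X' - i).
Proof.
move=> bE bz cY XE wE; have iY : i = i * (c * (a + a' - c)) by rewrite cY mulr1.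
split.
  rewrite [(a * w + b) * _]mulrDl -[a * w * _]mulrA wE bE XE [X in c * (_ + X)]iY.
  by ring.
rewrite [(b' * w + a') * _]mulrDl -[b' * w * _]mulrA wE mulrA bz XE [X in c * (_ - X)]iY.
by ring.
Qed.

Lemma mobius_axis ab t : SU11 ab -> mobius ab (cis t) = cis t ->
  exists r d, [/\ 0 < r, r = 1 -> d = 0 -> ab.2 = 0 &
    forall x, mobius ab (cis (pt t x)) = cis (pt t (r * x + d))].
Proof.
case: ab => a b; rewrite /SU11 /mobius /= => H fx.
set z := cis t in fx; have z0 : z != 0 := cis_neq0 t.
pose c := conjc b * z + conjc a.
have c0 : c != 0 by apply/eqP => c0; move: fx; rewrite -/c c0 invr0 mulr0 => /eqP; rewrite eq_sym (negPf z0).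
have fz : a * z + b = z * c by rewrite -[LHS](mulfVK c0) fx.
have cc := cis_conj t; rewrite -/z in cc.
have cr : conjc c = c.
  rewrite /c conjcD conjcM !conjcK.
  apply: (mulIf z0); rewrite mulrDl -mulrA [conjc z * z]mulrC cc mulr1 addrC fz.
  by rewrite /c mulrC.
have bz : conjc b * z = c - conjc a by rewrite /c addrK.
have bz' : b = z * (c - a).
  by rewrite mulrBr -fz [z * a]mulrC addrC addKr.
(* [c] is an eigenvalue of a matrix of determinant 1 and trace [a + conjc a]; by [cr] it is real, so
   the ratio [c^2] is positive. *)
have key : c * (a + conjc a - c) = 1.
  rewrite -H; have -> : b * conjc b = (c - a) * (c - conjc a) by rewrite -bz bz'; ring.
  ring.
pose be := complex.Im a; pose cR := complex.Re c.
have cE : c = cR%:C%C.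
  by move: cr; rewrite /cR; case: (c) => u v /eqP; rewrite eq_complex /= => /andP[_ /eqP h]; apply/eqP; rewrite eq_complex /= eqxx; apply/eqP; lra.
have cR0 : cR != 0 by apply: contra c0; rewrite cE => /eqP ->.
exists (cR ^+ 2), (- (2 * be * cR)); split; first by rewrite exprn_even_gt0.
  move=> c1 d0; have be0 : be = 0.
    by move/eqP: d0; rewrite oppr_eq0 !mulf_eq0 (negPf cR0) pnatr_eq0 orbF => /eqP.
  have ca : conjc a = a by move: be0; rewrite /be; case: (a) => al be1 /= ->; rewrite oppr0.
  have cc1 : c * c = 1 by rewrite cE -rmorphM -expr2 c1.
  have e : 2%:R * (c * (a - c)) = 0.
    transitivity (c * (a + a - c) - c * c); first by ring.
    by move: key; rewrite ca cc1 => ->; rewrite subrr.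
  move/eqP: e; rewrite !mulf_eq0 pnatr_eq0 (negPf c0) subr_eq0 => /eqP e.
  by rewrite bz' e subrr mulr0.
move=> x; set x' := cR ^+ 2 * x - _.
have N1 : -1 != 0 :> R by rewrite oppr_eq0 oner_eq0.
have nx := Complex_unit x N1; have nx' := Complex_unit x' N1.
have p1 := cis_pt t x; have p2 := cis_pt t x'; rewrite -/z in p1 p2.
set w := cis (pt t x) in p1 *; set w' := cis (pt t x') in p2 *.
have aE : a - conjc a = 2%:R * 'i%C * be%:C%C.
  by rewrite /be; case: (a) => al b0; apply/eqP; rewrite eq_complex /=; apply/andP; split; apply/eqP; ring.
have x'E : x'%:C%C = c ^+ 2 * x%:C%C + 'i%C * (a - conjc a) * c.
  rewrite aE cE; apply/eqP; rewrite eq_complex /=; apply/andP; split; apply/eqP; rewrite /x'; ring.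
have plus y : Complex y 1 = y%:C%C + 'i%C by apply/eqP; rewrite eq_complex /= addr0 add0r !eqxx.
have minus y : Complex y (- 1) = y%:C%C - 'i%C.
  by apply/eqP; rewrite eq_complex /= subr0 sub0r !eqxx.
have c2 : c ^+ 2 != 0 by rewrite expf_neq0.
have wE : w * (x%:C%C - 'i%C) = z * (x%:C%C + 'i%C) by rewrite -plus -minus.
have [N1' D1'] := axis_action bz' bz key x'E wE.
have NE : (a * w + b) * Complex x (- 1) = z * (c * Complex x' 1) / c ^+ 2.
  by rewrite plus minus -N1' mulfK.
have DE : (conjc b * w + conjc a) * Complex x (- 1) = c * Complex x' (- 1) / c ^+ 2.
  by rewrite !minus -D1' mulfK.
have D0 : conjc b * w + conjc a != 0.
  apply/eqP => D0; move/eqP: DE; rewrite D0 mul0r eq_sym mulf_eq0 invr_eq0 expf_eq0 /=.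
  by rewrite mulf_eq0 (negPf c0) (negPf nx').
apply: (mulIf D0); rewrite mulfVK //; apply: (mulIf nx); rewrite NE -[RHS]mulrA DE.
by rewrite [RHS]mulrA [in RHS]mulrCA p2 [z * (c * _)]mulrCA.
Qed.

(** With [q = conjc b * z], fixed points solve [q^2 - 2 i Im(a) q = |b|^2]. If [Re(a)^2 >= 1] the
    roots have modulus [|b|], which puts [z] on the circle; otherwise both are imaginary with
    product of modulus [|b|^2], and the smaller one puts [z] in the disc. *)
Lemma SU11_fixed ab : SU11 ab ->
  (exists z, z * conjc z < 1 /\ mobius ab z = z) \/ exists t, mobius ab (cis t) = cis t.
Proof.
case: ab => a b; rewrite /SU11 /mobius /= => H.
have [b0|b0] := eqVneq b 0.
  by left; exists 0; rewrite mul0r ltr01 b0 mulr0 add0r mul0r.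
pose be := complex.Im a; pose al := complex.Re a; pose N : R := complex.Re b ^+ 2 + complex.Im b ^+ 2.
have NE : b * conjc b = N%:C%C.
  by rewrite /N; case: (b) => u v; apply/eqP; rewrite eq_complex /=; apply/andP; split; apply/eqP; ring.
have N0 : 0 < N.
  have : N%:C%C != 0 :> C by rewrite -NE mulf_neq0 // conjc_eq0.
  by rewrite lt_def addr_ge0 ?sqr_ge0 // andbT; apply: contra => /eqP ->.
have aE : a = Complex al be by rewrite /al /be; case: (a).
have ab1 : al ^+ 2 + be ^+ 2 = N + 1.
  apply/eqP; rewrite addrC -subr_eq; apply/eqP.
  have : (al ^+ 2 + be ^+ 2 - N)%:C%C = 1 :> C.
    rewrite -H NE aE; apply/eqP; rewrite eq_complex /=; apply/andP; split; apply/eqP; ring.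
  by move/eqP; rewrite eq_complex /= => /andP[/eqP + _]; lra.
have cb0 : conjc b != 0 by rewrite conjc_eq0.
have fixq q : conjc b * q + conjc a != 0 -> (conjc b * q) ^+ 2 - (a - conjc a) * (conjc b * q) = b * conjc b ->
    (a * q + b) / (conjc b * q + conjc a) = q.
  move=> D0 Q; apply: (mulIf D0); rewrite mulfVK //; apply: (mulIf cb0).
  by rewrite mulrDl -Q; ring.
have [s1|s1] := leP 1 (al ^+ 2); [right|left].
  pose s := Num.sqrt (al ^+ 2 - 1); have ss : s ^+ 2 = al ^+ 2 - 1 by rewrite sqr_sqrtr // subr_ge0.
  pose q := Complex s be / conjc b.
  have [|t _ tE] := @cis_surj q.
    rewrite /q conjcM conjcV conjcK mulrACA -invfM [conjc b * b]mulrC NE.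
    have -> : Complex s be * conjc (Complex s be) = N%:C%C.
      apply/eqP; rewrite eq_complex /=; apply/andP; split; apply/eqP; last by ring.
      by rewrite mulrN opprK -!expr2 ss; lra.
    by rewrite mulfV // eq_complex /= gt_eqF.
  have qE : conjc b * q = Complex s be by rewrite /q mulrC mulfVK.
  exists t; rewrite -tE; apply: fixq.
    rewrite qE aE eq_complex /= subrr eqxx andbT; apply/eqP => z.
    have : s ^+ 2 = al ^+ 2 by rewrite (_ : s = - al) ?sqrrN //; lra.
    by rewrite ss; lra.
  rewrite qE NE aE; apply/eqP; rewrite eq_complex /=; apply/andP; split; apply/eqP; last by ring.
  have e : s * s + be * be = N by rewrite -!expr2 ss; lra.
  by rewrite ?expr2 /=; lra.
pose s := Num.sqrt (1 - al ^+ 2); have ss : s ^+ 2 = 1 - al ^+ 2 by rewrite sqr_sqrtr // subr_ge0 ltW.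
have s0 : 0 < s by rewrite sqrtr_gt0 subr_gt0.
have bs : be ^+ 2 = N + s ^+ 2 by lra.
have [r [rr r1]] : exists r, r ^+ 2 - 2 * be * r = - N /\ r ^+ 2 < N.
  have [b1|b1] := leP 0 be.
    by exists (be - s); split; nra.
  by exists (be + s); split; nra.
pose q := Complex 0 r / conjc b.
have qE : conjc b * q = Complex 0 r by rewrite /q mulrC mulfVK.
exists q; split.
  rewrite /q conjcM conjcV conjcK mulrACA -invfM [conjc b * b]mulrC NE.
  have -> : Complex 0 r * conjc (Complex 0 r) = (r ^+ 2)%:C%C.
    by apply/eqP; rewrite eq_complex /=; apply/andP; split; apply/eqP; ring.
  rewrite -fmorphV -rmorphM /= (@ltcR _ _ 1) ltr_pdivrMr // mul1r //.
apply: fixq.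
  rewrite qE aE eq_complex /= add0r negb_and; have [al0|//] := eqVneq al 0 => /=.
  apply/eqP => z; have rb : r = be by lra.
  by move: ab1 r1; rewrite rb al0 expr0n; lra.
rewrite qE NE aE; apply/eqP; rewrite eq_complex /=; apply/andP; split; apply/eqP; last by ring.
by move: rr; rewrite !expr2 /=; lra.
Qed.

Lemma mobius_classify ab : SU11 ab ->
  (exists z, z * conjc z < 1 /\ mobius ab z = z) \/
  exists t r d, [/\ 0 < r, r != 1 \/ d != 0, mobius ab (cis t) = cis t &
    forall x, mobius ab (cis (pt t x)) = cis (pt t (r * x + d))].
Proof.
move=> H; have [|[t ft]] := SU11_fixed H; first by left.
have [r [d [r0 b0 act]]] := mobius_axis H ft.
have [r1|r1] := eqVneq r 1; last by right; exists t, r, d; split=> //; left.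
have [d0|d0] := eqVneq d 0; last by right; exists t, r, d; split=> //; right.
left; exists 0; rewrite mul0r ltr01; split=> //.
by rewrite /mobius (b0 r1 d0) mulr0 add0r mul0r.
Qed.

End Circle.

(** * Maximal representations *)

Section LeviInverse.
Variables (R : realType) (n : nat).
Implicit Types (h : 'M[R]_(n + n)) (Y A X : 'M[R]_n).

Local Notation J := (sympl_form R n).

(** Conjugation by [J] sends [levi A^T] to the inverse of [levi A]. So the inverse is again in
    normal form with an expanding block, and its attractive Lagrangian is the repulsive one of the
    original. *)
Lemma levi_inverse h A : Sp h -> A \in unitmx ->
  invmx (h *m levi A *m invmx h) = (h *m J) *m levi A^T *m invmx (h *m J).
Proof.
move=> hS uA; have uh := Sp_unit hS; have uJ := Sp_unit (J_Sp R n).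
have ul := Sp_unit (levi_Sp uA).
have ulh : h *m levi A *m invmx h \in unitmx by rewrite !unitmx_mul uh ul unitmx_inv.
apply: (can_inj (mulKmx ulh)); rewrite mulmxV //.
have lJ : levi A *m J *m levi A^T = J.
  rewrite /levi /sympl_form !mulmx_block trmx_inv trmxK.
  rewrite !(mul0mx, mulmx0, mulmx1, mulmxN, mul1mx, mulNmx, oppr0, addr0, add0r).
  by rewrite mulmxV // trmx_inv mulVmx ?unitmx_tr.
rewrite invmxM // !mulmxA (mulmxKV uh) -(mulmxA h) -(mulmxA h) lJ (mulmxK uJ).
by rewrite mulmxV.
Qed.

Lemma lag_infty_J h : (lag_infty R n *m (h *m J)^T :=: lag_of (0 : 'M[R]_n) *m h^T)%MS.
Proof.
rewrite trmx_mul J_tr mulmxA mulmxN mulNmx; apply: eqmx_trans (eqmx_opp _) _.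
suff -> : lag_infty R n *m J = lag_of (0 : 'M[R]_n) by [].
rewrite /lag_infty /lag_of /sympl_form trmx0 mul_row_block.
by rewrite !(mul0mx, mulmx0, mul1mx, addr0).
Qed.

End LeviInverse.

(** Start where the first increment [del] is positive; as [r >= 1], no later increment is
    smaller. *)
Lemma affine_orbit (R : realType) (r d : R) : 1 <= r -> 1 < r \/ 0 < d ->
  exists x : nat -> R, [/\ forall m, x m.+1 = r * x m + d, forall m, x 0 < x m.+1 &
    forall B, exists m, B < x m.+1].
Proof.
move=> r1 rd; have [x0 x0P] : exists x0, 0 < (r - 1) * x0 + d.
  have [r2|r2] := eqVneq r 1.
    by exists 0; rewrite r2 mulr0 add0r; case: rd => //; rewrite r2 ltxx.
  exists ((1 - d) / (r - 1)); rewrite mulrCA divff ?subr_eq0 // mulr1 subrK //.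
set del := _ + d in x0P; pose x := fix x m := if m is m'.+1 then r * x m' + d else x0.
have xS m : x m.+1 = r * x m + d by [].
have low m : x0 + m%:R * del <= x m.
  elim: m => [|m IH]; first by rewrite mul0r addr0.
  have xm : x0 <= x m.
    by apply: le_trans IH; rewrite lerDl mulr_ge0 // ltW.
  have : del <= (r - 1) * x m + d by rewrite lerD2r ler_wpM2l // subr_ge0.
  have -> : m.+1%:R * del = m%:R * del + del by rewrite -natr1 mulrDl mul1r.
  by rewrite xS; lra.
exists x; split=> // [m|B].
  apply: lt_le_trans (low _); rewrite ltrDl mulr_gt0 ?ltr0n //.
exists (Num.bound `|(B - x0) / del|); apply: lt_le_trans (low _).
rewrite -ltrBlDl -ltr_pdivrMr //; apply: le_lt_trans (ler_norm _) _.
apply: lt_le_trans (archi_boundP (normr_ge0 _)) _.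
by rewrite ler_nat.
Qed.

Section MaximalRepresentations.
Variables (R : realType) (n : nat) (D : surface R) (w : D) (E : univ_cover R w).
Variables (hD : hyperbolization E).
Hypothesis n_gt0 : (0 < n)%N.
Local Notation C := R[i].
Local Notation pE := (@uc_proj _ _ _ E).

(** The developing map is injective, so the deck transformation of [f] fixes a point [e]; then [f q]
    and [q] lift to paths with the same ends, for [q] the projection of a path to [e]. *)
Lemma disc_fixed_null f (z : C) : loop_at w f -> z * conjc z < 1 ->
  mobius (hol hD f) z = z -> homotopic f (fun=> w).
Proof.
move=> lf z1 fz; have [im dK _ _] := dev_homeo hD.
have [e ie de] : exists2 e, @uc_interior R D w E e & dev hD e = (complex.Re z, complex.Im z).
  have : disc (complex.Re z, complex.Im z).
    move: z1; case: (z) => x y; rewrite ltcE /= => /andP[_]; rewrite /disc /= !expr2; lra.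
  by rewrite -im => -[e ie de]; exists e.
have pc : continuous pE by have [] := uc_covering E.
have sc := uc_simply_connected E; have [q pq] := sc.1 (uc_base E) e.
have ppq : path_from_to w (pE e) (pE \o q) by rewrite -[w in path_from_to w](uc_baseP E); exact: path_comp.
have pfq := path_concat lf ppq.
have [l [e' [pl lP]]] := covering_lift (uc_covering E) pfq (uc_baseP E).
have [lc l0 l1] := pl; have ppl := path_comp pc pl.
have hl : homotopic (pE \o l) (concat f (pE \o q)).
  by apply: hom_eq => //; have [] := ppl.
have pe' : pE e' = pE e.
  by have [_ _ <-] := ppl; have [_ _ <-] := pfq; have [_ ->] := hom_ends hl.
have ie' : @uc_interior R D w E e' by rewrite /uc_interior /= pe'.
have dk : deck f e e' by exists q, l.
have := @dev_equiv _ _ _ _ hD f e e' lf ie dk; rewrite de.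
have -> : cplx_of (complex.Re z, complex.Im z) = z by case: (z).
rewrite fz => dz; have ee : e' = e.
  rewrite -(dK _ ie') -(dK _ ie) de; congr dev_inv.
  by rewrite -dz /cplx_of /=; case: (dev hD e').
rewrite ee in pl.
have h1 : homotopic (concat f (pE \o q)) (pE \o q).
  apply: hom_trans (hom_sym hl) _; apply: hom_comp => //.
  exact: simply_connected_hom sc pl pq.
have rq := path_rev ppq.
apply: hom_trans (hom_sym (hom_idr lf)) _.
apply: hom_trans (hom_concatr lf (path_cst R w) (hom_sym (hom_inv ppq))) _.
apply: hom_trans (hom_sym (hom_assoc lf ppq rq)) _.
exact: hom_trans (hom_concatl pfq rq h1) (hom_inv ppq).
Qed.

Variable rho : (R -> D) -> 'M[R]_(n + n).
Variable xi : C -> 'M[R]_(n, n + n).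
Hypothesis rho_rep : representation w rho.
Hypothesis xi_lag : forall t, Lagrangian (xi (cis t)).
Hypothesis xi_equiv : forall f t, loop_at w f ->
  (xi (mobius (hol hD f) (cis t)) :=: xi (cis t) *m (rho f)^T)%MS.
Hypothesis xi_right : forall t (U : set 'M[R]_(n, n + n)), nbhs (xi (cis t)) U ->
  exists2 eps : R, 0 < eps & forall s, t < s < t + eps ->
    exists2 P : 'M[R]_n, P \in unitmx & U (P *m xi (cis s)).
Hypothesis xi_max : forall t1 t2 t3, t1 < t2 -> t2 < t3 -> t3 < t1 + 2 * pi ->
  maximal_triple (xi (cis t1)) (xi (cis t2)) (xi (cis t3)).

(** Two distinct points start a maximal triple, whose first two Lagrangians differ since [n > 0]. *)
Lemma xi_inj t u : (xi (cis t) :=: xi (cis u))%MS -> cis t = cis u.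
Proof.
move=> e; apply/eqP; apply: contraT => ne.
have [|u' /andP[tu ut] uE] := @cis_arc _ t (cis u) (cis_conj u); first by rewrite eq_sym.
have [|||g gS [ea eb _]] := @xi_max t u' ((u' + (t + 2 * pi)) / 2); [by []|lra|lra|].
have ug : g^T \in unitmx by rewrite unitmx_tr Sp_unit.
have : (lag_infty R n *m g^T :=: lag_of (0 : 'M[R]_n) *m g^T)%MS.
  by apply: eqmx_trans (eqmx_sym ea) _; rewrite -uE in eb; exact: eqmx_trans e eb.
move/(eqmx_frame (row_freeM (lag_of_free _) ug)) => [U uU].
rewrite mulmxA => /(can_inj (mulmxK ug)); rewrite /lag_infty /lag_of mul_mx_row trmx0 mulmx0.
move=> /eq_row_mx[/matrixP/(_ (Ordinal n_gt0) (Ordinal n_gt0)) + _].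
by rewrite !mxE eqxx => /eqP; rewrite oner_eq0.
Qed.

(** By injectivity of the boundary map the homography of [f] is an involution of the circle. Without
    a fixed point in the disc it would be an affine involution with positive ratio, hence the
    identity, which the classification excludes. *)
Lemma rho_sqr_null f : loop_at w f -> rho f *m rho f = 1%:M -> homotopic f (fun=> w).
Proof.
move=> lf gg; have SU := hol_SU11 hD lf.
have mm t : mobius (hol hD f) (mobius (hol hD f) (cis t)) = cis t.
  have [u uE] := mobius_circle t SU; have [u' uE'] := mobius_circle u SU.
  rewrite uE uE'; apply: xi_inj; rewrite -uE'.
  apply: eqmx_trans (xi_equiv u lf) _; rewrite -uE.
  apply: eqmx_trans (eqmxMr _ (xi_equiv t lf)) _.
  by rewrite -mulmxA -trmx_mul gg trmx1 mulmx1.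
have [[z [z1 fz]]|[t [r [d [r0 rd _ act]]]]] := mobius_classify SU.
  exact: disc_fixed_null fz.
have lin x : r * (r * x + d) + d = x by apply: (@pt_inj _ t); rewrite -!act.
have l0 := lin 0; have l1 := lin 1.
have d0 : d = 0.
  have : (r + 1) * d = 0 by rewrite -[RHS]l0; ring.
  by move/eqP; rewrite mulf_eq0 gt_eqF /= ?addr_gt0 // => /eqP.
have : r = 1.
  have : (r - 1) * (r + 1) = 0 by move: l1; rewrite d0 => l1; rewrite -[0](subrr 1) -{3}l1; ring.
  by move/eqP; rewrite mulf_eq0 [r + 1 == 0]gt_eqF ?addr_gt0 // orbF subr_eq0 => /eqP.
by case: rd; rewrite ?d0 ?eqxx // => /eqP.
Qed.

(** The homography has a fixed point on the circle, its loop not being null-homotopic. The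
    alternative records whether [f] or its inverse has an orbit that tends to this point from the
    right, the only side on which continuity is given. *)
Lemma xi_shilov f h (A : 'M[R]_n) : loop_at w f -> Sp h -> A \in unitmx -> expanding A ->
  rho f = h *m levi A *m invmx h -> exists t,
    (xi (cis t) :=: lag_infty R n *m h^T)%MS \/
    (xi (cis t) :=: lag_of (0 : 'M[R]_n) *m h^T)%MS.
Proof.
move=> lf hS uA eA gE; have SU := hol_SU11 hD lf; have uh := Sp_unit hS.
have ug : (rho f)^T \in unitmx by rewrite unitmx_tr (repr_unit rho_rep lf).
have not_null : ~ homotopic f (fun=> w).
  move=> /(repr_null rho_rep lf); rewrite gE => g1.
  have lA : levi A = 1%:M.
    apply: (can_inj (mulKmx uh)); apply: (can_inj (mulmxK (etrans (unitmx_inv h) uh))).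
    by rewrite g1 mulmx1 mulmxV.
  have A1 : A = 1%:M by move: lA; rewrite /levi scalar_mx_block => /eq_block_mx[].
  have : 1 < `|1 : C|; last by rewrite normr1 ltxx.
  apply: eA; rewrite A1 cplx1; apply/eigenvalueP; exists (delta_mx 0 (Ordinal n_gt0)).
    by rewrite mulmx1 scale1r.
  by apply/matrix0Pn; exists 0, (Ordinal n_gt0); rewrite mxE !eqxx oner_eq0.
have [[z [z1 fz]]|[t [r [d [r0 rd ft act]]]]] := mobius_classify SU.
  by case: not_null; exact: disc_fixed_null fz.
exists t; pose X x := xi (cis (pt t x)).
have Xg x : (X (r * x + d)%R :=: X x *m (rho f)^T)%MS by rewrite /X -act; exact: xi_equiv.
have Kg : (xi (cis t) *m (rho f)^T :=: xi (cis t))%MS.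
  by apply: eqmx_sym; rewrite -{1}ft; exact: xi_equiv.
have fK : row_free (xi (cis t)) by have [] := xi_lag t.
have conv (x : nat -> R) : (forall m, x 0 < x m.+1) -> (forall B, exists m, B < x m.+1) ->
    (forall m, maximal_triple (xi (cis t)) (X (x m.+1)) (X (x 0))) /\
    (forall U : set 'M[R]_(n, n + n), nbhs (xi (cis t)) U ->
      exists m, exists2 Z : 'M[R]_n, Z \in unitmx & U (Z *m X (x m.+1))).
  move=> x0 xoo; split=> [m|U /xi_right[eps e0 eU]].
    have /andP[b1 b2] := pt_bounds t (x 0%N); have /andP[b3 b4] := pt_bounds t (x m.+1).
    by apply: xi_max => //; exact: pt_lt.
  have [y yP] := pt_near t e0; have [m my] := xoo y; exists m.
  by apply: eU; rewrite yP // andbT; have /andP[] := pt_bounds t (x m.+1).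
(* Here the affine map has an orbit going to [+oo], that is to [cis t] from the right; otherwise its
   inverse has one. *)
have [r1|r1] := boolP ((1 < r) || (r == 1) && (0 < d)).
  have [||x [xS x0 xoo]] := @affine_orbit _ r d.
  - by case/orP: r1 => [/ltW//|/andP[/eqP->]].
  - by case/orP: r1 => [|/andP[_]]; [left|right].
  have [mt acc] := conv x x0 xoo; left.
  apply: (limit_lagrangian n_gt0 hS uA eA gE fK Kg (L := X \o x)) => // m.
  by rewrite /= xS.
have uAT : A^T \in unitmx by rewrite unitmx_tr.
have eAT : expanding A^T by move=> x; rewrite cplxT eigenvalue_tr; exact: eA.
have [||x [xS x0 xoo]] := @affine_orbit _ r^-1 (- (d / r)).
- rewrite invf_ge1 //; move: r1; rewrite negb_or -leNgt => /andP[].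
  by [].
- move: r1; rewrite negb_or -leNgt negb_and -leNgt => /andP[r1 rd'].
  have [r2|r2] := eqVneq r 1; last by left; rewrite invf_gt1 // lt_neqAle r2.
  right; rewrite r2 eqxx /= in rd'; rewrite r2 divr1 oppr_gt0 lt_neqAle rd' andbT.
  by case: rd => //; rewrite r2 eqxx.
have [mt acc] := conv x x0 xoo; right.
apply: eqmx_trans (lag_infty_J h).
have gE' := etrans (congr1 invmx gE) (levi_inverse hS uA).
have iT : (invmx (rho f))^T = invmx (rho f)^T by rewrite trmx_inv.
apply: (limit_lagrangian n_gt0 (Sp_mul hS (J_Sp R n)) uAT eAT gE' fK (L := X \o x)) => //.
  rewrite iT; apply: eqmx_trans (eqmxMr _ (eqmx_sym Kg)) _.
  by rewrite mulmxK.
move=> m /=; rewrite iT; apply: eqmx_sym; apply: eqmx_trans (_ : _ :=: X (x m.+1) *m (rho f)^T *m invmx (rho f)^T)%MS _; last by rewrite mulmxK.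
apply: eqmxMr; apply: eqmx_trans (Xg _); rewrite xS.
by rewrite (_ : r * _ + d = x m) //; field; rewrite gt_eqF.
Qed.

(** If the three points of the circle are distinct, the order of the last two after [cis t] decides
    the cyclic order of the triple. If the first or second translate is [cis t], the Lagrangian
    returns; the two translates can coincide only when the first is already trivial. *)
Lemma xi_orbit f t : loop_at w f -> let a := xi (cis t) in
  (a *m (rho f)^T *m (rho f)^T :=: a)%MS \/
  exists b c, [/\ (b :=: a *m (rho f)^T)%MS, (c :=: b *m (rho f)^T)%MS &
    maximal_triple a b c \/ maximal_triple a c b].
Proof.
move=> lf a; have SU := hol_SU11 hD lf.
have ug : (rho f)^T \in unitmx by rewrite unitmx_tr (repr_unit rho_rep lf).
have [u uE] := mobius_circle t SU; have [u' uE'] := mobius_circle u SU.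
have eb : (xi (cis u) :=: a *m (rho f)^T)%MS by rewrite -uE; exact: xi_equiv.
have ec : (xi (cis u') :=: xi (cis u) *m (rho f)^T)%MS by rewrite -uE'; exact: xi_equiv.
have ec' : (xi (cis u') :=: a *m (rho f)^T *m (rho f)^T)%MS.
  by apply: eqmx_trans ec _; exact: eqmxMr.
have [e1|n1] := eqVneq (cis u) (cis t).
  left; rewrite e1 in eb ec; apply: eqmx_trans (eqmx_sym ec') _.
  by apply: eqmx_trans ec _; exact: eqmx_sym.
have [e2|n2] := eqVneq (cis u') (cis t).
  by left; apply: eqmx_trans (eqmx_sym ec') _; rewrite e2.
right; exists (xi (cis u)), (xi (cis u')); split=> //.
have [b /andP[tb bt] bE] := cis_arc (cis_conj u) n1.
have [c /andP[tc ct] cE] := cis_arc (cis_conj u') n2.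
rewrite /a bE cE; have [bc|cb|bc] := ltgtP b c; [by left; exact: xi_max|by right; exact: xi_max|].
exfalso; move/eqP: n1; apply; apply: xi_inj.
have e : (a *m (rho f)^T *m (rho f)^T :=: a *m (rho f)^T)%MS.
  by apply: eqmx_trans (eqmx_sym ec') _; rewrite cE -bc -bE.
apply: eqmx_trans eb _; have := eqmxMr (invmx (rho f)^T) e.
by rewrite !mulmxK.
Qed.

End MaximalRepresentations.

Section Reversal.
Variables (R : realType) (X : topologicalType).

Lemma hom_of_null (x y : X) (f g : R -> X) : path_from_to x y f -> path_from_to x y g ->
  homotopic (concat f (rev_path g)) (fun=> x) -> homotopic f g.
Proof.
move=> pf pg h; have rg := path_rev pg.
apply: hom_trans (hom_sym (hom_idr pf)) _.
apply: hom_trans (hom_concatr pf (path_cst R y) (hom_sym (hom_invl pg))) _.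
apply: hom_trans (hom_sym (hom_assoc pf rg pg)) _.
exact: hom_trans (hom_concatl (path_concat pf rg) pg h) (hom_idl pg).
Qed.

End Reversal.

(** * Reflections attached to an orthotube *)

Section Assembly.
Variables (R : realType) (n : nat).
Hypothesis n_gt0 : (0 < n)%N.
Implicit Types (g h s : 'M[R]_(n + n)).

(** The same [s] is given two expressions: in the frame of the orthotube, where the product of
    reflections is computed, and in that of [g], which identifies it with [sigma_g]. *)
Lemma orthogonal_tube_sigma h g (T1 : set 'M[R[i]]_n) X : Sp h -> is_tube_of g T1 ->
  orthogonal_at [set Z | exists2 Y, pos_def Y & Z = siegel_act h (imag Y)] T1 X ->
  exists h1 A s e Y, [/\ Sp h1, A \in unitmx, expanding A & g = h1 *m levi A *m invmx h1] /\
    [/\ pos_def Y, X = siegel_act h (imag Y), e * e = 1,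
        s = e *: (h *m imag_refl Y *m invmx h) &
        s = - (h1 *m axis_refl R n *m invmx h1)].
Proof.
move=> hS [Lm [Lp [[h1 [A [h1S uA eA gE [ep em]]]] ->]]]; rewrite (tubeP h1S em ep).
move=> [int orth].
have : [set X] X by [].
rewrite -int => -[[Y pY XE] [Y1 pY1 XE1]].
have [e ee eE] := @orthogonal_reflection R n h h1 Y Y1 hS h1S pY pY1 (etrans (esym XE) XE1)
  (fun U V => eq_ind X (fun X => tangent _ X U -> tangent _ X V -> siegel_metric X U V = 0) (orth U V) _ XE).
exists h1, A, (- (h1 *m axis_refl R n *m invmx h1)), (- e), Y; split=> //; split=> //.
  by rewrite mulrNN.
by rewrite eE scaleNr.
Qed.

Lemma is_sigma_of g h (A : 'M[R]_n) s : Sp h -> A \in unitmx -> expanding A ->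
  g = h *m levi A *m invmx h -> s = - (h *m axis_refl R n *m invmx h) -> is_sigma g s.
Proof.
move=> hS uA eA gE sE; exists (lag_of 0 *m h^T), (lag_infty R n *m h^T); split.
- by exists h, A.
- by rewrite (sigma_lag0 hS sE) scale1r.
- by rewrite (sigma_lag_infty hS sE) scaleN1r.
Qed.

Lemma is_sigma_sqr g s : is_sigma g s -> s *m s = 1%:M.
Proof.
move=> gs; have [Lm [Lp [[h [A [hS uA eA gE _]]] _ _]]] := gs.
exact: sigma_sqr hS (is_sigmaE n_gt0 hS uA eA gE gs).
Qed.

End Assembly.

Theorem proposition4p4 (R : realType) (n : nat) (n_gt0 : (0 < n)%N)
  (S : surface R) (chi : int) (S_chi : euler_char S chi) (chi_lt0 : chi < 0)
  (v : S) (v_bd : boundary v)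
  (E : univ_cover R v) (h : hyperbolization E)
  (D : surface R) (j0 j1 : S -> D) (j : D -> D) (dbl : is_double j0 j1 j)
  (ED : univ_cover R (j0 v)) (hD : hyperbolization ED)
  (rho : (R -> S) -> 'M[R]_(n + n))
  (rho_max : maximal_rep h rho) (rho_Anosov : Anosov v rho)
  (Drho : (R -> D) -> 'M[R]_(n + n))
  (Drho_double : holomorphic_double j hD rho Drho)
  (d1 d2 : R -> S)
  (d1_per : peripheral v d1) (d2_per : peripheral v d2)
  (d12 : ~ homotopic d1 d2)
  (A1 A2 : set E) (A1_axis : axis d1 A1) (A2_axis : axis d2 A2)
  (x1 x2 : E) (A1x1 : A1 x1) (A2x2 : A2 x2)
  (beta alpha : R -> E)
  (beta_path : path_from_to (uc_base E) x1 beta)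
  (alpha_path : path_from_to x1 x2 alpha)
  (T : set 'M[R[i]]_n) (X1 X2 : 'M[R[i]]_n)
  (T_ortho : orthotube (rho d1) (rho d2) T X1 X2) :
  let Dalpha := double_loop j0 j (@uc_proj _ _ _ E \o beta)
                                 (@uc_proj _ _ _ E \o alpha) in
  is_tube_of (Drho Dalpha) T /\
  2 * dF X1 X2 = lF (Drho Dalpha).
Proof.
move=> Dalpha.
have [Dmax Dj0 [c0 [s0 [c0b c0v s0g Dj Darc]]]] := Drho_double.
have [Drep [xi [xiL xiE xiR xiM]]] := Dmax.
have [rrep _] := rho_max; have s00 := is_sigma_sqr n_gt0 s0g.
have [[j0c _] _ _ _ _] := dbl.
have [Ttube [T1 [T2 [tube1 tube2 orth1 orth2]]]] := T_ortho.
have [a [b [La Lb tab TE]]] := Ttube.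
have [k [kS ea eb]] := transverse_Sp La Lb tab.
rewrite (tubeP kS ea eb) in TE; rewrite TE in orth1 orth2 *.
have [h1 [B1 [s1 [e1 [Y1 [[h1S uB1 eB1 g1E] [pY1 X1E ee1 s1E s1h]]]]]]] :=
  orthogonal_tube_sigma kS tube1 orth1.
have [h2 [B2 [s2 [e2 [Y2 [[h2S uB2 eB2 g2E] [pY2 X2E ee2 s2E s2h]]]]]]] :=
  orthogonal_tube_sigma kS tube2 orth2.
have pEc : continuous (@uc_proj _ _ _ E) by have [] := uc_covering E.
have [_ Dhom Dmul] := Drep; have [_ rhom _] := rrep.
have square_null f : loop_at (j0 v) f -> Drho f *m Drho f = 1%:M ->
    homotopic f (fun=> j0 v) := rho_sqr_null n_gt0 xiE xiM (f := f).
(* The relation defining the double concerns lassos; a peripheral element is homotopic to one, with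
   the same image and so the same [sigma]. *)
have arc d q c s g A : loop_at v d -> boundary_loop c -> path_from_to v (c 0) q ->
    homotopic d (lasso q c) -> Sp g -> A \in unitmx -> expanding A ->
    rho d = g *m levi A *m invmx g -> s = - (g *m axis_refl R n *m invmx g) ->
    boundary (c 0) /\ Drho (mirror j0 j1 q) = s *m s0.
  move=> dl cb pq hd gS uA eA dE sE; have [cl _ cbd _] := cb.
  split; first by apply: cbd; rewrite in_itv /= lexx ler01.
  have ll : loop_at v (lasso q c) := path_concat (path_concat pq cl) (path_rev pq).
  have := Darc _ _ s cb pq; rewrite -(rhom _ _ dl ll hd) (double_j0 dbl); apply.
  exact: is_sigma_of gS uA eA dE sE.
have key d A x bpath q c s g B : loop_at v d -> axis d A -> A x ->
    path_from_to (uc_base E) x bpath -> boundary_loop c -> path_from_to v (c 0) q ->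
    homotopic d (lasso q c) -> Sp g -> B \in unitmx -> expanding B ->
    rho d = g *m levi B *m invmx g -> s = - (g *m axis_refl R n *m invmx g) ->
    boundary (@uc_proj _ _ _ E x) /\
    Drho (mirror j0 j1 (@uc_proj _ _ _ E \o bpath)) = s *m s0.
  move=> dl dA Ax pb cb pq hd gS uB eB dE sE.
  have [bx comm] := mirror_axis_commute dbl v_bd ED Drep Dj0 Dj s00 dl dA Ax pb.
  have [bc mq] := arc _ _ _ _ _ _ dl cb pq hd gS uB eB dE sE.
  have ppb := path_proj pb; split=> //.
  set N := Drho _ *m s0 in comm.
  have sN := sigma_commute n_gt0 gS uB eB dE sE comm; have ss := sigma_sqr gS sE.
  have NN : N *m N = 1%:M := mirror_s0_sqr dbl v_bd Drep Dj ppb bx.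
  have lm := loop_mirror dbl v_bd bx ppb; have lq := loop_mirror dbl v_bd bc pq.
  have rq := path_rev lq; have lG := path_concat lm rq.
  (* The inverse of the mirror loop of [q] has image [s0 (s s0) s0 = s0 s], so [N s] is the image of
     a loop although neither factor need be. *)
  have GE : Drho (concat (mirror j0 j1 (@uc_proj _ _ _ E \o bpath)) (rev_path (mirror j0 j1 q))) = N *m s.
    rewrite Dmul // (rev_mirror dbl v_bd bc pq) Dj // mq /N.
    by rewrite [s0 *m (_ *m _)]mulmxA -[s0 *m s *m s0 *m s0]mulmxA s00 mulmx1 mulmxA.
  have : N *m s = 1%:M.
    rewrite -GE; apply: (repr_null Drep lG); apply: square_null => //.
    by rewrite GE -(mulmxA N) [s *m _]mulmxA sN -(mulmxA N s) ss mulmx1.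
  move=> Ns; have NE : N = s by rewrite -[N]mulmx1 -ss mulmxA Ns mul1mx.
  by rewrite -NE /N -mulmxA s00 mulmx1.
have [d1l [q1 [c1 [c1b pq1 hd1]]]] := d1_per.
have [d2l [q2 [c2 [c2b pq2 hd2]]]] := d2_per.
have [bc1 mq1] := arc _ _ _ _ _ _ d1l c1b pq1 hd1 h1S uB1 eB1 g1E s1h.
have [bc2 mq2] := arc _ _ _ _ _ _ d2l c2b pq2 hd2 h2S uB2 eB2 g2E s2h.
have [bx1 m1] := key _ _ _ _ _ _ _ _ _ d1l A1_axis A1x1 beta_path c1b pq1 hd1 h1S uB1 eB1 g1E s1h.
have [bx2 m2] := key _ _ _ _ _ _ _ _ _ d2l A2_axis A2x2 (path_concat beta_path alpha_path)
  c2b pq2 hd2 h2S uB2 eB2 g2E s2h.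
have s11 := sigma_sqr h1S s1h; have s22 := sigma_sqr h2S s2h.
have pb := path_proj beta_path; have pa := path_comp pEc alpha_path.
have [lDa hDa] := double_loop_hom dbl v_bd pb pa bx1 bx2.
have lmb := loop_mirror dbl v_bd bx1 pb.
have lmba := loop_mirror dbl v_bd bx2 (path_concat pb pa).
(* The mirror loop of [beta alpha] gives [s2 s0], and the inverse of that of [beta] gives
   [s0 s1]. *)
have tE : Drho Dalpha = s2 *m s1.
  rewrite (Dhom _ _ lDa (path_concat lmba (path_rev lmb)) hDa) Dmul //; last exact: path_rev.
  rewrite -comp_concat m2 (rev_mirror dbl v_bd bx1 pb) Dj // m1.
  by rewrite [s0 *m (_ *m _)]mulmxA -[s0 *m s1 *m s0 *m s0]mulmxA s00 mulmx1 !mulmxA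
    -[s2 *m s0 *m s0]mulmxA s00 mulmx1.
(* Otherwise [D alpha] is null-homotopic and [s1 = s2]. Then the mirror loops of the lasso paths
   [q1] and [q2] have the same image, hence are homotopic, and [d1], [d2] are homotopic too. *)
have tt1 : (s2 *m s1) *m (s2 *m s1) <> 1%:M.
  rewrite -tE => /(square_null _ lDa) /(repr_null Drep lDa); rewrite -/Dalpha tE => t1.
  have s12 : s2 = s1 by rewrite -[s2]mulmx1 -s11 mulmxA t1 mul1mx.
  have lq1 := loop_mirror dbl v_bd bc1 pq1; have lq2 := loop_mirror dbl v_bd bc2 pq2.
  have lG := path_concat lq1 (path_rev lq2).
  have G1 : Drho (concat (mirror j0 j1 q1) (rev_path (mirror j0 j1 q2))) = 1%:M.
    rewrite Dmul //; last exact: path_rev.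
    by rewrite mq1 -s12 -mq2; exact: (repr_rev Drep).
  have mm := hom_of_null lq1 lq2 (square_null _ lG (etrans (congr2 _ G1 G1) (mulmx1 _))).
  have hk := mirror_eq_homotopic dbl v_bd pq1 pq2 bc1 bc2 mm.
  apply: d12; apply: hom_trans hd1 _; apply: hom_trans _ (hom_sym hd2).
  exact: (mirror_homotopic_conj dbl c1b c2b pq1 pq2 hk).
have lf1 : loop_at (j0 v) (j0 \o d1) by exact: path_comp.
have f1E : Drho (j0 \o d1) = h1 *m levi B1 *m invmx h1 by rewrite Dj0.
have [theta xit] := xi_shilov n_gt0 Drep xiL xiE xiR xiM lf1 h1S uB1 eB1 f1E.
have uh1T : h1^T \in unitmx by rewrite unitmx_tr Sp_unit.
(* [s1] is -1 on the attractive Lagrangian of [rho(d1)] and 1 on the repulsive one; either is good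
   enough. *)
have [d [dd as1]] : exists d : R, d * d = 1 /\ xi (cis theta) *m s1^T = d *: xi (cis theta).
  case: xit => xe; [exists (- 1)|exists 1]; (split; first by ring).
    exact: eqmx_eigen (row_freeM (lag_infty_free R n) uh1T) xe (sigma_lag_infty h1S s1h).
  exact: eqmx_eigen (row_freeM (lag_of_free _) uh1T) xe (sigma_lag0 h1S s1h).
have fa : row_free (xi (cis theta)) by have [] := xiL theta.
rewrite X1E X2E tE; have := xi_orbit n_gt0 Drep xiE xiM theta lDa.
rewrite -/Dalpha tE => -[fixed|[x [y [ex ey mt]]]].
  by case: tt1; exact: (translation_sqr kS pY1 pY2 ee1 ee2 dd s1E s2E fa as1 fixed).
exact: (double_translation kS pY1 pY2 ee1 ee2 dd s1E s2E fa as1 ex ey mt).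
Qed.
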